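(* Let $M$ be a closed connected Kähler manifold of real dimension $2m$ and let $\mathbf{S}_\rho$ be the bundle associated to a dominant integral weight $\rho$ of $U(m)$; assume $\mathbf{S}_\rho$ has rank $\ge2$. Then the Kählerian gradients $D_{\pm i}$ associated to $\rho$ and their formal adjoints satisfy $$\sum_{1\le i\le m-1}\frac{2(w_{-m}-w_{-i})}{w_{+1}+w_{-m}}D_{-i}^{\ast}D_{-i}+\sum_{2\le i\le m}\frac{2(w_{+1}-w_{+i})}{w_{+1}+w_{-m}}D_{+i}^{\ast}D_{+i}=\nabla^{\ast}\nabla-\frac{2}{w_{+1}+w_{-m}}R^1_\rho-\frac{w_{+1}-w_{-m}}{w_{+1}+w_{-m}}R^0_\rho.$$ If the curvature endomorphism $$-\frac{2}{w_{+1}+w_{-m}}R^1_\rho-\frac{w_{+1}-w_{-m}}{w_{+1}+w_{-m}}R^0_\rho$$ is non-negative (at every point of $M$) and positive at some point, then $$\bigcap_{1\le i\le m-1}\ker D_{-i}\ \cap\bigcap_{2\le i\le m}\ker D_{+i}=\{0\}.$$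
   Context: Representations. Irreducible unitary representations $(\pi_\rho,V_\rho)$ of $U(m)$ are labelled by highest weights $\rho=(\rho^1,\dots,\rho^m)\in\mathbb{Z}^m$, $\rho^1\ge\cdots\ge\rho^m$ (''dominant integral''); weights are simultaneous eigenvalues of $e_{11},\dots,e_{mm}$, $e_{kl}$ being the matrix units of $\mathfrak{gl}(m,\mathbb{C})=\mathfrak{u}(m)\otimes\mathbb{C}$, on which $\pi_\rho$ is extended. Let $\mu_i$ be the $i$-th standard basis vector of $\mathbb{Z}^m$. One has multiplicity-free orthogonal decompositions $V_\rho\otimes\mathbb{C}^m=\bigoplus_iV_{\rho+\mu_i}$, $V_\rho\otimes\overline{\mathbb{C}^m}=\bigoplus_iV_{\rho-\mu_i}$, with $V_{\rho\pm\mu_i}:=\{0\}$ when $\rho\pm\mu_i$ is not dominant integral; $\Pi_{\pm i}$ is the orthogonal projection onto $V_{\rho\pm\mu_i}$. Conformal weights: $w_{+i}:=-\rho^i+i-1$, $w_{-i}:=\rho^i+m-i$. (Thus $w_{+1}+w_{-m}=\rho^m-\rho^1$, non-zero when $\dim V_\rho\ge2$.) Geometry. $M$ is Kähler with metric $g$ (extended complex bilinearly), $\mathbf{U}(M)$ its principal $U(m)$-bundle of unitary frames $(\epsilon_1,\dots,\epsilon_m)$ of $T^{1,0}(M)$ (so $g(\epsilon_k,\bar\epsilon_l)=\delta_{kl}$), with the Levi-Civita connection. $\mathbf{S}_\rho:=\mathbf{U}(M)\times_{\pi_\rho}V_\rho$ with induced Hermitian metric and covariant derivative $\nabla=\nabla^{1,0}+\nabla^{0,1}$.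 Identifying $\Lambda^{0,1}(M)\simeq T^{1,0}(M)$ and $\Lambda^{1,0}(M)\simeq T^{0,1}(M)$ by $g$, $\nabla^{0,1}\phi=\sum_k\nabla_{\bar\epsilon_k}\phi\otimes\epsilon_k$ and $\nabla^{1,0}\phi=\sum_k\nabla_{\epsilon_k}\phi\otimes\bar\epsilon_k$. The Kählerian gradients are $D_{+i}:=\Pi_{+i}\circ\nabla^{0,1}:\Gamma(\mathbf{S}_\rho)\to\Gamma(\mathbf{S}_{\rho+\mu_i})$ and $D_{-i}:=\Pi_{-i}\circ\nabla^{1,0}:\Gamma(\mathbf{S}_\rho)\to\Gamma(\mathbf{S}_{\rho-\mu_i})$ (fibrewise projections). ${}^{\ast}$ denotes formal adjoint with respect to $L^2$ inner products. Curvature endomorphisms. Let $R_\rho(V,W)=\nabla_V\nabla_W-\nabla_W\nabla_V-\nabla_{[V,W]}$ be the curvature of $\nabla$ on $\mathbf{S}_\rho$, extended complex bilinearly. Put $R^0_\rho:=\sum_kR_\rho(\epsilon_k,\bar\epsilon_k)$ and $R^1_\rho:=\sum_{k,l}\pi_\rho(e_{lk})R_\rho(\epsilon_k,\bar\epsilon_l)$, where $\pi_\rho(e_{lk})$ acts through the trivialization of $\mathbf{S}_\rho$ given by the frame $\{\epsilon_k\}$ (the result is independent of the frame). These are self-adjoint bundle endomorphisms; non-negative (positive) at a point means that all eigenvalues at that point are non-negative (positive). *)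

(* Defs.v *)
From mathcomp Require Import all_boot all_order all_algebra.
From mathcomp Require Import spectral.
From mathcomp Require Import all_classical all_reals all_analysis.
From mathcomp Require Import complex.

Set Implicit Arguments.
Unset Strict Implicit.
Unset Printing Implicit Defensive.

Import Order.TTheory GRing.Theory Num.Theory.
Import numFieldNormedType.Exports.

Local Open Scope classical_set_scope.
Local Open Scope ring_scope.

(* Calculus on R^N                                                            *)

Section Calculus.
Variables (R : realType) (N : nat).
Implicit Types (a : 'I_N) (x : 'rV[R]_N).

Definition pd a (f : 'rV[R]_N -> R) x : R := 'D_(delta_mx ord0 a) f x.

Definition iter_pd (s : seq 'I_N) (f : 'rV[R]_N -> R) : 'rV[R]_N -> R :=
  foldr pd f s.

(* C^oo on an open set: all iterated partial derivatives exist and are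
   continuous there; the values outside the set are irrelevant. *)
Definition smooth_on (U : set 'rV[R]_N) (f : 'rV[R]_N -> R) : Prop :=
  forall s x, U x ->
    {for x, continuous (iter_pd s f)} /\
    forall a, derivable (iter_pd s f) x (delta_mx ord0 a).

Definition smooth_mx_on p q (U : set 'rV[R]_N) (f : 'rV[R]_N -> 'M[R]_(p, q)) :=
  forall i j, smooth_on U (fun x => f x i j).

Definition smooth_cmx_on p q (U : set 'rV[R]_N)
    (f : 'rV[R]_N -> 'M[R[i]]_(p, q)) :=
  forall i j, smooth_on U (fun x => complex.Re (f x i j)) /\
              smooth_on U (fun x => complex.Im (f x i j)).

Definition pd_cmx p q a (f : 'rV[R]_N -> 'M[R[i]]_(p, q)) x : 'M[R[i]]_(p, q) :=
  \matrix_(i, j) Complex (pd a (fun y => complex.Re (f y i j)) x)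
                         (pd a (fun y => complex.Im (f y i j)) x).

(* jacobian f x has rows d_a f, so that a tangent (row) vector v at x is mapped
   to v *m jacobian f x. *)
Definition jacobian (f : 'rV[R]_N -> 'rV[R]_N) x : 'M[R]_N :=
  \matrix_(a, b) pd a (fun y => f y ord0 b) x.

End Calculus.

(* Iterated Lebesgue integral over R^N; only applied to continuous functions
   with compact support. *)
Fixpoint iterated_integral (R : realType) (N : nat) :
    ('rV[R]_N -> R) -> R :=
  match N with
  | 0 => fun f => f 0
  | N'.+1 => fun f =>
      \int[@lebesgue_measure R]_t
        iterated_integral (fun y : 'rV[R]_N' => f (row_mx (t%:M : 'rV[R]_1) y))
  end.

Section ComplexMatrices.
Variable R : realType.

Definition cplx p q (A : 'M[R]_(p, q)) : 'M[R[i]]_(p, q) :=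
  map_mx (real_complex R) A.

Definition conjmx p q (A : 'M[R[i]]_(p, q)) : 'M[R[i]]_(p, q) :=
  map_mx Num.conj A.

Definition hdot p q (A B : 'M[R[i]]_(p, q)) : R[i] :=
  \sum_i \sum_j A i j * Num.conj (B i j).

Definition mx_derivative_at p q (u : R -> 'M[R[i]]_(p, q)) (t : R)
    (X : 'M[R[i]]_(p, q)) : Prop :=
  forall i j, is_derive t (1 : R) (fun s : R => complex.Re (u s i j)) (complex.Re (X i j)) /\
              is_derive t (1 : R) (fun s : R => complex.Im (u s i j)) (complex.Im (X i j)).

End ComplexMatrices.

(* Unitary representations of U(m)                                            *)

(* V = C^d with its standard Hermitian product.  urep_diff is the complex linear
   extension to gl(m, C) = u(m) (x) C of the differential of urep_act at 1; only
   the values of urep_act at unitary matrices matter. *)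
Record unitary_rep (R : realType) (m d : nat) := UnitaryRep {
  urep_act :> 'M[R[i]]_m -> 'M[R[i]]_d;
  urep_diff : {linear 'M[R[i]]_m -> 'M[R[i]]_d};
  urep_unitary : forall u, u \is unitarymx -> urep_act u \is unitarymx;
  urep_1 : urep_act 1%:M = 1%:M;
  urep_mul : forall u v, u \is unitarymx -> v \is unitarymx ->
    urep_act (u *m v) = urep_act u *m urep_act v;
  urep_diffP : forall (u : R -> 'M[R[i]]_m) (X : 'M[R[i]]_m),
    (forall t, u t \is unitarymx) -> u 0 = 1%:M ->
    mx_derivative_at u 0 X ->
    mx_derivative_at (fun t => urep_act (u t)) 0 (urep_diff X)
}.

Section Representations.
Variables (R : realType) (m d : nat) (V : unitary_rep R m d).

Definition dominant (lam : 'I_m -> int) : Prop :=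
  forall i j : 'I_m, (i <= j)%N -> lam j <= lam i.

(* V (x) W, for W = C^e acted upon by sg, is the space of d x e matrices: the
   column k of a matrix is the coefficient of the k-th basis vector of W. *)
Definition tensor_act e (sg : 'M[R[i]]_m -> 'M[R[i]]_e) (u : 'M[R[i]]_m)
    (A : 'M[R[i]]_(d, e)) : 'M[R[i]]_(d, e) := V u *m A *m (sg u)^T.

Definition tensor_diff e (dsg : 'M[R[i]]_m -> 'M[R[i]]_e) (X : 'M[R[i]]_m)
    (A : 'M[R[i]]_(d, e)) : 'M[R[i]]_(d, e) :=
  urep_diff V X *m A + A *m (dsg X)^T.

Definition act0 : 'M[R[i]]_m -> 'cV[R[i]]_d -> 'cV[R[i]]_d :=
  fun u v => V u *m v.
Definition diff0 : 'M[R[i]]_m -> 'cV[R[i]]_d -> 'cV[R[i]]_d :=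
  fun X v => urep_diff V X *m v.

(* V (x) C^m *)
Definition actp := tensor_act (fun u => u).
Definition diffp := tensor_diff (fun X => X).

(* V (x) conj(C^m): for X in u(m), conj X = - X^T, and the right-hand side is
   the complex linear extension to gl(m, C). *)
Definition actm := tensor_act (fun u => conjmx u).
Definition diffm := tensor_diff (fun X => - X^T).

(* V (x) (C^m (+) conj(C^m)) *)
Definition actpm :=
  tensor_act (fun u => block_mx u 0 0 (conjmx u) : 'M[R[i]]_(m + m)).

Section Subrepresentations.
Variables (e : nat).
Variables (act diff : 'M[R[i]]_m -> 'M[R[i]]_(d, e) -> 'M[R[i]]_(d, e)).

Definition invariant_subspace (U : {vspace 'M[R[i]]_(d, e)}) : Prop :=
  forall u, u \is unitarymx -> forall v, v \in U -> act u v \in U.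

Definition irreducible_subspace (U : {vspace 'M[R[i]]_(d, e)}) : Prop :=
  [/\ U != 0%VS, invariant_subspace U &
      forall U', (U' <= U)%VS -> invariant_subspace U' -> U' = 0%VS \/ U' = U].

Definition has_highest_weight (U : {vspace 'M[R[i]]_(d, e)})
    (lam : 'I_m -> int) : Prop :=
  exists v, [/\ v \in U, v != 0,
    forall k, diff (delta_mx k k) v = (lam k)%:~R *: v &
    forall k l : 'I_m, (k < l)%N -> diff (delta_mx k l) v = 0].

Definition orthogonal_projection (P : 'End('M[R[i]]_(d, e))) : Prop :=
  (forall A, P (P A) = P A) /\ (forall A B, hdot (P A) B = hdot A (P B)).

(* limg P is the subrepresentation V_lam, which is 0 if lam is not dominant. *)
Definition projection_onto_weight (lam : 'I_m -> int)
    (P : 'End('M[R[i]]_(d, e))) : Prop :=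
  [/\ orthogonal_projection P,
      dominant lam ->
        irreducible_subspace (limg P) /\ has_highest_weight (limg P) lam &
      ~ dominant lam -> P = 0].

(* The orthogonal decomposition into the V_(lam i), given by its projections. *)
Definition weight_decomposition (lam : 'I_m -> 'I_m -> int)
    (P : 'I_m -> 'End('M[R[i]]_(d, e))) : Prop :=
  (forall i, projection_onto_weight (lam i) (P i)) /\
  \sum_i P i = \1%VF.

End Subrepresentations.

Definition irreducible_of_weight (rho : 'I_m -> int) : Prop :=
  irreducible_subspace act0 fullv /\ has_highest_weight diff0 fullv rho.

End Representations.

Definition mu (m : nat) (i : 'I_m) : 'I_m -> int := fun j => (j == i)%:Z.

(* The ordinal i stands for the index i + 1 of the conformal weights. *)
Definition wp (m : nat) (rho : 'I_m -> int) (i : 'I_m) : int :=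
  - rho i + (i : nat)%:Z.
Definition wm (m : nat) (rho : 'I_m -> int) (i : 'I_m) : int :=
  rho i + m%:Z - (i : nat).+1%:Z.

(* Kaehler manifolds                                                          *)

(* The standard complex structure of R^(2m) = C^m, coordinates
   (x_1, .., x_m, y_1, .., y_m), acting on row vectors from the right. *)
Definition stdJ (R : realType) (m : nat) : 'M[R]_(m + m) :=
  block_mx 0 1%:M (- 1%:M) 0.

Record kahler (R : realType) (m : nat) (M : topologicalType) := Kahler {
  (* complex atlas *)
  kidx : Type;
  kdom : kidx -> set M;
  kcod : kidx -> set 'rV[R]_(m + m);
  kchart : kidx -> M -> 'rV[R]_(m + m);
  kinv : kidx -> 'rV[R]_(m + m) -> M;
  kdom_open : forall c, open (kdom c);
  kcod_open : forall c, open (kcod c);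
  kdom_cover : forall p, exists c, kdom c p;
  kchart_cod : forall c p, kdom c p -> kcod c (kchart c p);
  kinv_dom : forall c x, kcod c x -> kdom c (kinv c x);
  kchartK : forall c p, kdom c p -> kinv c (kchart c p) = p;
  kinvK : forall c x, kcod c x -> kchart c (kinv c x) = x;
  kchart_cont : forall c p, kdom c p -> {for p, continuous (kchart c)};
  kinv_cont : forall c x, kcod c x -> {for x, continuous (kinv c)};
  ktrans_smooth : forall c c',
    smooth_mx_on [set x | kcod c x /\ kdom c' (kinv c x)]
                 (fun x => kchart c' (kinv c x));
  ktrans_holo : forall c c' x, kcod c x -> kdom c' (kinv c x) ->
    let D := jacobian (fun y => kchart c' (kinv c y)) x in
    D *m stdJ R m = stdJ R m *m D;
  (* Riemannian metric *)
  kmet : kidx -> 'rV[R]_(m + m) -> 'M[R]_(m + m);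
  kmet_smooth : forall c, smooth_mx_on (kcod c) (kmet c);
  kmet_sym : forall c x, kcod c x -> (kmet c x)^T = kmet c x;
  kmet_pos : forall c x (v : 'rV[R]_(m + m)), kcod c x -> v != 0 ->
    0 < (v *m kmet c x *m v^T) ord0 ord0;
  kmet_trans : forall c c' x, kcod c x -> kdom c' (kinv c x) ->
    let D := jacobian (fun y => kchart c' (kinv c y)) x in
    kmet c x = D *m kmet c' (kchart c' (kinv c x)) *m D^T;
  (* g (J X) (J Y) = g X Y, and the form g (J X) Y is closed *)
  kmet_herm : forall c x, kcod c x ->
    stdJ R m *m kmet c x *m (stdJ R m)^T = kmet c x;
  kform_closed : forall c x (i j k : 'I_(m + m)), kcod c x ->
    let om a b := fun y => (stdJ R m *m kmet c y) a b in
    pd i (om j k) x + pd j (om k i) x + pd k (om i j) x = 0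
}.

Section KahlerGeometry.
Variables (R : realType) (m : nat) (M : topologicalType) (K : kahler R m M).

Definition trans_jac (c c' : kidx K) (x : 'rV[R]_(m + m)) : 'M[R]_(m + m) :=
  jacobian (fun y => kchart c' (kinv c y)) x.

(* Levi-Civita connection: nabla_(d_a) d_b = \sum_e christoffel c a b e x d_e *)
Definition christoffel (c : kidx K) (a b e : 'I_(m + m))
    (x : 'rV[R]_(m + m)) : R :=
  let g i j := fun y => kmet c y i j in
  2^-1 * \sum_f invmx (kmet c x) e f *
    (pd a (g f b) x + pd b (g f a) x - pd f (g a b) x).

(* Covariant derivative of a complex vector field Y along the tangent vector X
   at x, extended complex linearly in X. *)
Definition levi_civita (c : kidx K) (X : 'rV[R[i]]_(m + m))
    (Y : 'rV[R]_(m + m) -> 'rV[R[i]]_(m + m)) (x : 'rV[R]_(m + m)) :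
    'rV[R[i]]_(m + m) :=
  \sum_a X ord0 a *:
    (pd_cmx a Y x +
     \row_e \sum_b Y x ord0 b * real_complex R (christoffel c a b e x)).

(* Complex bilinear extension of the metric. *)
Definition cmet (c : kidx K) x (X Y : 'rV[R[i]]_(m + m)) : R[i] :=
  (X *m cplx (kmet c x) *m Y^T) ord0 ord0.

(* Local smooth sections of the bundle U(M) of unitary frames: the row k of
   lfr_mx x is eps_k in the coordinates of the chart, J eps_k = i eps_k and
   g(eps_k, conj eps_l) = delta_kl. *)
Record local_frame := LocalFrame {
  lfr_idx : kidx K;
  lfr_dom : set 'rV[R]_(m + m);
  lfr_mx : 'rV[R]_(m + m) -> 'M[R[i]]_(m, m + m);
  lfr_open : open lfr_dom;
  lfr_sub : lfr_dom `<=` kcod lfr_idx;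
  lfr_smooth : smooth_cmx_on lfr_dom lfr_mx;
  lfr_type10 : forall x, lfr_dom x ->
    lfr_mx x *m cplx (stdJ R m) = Complex 0 1 *: lfr_mx x;
  lfr_unitary : forall x, lfr_dom x ->
    lfr_mx x *m cplx (kmet lfr_idx x) *m (conjmx (lfr_mx x))^T = 1%:M
}.

Definition lfr_pt (al : local_frame) (x : 'rV[R]_(m + m)) : M :=
  kinv (lfr_idx al) x.

Definition eps (al : local_frame) (k : 'I_m) (x : 'rV[R]_(m + m)) :
  'rV[R[i]]_(m + m) := row k (lfr_mx al x).
Definition epsbar (al : local_frame) (k : 'I_m) (x : 'rV[R]_(m + m)) :
  'rV[R[i]]_(m + m) := conjmx (eps al k x).

(* The connection form of U(M):
   nabla_X eps_l = \sum_k (conn al X x) k l eps_k. *)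
Definition conn (al : local_frame) (X : 'rV[R[i]]_(m + m))
    (x : 'rV[R]_(m + m)) : 'M[R[i]]_m :=
  \matrix_(k, l) cmet (lfr_idx al) x
    (levi_civita (lfr_idx al) X (eps al l) x) (epsbar al k x).

(* A section of U(M) x_V W is given by its components, with values in W, in the
   trivializations defined by the local frames, subject to [eps u, v] =
   [eps, u v]; its values outside the domains of the frames are irrelevant. *)
Definition field (d e : nat) :=
  local_frame -> 'rV[R]_(m + m) -> 'M[R[i]]_(d, e).

Definition is_section d e
    (act : 'M[R[i]]_m -> 'M[R[i]]_(d, e) -> 'M[R[i]]_(d, e))
    (U : {vspace 'M[R[i]]_(d, e)}) (phi : field d e) : Prop :=
  [/\ forall al, smooth_cmx_on (lfr_dom al) (phi al),
      forall al x, lfr_dom al x -> phi al x \in U &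
      forall al be x y u, lfr_dom al x -> lfr_dom be y ->
        lfr_pt al x = lfr_pt be y -> u \is unitarymx ->
        (* the frame be is the frame al multiplied by u:
           eps'_l = \sum_k eps_k u_kl *)
        lfr_mx be y =
          u^T *m lfr_mx al x *m cplx (trans_jac (lfr_idx al) (lfr_idx be) x) ->
        phi al x = act u (phi be y)].

Definition vanishes d e (phi : field d e) : Prop :=
  forall al x, lfr_dom al x -> phi al x = 0.

(* Integration and formal adjoints *)

(* The integral with respect to the Riemannian volume measure, on continuous
   functions. By partitions of unity it is determined by linearity and by its
   values on functions supported in a chart; M is compact here, so that closed
   supports are compact. *)
Definition riemannian_integral (I : (M -> R) -> R) : Prop :=
  [/\ forall f h, continuous f -> continuous h ->
        I (fun p => f p + h p) = I f + I h,
      forall (a : R) f, continuous f -> I (fun p => a * f p) = a * I f &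
      forall (c : kidx K) f, continuous f ->
        closure [set p | f p != 0] `<=` kdom c ->
        I f = iterated_integral
          ((fun x => f (kinv c x) * Num.sqrt (\det (kmet c x))) \_ (kcod c))].

(* Hermitian product of two sections at p, computed in any frame at p. *)
Definition fibre_dot d e (phi psi : field d e) (p : M) : R[i] :=
  xget 0 [set z | exists al x,
    [/\ lfr_dom al x, lfr_pt al x = p & z = hdot (phi al x) (psi al x)]].

Definition L2_dot (I : (M -> R) -> R) d e (phi psi : field d e) : R[i] :=
  Complex (I (fun p => complex.Re (fibre_dot phi psi p)))
          (I (fun p => complex.Im (fibre_dot phi psi p))).

Definition formal_adjoint (I : (M -> R) -> R) d e d' e'
    (sec : set (field d e)) (sec' : set (field d' e'))
    (D : field d e -> field d' e') (Dst : field d' e' -> field d e) : Prop :=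
  (forall psi, sec' psi -> sec (Dst psi)) /\
  (forall phi psi, sec phi -> sec' psi ->
    L2_dot I (D phi) psi = L2_dot I phi (Dst psi)).

(* Covariant derivatives and curvature on U(M) x_V C^d *)

Section Bundle.
Variables (d : nat) (V : unitary_rep R m d).

(* In the trivialization al, along the complex vector field X. *)
Definition cov (al : local_frame) (X : 'rV[R]_(m + m) -> 'rV[R[i]]_(m + m))
    (f : 'rV[R]_(m + m) -> 'cV[R[i]]_d) : 'rV[R]_(m + m) -> 'cV[R[i]]_d :=
  fun x => \sum_a X x ord0 a *: pd_cmx a f x
           + urep_diff V (conn al (X x) x) *m f x.

(* nabla^{0,1} and nabla^{1,0}: the column k is the coefficient of eps_k,
   respectively of conj eps_k. *)
Definition nabla01 (phi : field d 1) : field d m :=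
  fun al x => \matrix_(i, k) cov al (epsbar al k) (phi al) x i ord0.
Definition nabla10 (phi : field d 1) : field d m :=
  fun al x => \matrix_(i, k) cov al (eps al k) (phi al) x i ord0.
Definition nabla (phi : field d 1) : field d (m + m) :=
  fun al x => row_mx (nabla01 phi al x) (nabla10 phi al x).

Definition grad_p (P : 'I_m -> 'End('M[R[i]]_(d, m))) (i : 'I_m)
    (phi : field d 1) : field d m := fun al x => P i (nabla01 phi al x).
Definition grad_m (P : 'I_m -> 'End('M[R[i]]_(d, m))) (i : 'I_m)
    (phi : field d 1) : field d m := fun al x => P i (nabla10 phi al x).

Definition bracket (X Y : 'rV[R]_(m + m) -> 'rV[R[i]]_(m + m)) :
    'rV[R]_(m + m) -> 'rV[R[i]]_(m + m) :=
  fun x => \sum_a (X x ord0 a *: pd_cmx a Y x - Y x ord0 a *: pd_cmx a X x).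

Definition curv_op (al : local_frame)
    (X Y : 'rV[R]_(m + m) -> 'rV[R[i]]_(m + m))
    (f : 'rV[R]_(m + m) -> 'cV[R[i]]_d) : 'rV[R]_(m + m) -> 'cV[R[i]]_d :=
  fun x => cov al X (cov al Y f) x - cov al Y (cov al X f) x
           - cov al (bracket X Y) f x.

(* The operator curv_op al X Y is tensorial: its matrix at x is obtained by
   applying it to the sections that are constant in the trivialization. *)
Definition curv (al : local_frame)
    (X Y : 'rV[R]_(m + m) -> 'rV[R[i]]_(m + m)) (x : 'rV[R]_(m + m)) :
    'M[R[i]]_d :=
  \matrix_(i, j) curv_op al X Y (fun _ => delta_mx j ord0) x i ord0.

Definition curv0 (al : local_frame) (x : 'rV[R]_(m + m)) : 'M[R[i]]_d :=
  \sum_k curv al (eps al k) (epsbar al k) x.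

Definition curv1 (al : local_frame) (x : 'rV[R]_(m + m)) : 'M[R[i]]_d :=
  \sum_k \sum_l
    urep_diff V (delta_mx l k) *m curv al (eps al k) (epsbar al l) x.

Definition sections : set (field d 1) := is_section (act0 V) fullv.

End Bundle.

End KahlerGeometry.

Arguments sections {R m M} K {d} V.

(* The endomorphism - 2/(w_{+1}+w_{-m}) R^1 - (w_{+1}-w_{-m})/(w_{+1}+w_{-m}) R^0
   in the trivialization al. *)
Definition weitzenboeck_curv (R : realType) (n : nat) (M : topologicalType)
    (K : kahler R n.+1 M) (d : nat) (V : unitary_rep R n.+1 d)
    (rho : 'I_n.+1 -> int) (al : local_frame K) (x : 'rV[R]_(n.+1 + n.+1)) :
    'M[R[i]]_d :=
  let w1 := wp rho ord0 in
  let wn := wm rho ord_max in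
  - ((2 / (w1 + wn)%:~R) *: curv1 V al x)
  - (((w1 - wn)%:~R / (w1 + wn)%:~R) *: curv0 V al x).

(* Main.v *)
Require Import Defs.
From HB Require Import structures.
From mathcomp Require Import all_boot all_order all_algebra.
From mathcomp Require Import spectral perm.
From mathcomp Require Import all_classical all_reals all_analysis.
From mathcomp Require Import complex ring lra.

(* Let T_kl be endomorphisms of V with T_kl^* = T_lk that transform like the matrix units. On a
   domain with a unitary frame eps_k, the Kaehler condition implies that
     sum_kl <T_kl nabla_l h, nabla_k f> - <T_kl nabla_kbar h, nabla_lbar f>
            - <h, T_lk R(eps_k, epsbar_l) f>
   is the divergence of a vector field. The operators sum_kl pi(e_kl) A e_kl and
   sum_kl pi(e_kl) A e_lk are determined by the Casimir operator and act on the summands of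
   V (x) C^m and V (x) conj(C^m) by conformal weights, so T_kl = delta_kl and T_kl = pi(e_kl)
   combine to the integrand of the formula: for h with compact support in the domain of a frame,
     int sum coef <D h, D f> = int <nabla h, nabla f> + <h, W f>.
   This tests the first assertion against sections supported in one frame domain, and it shows
   that W is Hermitian. For the second, let h run through the pieces of phi cut out by a partition
   of unity: the integral of |nabla phi|^2 plus a non-negative curvature term vanishes, so phi is
   parallel and has a zero. *)

Set Implicit Arguments.
Unset Strict Implicit.
Unset Printing Implicit Defensive.

Import Order.TTheory GRing.Theory Num.Theory.
Import numFieldNormedType.Exports.

Local Open Scope classical_set_scope.
Local Open Scope ring_scope.

Local Notation conjmx := Defs.conjmx.

(** * Smooth functions on R^N *)

Section Lines.
Variables (R : realType).

(** Write s for w_{+1} + w_{-m}, and N10, N01 for the squared norms of the two halves of nabla. The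
    weighted sum of the gradients is (2 w_{-m} / s) N10 + (2 w_{+1} / s) N01 - (2 / s) C, where C is
    the form of the Casimir operators. The first two coefficients are 1 minus and 1 plus (w_{+1} -
    w_{-m}) / s, so the choice T = delta trades N10 - N01 for R^0 and T = pi trades C for R^1. That
    s is non-zero has to be proved: if s = 0, then V (x) C^m has a single summand, and this forces V
    to act by scalars. Three features of the data shape the proof. [V] is only known to be
    differentiable along unitary curves through 1, so the algebra of [urep_diff] and the smoothness
    of [V] along smooth families are both derived. The functional I is linear on continuous
    functions but prescribed only on those supported in a chart, so even its positivity comes from a
    partition of unity. The formal adjoints are arbitrary operators with the adjoint property, so no
    formula for them is at hand. *)

Lemma is_deriveE (V : normedModType R) (f : V -> R) (x v : V) (df : R) :
  is_derive x v f df <->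
  (fun h : R => h^-1 *: (f (h *: v + x) - f x)) @ 0^' --> df.
Proof.
split=> [[fx <-]|fx].
  exact: fx.
have cf : derivable f x v by apply: cvgP; exact: fx.
by apply: DeriveDef => //; apply: cvg_lim fx.
Qed.

Lemma is_derive_line (V : normedModType R) (f : V -> R) (x v : V) (t df : R) :
  is_derive (x + t *: v) v f df <->
  is_derive t 1 (fun s : R => f (x + s *: v)) df.
Proof.
rewrite !is_deriveE.
have -> : (fun h : R => h^-1 *: (f (h *: v + (x + t *: v)) - f (x + t *: v))) =
  (fun h : R => h^-1 *: (f (x + (h *: (1 : R) + t) *: v) - f (x + t *: v))).
  apply/funext => h; congr (_ *: (f _ - _)).
  by rewrite scalerDl addrCA /GRing.scale /= mulr1.
by [].
Qed.

(** Bounding the intermediate point by the absolute value of h, instead of placing it in an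
    interval, treats both signs of h at once. *)
Lemma line_MVT (V : normedModType R) (f : V -> R) (x v : V) (h : R) :
  (forall c, `|c| <= `|h| -> derivable f (x + c *: v) v) ->
  exists2 c, `|c| <= `|h| & f (x + h *: v) - f x = h * 'D_v f (x + c *: v).
Proof.
move=> fx.
pose g s := f (x + s *: v); pose dg s := 'D_v f (x + s *: v).
have gd (s : R) : `|s| <= `|h| -> is_derive s (1 : R) g (dg s).
  by move=> sh; apply: (is_derive_line f x v s (dg s)).1; apply: derivableP; exact: fx.
have g0 : g 0 = f x by rewrite /g scale0r addr0.
have gc (a b : R) : (forall s, s \in `[a, b] -> `|s| <= `|h|) ->
    {within `[a, b], continuous g}.
  move=> H; apply: derivable_within_continuous => s /H/gd sh.
  exact: (@ex_derive _ _ _ _ _ _ _ sh).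
have [h0|h0] := leP 0 h.
  have H s : s \in `[0, h] -> `|s| <= `|h|.
    by rewrite in_itv /= => /andP[s0 sh]; rewrite !ger0_norm.
  have [|c cI E] := @MVT_segment R g dg 0 h h0 _ (gc _ _ H).
    by move=> s sI; apply: gd; apply: H; apply: subset_itv_oo_cc sI.
  by exists c; [exact: H|rewrite -g0 -/(g h) E subr0 mulrC].
have H s : s \in `[h, 0] -> `|s| <= `|h|.
  by rewrite in_itv /= => /andP[s0 sh]; rewrite !ler0_norm ?lerN2 // ltW.
have [|c cI E] := @MVT_segment R g dg h 0 (ltW h0) _ (gc _ _ H).
  by move=> s sI; apply: gd; apply: H; apply: subset_itv_oo_cc sI.
exists c; [exact: H|rewrite -g0 -/(g h) -opprB E /dg; lra].
Qed.

End Lines.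

Section PartialDerivatives.
Variables (R : realType) (N : nat).
Local Notation E := 'rV[R]_N.
Local Notation e_ a := (delta_mx ord0 a : E).
Implicit Types (f g : E -> R) (x y : E) (U : set E).

(** Balls of the sup norm, written by coordinates because the estimates change one coordinate at a
    time. *)
Definition box (r : R) x : set E := [set y | forall i, `|y ord0 i - x ord0 i| < r].

Lemma nbhs_box x (A : set E) : nbhs x A <-> exists2 r : R, 0 < r & box r x `<=` A.
Proof.
rewrite -nbhs_ballE; split=> [[r /= r0 rA]|[r r0 rA]]; exists r => //.
  move=> y yr; apply: rA; split=> // i j; rewrite (ord1 i) /ball /= distrC.
  exact: yr.
move=> y yr; apply: rA; case: yr => _ yr i; have := yr ord0 i; by rewrite /ball /= distrC.
Qed.

Lemma box_nbhs x r : 0 < r -> nbhs x (box r x).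
Proof. by move=> r0; apply/nbhs_box; exists r. Qed.

Lemma box_center x r : 0 < r -> box r x x.
Proof. by move=> r0 i; rewrite subrr normr0. Qed.

Lemma cvg_sum_ord (T : Type) (F : set_system T) {FF : Filter F} (n : nat)
    (h : 'I_n -> T -> R) (l : 'I_n -> R) :
  (forall i, h i @ F --> l i) -> (fun t => \sum_i h i t) @ F --> \sum_i l i.
Proof.
move=> hl; rewrite -fct_sumE.
elim/big_ind2: _ => [|l1 h1 l2 h2 H1 H2|//]; first exact: cvg_cst.
exact: cvgD H1 H2.
Qed.

Lemma near_open U (P : E -> Prop) x : open U -> U x -> (forall y, U y -> P y) ->
  \forall y \near nbhs x, P y.
Proof.
move=> Uo Ux UP; have : nbhs x U by exact: open_nbhs_nbhs.
by apply: (@filterS _ (nbhs x) (nbhs_filter x)).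
Qed.

Lemma continuous_box f x : {for x, continuous f} <->
  forall e : R, 0 < e -> exists2 r : R, 0 < r & forall y, box r x y -> `|f y - f x| < e.
Proof.
have H := @cvgrPdist_lt R R E (nbhs x) (nbhs_filter x) f (f x).
split=> [/H fx e e0|fx].
  have /nbhs_box[r r0 rA] := fx _ e0; exists r => // y /rA /=.
  by rewrite distrC.
apply/H => e e0; apply/nbhs_box; have [r r0 rA] := fx e e0.
by exists r => // y /rA /=; rewrite distrC.
Qed.

Lemma openP U : open U <-> forall x, U x -> exists2 r : R, 0 < r & box r x `<=` U.
Proof.
rewrite openE; split=> [H x /H|H x /H].
  by move=> /nbhs_box.
by move=> H'; apply/nbhs_box.
Qed.

(** The points [clip k x y], for k from 0 to N, are the corners of a path from x to y parallel to
    the axes. *)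
Definition clip (k : nat) x y : E :=
  \row_i (if (i < k)%N then y ord0 i else x ord0 i).

(** Each step of the path [clip k x y] changes one coordinate, so the mean value theorem on a line
    applies to it. Continuity, the chain rule and the local constancy of |phi|^2 for parallel phi
    all rest on this. *)
Lemma pd_telescope f x r y : box r x y ->
  (forall z, box r x z -> forall a, derivable f z (e_ a)) ->
  exists xi : 'I_N -> E,
    (forall a i, `|xi a ord0 i - x ord0 i| <= `|y ord0 i - x ord0 i|) /\
    f y - f x = \sum_a (y ord0 a - x ord0 a) * pd a f (xi a).
Proof.
move=> yr fd.
have S (a : 'I_N) : exists z : E,
    (forall i, `|z ord0 i - x ord0 i| <= `|y ord0 i - x ord0 i|) /\
    f (clip a.+1 x y) - f (clip a x y) = (y ord0 a - x ord0 a) * pd a f z.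
  set h := y ord0 a - x ord0 a; pose z0 := clip a x y.
  have zc c : `|c| <= `|h| ->
      forall i, `|(z0 + c *: e_ a) ord0 i - x ord0 i| <= `|y ord0 i - x ord0 i|.
    move=> ch i; rewrite !mxE eqxx /=; have [->|ia] := eqVneq i a.
      by rewrite ltnn mulr1 addrAC subrr add0r.
    by rewrite mulr0 addr0; case: ifP => // _; rewrite subrr normr0.
  have [|c ch E1] := @line_MVT _ _ f z0 (e_ a) h.
    move=> c ch; apply: fd => i; apply: le_lt_trans (zc c ch i) (yr i).
  exists (z0 + c *: e_ a); split; first exact: zc.
  rewrite -E1; congr (f _ - f _); apply/rowP => i; rewrite !mxE eqxx /=.
  have [->|ia] := eqVneq i a; first by rewrite ltnS leqnn ltnn mulr1 /h; lra.
  by rewrite mulr0 addr0 ltnS leq_eqVlt (inj_eq val_inj) (negbTE ia).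
have [xi H] := choice S; exists xi; split=> [a|]; first exact: (H a).1.
transitivity (f (clip N x y) - f (clip 0 x y)).
  by congr (f _ - f _); apply/rowP => i; rewrite mxE // ltn_ord.
rewrite -(telescope_sumr (fun k => f (clip k x y)) (leq0n N)) big_mkord.
by apply: eq_bigr => a _; exact: (H a).2.
Qed.

(** The case in view is [smooth_urep], where the partial derivatives are bounded before the function
    is known to be continuous. *)
Lemma partials_bounded_continuous f x r (C : R) : 0 < r ->
  (forall z, box r x z -> forall a, derivable f z (e_ a)) ->
  (forall z, box r x z -> forall a, `|pd a f z| <= C) ->
  {for x, continuous f}.
Proof.
move=> r0 fd fC; apply/continuous_box => e e0.
have C1 : 0 < `|C| * N%:R + 1 by rewrite ltr_wpDl // mulr_ge0.
pose s := Num.min r (e / (`|C| * N%:R + 1)).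
have s0 : 0 < s by rewrite lt_min r0 divr_gt0.
exists s => // y ys.
have yr : box r x y.
  by move=> i; apply: lt_le_trans (ys i) _; rewrite ge_min lexx.
have [xi [xiy E1]] := pd_telescope yr fd.
rewrite E1 (le_lt_trans (ler_norm_sum _ _ _)) //.
apply: (@le_lt_trans _ _ (\sum_(a < N) s * `|C|)).
  apply: ler_sum => a _; rewrite normrM ler_pM //; first exact/ltW/ys.
  apply: (le_trans (fC _ _ _)); last exact: ler_norm.
  by move=> i; apply: le_lt_trans (xiy a i) (yr i).
rewrite sumr_const card_ord -mulr_natr -mulrA.
have : s <= e / (`|C| * N%:R + 1) by rewrite ge_min lexx orbT.
rewrite ler_pdivlMr // mulrDr mulr1 => H.
by apply: lt_le_trans H; rewrite ltrDl.
Qed.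

(** By [pd_telescope] the difference quotient of f o c is a sum of difference quotients of the
    coordinates of c times partial derivatives of f at intermediate points, and these points
    converge to [c w]. *)
Lemma chain_rule (W : normedModType R) (c : W -> E) (w v : W) (dc : E) f r :
  0 < r -> (forall z, box r (c w) z -> forall a, derivable f z (e_ a)) ->
  (forall a, {for c w, continuous (pd a f)}) ->
  (forall a, is_derive w v (fun t => c t ord0 a) (dc ord0 a)) ->
  is_derive w v (f \o c) (\sum_a dc ord0 a * pd a f (c w)).
Proof.
move=> r0 fd fc cd.
pose q (a : 'I_N) (h : R) := h^-1 * (c (h *: v + w) ord0 a - c w ord0 a).
have qd (a : 'I_N) : q a @ 0^' --> dc ord0 a by exact: (is_deriveE (fun t => c t ord0 a) w v (dc ord0 a)).1.
have cb (s : R) : 0 < s -> \forall h \near (0 : R)^', box s (c w) (c (h *: v + w)).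
  move=> s0; rewrite /box /=.
  suff H (a : 'I_N) : \forall h \near (0 : R)^', `|c (h *: v + w) ord0 a - c w ord0 a| < s.
    by apply: filter_forall => a; exact: H.
  have H : (fun h => h * q a h) @ 0^' --> 0 * dc ord0 a.
    apply: cvgM (qd a); apply: cvg_within.
  rewrite mul0r in H; move/cvgrPdist_lt/(_ _ s0) : H; apply: filter_app.
  near=> h => H.
  have h0 : h != 0 by near: h; exact: nbhs_dnbhs_neq.
  by move: H; rewrite /q sub0r normrN mulVKf.
pose P (h : R) (xi : 'I_N -> E) := (forall a i, `|xi a ord0 i - c w ord0 i| <=
   `|c (h *: v + w) ord0 i - c w ord0 i|) /\
   f (c (h *: v + w)) - f (c w) =
     \sum_a (c (h *: v + w) ord0 a - c w ord0 a) * pd a f (xi a).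
(* The intermediate points are chosen for all h at once. Where the increment leaves the box their
   value is arbitrary, and the limit only sees small h. *)
have /choice[X HX] : forall h, exists xi, box r (c w) (c (h *: v + w)) -> P h xi.
  move=> h; have [b|b] := pselect (box r (c w) (c (h *: v + w))).
    by have [xi Pxi] := pd_telescope b fd; exists xi.
  by exists (fun=> 0).
apply: (is_deriveE _ w v _).2.
apply: (@cvg_trans _ ((fun h : R => \sum_a q a h * pd a f (X h a)) @ 0^')).
  apply: near_eq_cvg; near=> h.
  have b : box r (c w) (c (h *: v + w)) by near: h; exact: cb.
  rewrite /= (HX h b).2 /GRing.scale /= mulr_sumr.
  by apply: eq_bigr => a _; rewrite /q mulrA.
apply: cvg_sum_ord => a; apply: cvgM; first exact: qd.
apply: (cvg_comp (fun h => X h a) (pd a f)); last exact: fc.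
move=> A /nbhs_box[s s0 sA].
suff : \forall h \near (0 : R)^', A (X h a) by [].
near=> h; apply: sA.
have b : box r (c w) (c (h *: v + w)) by near: h; exact: cb.
have b' : box s (c w) (c (h *: v + w)) by near: h; exact: cb.
by move=> i; apply: le_lt_trans ((HX h b).1 a i) (b' i).
Unshelve. all: by end_near. Qed.

Lemma is_derive_comp1 (h : R -> R) (f : E -> R) x v dh df :
  is_derive (f x) (1 : R) h dh -> is_derive x v f df ->
  is_derive x v (h \o f) (dh * df).
Proof.
move=> hd fd.
have E0 : x + 0 *: v = x by rewrite scale0r addr0.
have := is_derive_line (h \o f) x v 0 (dh * df); rewrite E0 => -[_]; apply.
have fd' : is_derive (0 : R) (1 : R) (fun s => f (x + s *: v)) df.
  by apply: (is_derive_line f x v 0 df).1; rewrite E0.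
by apply: (@is_derive1_comp R h (fun s => f (x + s *: v)) 0 dh df) => //; rewrite E0.
Qed.

Lemma pd_ext U f g x a : open U -> (forall y, U y -> f y = g y) -> U x ->
  pd a f x = pd a g x.
Proof.
move=> Uo fg Ux; apply: near_eq_derive.
exact: near_open fg.
Qed.

Lemma pd_cst a (c : R) x : pd a (fun=> c) x = 0.
Proof. exact: (derive_cst c). Qed.

Lemma derivable_ext U f g x v : open U -> (forall y, U y -> f y = g y) -> U x ->
  derivable f x v -> derivable g x v.
Proof.
move=> Uo fg Ux; apply: near_eq_derivable.
exact: near_open fg.
Qed.

Lemma continuous_ext U f g x : open U -> (forall y, U y -> f y = g y) -> U x ->
  {for x, continuous f} -> {for x, continuous g}.
Proof.
move=> Uo fg Ux fc; rewrite /prop_for /continuous_at -(fg _ Ux).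
apply: cvg_trans fc; apply: (@near_eq_cvg _ _ (nbhs x) (nbhs_filter x)).
exact: near_open fg.
Qed.

Lemma smooth_on_ext U f g : open U -> (forall y, U y -> f y = g y) ->
  smooth_on U f -> smooth_on U g.
Proof.
move=> Uo fg fs s x Ux; have H : forall y, U y -> iter_pd s f y = iter_pd s g y.
  elim: s => [//|a s IH] /= y Uy; exact: pd_ext IH Uy.
split; first by apply: continuous_ext H Ux (fs s x Ux).1.
by move=> a; apply: derivable_ext H Ux ((fs s x Ux).2 a).
Qed.

Lemma smooth_on_sub U U' f : U `<=` U' -> smooth_on U' f -> smooth_on U f.
Proof. by move=> UU' fs s x /UU'; exact: fs. Qed.

Lemma smooth_continuous U f x : smooth_on U f -> U x -> {for x, continuous f}.
Proof. by move=> /(_ [::] x) H /H[]. Qed.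

Lemma smooth_derivable U f x a : smooth_on U f -> U x -> derivable f x (e_ a).
Proof. by move=> /(_ [::] x) H /H[]. Qed.

Lemma smooth_is_derive U f x a : smooth_on U f -> U x ->
  is_derive x (e_ a) f (pd a f x).
Proof. by move=> fs Ux; apply: derivableP; exact: smooth_derivable fs Ux. Qed.

Lemma smooth_pd U f a : smooth_on U f -> smooth_on U (pd a f).
Proof.
by move=> fs s x Ux; have := fs (rcons s a) x Ux; rewrite /iter_pd foldr_rcons.
Qed.

Lemma smooth_on_bigcup U f :
  (forall x, U x -> exists2 r : R, 0 < r & smooth_on (box r x) f) -> smooth_on U f.
Proof.
by move=> H s x /H[r r0 fs]; apply: fs; exact: box_center.
Qed.

(* Derivatives of a generator need only be polynomials in the generators. *)
Inductive gen U (S : set (E -> R)) : (E -> R) -> Prop :=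
| gen_in f : S f -> gen U S f
| gen_cst c : gen U S (fun=> c)
| gen_add f g : gen U S f -> gen U S g -> gen U S (fun x => f x + g x)
| gen_mul f g : gen U S f -> gen U S g -> gen U S (fun x => f x * g x)
| gen_eq f g : gen U S f -> (forall x, U x -> f x = g x) -> gen U S g.

(** Continuity and differentiability on U pass to the algebra generated by S, and this algebra is
    closed under partial derivatives; so all iterated derivatives of a member are again members. *)
Lemma gen_smooth U (S : set (E -> R)) : open U ->
  (forall f, S f -> [/\ forall x, U x -> {for x, continuous f},
     forall x a, U x -> derivable f x (e_ a) & forall a, gen U S (pd a f)]) ->
  forall f, gen U S f -> smooth_on U f.
Proof.
move=> Uo HS.
have H f : gen U S f -> [/\ forall x, U x -> {for x, continuous f},
     forall x a, U x -> derivable f x (e_ a) & forall a, gen U S (pd a f)].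
  elim=> {f}[f /HS//|c|f g fg [fc fd fp] gg [gc gd gp]|f g fg [fc fd fp] gg [gc gd gp]|].
  - split=> [x _|x a _|a].
    + exact: cst_continuous.
    + exact: derivable_cst.
    + apply: gen_eq (gen_cst _ _ 0) _ => x _; rewrite /pd.
      by rewrite (derive_cst c).
  - split=> [x Ux|x a Ux|a].
    + exact: (continuousD (fc x Ux) (gc x Ux)).
    + by apply: derivableD; [exact: fd|exact: gd].
    + apply: gen_eq (gen_add (fp a) (gp a)) _ => x Ux; rewrite /pd.
      by rewrite -deriveD //; [exact: fd|exact: gd].
  - split=> [x Ux|x a Ux|a].
    + exact: (continuousM (fc x Ux) (gc x Ux)).
    + by apply: derivableM; [exact: fd|exact: gd].
    + apply: gen_eq (gen_add (gen_mul fg (gp a)) (gen_mul gg (fp a))) _ => x Ux.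
      by rewrite /pd deriveM //; [exact: fd|exact: gd].
  - move=> f g _ [fc fd fp] fg; split=> [x Ux|x a Ux|a].
    + exact: continuous_ext fg Ux (fc x Ux).
    + exact: derivable_ext fg Ux (fd x a Ux).
    + by apply: gen_eq (fp a) _ => x Ux; exact: pd_ext fg Ux.
move=> f fg s x Ux.
have /H[sc sd _] : gen U S (iter_pd s f).
  by elim: s => [//|a s /H[_ _]] /=; exact.
by split=> [|a]; [exact: sc|exact: sd].
Qed.

Lemma smooth_self U f : smooth_on U f -> [/\ forall x, U x -> {for x, continuous f},
     forall x a, U x -> derivable f x (e_ a) & forall a, smooth_on U (pd a f)].
Proof.
move=> fs; split=> [x Ux|x a Ux|a].
- exact: smooth_continuous fs Ux.
- exact: smooth_derivable fs Ux.
- exact: smooth_pd.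
Qed.

Lemma gen_of_smooth U f : open U -> gen U (smooth_on U) f -> smooth_on U f.
Proof.
move=> Uo; apply: gen_smooth => // g /smooth_self[gc gd gp]; split=> // a.
exact: gen_in.
Qed.

Lemma smooth_cst U (c : R) : open U -> smooth_on U (fun=> c).
Proof. by move=> Uo; apply: gen_of_smooth => //; exact: gen_cst. Qed.

Lemma smooth_add U f g : open U -> smooth_on U f -> smooth_on U g ->
  smooth_on U (fun x => f x + g x).
Proof. by move=> Uo fs gs; apply: gen_of_smooth => //; apply: gen_add; exact: gen_in. Qed.

Lemma smooth_mul U f g : open U -> smooth_on U f -> smooth_on U g ->
  smooth_on U (fun x => f x * g x).
Proof. by move=> Uo fs gs; apply: gen_of_smooth => //; apply: gen_mul; exact: gen_in. Qed.

Lemma smooth_opp U f : open U -> smooth_on U f -> smooth_on U (fun x => - f x).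
Proof.
move=> Uo fs; apply: (smooth_on_ext Uo _ (smooth_mul Uo (smooth_cst (-1) Uo) fs)).
by move=> x _; rewrite mulN1r.
Qed.

Lemma smooth_sub U f g : open U -> smooth_on U f -> smooth_on U g ->
  smooth_on U (fun x => f x - g x).
Proof. by move=> Uo fs gs; exact: (smooth_add Uo fs (smooth_opp Uo gs)). Qed.

Lemma smooth_sum U (J : Type) (s : seq J) (P : pred J) (f : J -> E -> R) : open U ->
  (forall j, P j -> smooth_on U (f j)) -> smooth_on U (fun x => \sum_(j <- s | P j) f j x).
Proof.
move=> Uo fs; elim: s => [|j s IH].
  by apply: (smooth_on_ext Uo _ (smooth_cst 0 Uo)) => x _; rewrite big_nil.
have [Pj|Pj] := boolP (P j).
  apply: (smooth_on_ext Uo _ (smooth_add Uo (fs j Pj) IH)) => x _.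
  by rewrite big_cons Pj.
by apply: (smooth_on_ext Uo _ IH) => x _; rewrite big_cons (negbTE Pj).
Qed.

Lemma smooth_prod U (J : Type) (s : seq J) (P : pred J) (f : J -> E -> R) : open U ->
  (forall j, P j -> smooth_on U (f j)) -> smooth_on U (fun x => \prod_(j <- s | P j) f j x).
Proof.
move=> Uo fs; elim: s => [|j s IH].
  by apply: (smooth_on_ext Uo _ (smooth_cst 1 Uo)) => x _; rewrite big_nil.
have [Pj|Pj] := boolP (P j).
  apply: (smooth_on_ext Uo _ (smooth_mul Uo (fs j Pj) IH)) => x _.
  by rewrite big_cons Pj.
by apply: (smooth_on_ext Uo _ IH) => x _; rewrite big_cons (negbTE Pj).
Qed.

Lemma is_derive_coord (b : 'I_N) x v :
  is_derive x v (fun y : E => y ord0 b) (v ord0 b).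
Proof.
apply: (is_deriveE _ x v _).2.
apply: (@cvg_trans _ ((fun h : R => v ord0 b) @ 0^')); last exact: cvg_cst.
apply: near_eq_cvg; near=> h.
have h0 : h != 0 by near: h; exact: nbhs_dnbhs_neq.
by rewrite /= !mxE addrK /GRing.scale /= mulKf.
Unshelve. all: by end_near. Qed.

Lemma smooth_coord U b : open U -> smooth_on U (fun y : E => y ord0 b).
Proof.
move=> Uo; apply: (@gen_smooth U [set fun y : E => y ord0 b]) => //; last exact: gen_in.
move=> _ ->; split=> [x _|x a _|a].
- exact: coord_continuous.
- exact: (@ex_derive _ _ _ _ _ _ _ (is_derive_coord b x (e_ a))).
- apply: gen_eq (gen_cst _ _ ((e_ a) ord0 b)) _ => x _.
  by rewrite /pd (@derive_val _ _ _ _ _ _ _ (is_derive_coord b x (e_ a))).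
Qed.

(** With 1/f added to the smooth functions as a generator, the derivative - f' (1/f)^2 is a
    polynomial in the generators. *)
Lemma smooth_inv U f : open U -> smooth_on U f -> (forall x, U x -> f x != 0) ->
  smooth_on U (fun x => (f x)^-1).
Proof.
move=> Uo fs f0; pose S := smooth_on U `|` [set fun x => (f x)^-1].
have Sf : gen U S (fun x => (f x)^-1) by apply: gen_in; right.
apply: (gen_smooth _ _ (Sf)) => // g [/smooth_self[gc gd gp]|->].
  by split; [exact: gc|exact: gd|move=> a; apply: gen_in; left; exact: gp].
have H x a : U x -> is_derive x (e_ a) (fun x => (f x)^-1) (- f x ^- 2 * 1 * pd a f x).
  move=> Ux; have H1 := @is_deriveV R id (f x) 1 1 (f0 x Ux) (is_derive_id _ _).
  exact: (@is_derive_comp1 _ f x (e_ a) _ _ H1 (smooth_is_derive a fs Ux)).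
split=> [x Ux|x a Ux|a].
- exact: (continuousV (f0 x Ux) (smooth_continuous fs Ux)).
- exact: (@ex_derive _ _ _ _ _ _ _ (H x a Ux)).
- apply: (gen_eq (f := fun x => (-1 * pd a f x) * ((f x)^-1 * (f x)^-1))).
    apply: gen_mul; last exact: gen_mul.
    apply: gen_mul; first exact: gen_cst.
    by apply: gen_in; left; exact: smooth_pd.
  move=> x Ux; rewrite [RHS]/pd (@derive_val _ _ _ _ _ _ _ (H x a Ux)).
  by have := f0 x Ux; move=> ?; field.
Qed.

(** The derivative is written as f' (1/f) (sqrt f) / 2, a polynomial in sqrt f and smooth
    functions. *)
Lemma smooth_sqrt U f : open U -> smooth_on U f -> (forall x, U x -> 0 < f x) ->
  smooth_on U (fun x => Num.sqrt (f x)).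
Proof.
move=> Uo fs f0; pose S := smooth_on U `|` [set fun x => Num.sqrt (f x)].
have Sf : gen U S (fun x => Num.sqrt (f x)) by apply: gen_in; right.
have fi : smooth_on U (fun x => (f x)^-1).
  by apply: smooth_inv => // x /f0; rewrite lt0r => /andP[].
apply: (gen_smooth _ _ (Sf)) => // g [/smooth_self[gc gd gp]|->].
  by split; [exact: gc|exact: gd|move=> a; apply: gen_in; left; exact: gp].
have H x a : U x -> is_derive x (e_ a) (fun x => Num.sqrt (f x))
    ((2 * Num.sqrt (f x))^-1 * pd a f x).
  move=> Ux; apply: (@is_derive_comp1 Num.sqrt f).
    exact: is_derive1_sqrt (f0 x Ux).
  exact: smooth_is_derive fs Ux.
split=> [x Ux|x a Ux|a].
- apply: (continuous_comp (smooth_continuous fs Ux)).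
  exact: sqrt_continuous.
- exact: (@ex_derive _ _ _ _ _ _ _ (H x a Ux)).
- apply: (gen_eq (f := fun x => (2^-1 * pd a f x) * ((f x)^-1 * Num.sqrt (f x)))).
    apply: gen_mul; last by apply: gen_mul; [apply: gen_in; left; exact: fi|exact: Sf].
    apply: gen_mul; first exact: gen_cst.
    by apply: gen_in; left; exact: smooth_pd.
  move=> x Ux; rewrite [RHS]/pd (@derive_val _ _ _ _ _ _ _ (H x a Ux)).
  have s0 : Num.sqrt (f x) != 0 by rewrite sqrtr_eq0 -ltNge f0.
  have -> : (f x)^-1 = (Num.sqrt (f x))^-1 * (Num.sqrt (f x))^-1.
    by rewrite -invfM -expr2 sqr_sqrtr // ltW // f0.
  by field.
Qed.

End PartialDerivatives.

Section Composition.
Variables (R : realType) (N N' : nat).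

Lemma smooth_is_derive_comp (U : set 'rV[R]_N) (U' : set 'rV[R]_N')
    (c : 'rV[R]_N -> 'rV[R]_N') f x a : open U' ->
  smooth_mx_on U c -> smooth_on U' f -> U x -> U' (c x) ->
  is_derive x (delta_mx ord0 a) (f \o c)
    (\sum_b pd a (fun y => c y ord0 b) x * pd b f (c x)).
Proof.
move=> U'o cs fs Ux U'x.
have [r r0 rU] := (openP _).1 U'o _ U'x.
pose dc : 'rV[R]_N' := \row_b pd a (fun y => c y ord0 b) x.
have := @chain_rule R N' _ c x (delta_mx ord0 a) dc f r r0.
under eq_bigr => b _ do rewrite /dc mxE.
apply.
- by move=> z /rU zU b; exact: smooth_derivable fs zU.
- by move=> b; exact: smooth_continuous (smooth_pd b fs) U'x.
- by move=> b; rewrite mxE; exact: smooth_is_derive (cs _ _) Ux.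
Qed.

Lemma smooth_mx_continuous (U : set 'rV[R]_N) (c : 'rV[R]_N -> 'rV[R]_N') x :
  smooth_mx_on U c -> U x -> {for x, continuous c}.
Proof.
move=> cs Ux A /nbhs_box[r r0 rA].
suff : nbhs x (fun y => forall i, `|c y ord0 i - c x ord0 i| < r).
  by apply: (@filterS _ (nbhs x) (nbhs_filter x)) => y; exact: rA.
apply: (@filter_forall _ 'I_N' (fun i => [set y | `|c y ord0 i - c x ord0 i| < r])
  (nbhs x) (nbhs_filter x)) => i; apply/nbhs_box.
by have /continuous_box/(_ _ r0) := smooth_continuous (cs ord0 i) Ux.
Qed.

(** All compositions g o c with g smooth are made generators at once, since the chain rule produces
    compositions of the partial derivatives of g. *)
Lemma smooth_comp (U : set 'rV[R]_N) (U' : set 'rV[R]_N')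
    (c : 'rV[R]_N -> 'rV[R]_N') f : open U -> open U' ->
  smooth_mx_on U c -> smooth_on U' f -> (forall x, U x -> U' (c x)) ->
  smooth_on U (f \o c).
Proof.
move=> Uo U'o cs fs cU.
pose S : set ('rV[R]_N -> R) := smooth_on U `|` [set f \o c | f in smooth_on U'].
have Sf : gen U S (f \o c) by apply: gen_in; right; exists f.
apply: (gen_smooth _ _ (Sf)) => // g' [/smooth_self[gc gd gp]|[g gs <-]].
  by split; [exact: gc|exact: gd|move=> a; apply: gen_in; left; exact: gp].
have H x a : U x -> is_derive x (delta_mx ord0 a) (g \o c)
    (\sum_b pd a (fun y => c y ord0 b) x * pd b g (c x)).
  by move=> Ux; apply: smooth_is_derive_comp U'o cs gs Ux (cU _ Ux).
split=> [x Ux|x a Ux|a].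
- apply: continuous_comp; first exact: smooth_mx_continuous cs Ux.
  exact: smooth_continuous gs (cU _ Ux).
- exact: (@ex_derive _ _ _ _ _ _ _ (H x a Ux)).
- apply: (gen_eq (f := fun x => \sum_b pd a (fun y => c y ord0 b) x * pd b g (c x))).
    rewrite (_ : (fun x => _) = \sum_b (fun x => pd a (fun y => c y ord0 b) x * pd b g (c x))); last first.
      by apply/funext => x; rewrite fct_sumE.
    apply: (big_ind (gen U S)) => [|h1 h2 H1 H2|b _]; first exact: gen_cst.
      exact: gen_add.
    apply: gen_mul; apply: gen_in; [left|right].
      by apply: smooth_pd; exact: cs.
    by exists (pd b g); [exact: smooth_pd gs|].
  by move=> x Ux; rewrite /pd (@derive_val _ _ _ _ _ _ _ (H x a Ux)).
Qed.

End Composition.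

(** * Symmetry of second derivatives *)

Section Schwarz.
Variables (R : realType) (N : nat).
Local Notation e_ a := (delta_mx ord0 a : 'rV[R]_N).

(** The mean value theorem is applied to y |-> f (y + h e_b) - f y along e_a, and then along e_b.
    The second difference itself is symmetric in a and b, which is what [pdC] uses. *)
Lemma mixed_difference (U : set 'rV[R]_N) (f : 'rV[R]_N -> R) x a b (r h : R) :
  smooth_on U f -> box r x `<=` U -> 0 < h -> h + h < r ->
  exists2 z, box r x z &
    f (x + h *: e_ b + h *: e_ a) - f (x + h *: e_ a) - (f (x + h *: e_ b) - f x)
      = h * h * pd b (pd a f) z.
Proof.
move=> fs rU h0 hr.
have inr c d : `|c| <= `|h| -> `|d| <= `|h| -> box r x (x + c *: e_ a + d *: e_ b).
  move=> ch dh i; rewrite !mxE -addrA [x _ _ + _]addrC addrK.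
  rewrite (le_lt_trans (ler_normD _ _)) // (le_lt_trans _ hr) //.
  rewrite !normrM -[leRHS](ger0_norm (addr_ge0 (ltW h0) (ltW h0))).
  rewrite [leRHS]ger0_norm ?addr_ge0 ?(ltW h0) // -[h in leRHS](ger0_norm (ltW h0)).
  by apply: lerD; rewrite -[leRHS]mulr1 ler_pM // !eqxx /=;
    case: (_ == _); rewrite ?normr1 ?normr0.
have fd u v : `|u| <= `|h| -> `|v| <= `|h| ->
    is_derive (x + u *: e_ a + v *: e_ b) (e_ a) f (pd a f (x + u *: e_ a + v *: e_ b)).
  by move=> uh vh; apply: smooth_is_derive fs _; apply: rU; exact: inr.
have h1 : `|h| <= `|h| by [].
have z1 : `|0 : R| <= `|h| by rewrite normr0.
pose g y := f (y + h *: e_ b) - f y.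
have gd c : `|c| <= `|h| -> is_derive (x + c *: e_ a) (e_ a) g
   (pd a f (x + c *: e_ a + h *: e_ b) - pd a f (x + c *: e_ a)).
  move=> ch; apply: is_deriveB; last by have := fd c 0 ch z1; rewrite scale0r addr0.
  apply: (is_deriveE _ _ _ _).2; have := (is_deriveE _ _ _ _).1 (fd c h ch h1).
  by under eq_fun do rewrite addrA.
have [c ch] := @line_MVT _ _ g x (e_ a) h (fun c ch =>
   @ex_derive _ _ _ _ _ _ _ (gd c ch)).
rewrite (@derive_val _ _ _ _ _ _ _ (gd c ch)) /g => gE.
have [d dh] := @line_MVT _ _ (pd a f) (x + c *: e_ a) (e_ b) h (fun d dh =>
   smooth_derivable (a := b) (smooth_pd a fs) (rU _ (inr c d ch dh))).
rewrite -/(pd b (pd a f) _) => dE.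
exists (x + c *: e_ a + d *: e_ b); first exact: inr.
by rewrite -mulrA -dE -gE [x + h *: e_ b + _]addrAC; lra.
Qed.

Lemma pdC (U : set 'rV[R]_N) (f : 'rV[R]_N -> R) x a b :
  open U -> smooth_on U f -> U x -> pd a (pd b f) x = pd b (pd a f) x.
Proof.
move=> Uo fs Ux; apply/eqP; rewrite -subr_eq0 -normr_le0.
apply/ler_addgt0Pl => e e0; rewrite addr0.
have [r r0 rU] := (openP _).1 Uo _ Ux.
have e2 : 0 < e / 2 by rewrite divr_gt0.
have [r1 r10 r1c] := (continuous_box _ _).1
  (smooth_continuous (smooth_pd a (smooth_pd b fs)) Ux) _ e2.
have [r2 r20 r2c] := (continuous_box _ _).1
  (smooth_continuous (smooth_pd b (smooth_pd a fs)) Ux) _ e2.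
pose s := Num.min r (Num.min r1 r2).
have s0 : 0 < s by rewrite !lt_min r0 r10.
have sU : box s x `<=` U.
  by move=> y ys; apply: rU => i; apply: lt_le_trans (ys i) _; rewrite ge_min lexx.
(* With side s / 3 the square of the second difference stays strictly inside the box of radius s. *)
have h0 : 0 < s / 3 by rewrite divr_gt0.
have hs : s / 3 + s / 3 < s by lra.
have [z zs zE] := mixed_difference a b fs sU h0 hs.
have [w ws wE] := mixed_difference b a fs sU h0 hs.
have E1 : pd b (pd a f) z = pd a (pd b f) w.
  move: zE wE; move: (pd b (pd a f) z) (pd a (pd b f) w) => P Q zE wE.
  apply: (mulfI (mulf_neq0 (lt0r_neq0 h0) (lt0r_neq0 h0))).
  rewrite -zE -wE [x + _ + (s / 3) *: e_ b]addrAC.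
  by move: (f _) (f (x + _ *: e_ a)) (f (x + _ *: e_ b)) (f x) => p1 p2 p3 p4; ring.
have zr : box r2 x z.
  by move=> i; apply: lt_le_trans (zs i) _; rewrite !ge_min lexx !orbT.
have wr : box r1 x w.
  by move=> i; apply: lt_le_trans (ws i) _; rewrite !ge_min lexx !orbT.
have := r1c _ wr; have := r2c _ zr; rewrite E1.
move: (pd a (pd b f) x) (pd b (pd a f) x) (pd a (pd b f) w) => p q t A B.
rewrite -(subrKA t) addrC; apply: (le_trans (ler_normD _ _)).
by rewrite [e]splitr; apply: lerD; [exact: ltW A|rewrite distrC; exact: ltW B].
Qed.

End Schwarz.

(** * Complex matrix-valued functions *)

Section ComplexParts.
Variable R : realType.
Implicit Types (a b : R[i]).

Lemma reD a b : complex.Re (a + b) = complex.Re a + complex.Re b.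
Proof. by case: a b => [? ?] [? ?]. Qed.
Lemma imD a b : complex.Im (a + b) = complex.Im a + complex.Im b.
Proof. by case: a b => [? ?] [? ?]. Qed.
Lemma reN a : complex.Re (- a) = - complex.Re a.
Proof. by case: a => [? ?]. Qed.
Lemma imN a : complex.Im (- a) = - complex.Im a.
Proof. by case: a => [? ?]. Qed.
Lemma reM a b : complex.Re (a * b) =
  complex.Re a * complex.Re b - complex.Im a * complex.Im b.
Proof. by case: a b => [? ?] [? ?]. Qed.
Lemma imM a b : complex.Im (a * b) =
  complex.Re a * complex.Im b + complex.Im a * complex.Re b.
Proof. by case: a b => [? ?] [? ?]. Qed.
Lemma reJ a : complex.Re (Num.conj a) = complex.Re a.
Proof. by case: a => [? ?]. Qed.
Lemma imJ a : complex.Im (Num.conj a) = - complex.Im a.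
Proof. by case: a => [? ?]. Qed.
Lemma re_sum (J : Type) (s : seq J) (P : pred J) (f : J -> R[i]) :
  complex.Re (\sum_(j <- s | P j) f j) = \sum_(j <- s | P j) complex.Re (f j).
Proof. by apply: (big_morph (@complex.Re R)) => [a b|]; rewrite ?reD. Qed.
Lemma im_sum (J : Type) (s : seq J) (P : pred J) (f : J -> R[i]) :
  complex.Im (\sum_(j <- s | P j) f j) = \sum_(j <- s | P j) complex.Im (f j).
Proof. by apply: (big_morph (@complex.Im R)) => [a b|]; rewrite ?imD. Qed.
Lemma complexP a b : complex.Re a = complex.Re b -> complex.Im a = complex.Im b -> a = b.
Proof. by case: a b => [? ?] [? ?] /= -> ->. Qed.
Lemma conjC_sum (J : Type) (s : seq J) (P : pred J) (f : J -> R[i]) :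
  Num.conj (\sum_(j <- s | P j) f j) = \sum_(j <- s | P j) Num.conj (f j).
Proof. exact: raddf_sum. Qed.

End ComplexParts.

Lemma linear_mx_delta (F : comNzRingType) p q p' q'
    (T : {linear 'M[F]_(p, q) -> 'M[F]_(p', q')}) (A : 'M[F]_(p, q)) :
  T A = \sum_i \sum_j A i j *: T (delta_mx i j).
Proof.
rewrite {1}[A]matrix_sum_delta (big_morph T (raddfD T) (raddf0 T)).
apply: eq_bigr => i _; rewrite (big_morph T (raddfD T) (raddf0 T)).
by apply: eq_bigr => j _; exact: linearZ_LR.
Qed.

Section ComplexDerivatives.
Variables (R : realType) (W : normedModType R).
Implicit Types (x v : W) (f g : W -> R[i]).

(** The direction and the differentiation are real; only the values are complex. As a relation it
    carries existence and value of the derivative together, so the rules compose without side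
    conditions. *)
Definition dC v f x (l : R[i]) : Prop :=
  is_derive x v (fun y => complex.Re (f y)) (complex.Re l) /\
  is_derive x v (fun y => complex.Im (f y)) (complex.Im l).

Lemma is_derive_eq1 (f g : W -> R) x v l l' : f = g -> l = l' ->
  is_derive x v f l -> is_derive x v g l'.
Proof. by move=> -> ->. Qed.

Lemma dC_cst v c x : dC v (fun=> c) x 0.
Proof. by split; apply: is_derive_cst. Qed.

Lemma dC_add v f g x l k : dC v f x l -> dC v g x k ->
  dC v (fun y => f y + g y) x (l + k).
Proof.
move=> [fr fi] [gr gi]; split.
  by apply: is_derive_eq1 (is_deriveD fr gr); [apply/funext => y|]; rewrite reD.
by apply: is_derive_eq1 (is_deriveD fi gi); [apply/funext => y|]; rewrite imD.
Qed.

Lemma dC_opp v f x l : dC v f x l -> dC v (fun y => - f y) x (- l).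
Proof.
move=> [fr fi]; split.
  by apply: is_derive_eq1 (is_deriveN fr); [apply/funext => y|]; rewrite reN.
by apply: is_derive_eq1 (is_deriveN fi); [apply/funext => y|]; rewrite imN.
Qed.

Lemma dC_mul v f g x l k : dC v f x l -> dC v g x k ->
  dC v (fun y => f y * g y) x (l * g x + f x * k).
Proof.
move=> [fr fi] [gr gi]; split.
  apply: is_derive_eq1 (is_deriveB (is_deriveM fr gr) (is_deriveM fi gi)).
    by apply/funext => y; rewrite reM.
  rewrite reD !reM /GRing.scale /=; move: (f x) (g x) => [a b] [c d] /=; ring.
apply: is_derive_eq1 (is_deriveD (is_deriveM fr gi) (is_deriveM fi gr)).
  by apply/funext => y; rewrite imM.
rewrite imD !imM /GRing.scale /=; move: (f x) (g x) => [a b] [c d] /=; ring.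
Qed.

Lemma dC_conj v f x l : dC v f x l -> dC v (fun y => Num.conj (f y)) x (Num.conj l).
Proof.
move=> [fr fi]; split.
  by apply: is_derive_eq1 fr; [apply/funext => y|]; rewrite reJ.
by apply: is_derive_eq1 (is_deriveN fi); [apply/funext => y|]; rewrite imJ.
Qed.

Lemma dC_sum v (J : Type) (s : seq J) (P : pred J) (f : J -> W -> R[i]) x (l : J -> R[i]) :
  (forall j, P j -> dC v (f j) x (l j)) ->
  dC v (fun y => \sum_(j <- s | P j) f j y) x (\sum_(j <- s | P j) l j).
Proof.
move=> H; elim: s => [|j s IH].
  by rewrite big_nil; under eq_fun do rewrite big_nil; exact: dC_cst.
rewrite big_cons; under eq_fun do rewrite big_cons.
by case: ifP => // /H Hj; exact: dC_add.
Qed.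

Lemma dC_real v (f : W -> R) x (l : R) : is_derive x v f l ->
  dC v (fun y => real_complex R (f y)) x (real_complex R l).
Proof. by move=> fl; split=> //=; apply: is_derive_cst. Qed.

Lemma dC_unique v f x l k : dC v f x l -> dC v f x k -> l = k.
Proof.
move=> [fr fi] [gr gi]; apply: complexP.
  by rewrite -(@derive_val _ _ _ _ _ _ _ fr) (@derive_val _ _ _ _ _ _ _ gr).
by rewrite -(@derive_val _ _ _ _ _ _ _ fi) (@derive_val _ _ _ _ _ _ _ gi).
Qed.

Definition dM p q v (F : W -> 'M[R[i]]_(p, q)) x (L : 'M[R[i]]_(p, q)) : Prop :=
  forall i j, dC v (fun y => F y i j) x (L i j).

Lemma dM_cst p q v (A : 'M[R[i]]_(p, q)) x : dM v (fun=> A) x 0.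
Proof. by move=> i j; rewrite mxE; exact: dC_cst. Qed.

Lemma dM_add p q v (F G : W -> 'M[R[i]]_(p, q)) x L K : dM v F x L -> dM v G x K ->
  dM v (fun y => F y + G y) x (L + K).
Proof.
by move=> FL GK i j; rewrite mxE; under eq_fun do rewrite mxE; exact: dC_add.
Qed.

Lemma dM_opp p q v (F : W -> 'M[R[i]]_(p, q)) x L : dM v F x L ->
  dM v (fun y => - F y) x (- L).
Proof.
by move=> FL i j; rewrite mxE; under eq_fun do rewrite mxE; exact: dC_opp.
Qed.

Lemma dM_mul p q r v (F : W -> 'M[R[i]]_(p, q)) (G : W -> 'M[R[i]]_(q, r)) x L K :
  dM v F x L -> dM v G x K ->
  dM v (fun y => F y *m G y) x (L *m G x + F x *m K).
Proof.
move=> FL GK i j; under eq_fun do rewrite mxE.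
rewrite !mxE -big_split /=; apply: dC_sum => k _; exact: dC_mul.
Qed.

Lemma dM_mull p q r v (A : 'M[R[i]]_(p, q)) (G : W -> 'M[R[i]]_(q, r)) x K :
  dM v G x K -> dM v (fun y => A *m G y) x (A *m K).
Proof.
by move=> GK; have := dM_mul (dM_cst v A x) GK; rewrite mul0mx add0r.
Qed.

Lemma dM_mulr p q r v (A : 'M[R[i]]_(q, r)) (F : W -> 'M[R[i]]_(p, q)) x L :
  dM v F x L -> dM v (fun y => F y *m A) x (L *m A).
Proof.
by move=> FL; have := dM_mul FL (dM_cst v A x); rewrite mulmx0 addr0.
Qed.

Lemma dM_tr p q v (F : W -> 'M[R[i]]_(p, q)) x L : dM v F x L ->
  dM v (fun y => (F y)^T) x L^T.
Proof.
by move=> FL i j; rewrite mxE; under eq_fun do rewrite mxE; exact: FL.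
Qed.

Lemma dM_conj p q v (F : W -> 'M[R[i]]_(p, q)) x L : dM v F x L ->
  dM v (fun y => conjmx (F y)) x (conjmx L).
Proof.
by move=> FL i j; rewrite mxE; under eq_fun do rewrite mxE; exact: dC_conj.
Qed.

Lemma dM_scale p q v f (F : W -> 'M[R[i]]_(p, q)) x l L : dC v f x l -> dM v F x L ->
  dM v (fun y => f y *: F y) x (l *: F x + f x *: L).
Proof.
move=> fl FL i j; rewrite !mxE; under eq_fun do rewrite mxE; exact: dC_mul.
Qed.

Lemma dM_sum p q v (J : Type) (s : seq J) (P : pred J) (F : J -> W -> 'M[R[i]]_(p, q)) x
    (L : J -> 'M[R[i]]_(p, q)) :
  (forall j, P j -> dM v (F j) x (L j)) ->
  dM v (fun y => \sum_(j <- s | P j) F j y) x (\sum_(j <- s | P j) L j).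
Proof.
move=> H; elim: s => [|j s IH].
  by rewrite big_nil; under eq_fun do rewrite big_nil; exact: dM_cst.
rewrite big_cons; under eq_fun do rewrite big_cons.
by case: ifP => // /H Hj; exact: dM_add.
Qed.

Lemma dM_linear p q p' q' v (T : {linear 'M[R[i]]_(p, q) -> 'M[R[i]]_(p', q')})
    (F : W -> 'M[R[i]]_(p, q)) x L :
  dM v F x L -> dM v (fun y => T (F y)) x (T L).
Proof.
move=> FL; rewrite linear_mx_delta; under eq_fun do rewrite linear_mx_delta.
apply: dM_sum => i _; apply: dM_sum => j _.
have := dM_scale (FL i j) (dM_cst v (T (delta_mx i j)) x).
by rewrite scaler0 addr0.
Qed.

Lemma dM_unique p q v (F : W -> 'M[R[i]]_(p, q)) x L K : dM v F x L -> dM v F x K -> L = K.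
Proof. by move=> FL FK; apply/matrixP => i j; apply: dC_unique (FL i j) (FK i j). Qed.

Lemma dC_near v f g x l : (\near x, f x = g x) -> dC v f x l -> dC v g x l.
Proof.
move=> fg [fr fi]; split.
  by apply: near_eq_is_derive fr; apply: filterS fg => y /= ->.
by apply: near_eq_is_derive fi; apply: filterS fg => y /= ->.
Qed.

Lemma dM_eq p q v (F G : W -> 'M[R[i]]_(p, q)) x L : (forall y, F y = G y) ->
  dM v F x L -> dM v G x L.
Proof. by move=> /funext ->. Qed.

Lemma dM_near p q v (F G : W -> 'M[R[i]]_(p, q)) x L : (\near x, F x = G x) ->
  dM v F x L -> dM v G x L.
Proof. by move=> FG FL i j; apply: dC_near (FL i j); apply: filterS FG => y /= ->. Qed.

End ComplexDerivatives.

Lemma dM_line (R : realType) (W : normedModType R) p q (v : W) (F : W -> 'M[R[i]]_(p, q)) x (t : R) L :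
  dM v F (x + t *: v) L <-> dM (1 : R) (fun s : R => F (x + s *: v)) t L.
Proof.
split=> H i j; have [Hr Hi] := H i j; split.
- exact: (is_derive_line (fun y => complex.Re (F y i j)) _ _ _ _).1.
- exact: (is_derive_line (fun y => complex.Im (F y i j)) _ _ _ _).1.
- exact: (is_derive_line (fun y => complex.Re (F y i j)) _ _ _ _).2.
- exact: (is_derive_line (fun y => complex.Im (F y i j)) _ _ _ _).2.
Qed.

Lemma is_derive_pd (R : realType) (N : nat) a (f : 'rV[R]_N -> R) x l :
  is_derive x (delta_mx ord0 a) f l -> pd a f x = l.
Proof. by move=> fl; exact: (@derive_val _ _ _ _ _ _ _ fl). Qed.

Local Opaque smooth_on pd.

Section ComplexSmooth.
Variables (R : realType) (N : nat).
Local Notation E := 'rV[R]_N.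
Local Notation e_ a := (delta_mx ord0 a : E).
Implicit Types (U : set E) (f g : E -> R[i]).

Definition pdC1 a f x : R[i] :=
  Complex (pd a (fun y => complex.Re (f y)) x) (pd a (fun y => complex.Im (f y)) x).

Definition smoothC U f : Prop :=
  smooth_on U (fun x => complex.Re (f x)) /\ smooth_on U (fun x => complex.Im (f x)).

Lemma smoothC_ext U f g : open U -> (forall x, U x -> f x = g x) ->
  smoothC U f -> smoothC U g.
Proof.
move=> Uo fg [fr fi]; split.
  by apply: smooth_on_ext Uo _ fr => x /fg ->.
by apply: smooth_on_ext Uo _ fi => x /fg ->.
Qed.

Lemma smoothC_dC U f a x : smoothC U f -> U x -> dC (e_ a) f x (pdC1 a f x).
Proof. by move=> [fr fi] Ux; split; [exact: (smooth_is_derive a fr Ux)|exact: (smooth_is_derive a fi Ux)]. Qed.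

Lemma dC_pdC1 a f x l : dC (e_ a) f x l -> pdC1 a f x = l.
Proof.
move=> [fr fi]; apply: complexP.
  exact: is_derive_pd fr.
exact: is_derive_pd fi.
Qed.

Lemma smoothC_cst U c : open U -> smoothC U (fun=> c).
Proof. by move=> Uo; split; exact: smooth_cst. Qed.

Lemma smoothC_add U f g : open U -> smoothC U f -> smoothC U g ->
  smoothC U (fun x => f x + g x).
Proof.
move=> Uo [fr fi] [gr gi]; split.
  by under eq_fun do rewrite reD; exact: smooth_add.
by under eq_fun do rewrite imD; exact: smooth_add.
Qed.

Lemma smoothC_opp U f : open U -> smoothC U f -> smoothC U (fun x => - f x).
Proof.
move=> Uo [fr fi]; split.
  by under eq_fun do rewrite reN; exact: smooth_opp.
by under eq_fun do rewrite imN; exact: smooth_opp.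
Qed.

Lemma smoothC_mul U f g : open U -> smoothC U f -> smoothC U g ->
  smoothC U (fun x => f x * g x).
Proof.
move=> Uo [fr fi] [gr gi]; split.
  under eq_fun do rewrite reM.
  exact: (smooth_sub Uo (smooth_mul Uo fr gr) (smooth_mul Uo fi gi)).
under eq_fun do rewrite imM.
exact: (smooth_add Uo (smooth_mul Uo fr gi) (smooth_mul Uo fi gr)).
Qed.

Lemma smoothC_conj U f : open U -> smoothC U f -> smoothC U (fun x => Num.conj (f x)).
Proof.
move=> Uo [fr fi]; split; first by under eq_fun do rewrite reJ; exact: fr.
by under eq_fun do rewrite imJ; exact: smooth_opp.
Qed.

Lemma smoothC_real U (f : E -> R) : open U -> smooth_on U f ->
  smoothC U (fun x => real_complex R (f x)).
Proof. by move=> Uo fs; split; [exact: fs|exact: (smooth_cst 0 Uo)]. Qed.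

Lemma smoothC_sum U (J : Type) (s : seq J) (P : pred J) (f : J -> E -> R[i]) : open U ->
  (forall j, P j -> smoothC U (f j)) -> smoothC U (fun x => \sum_(j <- s | P j) f j x).
Proof.
move=> Uo H; elim: s => [|j s IH].
  by under eq_fun do rewrite big_nil; exact: smoothC_cst.
under eq_fun do rewrite big_cons.
by case Pj : (P j); [exact: smoothC_add (H j Pj) IH|exact: IH].
Qed.

Lemma smoothC_pd U f a : smoothC U f -> smoothC U (pdC1 a f).
Proof. by move=> [fr fi]; split; exact: smooth_pd. Qed.

Lemma pdC1C U f a b x : open U -> smoothC U f -> U x ->
  pdC1 a (pdC1 b f) x = pdC1 b (pdC1 a f) x.
Proof. by move=> Uo [fr fi] Ux; apply: complexP; exact: pdC Ux. Qed.

Lemma smooth_cmx_ext p q U (F G : E -> 'M[R[i]]_(p, q)) : open U ->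
  (forall x, U x -> F x = G x) -> smooth_cmx_on U F -> smooth_cmx_on U G.
Proof.
move=> Uo FG Fs i j; apply: (smoothC_ext Uo _ (Fs i j)) => x Ux.
by rewrite (FG _ Ux).
Qed.

Lemma smooth_cmx_sub p q U U' (F : E -> 'M[R[i]]_(p, q)) : U `<=` U' ->
  smooth_cmx_on U' F -> smooth_cmx_on U F.
Proof.
by move=> UU' Fs i j; have [Fr Fi] := Fs i j; split; apply: smooth_on_sub UU' _.
Qed.

Lemma smooth_cmx_dM p q U (F : E -> 'M[R[i]]_(p, q)) a x : smooth_cmx_on U F -> U x ->
  dM (e_ a) F x (pd_cmx a F x).
Proof. by move=> Fs Ux i j; rewrite mxE; exact: smoothC_dC (Fs i j) Ux. Qed.

Lemma dM_pd_cmx p q a (F : E -> 'M[R[i]]_(p, q)) x L : dM (e_ a) F x L ->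
  pd_cmx a F x = L.
Proof. by move=> FL; apply/matrixP => i j; rewrite mxE; exact: (dC_pdC1 (FL i j)). Qed.

Lemma pd_cmx_ext p q U (F G : E -> 'M[R[i]]_(p, q)) a x : open U ->
  (forall y, U y -> F y = G y) -> U x -> pd_cmx a F x = pd_cmx a G x.
Proof.
move=> Uo FG Ux; apply/matrixP => i j; rewrite !mxE.
by congr Complex; apply: pd_ext Uo _ Ux => y /FG ->.
Qed.

Lemma smooth_cmx_cst p q U (A : 'M[R[i]]_(p, q)) : open U -> smooth_cmx_on U (fun=> A).
Proof. by move=> Uo i j; exact: smoothC_cst. Qed.

Lemma smooth_cmx_add p q U (F G : E -> 'M[R[i]]_(p, q)) : open U ->
  smooth_cmx_on U F -> smooth_cmx_on U G -> smooth_cmx_on U (fun x => F x + G x).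
Proof.
move=> Uo Fs Gs i j; rewrite -/(smoothC U _); under eq_fun do rewrite mxE.
exact: smoothC_add.
Qed.

Lemma smooth_cmx_opp p q U (F : E -> 'M[R[i]]_(p, q)) : open U ->
  smooth_cmx_on U F -> smooth_cmx_on U (fun x => - F x).
Proof.
move=> Uo Fs i j; rewrite -/(smoothC U (fun x => (- F x) i j)).
by under eq_fun do rewrite mxE; exact: smoothC_opp.
Qed.

Lemma smooth_cmx_mul p q r U (F : E -> 'M[R[i]]_(p, q)) (G : E -> 'M[R[i]]_(q, r)) : open U ->
  smooth_cmx_on U F -> smooth_cmx_on U G -> smooth_cmx_on U (fun x => F x *m G x).
Proof.
move=> Uo Fs Gs i j; rewrite -/(smoothC U (fun x => (F x *m G x) i j)).
under eq_fun do rewrite mxE.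
by apply: smoothC_sum => // k _; exact: smoothC_mul.
Qed.

Lemma smooth_cmx_tr p q U (F : E -> 'M[R[i]]_(p, q)) :
  smooth_cmx_on U F -> smooth_cmx_on U (fun x => (F x)^T).
Proof.
move=> Fs i j; rewrite -/(smoothC U (fun x => (F x)^T i j)).
by under eq_fun do rewrite mxE; exact: Fs.
Qed.

Lemma smooth_cmx_conj p q U (F : E -> 'M[R[i]]_(p, q)) : open U ->
  smooth_cmx_on U F -> smooth_cmx_on U (fun x => conjmx (F x)).
Proof.
move=> Uo Fs i j; rewrite -/(smoothC U (fun x => (conjmx (F x)) i j)).
by under eq_fun do rewrite mxE; exact: smoothC_conj.
Qed.

Lemma smooth_cmx_scale p q U f (F : E -> 'M[R[i]]_(p, q)) : open U -> smoothC U f ->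
  smooth_cmx_on U F -> smooth_cmx_on U (fun x => f x *: F x).
Proof.
move=> Uo fs Fs i j; rewrite -/(smoothC U (fun x => (f x *: F x) i j)).
by under eq_fun do rewrite mxE; exact: (smoothC_mul Uo fs (Fs i j)).
Qed.

Lemma smooth_cmx_sum p q U (J : Type) (s : seq J) (P : pred J)
    (F : J -> E -> 'M[R[i]]_(p, q)) : open U ->
  (forall j, P j -> smooth_cmx_on U (F j)) ->
  smooth_cmx_on U (fun x => \sum_(j <- s | P j) F j x).
Proof.
move=> Uo H; elim: s => [|j s IH].
  by under eq_fun do rewrite big_nil; exact: smooth_cmx_cst.
under eq_fun do rewrite big_cons.
by case Pj : (P j); [exact: smooth_cmx_add (H j Pj) IH|exact: IH].
Qed.

Lemma smooth_cmx_linear p q p' q' U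
    (T : {linear 'M[R[i]]_(p, q) -> 'M[R[i]]_(p', q')})
    (F : E -> 'M[R[i]]_(p, q)) : open U ->
  smooth_cmx_on U F -> smooth_cmx_on U (fun y => T (F y)).
Proof.
move=> Uo Fs; under eq_fun do rewrite linear_mx_delta.
apply: smooth_cmx_sum => // i _; apply: smooth_cmx_sum => // j _.
exact: (smooth_cmx_scale Uo (Fs i j) (smooth_cmx_cst _ Uo)).
Qed.

Lemma smooth_cmx_pd p q U (F : E -> 'M[R[i]]_(p, q)) a :
  smooth_cmx_on U F -> smooth_cmx_on U (pd_cmx a F).
Proof.
move=> Fs i j; rewrite -/(smoothC U (fun x => (pd_cmx a F x) i j)).
by under eq_fun do rewrite mxE; exact: smoothC_pd (Fs i j).
Qed.

Lemma pd_cmxC p q U (F : E -> 'M[R[i]]_(p, q)) a b x : open U -> smooth_cmx_on U F -> U x ->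
  pd_cmx a (pd_cmx b F) x = pd_cmx b (pd_cmx a F) x.
Proof.
move=> Uo Fs Ux; apply/matrixP => i j; rewrite [LHS]mxE [RHS]mxE.
have := pdC1C a b Uo (Fs i j) Ux; rewrite /pdC1 => H.
transitivity (pdC1 a (fun y => pdC1 b (fun z => F z i j) y) x).
  by rewrite /pdC1; congr Complex; congr (pd a _ x); apply/funext => y; rewrite mxE.
rewrite -/(pdC1 _ _) in H *; rewrite [LHS]H.
by rewrite /pdC1; congr Complex; congr (pd b _ x); apply/funext => y; rewrite mxE.
Qed.

Lemma smooth_cplx p q U (F : E -> 'M[R]_(p, q)) : open U -> smooth_mx_on U F ->
  smooth_cmx_on U (fun x => cplx (F x)).
Proof.
move=> Uo Fs i j; rewrite -/(smoothC U (fun x => (cplx (F x)) i j)).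
by under eq_fun do rewrite mxE; exact: smoothC_real.
Qed.

Lemma smooth_cmx_row_mx p q r U (F : E -> 'M[R[i]]_(p, q)) (G : E -> 'M[R[i]]_(p, r)) :
  smooth_cmx_on U F -> smooth_cmx_on U G -> smooth_cmx_on U (fun x => row_mx (F x) (G x)).
Proof.
move=> Fs Gs i j; rewrite -/(smoothC U (fun x => (row_mx (F x) (G x)) i j)).
case: (splitP j) => k jk.
  have -> : j = lshift r k by apply: val_inj.
  by under eq_fun do rewrite row_mxEl; exact: Fs.
have -> : j = rshift q k by apply: val_inj.
by under eq_fun do rewrite row_mxEr; exact: Gs.
Qed.

Lemma smooth_cmx_col_mx p q r U (F : E -> 'M[R[i]]_(p, r)) (G : E -> 'M[R[i]]_(q, r)) :
  smooth_cmx_on U F -> smooth_cmx_on U G -> smooth_cmx_on U (fun x => col_mx (F x) (G x)).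
Proof.
move=> Fs Gs i j; rewrite -/(smoothC U (fun x => (col_mx (F x) (G x)) i j)).
case: (splitP i) => k ik.
  have -> : i = lshift q k by apply: val_inj.
  by under eq_fun do rewrite col_mxEu; exact: Fs.
have -> : i = rshift p k by apply: val_inj.
by under eq_fun do rewrite col_mxEd; exact: Gs.
Qed.

Lemma smooth_cmx_continuous p q U (F : E -> 'M[R[i]]_(p, q)) x i j :
  smooth_cmx_on U F -> U x ->
  {for x, continuous (fun y => complex.Re (F y i j))} /\
  {for x, continuous (fun y => complex.Im (F y i j))}.
Proof.
move=> Fs Ux; have [Fr Fi] := Fs i j.
by split; [exact: (smooth_continuous Fr Ux)|exact: (smooth_continuous Fi Ux)].
Qed.

Lemma smooth_det n U (F : E -> 'M[R]_n) : open U -> smooth_mx_on U F ->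
  smooth_on U (fun x => \det (F x)).
Proof.
move=> Uo Fs; apply: smooth_sum => // s _; apply: smooth_mul => //.
  exact: smooth_cst.
by apply: smooth_prod => // i _; exact: Fs.
Qed.

Lemma smooth_invmx n U (F : E -> 'M[R]_n) : open U -> smooth_mx_on U F ->
  (forall x, U x -> \det (F x) != 0) -> smooth_mx_on U (fun x => invmx (F x)).
Proof.
move=> Uo Fs F0 i j.
apply: (smooth_on_ext (f := fun x => (\det (F x))^-1 * cofactor (F x) j i)) => //.
  by move=> x Ux; rewrite /invmx unitmxE unitfE F0 // !mxE.
apply: smooth_mul => //.
  by apply: smooth_inv => //; exact: smooth_det.
apply: smooth_mul => //; first exact: smooth_cst.
apply: smooth_det => // k l; under eq_fun do rewrite !mxE; exact: Fs.
Qed.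

End ComplexSmooth.

Section ComplexChain.
Variables (R : realType) (N N' : nat).

Lemma smooth_cmx_comp p q (U : set 'rV[R]_N) (U' : set 'rV[R]_N')
    (c : 'rV[R]_N -> 'rV[R]_N') (F : 'rV[R]_N' -> 'M[R[i]]_(p, q)) :
  open U -> open U' -> smooth_mx_on U c -> smooth_cmx_on U' F ->
  (forall x, U x -> U' (c x)) -> smooth_cmx_on U (fun x => F (c x)).
Proof.
move=> Uo U'o cs Fs cU i j; have [Fr Fi] := Fs i j; split.
  exact: (smooth_comp Uo U'o cs Fr cU).
exact: (smooth_comp Uo U'o cs Fi cU).
Qed.

Lemma dM_comp p q (U : set 'rV[R]_N) (U' : set 'rV[R]_N')
    (c : 'rV[R]_N -> 'rV[R]_N') (F : 'rV[R]_N' -> 'M[R[i]]_(p, q)) a x :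
  open U' -> smooth_mx_on U c -> smooth_cmx_on U' F -> U x -> U' (c x) ->
  dM (delta_mx ord0 a) (fun y => F (c y)) x
    (\sum_b real_complex R (pd a (fun y => c y ord0 b) x) *: pd_cmx b F (c x)).
Proof.
move=> U'o cs Fs Ux U'x i j; have [Fr Fi] := Fs i j; rewrite summxE.
split.
  apply: is_derive_eq1 (smooth_is_derive_comp a U'o cs Fr Ux U'x) => //.
  rewrite re_sum; apply: eq_bigr => b _; rewrite !mxE reM /=; ring.
apply: is_derive_eq1 (smooth_is_derive_comp a U'o cs Fi Ux U'x) => //.
rewrite im_sum; apply: eq_bigr => b _; rewrite !mxE imM /=; ring.
Qed.

End ComplexChain.

Local Transparent smooth_on pd.

(** * Representations of U(m) and conformal weights *)

Section Adjoint.
Variable R : realType.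

Definition adj p q (A : 'M[R[i]]_(p, q)) : 'M[R[i]]_(q, p) := (conjmx A)^T.

Lemma adjE p q (A : 'M[R[i]]_(p, q)) i j : adj A i j = Num.conj (A j i).
Proof. by rewrite !mxE. Qed.

Lemma adj_t p q (A : 'M[R[i]]_(p, q)) : adj A = map_mx Num.conj A^T.
Proof. by apply/matrixP => i j; rewrite !mxE. Qed.

Lemma adjK p q (A : 'M[R[i]]_(p, q)) : adj (adj A) = A.
Proof. by apply/matrixP => i j; rewrite !adjE conjCK. Qed.

Lemma adjM p q r (A : 'M[R[i]]_(p, q)) (B : 'M[R[i]]_(q, r)) :
  adj (A *m B) = adj B *m adj A.
Proof.
apply/matrixP => i j; rewrite adjE !mxE conjC_sum; apply: eq_bigr => k _.
by rewrite rmorphM /= !adjE mulrC.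
Qed.

Lemma adjD p q (A B : 'M[R[i]]_(p, q)) : adj (A + B) = adj A + adj B.
Proof. by apply/matrixP => i j; rewrite !mxE rmorphD. Qed.

Lemma adjN p q (A : 'M[R[i]]_(p, q)) : adj (- A) = - adj A.
Proof. by apply/matrixP => i j; rewrite !mxE rmorphN. Qed.

Lemma adjZ p q a (A : 'M[R[i]]_(p, q)) : adj (a *: A) = Num.conj a *: adj A.
Proof. by apply/matrixP => i j; rewrite !mxE rmorphM. Qed.

Lemma adj0 p q : adj (0 : 'M[R[i]]_(p, q)) = 0.
Proof. by apply/matrixP => i j; rewrite adjE !mxE conjC0. Qed.

Lemma adj1 n : adj (1%:M : 'M[R[i]]_n) = 1%:M.
Proof. by apply/matrixP => i j; rewrite adjE !mxE eq_sym rmorph_nat. Qed.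

Lemma adj_sum p q (J : Type) (s : seq J) (P : pred J) (F : J -> 'M[R[i]]_(p, q)) :
  adj (\sum_(j <- s | P j) F j) = \sum_(j <- s | P j) adj (F j).
Proof. by apply: (big_morph (@adj p q)) => [A B|]; rewrite ?adjD ?adj0. Qed.

Lemma adj_delta p q i j : adj (delta_mx i j : 'M[R[i]]_(p, q)) = delta_mx j i.
Proof. by apply/matrixP => k l; rewrite adjE !mxE rmorph_nat andbC. Qed.

Lemma unitaryP n (u : 'M[R[i]]_n) : u \is unitarymx <-> u *m adj u = 1%:M.
Proof. by rewrite adj_t; split=> [/unitarymxP|] H //; apply/unitarymxP. Qed.

Lemma unitary_adjr n (u : 'M[R[i]]_n) : u \is unitarymx -> u *m adj u = 1%:M.
Proof. by move/unitaryP. Qed.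

Lemma unitary_adjl n (u : 'M[R[i]]_n) : u \is unitarymx -> adj u *m u = 1%:M.
Proof. by move/unitaryP/mulmx1C. Qed.

Lemma adj_unitary n (u : 'M[R[i]]_n) : u \is unitarymx -> adj u \is unitarymx.
Proof. by move=> uu; apply/unitaryP; rewrite adjK unitary_adjl. Qed.

Lemma mul_unitary n (u v : 'M[R[i]]_n) : u \is unitarymx -> v \is unitarymx ->
  u *m v \is unitarymx.
Proof. exact: mul_unitarymx. Qed.

Lemma hdotE p q (A B : 'M[R[i]]_(p, q)) : hdot A B = \tr (A *m adj B).
Proof.
by apply: eq_bigr => i _; rewrite mxE; apply: eq_bigr => j _; rewrite adjE.
Qed.

Lemma hdotC p q (A B : 'M[R[i]]_(p, q)) : hdot A B = Num.conj (hdot B A).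
Proof.
rewrite /hdot conjC_sum; apply: eq_bigr => i _; rewrite conjC_sum.
by apply: eq_bigr => j _; rewrite rmorphM /= conjCK mulrC.
Qed.

Lemma hdotMl p q r (T : 'M[R[i]]_(p, q)) (A : 'M[R[i]]_(q, r)) B :
  hdot (T *m A) B = hdot A (adj T *m B).
Proof. by rewrite !hdotE adjM adjK -mulmxA mxtrace_mulC -mulmxA. Qed.

Lemma hdotMr p q r (A : 'M[R[i]]_(p, q)) (S : 'M[R[i]]_(q, r)) B :
  hdot (A *m S) B = hdot A (B *m adj S).
Proof. by rewrite !hdotE adjM adjK mulmxA. Qed.

Lemma hdotDl p q (A A' B : 'M[R[i]]_(p, q)) : hdot (A + A') B = hdot A B + hdot A' B.
Proof. by rewrite !hdotE mulmxDl mxtraceD. Qed.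

Lemma hdotZl p q a (A B : 'M[R[i]]_(p, q)) : hdot (a *: A) B = a * hdot A B.
Proof. by rewrite !hdotE -scalemxAl mxtraceZ. Qed.

Lemma hdotDr p q (A B B' : 'M[R[i]]_(p, q)) : hdot A (B + B') = hdot A B + hdot A B'.
Proof. by rewrite hdotC hdotDl rmorphD /= -!hdotC. Qed.

Lemma hdotZr p q a (A B : 'M[R[i]]_(p, q)) : hdot A (a *: B) = Num.conj a * hdot A B.
Proof. by rewrite hdotC hdotZl rmorphM /= -hdotC. Qed.

Lemma hdot0l p q (B : 'M[R[i]]_(p, q)) : hdot 0 B = 0.
Proof. by rewrite hdotE mul0mx mxtrace0. Qed.

Lemma hdot0r p q (B : 'M[R[i]]_(p, q)) : hdot B 0 = 0.
Proof. by rewrite hdotC hdot0l conjC0. Qed.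

Lemma hdotNl p q (A B : 'M[R[i]]_(p, q)) : hdot (- A) B = - hdot A B.
Proof. by rewrite -scaleN1r hdotZl mulN1r. Qed.

Lemma hdotNr p q (A B : 'M[R[i]]_(p, q)) : hdot A (- B) = - hdot A B.
Proof. by rewrite hdotC hdotNl rmorphN /= -hdotC. Qed.

Lemma hdot_suml p q (J : Type) (s : seq J) (P : pred J) (F : J -> 'M[R[i]]_(p, q)) B :
  hdot (\sum_(j <- s | P j) F j) B = \sum_(j <- s | P j) hdot (F j) B.
Proof. by apply: (big_morph (fun A => hdot A B)) => [? ?|]; rewrite ?hdotDl ?hdot0l. Qed.

Lemma hdot_sumr p q (J : Type) (s : seq J) (P : pred J) (F : J -> 'M[R[i]]_(p, q)) B :
  hdot B (\sum_(j <- s | P j) F j) = \sum_(j <- s | P j) hdot B (F j).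
Proof. by apply: (big_morph (hdot B)) => [? ?|]; rewrite ?hdotDr ?hdot0r. Qed.

Lemma hdot_ge0 p q (A : 'M[R[i]]_(p, q)) : 0 <= hdot A A.
Proof. by do 2!(apply: sumr_ge0 => ? _); exact: mul_conjC_ge0. Qed.

Lemma hdot_eq0 p q (A : 'M[R[i]]_(p, q)) : hdot A A = 0 -> A = 0.
Proof.
move=> A0; apply/matrixP => i j; rewrite mxE.
have H k : 0 <= \sum_l A k l * Num.conj (A k l).
  by apply: sumr_ge0 => l _; exact: mul_conjC_ge0.
have Ai : \sum_l A i l * Num.conj (A i l) = 0.
  exact: (psumr_eq0P (fun k _ => H k) A0).
have /eqP : A i j * Num.conj (A i j) = 0.
  exact: (psumr_eq0P (fun l _ => mul_conjC_ge0 (A i l)) Ai).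
by rewrite mul_conjC_eq0 => /eqP.
Qed.

Lemma hdot_unitary p q (u : 'M[R[i]]_p) (A B : 'M[R[i]]_(p, q)) : u \is unitarymx ->
  hdot (u *m A) (u *m B) = hdot A B.
Proof. by move=> uu; rewrite hdotMl mulmxA unitary_adjl // mul1mx. Qed.

End Adjoint.

(** * Hermitian idempotents and the unitary curves that they generate *)

Section LieAlgebra.
Variables (R : realType) (m : nat).
Local Notation C := R[i].
Local Notation im := (Complex 0 1 : C).

Lemma im_sqr : im * im = -1.
Proof. by apply: complexP; rewrite ?reM ?imM /=; ring. Qed.

Lemma im_neq0 : im != 0.
Proof. by apply/eqP => /(congr1 (@complex.Im R)) /= /eqP; rewrite oner_eq0. Qed.

Lemma conj_im : Num.conj im = - im.
Proof. by apply: complexP; rewrite ?reJ ?imJ ?reN ?imN /= ?oppr0. Qed.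

(** Hermitian idempotents generate explicit unitary curves, so an identity for [urep_diff] that is
    linear in X can be obtained by differentiating an identity for [V] along such a curve. Their
    complex span is all of gl(m, C). *)
Lemma hermitian_idempotent_span (S : 'M[C]_m -> Prop) :
  (forall a X Y, S X -> S Y -> S (a *: X + Y)) ->
  (forall P, P *m P = P -> adj P = P -> S P) -> forall X, S X.
Proof.
move=> Slin Sidem.
have S0 : S 0 by apply: Sidem; rewrite ?mulmx0 ?adj0.
have SZ a X : S X -> S (a *: X) by move=> SX; rewrite -[_ *: _]addr0; exact: Slin.
have SD X Y : S X -> S Y -> S (X + Y).
  by move=> SX SY; rewrite -[X]scale1r; exact: Slin.
have dd k : S (delta_mx k k).
  by apply: Sidem; rewrite ?mul_delta_mx ?adj_delta.
have two0 : (2 : C) != 0 by rewrite pnatr_eq0.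
(* For |z| = 1 and distinct k, l, [Q z k l] is the orthogonal projection onto the line of e_k + z
   e_l. The values z = 1 and z = i isolate the sum and the difference of e_kl and e_lk. *)
pose w z k l : 'cV[C]_m := delta_mx k ord0 + z *: delta_mx l ord0.
pose Q z k l : 'M[C]_m := 2^-1 *: (w z k l *m adj (w z k l)).
have wE z k l : adj (w z k l) = delta_mx ord0 k + Num.conj z *: delta_mx ord0 l.
  by rewrite adjD adjZ !adj_delta.
have QE z k l : Q z k l = 2^-1 *: (delta_mx k k + Num.conj z *: delta_mx k l +
    (z *: delta_mx l k + (z * Num.conj z) *: delta_mx l l)).
  rewrite /Q wE /w mulmxDl !mulmxDr -!scalemxAl -!scalemxAr scalerA.
  by rewrite !mul_delta_mx.
have SQ z k l : k != l -> z * Num.conj z = 1 -> S (Q z k l).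
  move=> kl z1; apply: Sidem; last by rewrite /Q adjZ adjM adjK fmorphV rmorph_nat.
  rewrite /Q -scalemxAl -scalemxAr; congr (_ *: _); rewrite -mulmxA [adj _ *m _]mulmxA.
  have -> : adj (w z k l) *m w z k l = 2%:M.
    rewrite wE /w mulmxDl !mulmxDr -!scalemxAl -!scalemxAr scalerA [_ * z]mulrC z1.
    rewrite !mul_delta_mx_cond !eqxx (negbTE kl) [l == k]eq_sym (negbTE kl).
    rewrite !mulr0n !scaler0 addr0 add0r scale1r !mulr1n; apply/matrixP => i j.
    by rewrite !ord1 !mxE !eqxx /= -natrD.
  by rewrite mul_scalar_mx -scalemxAr scalerA mulVf // scale1r.
have dkl k l : S (delta_mx k l).
  have [->//|kl] := eqVneq k l.
  have SA : S (delta_mx k l + delta_mx l k).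
    have -> : delta_mx k l + delta_mx l k =
      2 *: Q 1 k l + ((-1) *: delta_mx k k + (-1) *: delta_mx l l) :> 'M[C]_m.
      rewrite QE conjC1 mulr1 !scale1r.
      move: (delta_mx k k) (delta_mx l l) (delta_mx k l) (delta_mx l k) => A B X Y.
      apply/matrixP => i j; rewrite !mxE; move: (A i j) (B i j) (X i j) (Y i j) => a b c e.
      by field.
    apply: Slin; first by apply: SQ; rewrite ?conjC1 ?mulr1.
    by apply: SD; exact: SZ.
  have SB : S (delta_mx k l - delta_mx l k).
    have -> : delta_mx k l - delta_mx l k =
      (2 * im) *: Q im k l + (- im *: delta_mx k k + - im *: delta_mx l l) :> 'M[C]_m.
      rewrite QE conj_im; have := im_sqr; move: im => z zz.
      move: (delta_mx k k) (delta_mx l l) (delta_mx k l) (delta_mx l k) => A B X Y.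
      rewrite !scalerDr !scalerA; apply/matrixP => i j; rewrite !mxE.
      move: (A i j) (B i j) (X i j) (Y i j) => a b c d.
      have -> : 2 * z / 2 * a + 2 * z / 2 * - z * c +
        (2 * z / 2 * z * d + 2 * z / 2 * (z * - z) * b) + (- z * a + - z * b) =
         (z * z) * (d - c) - (z * z) * (z * b) - z * b by field.
      by rewrite zz; ring.
    apply: Slin; last by apply: SD; exact: SZ.
    by apply: SQ => //; rewrite conj_im mulrN im_sqr opprK.
  have -> : delta_mx k l = 2^-1 *: ((delta_mx k l + delta_mx l k) +
      (delta_mx k l - delta_mx l k)) :> 'M[C]_m.
    by apply/matrixP => i j; rewrite !mxE; field.
  by apply: SZ; exact: SD.
move=> X; rewrite [X]matrix_sum_delta; apply: (big_ind S) => // i _.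
by apply: (big_ind S) => // j _; exact: SZ.
Qed.

Definition cexp (t : R) : C := Complex (cos t) (sin t).

Lemma cexpM_conj t : cexp t * Num.conj (cexp t) = 1.
Proof.
apply: complexP; first by rewrite reM reJ imJ /= mulrN opprK -!expr2 cos2Dsin2.
by rewrite imM reJ imJ /= mulrN addrC mulrC subrr.
Qed.

Lemma cexp0 : cexp 0 = 1.
Proof. by apply: complexP; rewrite /= ?cos0 ?sin0. Qed.

Lemma dC_cexp (t th : R) : dC (1 : R) (fun s : R => cexp (s * th)) t
  (im * real_complex R th * cexp (t * th)).
Proof.
have H : is_derive t (1 : R) (fun s : R => s * th) th.
  apply: is_derive_eq1 (is_deriveM (is_derive_id t 1) (is_derive_cst th t 1)) => //.
  by rewrite scaler0 add0r /GRing.scale /= mulr1.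
split=> /=.
  apply: is_derive_eq1 (@is_derive1_comp R cos (fun s => s * th) t _ _ _ H) => //.
  by rewrite /=; ring.
apply: is_derive_eq1 (@is_derive1_comp R sin (fun s => s * th) t _ _ _ H) => //.
by rewrite /=; ring.
Qed.

Lemma cexp_surj (z : C) : z * Num.conj z = 1 -> exists t, z = cexp t.
Proof.
move=> z1; have E : complex.Re z ^+ 2 + complex.Im z ^+ 2 = 1.
  have := congr1 (@complex.Re R) z1; rewrite reM reJ imJ /= => <-; ring.
set a := complex.Re z in E *; set b := complex.Im z in E *.
have a1 : -1 <= a <= 1.
  rewrite -ler_norml -(@expr_le1 _ 2) // real_normK ?num_real //.
  by rewrite -E lerDl sqr_ge0.
have ca : cos (acos a) = a by rewrite acosK // in_itv.
have sa : sin (acos a) = `|b|.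
  by rewrite sin_acos // -sqrtr_sqr; congr Num.sqrt; rewrite -E; ring.
have [b0|b0] := leP 0 b.
  by exists (acos a); apply: complexP; rewrite /= ?ca ?sa ?ger0_norm.
exists (- acos a); apply: complexP; rewrite /= ?cosN ?sinN ?ca ?sa ?ltr0_norm //.
by rewrite opprK.
Qed.

(** This is exp(i t P) when P is idempotent. *)
Definition rotation (P : 'M[C]_m) (t : R) : 'M[C]_m := 1%:M + (cexp t - 1) *: P.

Lemma rotation_unitary P t : P *m P = P -> adj P = P -> rotation P t \is unitarymx.
Proof.
move=> PP aP; apply/unitaryP; rewrite /rotation adjD adjZ adj1 aP.
rewrite mulmxDl !mulmxDr !mul1mx mulmx1 -scalemxAl -scalemxAr PP scalerA.
rewrite rmorphB /= conjC1 -addrA -!scalerDl -[RHS]addr0; congr (_ + _).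
have := cexpM_conj t; move: (cexp t) (Num.conj _) => z w zw.
have -> : w - 1 + (z - 1 + (z - 1) * (w - 1)) = z * w - 1 by ring.
by rewrite zw subrr scale0r.
Qed.

Lemma rotation0 P : rotation P 0 = 1%:M.
Proof. by rewrite /rotation cexp0 subrr scale0r addr0. Qed.

Lemma dM_rotation P : dM (1 : R) (rotation P) 0 (im *: P).
Proof.
have H := dC_cexp 0 1; rewrite mul0r cexp0 !mulr1 in H.
have H1 : dC (1 : R) (fun s : R => cexp s - 1) 0 im.
  have := dC_add H (dC_cst (1 : R) (-1) 0); rewrite addr0.
  by under eq_fun do rewrite mulr1.
have := dM_add (dM_cst (1 : R) 1%:M 0) (dM_scale H1 (dM_cst (1 : R) P 0)).
by rewrite scaler0 addr0 add0r.
Qed.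

End LieAlgebra.

Section RepresentationFacts.
Variables (R : realType) (m d : nat) (V : unitary_rep R m d).
Local Notation C := R[i].
Local Notation im := (Complex 0 1 : C).
Local Notation pi := (urep_diff V).

(** The record only differentiates [V] at 1, along curves that are unitary at all times. Left
    translation by [adj (w x)] moves the base point to 1. *)
Lemma dM_urep_unitary (W : normedModType R) (w : W -> 'M[C]_m) (x v : W) (L : 'M[C]_m) :
  (\near x, w x \is unitarymx) -> dM v w x L ->
  dM v (fun y => V (w y)) x (V (w x) *m pi (adj (w x) *m L)).
Proof.
move=> wu wL; have wux : w x \is unitarymx by exact: nbhs_singleton wu.
have E0 : x + 0 *: v = x by rewrite scale0r addr0.
(* The value 1 where [w] is not unitary makes the curve unitary for every s; this case does not
   occur near 0. *)
pose c (s : R) : 'M[C]_m :=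
  if w (x + s *: v) \is unitarymx then adj (w x) *m w (x + s *: v) else 1%:M.
have cu s : c s \is unitarymx.
  rewrite /c; case: ifP => [H|_]; last by apply/unitaryP; rewrite adj1 mulmx1.
  exact: mul_unitarymx (adj_unitary wux) H.
have c0 : c 0 = 1%:M by rewrite /c E0 wux; exact: unitary_adjl.
have nu : \forall s \near (0 : R), w (x + s *: v) \is unitarymx.
  have H : (fun s : R => x + s *: v) @ (0 : R) --> x + (0 : R) *: v.
    by apply: cvgD; [exact: cvg_cst|apply: cvgZr_tmp; exact: cvg_id].
  by rewrite E0 in H; exact: H wu.
have dw : dM (1 : R) (fun s : R => w (x + s *: v)) 0 L.
  by apply/dM_line; rewrite E0.
have dc : dM (1 : R) c 0 (adj (w x) *m L).
  apply: dM_near (dM_mull (adj (w x)) dw).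
  by apply: filterS nu => s su; rewrite /c su.
have dV : dM (1 : R) (fun s => V (c s)) 0 (pi (adj (w x) *m L)).
  exact: (urep_diffP V cu c0 dc).
have H : dM (1 : R) (fun s : R => V (w (x + s *: v))) 0 (V (w x) *m pi (adj (w x) *m L)).
  apply: dM_near (dM_mull (V (w x)) dV).
  apply: filterS nu => s su; rewrite -(urep_mul V wux (cu s)) /c su.
  by rewrite mulmxA (unitary_adjr wux) mul1mx.
by have := (dM_line v (fun y => V (w y)) x 0 _).2 H; rewrite E0.
Qed.

Lemma urep_adj u : u \is unitarymx -> V (adj u) = adj (V u).
Proof.
move=> uu; have uV := urep_unitary V uu.
have : V u *m V (adj u) = 1%:M.
  by rewrite -(urep_mul V uu (adj_unitary uu)) (unitary_adjr uu) urep_1.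
move/(congr1 (fun A => adj (V u) *m A)).
by rewrite mulmxA (unitary_adjl uV) mul1mx mulmx1.
Qed.

Lemma urep_diffZ a X : pi (a *: X) = a *: pi X.
Proof. exact: linearZ_LR. Qed.

Lemma urep_diff_lin a X Y : pi (a *: X + Y) = a *: pi X + pi Y.
Proof. exact: linearP. Qed.

Lemma dM_urep_rotation P : P *m P = P -> adj P = P ->
  dM (1 : R) (fun t => V (rotation P t)) 0 (pi (im *: P)).
Proof.
move=> PP aP; exact: (urep_diffP V (fun t => rotation_unitary t PP aP)
  (rotation0 P) (dM_rotation P)).
Qed.

(** Differentiating V(r) V(r)^* = 1 at time 0 along a rotation r shows that pi(i P) is
    skew-adjoint. *)
Lemma urep_diff_adj X : pi (adj X) = adj (pi X).
Proof.
move: X; apply: hermitian_idempotent_span => [a X Y HX HY|P PP aP].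
  by rewrite adjD adjZ !urep_diff_lin HX HY adjD adjZ.
have dV := dM_urep_rotation PP aP.
have H := dM_mul dV (dM_tr (dM_conj dV)).
have E t : V (rotation P t) *m (conjmx (V (rotation P t)))^T = 1%:M.
  exact: unitary_adjr (urep_unitary V (rotation_unitary t PP aP)).
have := dM_unique (dM_eq E H) (dM_cst (1 : R) 1%:M 0).
rewrite -!/(adj _) rotation0 urep_1 adj1 mulmx1 mul1mx urep_diffZ adjZ conj_im.
rewrite scaleNr -scalerBr => /(congr1 (fun A => - im *: A)).
rewrite scaler0 scalerA mulNr im_sqr opprK scale1r => /eqP.
by rewrite subr_eq0 aP => /eqP.
Qed.

(** Both sides, up to the common factor i, are the derivative at time 0 of V(u r u^* ) along a
    rotation r. *)
Lemma urep_diff_conj u X : u \is unitarymx -> V u *m pi X *m adj (V u) = pi (u *m X *m adj u).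
Proof.
move=> uu; move: X; apply: hermitian_idempotent_span => [a X Y HX HY|P PP aP].
  rewrite urep_diff_lin !(mulmxDr, mulmxDl) -!(scalemxAr, scalemxAl) HX HY.
  by rewrite urep_diff_lin.
have dV := dM_urep_rotation PP aP.
have H := dM_mulr (adj (V u)) (dM_mull (V u) dV).
have H1 := dM_mulr (adj u) (dM_mull u (dM_rotation P)).
have au := adj_unitary uu.
have ur t : rotation P t \is unitarymx by exact: rotation_unitary.
have uru t := mul_unitary uu (ur t).
have un t : u *m rotation P t *m adj u \is unitarymx := mul_unitary (uru t) au.
have u0 : u *m rotation P 0 *m adj u = 1%:M.
  by rewrite rotation0 mulmx1 (unitary_adjr uu).
have H2 := urep_diffP V un u0 H1.
have E t : V (u *m rotation P t *m adj u) = V u *m V (rotation P t) *m adj (V u).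
  by rewrite (urep_mul V (uru t) au) (urep_mul V uu (ur t)) urep_adj.
have := dM_unique (dM_eq E H2) H.
rewrite urep_diffZ -!(scalemxAr, scalemxAl) urep_diffZ => /(scalerI (im_neq0 R)).
by move=> ->.
Qed.

(** This is the derivative at time 0 of V(r) pi(Y) V(r)^* = pi(r Y r^* ), which is [urep_diff_conj]
    along a rotation r. *)
Lemma urep_diff_bracket X Y : pi X *m pi Y - pi Y *m pi X = pi (X *m Y - Y *m X).
Proof.
move: X; apply: hermitian_idempotent_span => [a X X' HX HX'|P PP aP].
  have E : (a *: X + X') *m Y - Y *m (a *: X + X') =
      a *: (X *m Y - Y *m X) + (X' *m Y - Y *m X').
    by rewrite mulmxDl mulmxDr -scalemxAl -scalemxAr opprD addrACA -scalerBr.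
  rewrite E !urep_diff_lin -HX -HX' mulmxDl mulmxDr -scalemxAl -scalemxAr.
  by rewrite opprD addrACA -scalerBr.
have dV := dM_urep_rotation PP aP.
have H := dM_mul (dM_mulr (pi Y) dV) (dM_tr (dM_conj dV)).
have dr := dM_rotation P.
have H1 := dM_linear pi (dM_mul (dM_mulr Y dr) (dM_tr (dM_conj dr))).
have E t : V (rotation P t) *m pi Y *m (conjmx (V (rotation P t)))^T =
    pi (rotation P t *m Y *m (conjmx (rotation P t))^T).
  by apply: urep_diff_conj; exact: rotation_unitary.
have := dM_unique (dM_eq E H) H1.
rewrite -!/(adj _) rotation0 urep_1 !adj1 !mulmx1 !mul1mx.
rewrite -urep_diff_adj !adjZ aP conj_im !urep_diffZ -!(scalemxAr, scalemxAl) !scaleNr.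
by rewrite -!scalerBr urep_diffZ => /(scalerI (im_neq0 R)).
Qed.

End RepresentationFacts.

Section TraceForm.
Variables (R : realType) (m : nat) (W : lmodType R[i]).
Variable Phi : 'M[R[i]]_m -> 'M[R[i]]_m -> W.
Hypothesis Phil : forall a X X' Y, Phi (a *: X + X') Y = a *: Phi X Y + Phi X' Y.
Hypothesis Phir : forall a X Y Y', Phi X (a *: Y + Y') = a *: Phi X Y + Phi X Y'.

Lemma bilinear_expandl X Y : Phi X Y = \sum_a \sum_b X a b *: Phi (delta_mx a b) Y.
Proof.
have P0 : Phi 0 Y = 0.
  by have := Phil (-1) 0 0 Y; rewrite scaler0 addr0 scaleN1r addNr.
have PD X1 X2 : Phi (X1 + X2) Y = Phi X1 Y + Phi X2 Y.
  by have := Phil 1 X1 X2 Y; rewrite !scale1r.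
rewrite {1}[X]matrix_sum_delta (big_morph (Phi^~ Y) PD P0); apply: eq_bigr => a _.
rewrite (big_morph (Phi^~ Y) PD P0); apply: eq_bigr => b _.
by rewrite -[_ *: delta_mx a b]addr0 Phil P0 addr0.
Qed.

Lemma bilinear_expandr X Y : Phi X Y = \sum_a \sum_b Y a b *: Phi X (delta_mx a b).
Proof.
have P0 : Phi X 0 = 0.
  by have := Phir (-1) X 0 0; rewrite scaler0 addr0 scaleN1r addNr.
have PD X1 X2 : Phi X (X1 + X2) = Phi X X1 + Phi X X2.
  by have := Phir 1 X X1 X2; rewrite !scale1r.
rewrite {1}[Y]matrix_sum_delta (big_morph (Phi X) PD P0); apply: eq_bigr => a _.
rewrite (big_morph (Phi X) PD P0); apply: eq_bigr => b _.
by rewrite -[_ *: delta_mx a b]addr0 Phir P0 addr0.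
Qed.

(* [delta_mx k l] and [delta_mx l k] are dual bases for the trace form. *)
Lemma trace_form_shift (X Z : 'M[R[i]]_m) :
  \sum_k \sum_l Phi (X *m delta_mx k l *m Z) (delta_mx l k) =
  \sum_k \sum_l Phi (delta_mx k l) (Z *m delta_mx l k *m X).
Proof.
have E (A B : 'M[R[i]]_m) k l a b : (A *m delta_mx k l *m B) a b = A a k * B l b.
  rewrite mxE (bigD1 l) //= mxE (bigD1 k) //= mxE !eqxx mulr1.
  rewrite big1 ?addr0 => [|j /negbTE jk]; last by rewrite mxE jk /= mulr0.
  rewrite big1 ?addr0 // => j /negbTE jl; rewrite mxE big1 ?mul0r // => j' _.
  by rewrite mxE jl andbF mulr0.
transitivity (\sum_k \sum_l \sum_a \sum_b (X a k * Z l b) *: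
    Phi (delta_mx a b) (delta_mx l k)).
  apply: eq_bigr => k _; apply: eq_bigr => l _; rewrite bilinear_expandl.
  by do 2!(apply: eq_bigr => ? _); rewrite E.
transitivity (\sum_a \sum_b \sum_k \sum_l (X a k * Z l b) *:
    Phi (delta_mx a b) (delta_mx l k)).
  rewrite pair_bigA [RHS]pair_bigA /=.
  under eq_bigr do rewrite pair_bigA; under [RHS]eq_bigr do rewrite pair_bigA.
  exact: exchange_big.
apply: eq_bigr => a _; apply: eq_bigr => b _; rewrite bilinear_expandr exchange_big.
by do 2!(apply: eq_bigr => ? _); rewrite E mulrC.
Qed.

End TraceForm.

(** Conjugation by u preserves the trace form, so it maps dual bases to dual bases. The equivariance
    of the Casimir operators comes from here. *)
Lemma trace_form_conj (R : realType) (m : nat) (W : lmodType R[i])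
    (Phi : 'M[R[i]]_m -> 'M[R[i]]_m -> W) (u : 'M[R[i]]_m) :
  (forall a X X' Y, Phi (a *: X + X') Y = a *: Phi X Y + Phi X' Y) ->
  (forall a X Y Y', Phi X (a *: Y + Y') = a *: Phi X Y + Phi X Y') ->
  u \is unitarymx ->
  \sum_k \sum_l Phi (adj u *m delta_mx k l *m u) (adj u *m delta_mx l k *m u) =
  \sum_k \sum_l Phi (delta_mx k l) (delta_mx l k).
Proof.
move=> Phil Phir uu.
have := @trace_form_shift R m W (fun X Y => Phi X (adj u *m Y *m u)) _ _ (adj u) u.
move=> -> /= => [|a X X' Y|a X Y Y'].
- do 2!(apply: eq_bigr => ? _); congr (Phi _ _).
  by rewrite !mulmxA (unitary_adjl uu) mul1mx -mulmxA (unitary_adjl uu) mulmx1.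
- exact: Phil.
- by rewrite mulmxDr mulmxDl -scalemxAr -scalemxAl Phir.
Qed.

(** * Casimir eigenvalues *)

Section Casimir.
Variable m : nat.
Implicit Types lam : 'I_m -> int.

(** The number (lam, lam + 2 delta), where 2 delta is the sum of the positive roots of gl(m). *)
Definition casimir_weight lam : int :=
  \sum_k \sum_l (if k == l then lam k * lam k
                 else if (k < l)%N then lam k - lam l else 0).

(** On a highest weight vector e_kl e_lk acts as the bracket e_kk - e_ll if k < l, and as 0 if k >
    l, because e_lk is then a raising operator. *)
Lemma casimir_highest_weight (C : comNzRingType) (W : lmodType C) (tau : 'M[C]_m -> W -> W)
    (lam : 'I_m -> int) (v : W) :
  (forall X a w, tau X (a *: w) = a *: tau X w) ->
  (forall X, tau X 0 = 0) ->
  (forall X Y w, tau (X - Y) w = tau X w - tau Y w) ->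
  (forall X Y w, tau X (tau Y w) - tau Y (tau X w) = tau (X *m Y - Y *m X) w) ->
  (forall k, tau (delta_mx k k) v = (lam k)%:~R *: v) ->
  (forall k l : 'I_m, (k < l)%N -> tau (delta_mx k l) v = 0) ->
  \sum_k \sum_l tau (delta_mx k l) (tau (delta_mx l k) v) = (casimir_weight lam)%:~R *: v.
Proof.
move=> tZ t0 tB br hk hkl.
rewrite rmorph_sum scaler_suml; apply: eq_bigr => k _.
rewrite rmorph_sum scaler_suml; apply: eq_bigr => l _.
case: eqVneq => [<-|kl]; first by rewrite hk tZ hk scalerA rmorphM.
case: ltnP => [ltkl|lelk]; last first.
  rewrite hkl ?t0 ?scale0r // ltn_neqAle lelk andbT.
  by rewrite (inj_eq val_inj) eq_sym.
have := br (delta_mx k l) (delta_mx l k) v.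
rewrite (hkl _ _ ltkl) t0 subr0 => ->.
by rewrite !mul_delta_mx tB !hk -scalerBl rmorphB.
Qed.

Lemma sum_ltn_const (i : nat) : (i <= m)%N -> \sum_(k < m) ((k < i)%N : nat)%:Z = i%:Z.
Proof.
move=> im; rewrite -(big_mkord xpredT (fun k => ((k < i)%N : nat)%:Z)).
rewrite (big_cat_nat (n := i)) //= [X in X + _](eq_big_nat _ _ (F2 := fun=> 1)).
  rewrite big_const_nat subn0 iter_addr_0 [X in _ + X]big_nat_cond big1 ?addr0 //.
    by rewrite natz.
  by move=> k /andP[/andP[ik _] _]; rewrite ltnNge ik.
by move=> k /andP[_ ->].
Qed.

Lemma casimir_weight_shift lam (s : int) (i : 'I_m) :
  casimir_weight (fun j => lam j + s * mu i j) - casimir_weight lam =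
  s * (lam i *+ 2) + s * s + s * (m%:Z - (i : nat).+1%:Z - (i : nat)%:Z).
Proof.
rewrite /casimir_weight -sumrB.
transitivity (\sum_k ((s * (lam k *+ 2) + s * s) * mu i k +
   \sum_(l < m) s * ((k < l)%N : nat)%:Z * (mu i k - mu i l))).
  apply: eq_bigr => k _; rewrite -sumrB (bigD1 k) //= [in RHS](bigD1 k) //=.
  rewrite eqxx ltnn subrr mulr0 add0r; congr (_ + _).
    rewrite /mu; case: (_ == _); rewrite ?mulr0 ?mulr1 /=; last by rewrite addr0 subrr.
    ring.
  apply: eq_bigr => l /negbTE lk; rewrite eq_sym lk; case: (_ < _)%N => /=; ring.
have S (F : 'I_m -> int) : \sum_k F k * mu i k = F i.
  rewrite (bigD1 i) //= /mu eqxx mulr1 big1 ?addr0 // => k /negbTE ->.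
  by rewrite mulr0.
rewrite big_split /= S -addrA -addrA; congr (_ + (_ + _)).
transitivity (s * (\sum_(k < m) \sum_(l < m) ((k < l)%N : nat)%:Z * mu i k -
                   \sum_(k < m) \sum_(l < m) ((k < l)%N : nat)%:Z * mu i l)).
  rewrite -sumrB mulr_sumr; apply: eq_bigr => k _; rewrite -sumrB mulr_sumr.
  by apply: eq_bigr => l _; ring.
congr (_ * _); congr (_ - _); last first.
  by rewrite exchange_big /= -[RHS](sum_ltn_const (ltnW (ltn_ord i))) exchange_big;
    apply: eq_bigr => k _; rewrite S.
under eq_bigr do rewrite -mulr_suml.
rewrite S; have : \sum_(l < m) ((i < l)%N : nat)%:Z + \sum_(l < m) ((l < i.+1)%N : nat)%:Z = m%:Z.
  rewrite -big_split /= -[RHS](sum_ltn_const (leqnn m)); apply: eq_bigr => l _.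
  by rewrite ltn_ord ltnS; case: ltnP.
by rewrite (sum_ltn_const (ltn_ord i)) => <-; rewrite addrK.
Qed.

End Casimir.

Section Schur.
Variables (R : realType) (m d e : nat).
Local Notation C := R[i].
Variable act : 'M[C]_m -> 'M[C]_(d, e) -> 'M[C]_(d, e).
Hypothesis actZ : forall u a v, act u (a *: v) = a *: act u v.

(** The vectors w of U with f w = c w form an invariant subspace, and it contains v. The eigenvector
    is an input because highest weight vectors supply it. *)
Lemma schur (U : {vspace 'M[C]_(d, e)}) (f : 'M[C]_(d, e) -> 'M[C]_(d, e)) c v :
  irreducible_subspace act U ->
  (forall a v w, f (a *: v + w) = a *: f v + f w) ->
  (forall u, u \is unitarymx -> forall v, f (act u v) = act u (f v)) ->
  v \in U -> v != 0 -> f v = c *: v -> forall w, w \in U -> f w = c *: w.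
Proof.
move=> [U0 Uinv Umin] flin fcomm vU v0 fv.
pose L : {linear 'M[C]_(d, e) -> 'M[C]_(d, e)} :=
  HB.pack f (GRing.isLinear.Build C _ _ _ f flin).
pose F : 'End('M[C]_(d, e)) := (linfun L - c *: \1)%VF.
have FE w : F w = f w - c *: w.
  by rewrite /F add_lfunE opp_lfunE scale_lfunE id_lfunE lfunE.
pose U' := (U :&: lker F)%VS.
have U'P w : (w \in U') = (w \in U) && (f w == c *: w).
  by rewrite memv_cap memv_ker FE subr_eq0.
have [||U'0|U'U] := Umin U'.
- exact: capvSl.
- move=> u uu w; rewrite !U'P => /andP[wU /eqP fw]; rewrite Uinv //=.
  by rewrite fcomm // fw actZ.
- have : v \in U' by rewrite U'P vU fv eqxx.
  by rewrite U'0 memv0 (negbTE v0).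
- by move=> w; rewrite -U'U U'P => /andP[_ /eqP].
Qed.

(* [act (adj u)] is the adjoint of [act u], so a self-adjoint projection onto an
   invariant subspace commutes with the action. *)
Lemma projection_equivariant (P : 'End('M[C]_(d, e))) :
  (forall u v w, act u (v + w) = act u v + act u w) ->
  (forall u v w, u \is unitarymx -> hdot (act u v) w = hdot v (act (adj u) w)) ->
  orthogonal_projection P -> invariant_subspace act (limg P) ->
  forall u, u \is unitarymx -> forall A, P (act u A) = act u (P A).
Proof.
move=> actD acth [PP Ph] Pinv u uu A.
have im B : P B \in limg P by apply: memv_img; exact: memvf.
have fixP B : B \in limg P -> P B = B by move=> /memv_imgP[B' _ ->]; rewrite PP.
have K B : P B = 0 -> P (act u B) = 0.
  move=> PB; apply: hdot_eq0; rewrite Ph PP (acth _ _ _ uu).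
  rewrite -(fixP (act (adj u) _)); last by apply: Pinv; rewrite ?adj_unitary.
  by rewrite -Ph PB hdot0l.
rewrite -{1}[A](subrK (P A)) actD linearD /= K ?add0r; last by rewrite linearB /= PP subrr.
by apply: fixP; exact: Pinv.
Qed.

End Schur.

Section Gradients.
Variables (R : realType) (m d : nat) (V : unitary_rep R m d).
Local Notation C := R[i].
Local Notation pi := (urep_diff V).
Implicit Types (A B : 'M[C]_(d, m)) (u : 'M[C]_m).

(* Up to sign, the mixed terms of the Casimir operator of V (x) C^m and V (x) conj(C^m); they act
   on the irreducible summands by the conformal weights. *)
Definition casimir_p A : 'M[C]_(d, m) :=
  - \sum_k \sum_l pi (delta_mx k l) *m A *m delta_mx k l.

Definition casimir_m A : 'M[C]_(d, m) :=
  \sum_k \sum_l pi (delta_mx k l) *m A *m delta_mx l k.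

Definition casimir0 : 'M[C]_d := \sum_k \sum_l pi (delta_mx k l) *m pi (delta_mx l k).

Lemma casimir0_comm u : u \is unitarymx -> casimir0 *m V u = V u *m casimir0.
Proof.
move=> uu; rewrite /casimir0 -[in LHS](trace_form_conj (u := adj u)
   (Phi := fun X Y => pi X *m pi Y)); first last.
- exact: adj_unitary.
- by move=> a X Y Y'; rewrite urep_diff_lin mulmxDr -scalemxAr.
- by move=> a X Y Y'; rewrite urep_diff_lin mulmxDl -scalemxAl.
have uV := urep_unitary V uu.
rewrite adjK mulmx_suml mulmx_sumr; apply: eq_bigr => k _.
rewrite mulmx_suml mulmx_sumr; apply: eq_bigr => l _.
rewrite -!(urep_diff_conj V _ uu) -!mulmxA (unitary_adjl uV) mulmx1.
by rewrite [adj _ *m (V u *m _)]mulmxA (unitary_adjl uV) mul1mx.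
Qed.

Lemma casimir_p_comm u A : u \is unitarymx ->
  casimir_p (actp V u A) = actp V u (casimir_p A).
Proof.
move=> uu; rewrite /casimir_p /actp /tensor_act mulmxN mulNmx; congr (- _).
(* C^m acts through right multiplication by u^T. Transposing the right factor exhibits the dual
   basis element e_lk that [trace_form_conj] expects. *)
have E k l : delta_mx k l = (delta_mx l k)^T :> 'M[C]_m by rewrite trmx_delta.
under eq_bigr do under eq_bigr do rewrite [X in _ *m X]E.
under [in RHS]eq_bigr do under eq_bigr do rewrite [X in _ *m X]E.
rewrite -[in LHS](trace_form_conj (u := adj u)
   (Phi := fun X Y => pi X *m (V u *m A *m u^T) *m Y^T)); first last.
- exact: adj_unitary.
- by move=> a X Y Y'; rewrite linearP /= mulmxDr -scalemxAr.
- by move=> a X Y Y'; rewrite urep_diff_lin !mulmxDl -!scalemxAl.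
have uV := urep_unitary V uu.
rewrite adjK mulmx_sumr mulmx_suml; apply: eq_bigr => k _.
rewrite mulmx_sumr mulmx_suml; apply: eq_bigr => l _.
rewrite -!(urep_diff_conj V _ uu) !trmx_mul !mulmxA.
rewrite -[_ *m adj (V u) *m V u]mulmxA (unitary_adjl uV) mulmx1.
rewrite -[_ *m u^T *m (adj u)^T]mulmxA -trmx_mul (unitary_adjl uu) trmx1 mulmx1.
by rewrite -!mulmxA.
Qed.

Lemma casimir_m_comm u A : u \is unitarymx ->
  casimir_m (actm V u A) = actm V u (casimir_m A).
Proof.
move=> uu; rewrite /casimir_m /actm /tensor_act -/(adj u).
rewrite -[in LHS](trace_form_conj (u := adj u)
   (Phi := fun X Y => pi X *m (V u *m A *m adj u) *m Y)); first last.
- exact: adj_unitary.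
- by move=> a X Y Y'; rewrite mulmxDr -scalemxAr.
- by move=> a X Y Y'; rewrite urep_diff_lin !mulmxDl -!scalemxAl.
have uV := urep_unitary V uu.
rewrite adjK mulmx_sumr mulmx_suml; apply: eq_bigr => k _.
rewrite mulmx_sumr mulmx_suml; apply: eq_bigr => l _.
rewrite -!(urep_diff_conj V _ uu) !mulmxA.
rewrite -[_ *m adj (V u) *m V u]mulmxA (unitary_adjl uV) mulmx1.
rewrite -[_ *m adj u *m u]mulmxA (unitary_adjl uu) mulmx1.
by rewrite -!mulmxA.
Qed.

Lemma casimir_p_lin a A B : casimir_p (a *: A + B) = a *: casimir_p A + casimir_p B.
Proof.
rewrite /casimir_p scalerN -opprD; congr (- _).
rewrite scaler_sumr -big_split; apply: eq_bigr => k _ /=.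
rewrite scaler_sumr -big_split; apply: eq_bigr => l _ /=.
by rewrite mulmxDr mulmxDl -scalemxAr -scalemxAl.
Qed.

Lemma casimir_m_lin a A B : casimir_m (a *: A + B) = a *: casimir_m A + casimir_m B.
Proof.
rewrite /casimir_m scaler_sumr -big_split; apply: eq_bigr => k _ /=.
rewrite scaler_sumr -big_split; apply: eq_bigr => l _ /=.
by rewrite mulmxDr mulmxDl -scalemxAr -scalemxAl.
Qed.

Lemma sum_delta_diag : \sum_k delta_mx k k = 1%:M :> 'M[C]_m.
Proof.
apply/matrixP => i j; rewrite summxE mxE (bigD1 i) //= mxE eqxx big1 ?addr0 /=.
  by rewrite eq_sym.
by move=> k /negbTE ki; rewrite mxE eq_sym ki.
Qed.

Section Weights.
Variable rho : 'I_m -> int.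
Hypothesis HV : irreducible_of_weight V rho.

Lemma act0Z u a v : act0 V u (a *: v) = a *: act0 V u v.
Proof. by rewrite /act0 -scalemxAr. Qed.

Lemma casimir0_scalar : casimir0 = (casimir_weight rho)%:~R%:M.
Proof.
have [Virr [v [_ v0 hv hv']]] := HV.
have hw : casimir0 *m v = (casimir_weight rho)%:~R *: v.
  have := @casimir_highest_weight m C _ (diff0 V) rho v.
  rewrite /diff0 => <- //.
  - rewrite /casimir0 mulmx_suml; apply: eq_bigr => k _.
    by rewrite mulmx_suml; apply: eq_bigr => l _; rewrite mulmxA.
  - by move=> X a w; rewrite -scalemxAr.
  - by move=> X; rewrite mulmx0.
  - by move=> X Y w; rewrite linearB /= mulmxBl.
  - by move=> X Y w; rewrite !mulmxA -mulmxBl urep_diff_bracket.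
have S (w : 'cV_d) : casimir0 *m w = (casimir_weight rho)%:~R *: w.
  apply: (schur act0Z Virr _ _ (memvf v) v0 hw (memvf w)).
    by move=> a v1 w1; rewrite mulmxDr -scalemxAr.
  by move=> u uu v1; rewrite /act0 !mulmxA casimir0_comm.
apply/matrixP => i j; have := congr1 (fun w : 'cV_d => w i ord0) (S (delta_mx j ord0)).
rewrite !mxE (bigD1 j) //= mxE eqxx mulr1 big1 ?addr0 => [->|k kj].
  by rewrite eqxx andbT mulr_natr.
by rewrite mxE (negbTE kj) mulr0.
Qed.

(** The Casimir operator of V (x) W is the sum of those of V and of W and of twice the mixed term.
    On a highest weight vector the total is known from lam, and that of V is the scalar of rho. The
    map S sends X to the transpose of its action on W, hence reverses brackets. *)
Lemma tensor_hw (lam : 'I_m -> int) (S : 'M[C]_m -> 'M[C]_m) A :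
  (forall X Y, S (X - Y) = S X - S Y) ->
  (forall X Y, S (X *m Y - Y *m X) = S Y *m S X - S X *m S Y) ->
  (forall k, pi (delta_mx k k) *m A + A *m S (delta_mx k k) = (lam k)%:~R *: A) ->
  (forall k l : 'I_m, (k < l)%N -> pi (delta_mx k l) *m A + A *m S (delta_mx k l) = 0) ->
  (\sum_k \sum_l pi (delta_mx k l) *m A *m S (delta_mx l k)) *+ 2 =
  (casimir_weight lam - casimir_weight rho)%:~R *: A
    - A *m (\sum_k \sum_l S (delta_mx l k) *m S (delta_mx k l)).
Proof.
move=> SB Sbr hk hkl; pose tau X w : 'M[C]_(d, m) := pi X *m w + w *m S X.
have E (x y : 'M[C]_d) (s t : 'M[C]_m) (w : 'M[C]_(d, m)) :
    x *m (y *m w + w *m t) + (y *m w + w *m t) *m s =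
    x *m y *m w + x *m w *m t + (y *m w *m s + w *m (t *m s)).
  by rewrite mulmxDr mulmxDl !mulmxA.
have T : \sum_k \sum_l tau (delta_mx k l) (tau (delta_mx l k) A) =
    (casimir_weight lam)%:~R *: A.
  apply: (casimir_highest_weight _ _ _ _ hk hkl) => [X a w|X|X Y w|X Y w]; rewrite /tau.
  - by rewrite scalerDr -scalemxAr -scalemxAl.
  - by rewrite mulmx0 mul0mx addr0.
  - by rewrite SB linearB /= mulmxBl mulmxBr addrACA -opprD.
  - rewrite Sbr -urep_diff_bracket mulmxBl mulmxBr !E.
    move: (pi X *m pi Y *m w) (pi X *m w *m S Y) (pi Y *m w *m S X) => a b c.
    move: (pi Y *m pi X *m w) (w *m (S Y *m S X)) (w *m (S X *m S Y)) => a' b' c'.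
    by apply/matrixP => i j; rewrite !mxE; ring.
rewrite rmorphB scalerBl -T.
have -> : (casimir_weight rho)%:~R *: A = casimir0 *m A.
  by rewrite casimir0_scalar mul_scalar_mx.
rewrite /casimir0 mulmx_suml mulmx_sumr -sumrB -sumrB mulr2n.
rewrite [X in _ + X = _]exchange_big -big_split; apply: eq_bigr => k _ /=.
rewrite mulmx_suml mulmx_sumr -sumrB -sumrB -big_split; apply: eq_bigr => l _ /=.
rewrite /tau E; move: (_ *m pi _ *m A) (pi _ *m A *m _) (pi _ *m A *m _) (A *m _) => a b c e.
by apply/matrixP => i j; rewrite !mxE; ring.
Qed.

Lemma sum_delta_mul :
  \sum_(k < m) \sum_(l < m) (delta_mx k l : 'M[C]_m) *m delta_mx l k = m%:R%:M :> 'M[C]_m.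
Proof.
under eq_bigr do under eq_bigr do rewrite mul_delta_mx.
under eq_bigr do rewrite sumr_const card_ord -scaler_nat.
by rewrite -scaler_sumr sum_delta_diag scalemx1.
Qed.

Lemma half_weight (w : int) (x : int) A B : A *+ 2 = x%:~R *: B -> x = w *+ 2 ->
  A = w%:~R *: B.
Proof.
move=> AB xw; have two0 : (2 : C) != 0 by rewrite pnatr_eq0.
apply: (scalerI two0); rewrite scaler_nat AB xw scalerA; congr (_ *: _).
by rewrite rmorphMn /= mulr_natl.
Qed.

(** The shift of the Casimir eigenvalue from rho to rho + mu_i, less the Casimir scalar m of C^m,
    equals - 2 w_{+i}. *)
Lemma casimir_p_hw i A :
  (forall k, diffp V (delta_mx k k) A = (rho k + mu i k)%:~R *: A) ->
  (forall k l : 'I_m, (k < l)%N -> diffp V (delta_mx k l) A = 0) ->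
  casimir_p A = (wp rho i)%:~R *: A.
Proof.
move=> hk hkl; have := tensor_hw (S := fun X => X^T) _ _ hk hkl.
under eq_bigr do under eq_bigr do rewrite trmx_delta.
under [X in _ *m X]eq_bigr do under eq_bigr do rewrite !trmx_delta.
rewrite sum_delta_mul mul_mx_scalar -scalerBl.
have -> : (casimir_weight (fun k => rho k + mu i k) - casimir_weight rho)%:~R - m%:R =
    (- (wp rho i) *+ 2)%:~R :> C.
  have -> : casimir_weight (fun k => rho k + mu i k) = casimir_weight (fun k => rho k + 1 * mu i k).
    by congr casimir_weight; apply/funext => k; rewrite mul1r.
  have := casimir_weight_shift rho 1 i.
  move=> ->; rewrite -[m%:R]/(m%:Z%:~R) -rmorphB; congr (_%:~R).
  by rewrite /wp; ring.
move=> H; rewrite /casimir_p; apply: oppr_inj; rewrite opprK -scaleNr -rmorphN /=.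
apply: half_weight (H _ _) _ => // [X Y|X Y]; first by rewrite linearB.
by rewrite linearB /= !trmx_mul.
Qed.

(** The same computation with rho - mu_i gives - 2 w_{-i}. The dual action X |-> - X^T supplies the
    sign by which [casimir_m] differs from [casimir_p]. *)
Lemma casimir_m_hw i A :
  (forall k, diffm V (delta_mx k k) A = (rho k - mu i k)%:~R *: A) ->
  (forall k l : 'I_m, (k < l)%N -> diffm V (delta_mx k l) A = 0) ->
  casimir_m A = (wm rho i)%:~R *: A.
Proof.
move=> hk hkl; have := tensor_hw (S := fun X => (- X^T)^T) _ _ hk hkl.
have E (X : 'M[C]_m) : (- X^T)^T = - X by rewrite linearN /= trmxK.
under eq_bigr do under eq_bigr do rewrite E mulmxN.
under [X in _ *m X]eq_bigr do under eq_bigr do rewrite !E mulNmx mulmxN opprK.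
rewrite exchange_big /= [in X in _ *m X]exchange_big sum_delta_mul mul_mx_scalar -scalerBl.
have -> : (casimir_weight (fun k => rho k - mu i k) - casimir_weight rho)%:~R - m%:R =
    (- (wm rho i) *+ 2)%:~R :> C.
  have -> : casimir_weight (fun k => rho k - mu i k) = casimir_weight (fun k => rho k + -1 * mu i k).
    by congr casimir_weight; apply/funext => k; rewrite mulN1r.
  have := casimir_weight_shift rho (-1) i.
  move=> ->; rewrite -[m%:R]/(m%:Z%:~R) -rmorphB; congr (_%:~R).
  by rewrite /wm; ring.
move=> H; rewrite /casimir_m exchange_big; apply: oppr_inj.
rewrite -scaleNr -rmorphN /= -sumrN; under eq_bigr do rewrite -sumrN.
apply: half_weight (H _ _) _ => // [X Y|X Y]; first by rewrite !E opprB opprK addrC.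
by rewrite !E !mulNmx !mulmxN !opprK opprB.
Qed.

Lemma actpD u A B : actp V u (A + B) = actp V u A + actp V u B.
Proof. by rewrite /actp /tensor_act mulmxDr mulmxDl. Qed.
Lemma actmD u A B : actm V u (A + B) = actm V u A + actm V u B.
Proof. by rewrite /actm /tensor_act mulmxDr mulmxDl. Qed.
Lemma actpZ u a A : actp V u (a *: A) = a *: actp V u A.
Proof. by rewrite /actp /tensor_act -scalemxAr -scalemxAl. Qed.
Lemma actmZ u a A : actm V u (a *: A) = a *: actm V u A.
Proof. by rewrite /actm /tensor_act -scalemxAr -scalemxAl. Qed.

End Weights.

End Gradients.

Section TensorActions.
Variables (R : realType) (m d : nat) (V : unitary_rep R m d).
Local Notation C := R[i].
Local Notation pi := (urep_diff V).
Implicit Types (u : 'M[C]_m).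

Lemma tr_unitary n (u : 'M[C]_n) : u \is unitarymx -> u^T \is unitarymx.
Proof.
move=> uu; apply/unitaryP.
have -> : adj u^T = (adj u)^T by apply/matrixP => i j; rewrite !mxE.
by rewrite -trmx_mul (unitary_adjl uu) trmx1.
Qed.

Lemma conj_unitary n (u : 'M[C]_n) : u \is unitarymx -> conjmx u \is unitarymx.
Proof. by move=> uu; rewrite -[conjmx u]trmxK; exact/tr_unitary/adj_unitary. Qed.

Lemma tensor_hdot e (sg : 'M[C]_m -> 'M[C]_e) u (A B : 'M[C]_(d, e)) : u \is unitarymx ->
  sg u \is unitarymx ->
  hdot (tensor_act V sg u A) (tensor_act V sg u B) = hdot A B.
Proof.
move=> uu su; rewrite /tensor_act hdotMr -[_ *m _ *m adj _]mulmxA.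
rewrite (unitary_adjr (tr_unitary su)) mulmx1.
exact: hdot_unitary (urep_unitary V uu).
Qed.

Lemma tensor_act_adj e (sg : 'M[C]_m -> 'M[C]_e) u (A B : 'M[C]_(d, e)) : u \is unitarymx ->
  sg (adj u) = adj (sg u) ->
  hdot (tensor_act V sg u A) B = hdot A (tensor_act V sg (adj u) B).
Proof.
move=> uu su; rewrite /tensor_act hdotMr hdotMl mulmxA (urep_adj V uu) su.
by congr (hdot _ (_ *m _)); apply/matrixP => i j; rewrite !mxE.
Qed.

Section Decomposition.
Variables (e : nat) (act diff : 'M[C]_m -> 'M[C]_(d, e) -> 'M[C]_(d, e)).
Variables (lam : 'I_m -> 'I_m -> int) (P : 'I_m -> 'End('M[C]_(d, e))).
Hypothesis HP : weight_decomposition act diff lam P.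
Hypothesis actD : forall u v w, act u (v + w) = act u v + act u w.
Hypothesis actZ : forall u a v, act u (a *: v) = a *: act u v.

(** Schur's lemma applies to each summand with a dominant weight; the other projections are zero. *)
Lemma decomposition_scalar (f : 'M[C]_(d, e) -> 'M[C]_(d, e)) (w : 'I_m -> int) :
  (forall a v w, f (a *: v + w) = a *: f v + f w) ->
  (forall u, u \is unitarymx -> forall v, f (act u v) = act u (f v)) ->
  (forall i A, (forall k, diff (delta_mx k k) A = (lam i k)%:~R *: A) ->
     (forall k l : 'I_m, (k < l)%N -> diff (delta_mx k l) A = 0) -> f A = (w i)%:~R *: A) ->
  forall A, f A = \sum_i (w i)%:~R *: P i A.
Proof.
move=> flin fcomm fhw A; have [HPi Psum] := HP.
have f0 : f 0 = 0 by have := flin (-1) 0 0; rewrite scaler0 addr0 scaleN1r addNr.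
have fD v v' : f (v + v') = f v + f v' by have := flin 1 v v'; rewrite !scale1r.
have {1}-> : A = \sum_i P i A by rewrite -sum_lfunE Psum id_lfunE.
rewrite (big_morph f fD f0); apply: eq_bigr => i _.
have [_ Pdom Pndom] := HPi i.
have [dom|ndom] := pselect (dominant (lam i)); last first.
  by rewrite (Pndom ndom) zero_lfunE f0 scaler0.
have [Pirr [v [vP v0 hv hv']]] := Pdom dom.
by apply: (schur actZ Pirr flin fcomm vP v0 (fhw i v hv hv')); apply: memv_img; exact: memvf.
Qed.

Lemma decomposition_equivariant i u A :
  (forall u v w, u \is unitarymx -> hdot (act u v) w = hdot v (act (adj u) w)) ->
  u \is unitarymx -> P i (act u A) = act u (P i A).
Proof.
move=> acth uu; have [HPi _] := HP; have [Porth Pdom Pndom] := HPi i.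
have [dom|ndom] := pselect (dominant (lam i)); last first.
  by rewrite (Pndom ndom) !zero_lfunE; have := actZ u 0 0; rewrite !scale0r.
have [[_ Pinv _] _] := Pdom dom.
exact: (projection_equivariant actD acth Porth Pinv).
Qed.

End Decomposition.

(** If all V u are scalars, then every line is an invariant subspace. *)
Lemma trivial_irreducible_dim : (forall u, u \is unitarymx -> exists c, V u = c%:M) ->
  irreducible_subspace (act0 V) fullv -> (d <= 1)%N.
Proof.
move=> Vc [_ _ irr]; case: d V Vc irr => // d' V' Vc irr.
pose v : 'cV[C]_d'.+1 := delta_mx ord0 ord0.
have v0 : v != 0.
  by apply/eqP => /matrixP/(_ ord0 ord0)/eqP; rewrite !mxE eqxx oner_eq0.
have [||H|H] := irr <[v]>%VS.
- exact: subvf.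
- move=> u uu w wv; have [c cE] := Vc u uu.
  by rewrite /act0 cE mul_scalar_mx; exact: memvZ.
- by have := memv_line v; rewrite H memv0 (negbTE v0).
- by have := dimvf 'cV[C]_d'.+1; rewrite -H dim_vline v0 /dim /= muln1 => <-.
Qed.

(** The derivative of |f|^2 is 2 Re(k) |f|^2 = 0. *)
Lemma linear_ode_zero (f : R -> C) (k : C) : complex.Re k = 0 ->
  (forall t, dC (1 : R) f t (k * f t)) -> f 0 = 0 -> forall t, f t = 0.
Proof.
move=> k0 fd f0 t; pose g s := f s * Num.conj (f s).
have gd s : is_derive s (1 : R) (fun s => complex.Re (g s)) 0.
  have [+ _] := dC_mul (fd s) (dC_conj (fd s)).
  congr (is_derive _ _ _ _); rewrite !(reD, reM, imM, reJ, imJ, k0) /=; ring.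
have [|c _ cE] := @line_MVT R R (fun s => complex.Re (g s)) 0 1 t.
  by move=> c _; exact: (@ex_derive _ _ _ _ _ _ _ (gd _)).
move: cE; rewrite (@derive_val _ _ _ _ _ _ _ (gd _)) mulr0 add0r [_ *: _]mulr1.
rewrite /g f0 mul0r subr0 reM reJ imJ mulrN opprK -!expr2 => /eqP.
rewrite paddr_eq0 ?sqr_ge0 // !sqrf_eq0 => /andP[/eqP r0 /eqP i0].
exact: complexP.
Qed.

(** The spectral theorem joins 1 to u by a curve U t with U' = U X and X skew-hermitian. Then V (U
    t) solves V' = k V with k = c tr X imaginary; so do its off-diagonal entries and the differences
    of its diagonal entries, and these vanish at t = 0. *)
Lemma urep_scalar (c : R) : (forall X, pi X = (real_complex R c * \tr X)%:M) ->
  forall u, u \is unitarymx -> exists z, V u = z%:M.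
Proof.
move=> piE u uu.
have nu : u \is normalmx.
  by apply/normalmxP; rewrite -adj_t (unitary_adjr uu) (unitary_adjl uu).
set Q := spectralmx u; set sp := spectral_diag u.
have Qu : Q \is unitarymx by exact: spectral_unitarymx.
have uE : u = adj Q *m diag_mx sp *m Q.
  by rewrite adj_t -(invmx_unitary Qu); exact: (orthomx_spectralP nu).
have dE : diag_mx sp = Q *m u *m adj Q.
  by rewrite uE !mulmxA (unitary_adjr Qu) mul1mx -mulmxA (unitary_adjr Qu) mulmx1.
have dU : diag_mx sp \is unitarymx.
  by rewrite dE; exact: mul_unitary (mul_unitary Qu uu) (adj_unitary Qu).
have diag_adj (v : 'rV[C]_m) : adj (diag_mx v) = diag_mx (conjmx v).
  apply/matrixP => i j; rewrite adjE !mxE eq_sym; case: eqP => [->//|_].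
  by rewrite !mulr0n conjC0.
have /choice[th thE] j : exists t, sp ord0 j = cexp t.
  apply: cexp_surj; have := unitary_adjr dU; rewrite diag_adj mulmx_diag.
  by move/matrixP/(_ j j); rewrite !mxE eqxx !mulr1n.
pose D t : 'rV[C]_m := \row_j cexp (t * th j).
pose U t : 'M[C]_m := adj Q *m diag_mx (D t) *m Q.
have Du t : diag_mx (D t) \is unitarymx.
  apply/unitaryP; rewrite diag_adj mulmx_diag -diag_const_mx.
  by congr diag_mx; apply/rowP => j; rewrite !mxE cexpM_conj.
have Uu t : U t \is unitarymx := mul_unitary (mul_unitary (adj_unitary Qu) (Du t)) Qu.
pose iT : 'rV[C]_m := \row_j (Complex 0 1 * real_complex R (th j)).
pose X : 'M[C]_m := adj Q *m diag_mx iT *m Q.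
have Ud t : dM (1 : R) U t (U t *m X).
  have -> : U t *m X = adj Q *m diag_mx (\row_j (iT ord0 j * D t ord0 j)) *m Q.
    rewrite /U /X !mulmxA -[_ *m Q *m adj Q]mulmxA (unitary_adjr Qu) mulmx1.
    rewrite -[adj Q *m _ *m _]mulmxA mulmx_diag; congr (_ *m diag_mx _ *m _).
    by apply/rowP => j; rewrite !mxE mulrC.
  apply: dM_mulr; apply: dM_mull => i j; rewrite mxE.
  under eq_fun do rewrite mxE.
  case: eqP => _; last by rewrite !mulr0n; exact: dC_cst.
  by rewrite !mulr1n !mxE; under eq_fun do rewrite mxE; exact: dC_cexp.
pose k := real_complex R c * \tr X.
have k0 : complex.Re k = 0.
  rewrite /k /X mxtrace_mulC mulmxA (unitary_adjr Qu) mul1mx mxtrace_diag mulr_sumr re_sum.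
  by rewrite big1 // => j _; rewrite !mxE !(reM, imM) /=; ring.
have Vd t : dM (1 : R) (fun s => V (U s)) t (k *: V (U t)).
  have := dM_urep_unitary V _ (Ud t); rewrite mulmxA (unitary_adjl (Uu t)) mul1mx piE -/k.
  rewrite mul_mx_scalar; apply.
  by apply: (@filterE _ (nbhs t) (nbhs_filter t)) => s; exact: Uu.
have V0 : V (U 0) = 1%:M.
  rewrite -(urep_1 V); congr (V _).
  rewrite /U (_ : D 0 = const_mx 1); last by apply/rowP => j; rewrite !mxE mul0r cexp0.
  by rewrite diag_const_mx mulmx1 (unitary_adjl Qu).
have U1 : U 1 = u.
  by rewrite uE /U; congr (_ *m diag_mx _ *m _); apply/rowP => j; rewrite mxE mul1r thE.
have off i j : i != j -> V u i j = 0.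
  move=> ij; rewrite -U1; apply: (@linear_ode_zero (fun t => V (U t) i j) k k0).
    by move=> t; have := Vd t i j; rewrite mxE.
  by rewrite V0 mxE (negbTE ij).
have dia i j : V u i i - V u j j = 0.
  rewrite -U1; apply: (@linear_ode_zero (fun t => V (U t) i i - V (U t) j j) k k0).
    move=> t; have := dC_add (Vd t i i) (dC_opp (Vd t j j)).
    by rewrite !mxE mulrBr.
  by rewrite V0 !mxE !eqxx subrr.
have [[i0 _]|no] := pselect (exists i : 'I_d, True); last first.
  by exists 0; apply/matrixP => i; case: no; exists i.
exists (V u i0 i0); apply/matrixP => i j; rewrite mxE.
case: eqVneq => [<-|/off ->]; last by rewrite mulr0n.
by rewrite mulr1n; apply/eqP; rewrite -subr_eq0 dia.
Qed.

End TensorActions.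

(** * Conformal weights on the summands, and their gap *)

Section WeightGap.
Variables (R : realType) (n d : nat) (V : unitary_rep R n.+1 d).
Local Notation C := R[i].
Local Notation pi := (urep_diff V).
Variables (rho : 'I_n.+1 -> int) (Pp Pm : 'I_n.+1 -> 'End('M[C]_(d, n.+1))).
Hypotheses (HV : irreducible_of_weight V rho)
  (HPp : weight_decomposition (actp V) (diffp V) (fun i j => rho j + mu i j) Pp)
  (HPm : weight_decomposition (actm V) (diffm V) (fun i j => rho j - mu i j) Pm).

Lemma casimir_pE A : casimir_p V A = \sum_i (wp rho i)%:~R *: Pp i A.
Proof.
apply: (decomposition_scalar HPp) => [u a v|a v w|u uu v|i B].
- exact: actpZ.
- exact: casimir_p_lin.
- exact: casimir_p_comm.
- exact: casimir_p_hw.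
Qed.

Lemma casimir_mE A : casimir_m V A = \sum_i (wm rho i)%:~R *: Pm i A.
Proof.
apply: (decomposition_scalar HPm) => [u a v|a v w|u uu v|i B].
- exact: actmZ.
- exact: casimir_m_lin.
- exact: casimir_m_comm.
- exact: casimir_m_hw.
Qed.

Lemma Pp_equivariant i u A : u \is unitarymx -> Pp i (actp V u A) = actp V u (Pp i A).
Proof.
apply: (decomposition_equivariant HPp) => [w v v'|w a v|w v v' wu].
- exact: actpD.
- exact: actpZ.
- exact: tensor_act_adj.
Qed.

Lemma Pm_equivariant i u A : u \is unitarymx -> Pm i (actm V u A) = actm V u (Pm i A).
Proof.
apply: (decomposition_equivariant HPm) => [w v v'|w a v|w v v' wu].
- exact: actmD.
- exact: actmZ.
- by apply: (tensor_act_adj _ _ _ wu); apply/matrixP => i' j'; rewrite !mxE.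
Qed.

(** If rho^m - rho^1 = 0, then rho is constant and rho + mu_i is dominant only for the first i. So V
    (x) C^m is one summand and [casimir_p] is a scalar; its matrix entries then force every pi(e_kl)
    to be a scalar, whence d <= 1. *)
Lemma weight_gap : dominant rho -> (2 <= d)%N ->
  (wp rho ord0 + wm rho ord_max)%:~R != 0 :> C.
Proof.
move=> Hrho Hd; rewrite intr_eq0; apply/eqP => w0.
have r0 : rho ord_max = rho ord0.
  by apply/eqP; rewrite -subr_eq0 -w0; apply/eqP; rewrite /wp /wm /=; ring.
have rc j : rho j = rho ord0.
  apply/eqP; rewrite eq_le Hrho // -r0 Hrho // -ltnS; exact: ltn_ord.
have P0 i : i != ord0 -> Pp i = 0.
  move=> i0; have [_ _ H] := (HPp.1 i); apply: H => /(_ ord0 i isT).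
  by rewrite rc /mu eqxx eq_sym (negbTE i0) lerD2l.
have H A : casimir_p V A = (wp rho ord0)%:~R *: A.
  rewrite casimir_pE.
  have {2}-> : A = \sum_i Pp i A by rewrite -sum_lfunE HPp.2 id_lfunE.
  rewrite scaler_sumr; apply: eq_bigr => i _.
  by have [->//|/P0 ->] := eqVneq i ord0; rewrite zero_lfunE !scaler0.
(* The entry (i, l) of [casimir_p] at the elementary matrix e_aj is minus the entry (i, a) of
   pi(e_jl). *)
have piE j l i a : pi (delta_mx j l) i a = (rho ord0)%:~R * (i == a)%:R * (j == l)%:R.
  have := congr1 (fun B : 'M[C]_(d, n.+1) => - B i l) (H (delta_mx a j)).
  rewrite /casimir_p [X in - X]mxE opprK !mxE /wp addr0 rmorphN mulNr opprK.
  rewrite -mulrA -mulnb natrM [l == j]eq_sym => <-; rewrite summxE (bigD1 j) //=.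
  rewrite [X in _ + X]big1 ?addr0 => [|k kj]; last first.
    rewrite summxE big1 // => l' _.
    by rewrite -mulmxA mul_delta_mx_cond eq_sym (negbTE kj) mulr0n mulmx0 mxE.
  rewrite summxE (bigD1 l) //= [X in _ + X]big1 ?addr0 => [|l' ll'].
    rewrite -mulmxA mul_delta_mx mxE (bigD1 a) //= mxE !eqxx mulr1 big1 ?addr0 //.
    by move=> b ba; rewrite mxE (negbTE ba) mulr0.
  rewrite -mulmxA mul_delta_mx mxE big1 // => b _.
  by rewrite mxE eq_sym [l == l']eq_sym (negbTE ll') andbF mulr0.
have piS X : pi X = (real_complex R (rho ord0)%:~R * \tr X)%:M.
  rewrite linear_mx_delta; apply/matrixP => i a; rewrite summxE !mxE.
  rewrite -mulr_natr rmorph_int /mxtrace mulr_sumr mulr_suml; apply: eq_bigr => j _.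
  rewrite summxE (bigD1 j) //= mxE piE eqxx big1 ?addr0 => [|l lj].
    by rewrite mulr1; ring.
  by rewrite mxE piE [j == l]eq_sym (negbTE lj) !mulr0.
have := trivial_irreducible_dim (urep_scalar piS) HV.1.
by rewrite leqNgt Hd.
Qed.

End WeightGap.

(** * Iterated integrals *)

Section LineIntegral.
Variable R : realType.
Local Notation mu := (@lebesgue_measure R).
Implicit Types (f g : R -> R) (L : R).

(** An explicit bound L for the support, instead of a compact set, passes to slices and yields
    quantitative bounds for integrals. *)
Definition csupp1 L f := continuous f /\ forall t, L < `|t| -> f t = 0.

Lemma csupp1_restrict L f : csupp1 L f -> f = f \_ `[- L, L].
Proof.
move=> [_ f0]; apply/funext => t; rewrite patchE; case: ifPn => // /negP tL.
by apply: f0; rewrite ltNge ler_norml; apply/negP => H; apply: tL; rewrite inE /= in_itv.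
Qed.

Lemma csupp1_integrable L f : csupp1 L f -> mu.-integrable setT (EFin \o f).
Proof.
move=> fL; have : mu.-integrable `[- L, L] (EFin \o f).
  apply: continuous_compact_integrable; first exact: segment_compact.
  by apply: continuous_subspaceT; exact: fL.1.
rewrite integrable_mkcond //; congr (mu.-integrable _ _).
apply/funext => t; rewrite patchE /=; case: ifPn => // /negP tL.
by rewrite [f](csupp1_restrict fL) patchE; case: ifPn.
Qed.

Lemma integralD1 L f g : csupp1 L f -> csupp1 L g ->
  \int[mu]_t (f t + g t) = \int[mu]_t f t + \int[mu]_t g t.
Proof. by move=> fL gL; rewrite RintegralD //; [exact: csupp1_integrable fL|exact: csupp1_integrable gL]. Qed.

Lemma integralZ1 L c f : csupp1 L f -> \int[mu]_t (c * f t) = c * \int[mu]_t f t.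
Proof. by move=> fL; rewrite RintegralZl //; exact: csupp1_integrable fL. Qed.

Lemma integral_cst_segment (a b c : R) : a <= b ->
  mu.-integrable setT (EFin \o (cst c \_ `[a, b])) /\
  \int[mu]_t (cst c \_ `[a, b]) t = c * (b - a).
Proof.
move=> ab; split.
  have : mu.-integrable `[a, b] (EFin \o cst c).
    apply: continuous_compact_integrable; first exact: segment_compact.
    by apply: continuous_subspaceT => x; exact: cst_continuous.
  by rewrite integrable_mkcond // restrict_EFin.
rewrite -Rintegral_mkcond Rintegral_cst //; congr (_ * _).
have mE : mu `[a, b]%classic = (if (a < b)%R then b%:E - a%:E else 0)%E.
  exact: (lebesgue_measure_itv (Interval (BLeft a) (BRight b))).
transitivity (fine (if (a < b)%R then b%:E - a%:E else 0)%E); first by congr fine; exact: mE.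
case: ltP => [//|ba].
by rewrite (@le_anti _ _ a b) ?ab //= subrr.
Qed.

Lemma integral_bound1 L C f : 0 <= L -> 0 <= C -> csupp1 L f -> (forall t, `|f t| <= C) ->
  `|\int[mu]_t f t| <= C * (L *+ 2).
Proof.
move=> L0 C0 fL fC; have LL : - L <= L by rewrite ge0_cp.
have [ci cE] := integral_cst_segment C LL.
have fi := csupp1_integrable fL.
apply: (le_trans (le_normr_Rintegral _ fi)) => //.
rewrite -[L *+ 2]/(L + L) -{2}[L]opprK -cE; apply: le_Rintegral => //.
  exact: (integrable_norm fi).
move=> t _; rewrite patchE; case: ifPn => [_|/negP tL]; first exact: fC.
by rewrite [f](csupp1_restrict fL) patchE; case: ifPn => //; rewrite normr0.
Qed.

(** A positive value f t0 bounds f from below by f t0 / 2 on a whole interval. *)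
Lemma integral_ge0_eq0 L f : csupp1 L f -> (forall t, 0 <= f t) -> \int[mu]_t f t = 0 ->
  forall t, f t = 0.
Proof.
move=> fL f0 fI t0; apply/eqP/contraT => ft; have fp : 0 < f t0 by rewrite lt0r ft f0.
have e0 : 0 < f t0 / 2 by rewrite divr_gt0.
have /cvgrPdist_lt/(_ _ e0) := fL.1 t0.
move=> /nbhs_ballP[r /= r0 rf].
have s0 : 0 < r / 2 by rewrite divr_gt0.
have ab : t0 - r / 2 <= t0 + r / 2 by rewrite lerD2l ge0_cp // ltW.
have [ci cE] := integral_cst_segment (f t0 / 2) ab.
suff : f t0 / 2 * (t0 + r / 2 - (t0 - r / 2)) <= \int[mu]_t f t.
  have -> : t0 + r / 2 - (t0 - r / 2) = r by lra.
  rewrite fI => H.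
  by have := lt_le_trans (mulr_gt0 e0 r0) H; rewrite ltxx.
rewrite -cE; apply: le_Rintegral => //; first exact: csupp1_integrable fL.
move=> t _; rewrite patchE; case: ifPn => [|_]; last exact: f0.
rewrite inE /= in_itv /= => /andP[t1 t2].
have : `|f t0 - f t| < f t0 / 2.
  apply: rf; rewrite /ball /= ltr_norml; apply/andP; split; lra.
by rewrite ltr_norml => /andP[_]; lra.
Qed.

Lemma integral_derivative L (F f : R -> R) : csupp1 L F -> continuous f ->
  (forall t, is_derive t (1 : R) F (f t)) -> \int[mu]_t f t = 0.
Proof.
(* Since M exceeds both L and 0, F vanishes at the two ends of [- M, M] and f vanishes outside. *)
move=> FL fc Fd; set M := `|L| + 1.
have LM : L < M by rewrite (le_lt_trans (ler_norm L)) // ltrDl.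
have M0 : 0 < M by rewrite ltr_wpDl.
have fM : csupp1 M f.
  split=> // t Mt; rewrite -(@derive_val _ _ _ _ _ _ _ (Fd t)).
  rewrite -[RHS](derive_cst (0 : R) t (1 : R)); apply: near_eq_derive.
  have H : \forall s \near t, M < `|s|.
    by apply: (@cvgr_gt _ _ (nbhs t) _ (fun s => `|s|) `|t|) => //; apply: cvg_norm.
  by apply: filterS H => s Ms; apply: FL.2; apply: lt_trans Ms.
have MM : - M < M by rewrite gtrN.
rewrite [f in LHS](csupp1_restrict fM) -Rintegral_mkcond /Rintegral.
have Fc : continuous F by exact: FL.1.
have fw : {within `[- M, M], continuous f} by exact: continuous_subspaceT.
have FD : derivable_oo_LRcontinuous F (- M) M.
  split=> [t _||]; first exact: (@ex_derive _ _ _ _ _ _ _ (Fd t)).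
    by apply: cvg_at_right_filter; exact: Fc.
  by apply: cvg_at_left_filter; exact: Fc.
rewrite (continuous_FTC2 MM fw FD) => [|t _].
  by rewrite !FL.2 ?subee // ?normrN gtr0_norm.
by rewrite derive1E (@derive_val _ _ _ _ _ _ _ (Fd t)).
Qed.

End LineIntegral.

Section IteratedIntegral.
Variable R : realType.

Definition csupp N (L : R) (f : 'rV[R]_N -> R) :=
  continuous f /\ forall (x : 'rV[R]_N) (i : 'I_N), L < `|x ord0 i| -> f x = 0.

Lemma csupp_add N L (f g : 'rV[R]_N -> R) : csupp L f -> csupp L g ->
  csupp L (fun x => f x + g x).
Proof.
move=> [fc f0] [gc g0]; split=> [x|x i xi]; last by rewrite (f0 x i) ?(g0 x i) ?addr0.
exact: (continuousD (fc x) (gc x)).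
Qed.

Lemma csupp_scale N L c (f : 'rV[R]_N -> R) : csupp L f -> csupp L (fun x => c * f x).
Proof.
move=> [fc f0]; split=> [x|x i xi]; last by rewrite (f0 x i) ?mulr0.
exact: (continuousM (@cst_continuous _ _ c x) (fc x)).
Qed.

Lemma csupp_pd N L a (f : 'rV[R]_N -> R) : csupp L f -> continuous (pd a f) ->
  csupp L (pd a f).
Proof.
move=> [fc f0] pc; split=> // x i xi.
have Uo : open [set y : 'rV[R]_N | L < `|y ord0 i|].
  apply/openP => y /= yi; exists (`|y ord0 i| - L); first by rewrite subr_gt0.
  move=> z /(_ i) zy /=; rewrite -(ltrD2r (- L)).
  have := ler_distD (z ord0 i) (y ord0 i) 0; rewrite !subr0 distrC => H; lra.
rewrite (pd_ext (g := fun=> 0) a Uo _ xi) => [|y yi]; last exact: f0 yi.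
exact: derive_cst.
Qed.

Section Step.
Variables (N : nat) (L : R).
Implicit Types (f : 'rV[R]_(1 + N) -> R) (t : R) (y : 'rV[R]_N).

Local Notation i0 := (@lshift 1 N ord0).
Local Notation iS := (@rshift 1 N).

Definition scons t y : 'rV[R]_(1 + N) := row_mx (t%:M : 'rV[R]_1) y.

Lemma scons0 t y : scons t y ord0 i0 = t.
Proof. by rewrite row_mxEl !mxE mulr1n. Qed.

Lemma sconsS t y i : scons t y ord0 (iS i) = y ord0 i.
Proof. by rewrite row_mxEr. Qed.

Lemma scons_box r t y t' y' : `|t' - t| < r -> box r y y' ->
  box r (scons t y) (scons t' y').
Proof.
move=> tt yy i; case: (split_ordP i) => j ->; last by rewrite !sconsS; exact: yy.
by rewrite (ord1 j) !scons0.
Qed.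

Lemma scons_shift0 t y h :
  scons t y + h *: delta_mx ord0 i0 = scons (t + h) y.
Proof.
apply/rowP => i; rewrite mxE [X in _ + X]mxE [X in _ * X]mxE eqxx /=.
case: (split_ordP i) => j ->; first by rewrite (ord1 j) !scons0 eqxx mulr1.
by rewrite !sconsS eq_rlshift mulr0 addr0.
Qed.

Lemma scons_shiftS t y h a :
  scons t y + h *: delta_mx ord0 (iS a) = scons t (y + h *: delta_mx ord0 a).
Proof.
apply/rowP => i; rewrite mxE [X in _ + X]mxE [X in _ * X]mxE eqxx /=.
case: (split_ordP i) => j ->; first by rewrite (ord1 j) !scons0 eq_lrshift mulr0 addr0.
by rewrite !sconsS eq_rshift !mxE eqxx.
Qed.

Lemma slice_csupp f t : csupp L f -> csupp L (fun y => f (scons t y)).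
Proof.
move=> [fc f0]; split=> [y|y i yi]; last by apply: (f0 _ (iS i)); rewrite sconsS.
apply/continuous_box => e e0.
have [r r0 rf] := (continuous_box _ _).1 (fc (scons t y)) e e0.
by exists r => // y' yy; apply: rf; apply: scons_box yy; rewrite subrr normr0.
Qed.

(** Continuity in t is uniform in y because the slices vanish off the cube [- L, L]^N, which is
    compact. *)
Lemma slice_unif f t e : csupp L f -> 0 < e -> exists2 r : R, 0 < r &
  forall t', `|t' - t| < r -> forall y, `|f (scons t' y) - f (scons t y)| < e.
Proof.
move=> [fc f0] e0.
pose K : set 'rV[R]_N := [set y | forall i, `[- L, L]%classic (y ord0 i)].
have /compact_near_coveringP Kc : compact K.
  by apply: (@rV_compact R N (fun=> `[- L, L]%classic)) => i; exact: segment_compact.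
have := Kc R (nbhs t) (fun t' y => `|f (scons t' y) - f (scons t y)| < e) _.
case=> [y _|/= r r0 rf].
  have e2 : 0 < e / 2 by rewrite divr_gt0.
  have [r r0 rf] := (continuous_box _ _).1 (fc (scons t y)) _ e2.
  exists (box r y, [set t' | `|t' - t| < r]) => [|[y' t'] /= [yy tt]].
    split; first exact: box_nbhs.
    by apply/nbhs_ballP; exists r => // s /=; rewrite /ball /= distrC.
  have A := rf _ (scons_box tt yy).
  have B := rf (scons t y') (scons_box (_ : `|t - t| < r) yy).
  rewrite -(subrKA (f (scons t y))) (le_lt_trans (ler_normD _ _)) // [e]splitr ltrD //.
  by rewrite distrC; apply: B; rewrite subrr normr0.
exists r => // t' tt y; have [Ky|nKy] := pselect (K y).
  by apply: rf => //; rewrite /ball_ /= distrC.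
have [i yi] : exists i, ~ (`[- L, L]%classic (y ord0 i)) by apply/existsNP.
have Ly : L < `|y ord0 i|.
  by rewrite ltNge ler_norml; apply/negP => H; apply: yi; rewrite /= in_itv.
by rewrite !(f0 _ (iS i)) ?sconsS // subrr normr0.
Qed.

End Step.

Lemma csupp_opp N L (f : 'rV[R]_N -> R) : csupp L f -> csupp L (fun x => - f x).
Proof. by move=> fL; have := csupp_scale (-1) fL; under eq_fun do rewrite mulN1r. Qed.

(** What the induction on the dimension has to know about the integral over the remaining variables:
    linearity, and a bound by the sup norm times the volume (2 L)^N of the cube. The bound takes the
    place of dominated convergence. *)
Definition linear_bounded N (J : ('rV[R]_N -> R) -> R) := [/\
  forall L f g, 0 <= L -> csupp L f -> csupp L g -> J (fun x => f x + g x) = J f + J g,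
  forall L c f, 0 <= L -> csupp L f -> J (fun x => c * f x) = c * J f &
  forall L C f, 0 <= L -> 0 <= C -> csupp L f -> (forall x, `|f x| <= C) ->
    `|J f| <= C * (L *+ 2) ^+ N].

Lemma linear_boundedB N J L (f g : 'rV[R]_N -> R) : linear_bounded J -> 0 <= L ->
  csupp L f -> csupp L g -> J (fun x => f x - g x) = J f - J g.
Proof.
move=> [JD JZ _] L0 fL gL; rewrite (JD L) //; last exact: csupp_opp.
by rewrite -mulN1r -(JZ L) //; congr (_ + J _); apply/funext => x; rewrite mulN1r.
Qed.

(** Slices at nearby t are uniformly close, and J is bounded for the sup norm. *)
Lemma slice_integral_csupp1 N L (f : 'rV[R]_(1 + N) -> R) J : linear_bounded J -> 0 <= L ->
  csupp L f -> csupp1 L (fun t => J (fun y => f (scons t y))).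
Proof.
move=> Jlin L0 fL; have [JD JZ JC] := Jlin; split=> [t|t Lt]; last first.
  rewrite (_ : (fun y => _) = (fun y => 0 * f (scons t y))).
    by rewrite (JZ L) ?mul0r //; exact: slice_csupp.
  apply/funext => y; rewrite mul0r; apply: (fL.2 _ (lshift N ord0)).
  by rewrite scons0.
apply/cvgrPdist_lt => e e0; set B := (L *+ 2) ^+ N.
(* The volume [B] may be 0, so e is divided by B + 1. *)
have B0 : 0 < B + 1 by rewrite ltr_wpDl // exprn_ge0 // mulrn_wge0.
have e'0 : 0 < e / (B + 1) by rewrite divr_gt0.
have [r r0 rf] := slice_unif t fL e'0.
apply/nbhs_ballP; exists r => // t' tt /=; rewrite distrC.
rewrite -(linear_boundedB Jlin L0); [|exact: slice_csupp|exact: slice_csupp].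
apply: (@le_lt_trans _ _ (e / (B + 1) * B)).
  apply: (JC L) => //; first exact: ltW.
    by apply: csupp_add; [|apply: csupp_opp]; exact: slice_csupp.
  by move=> y; apply/ltW/rf; rewrite distrC.
by rewrite -mulrA -[ltRHS]mulr1 ltr_pM2l // mulrC ltr_pdivrMr // mul1r ltrDl.
Qed.

(** Differentiation under J: the difference quotients converge uniformly in y, by the mean value
    theorem and the uniform continuity of the partial derivative. *)
Lemma slice_derivative N L (F : 'rV[R]_(1 + N) -> R) J t : linear_bounded J -> 0 <= L ->
  csupp L F -> (forall x, derivable F x (delta_mx ord0 (lshift N ord0))) ->
  continuous (pd (lshift N ord0) F) ->
  is_derive t (1 : R) (fun t => J (fun y => F (scons t y)))
    (J (fun y => pd (lshift N ord0) F (scons t y))).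
Proof.
move=> Jlin L0 FL Fd Fc; have [JD JZ JC] := Jlin.
set P := pd _ F; have PL : csupp L P by exact: csupp_pd.
apply: (is_deriveE _ t (1 : R) _).2; apply/cvgrPdist_lt => e e0.
set B := (L *+ 2) ^+ N.
have B0 : 0 < B + 1 by rewrite ltr_wpDl // exprn_ge0 // mulrn_wge0.
have e'0 : 0 < e / (B + 1) by rewrite divr_gt0.
have [r r0 rf] := slice_unif t PL e'0.
apply/nbhs_ballP; exists r => //= h; rewrite /ball /= sub0r normrN => hr h0.
have E (y : 'rV[R]_N) : `|h^-1 * (F (scons (t + h) y) - F (scons t y)) - P (scons t y)|
    <= e / (B + 1).
  have [c ch] := line_MVT (fun c (_ : `|c| <= `|h|) =>
    Fd (scons t y + c *: delta_mx ord0 (lshift N ord0))).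
  rewrite scons_shift0 => ->; rewrite mulKf // -/(pd _ F _) scons_shift0.
  by apply/ltW/rf; rewrite addrAC subrr add0r (le_lt_trans ch).
have S t' : csupp L (fun y => F (scons t' y)) by exact: slice_csupp.
have D := csupp_add (S (t + h)) (csupp_opp (S t)).
rewrite distrC [h *: (1 : R)]mulr1 [h + t]addrC.
suff H : `|h^-1 * (J (fun y => F (scons (t + h) y)) - J (fun y => F (scons t y))) -
    J (fun y => P (scons t y))| < e by exact: H.
rewrite -(linear_boundedB Jlin L0 (S (t + h)) (S t)) -(JZ L) //.
rewrite -(linear_boundedB Jlin L0 (csupp_scale _ D) (slice_csupp t PL)).
apply: (@le_lt_trans _ _ (e / (B + 1) * B)).
  apply: (JC L) => //; first exact: ltW.
  by apply: csupp_add; [exact: csupp_scale|apply: csupp_opp; exact: slice_csupp].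
by rewrite -mulrA -[ltRHS]mulr1 ltr_pM2l // mulrC ltr_pdivrMr // mul1r ltrDl.
Qed.

Lemma iterated_integral_linear_bounded N : linear_bounded (@iterated_integral R N).
Proof.
elim: N => [|N IH].
  by split=> // L C f _ _ _ fC; rewrite expr0 mulr1; exact: fC.
have [JD JZ JC] := IH.
have JL L (f : 'rV[R]_(1 + N) -> R) := @slice_integral_csupp1 N L f _ IH.
split=> [L f g L0 fL gL|L c f L0 fL|L C f L0 C0 fL fC].
- rewrite -[RHS](integralD1 (JL L f L0 fL) (JL L g L0 gL)).
  apply: eq_Rintegral => t _; rewrite -(JD L) //; exact: slice_csupp.
- rewrite -[RHS](integralZ1 _ (JL L f L0 fL)).
  by apply: eq_Rintegral => t _; rewrite -(JZ L) //; exact: slice_csupp.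
- rewrite exprSr mulrA; apply: (integral_bound1 L0 _ (JL L f L0 fL)).
    by rewrite mulr_ge0 // exprn_ge0 // mulrn_wge0.
  by move=> t; apply: (JC L) => //; exact: slice_csupp.
Qed.

Lemma iterated_integral_ge0 N (f : 'rV[R]_N -> R) : (forall x, 0 <= f x) ->
  0 <= iterated_integral f.
Proof.
elim: N f => [f f0|N IH f f0]; first exact: f0.
by apply: Rintegral_ge0 => t _; apply: IH => y; exact: f0.
Qed.

Lemma iterated_integral_eq0 N L (f : 'rV[R]_N -> R) : 0 <= L -> csupp L f ->
  (forall x, 0 <= f x) -> iterated_integral f = 0 -> forall x, f x = 0.
Proof.
move=> L0; elim: N f => [f _ _ J0 x|N IH f fL f0 J0 x].
  by rewrite -J0 /=; congr f; apply/rowP => -[].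
have fL1 := slice_integral_csupp1 (iterated_integral_linear_bounded N) L0 fL.
have J0t := integral_ge0_eq0 fL1
  (fun t => iterated_integral_ge0 (fun y => f0 (scons t y))) J0.
have {1}-> : x = scons (x ord0 ord0) (rsubmx (x : 'rV[R]_(1 + N))).
  apply/rowP => i; case: (@split_ordP 1 N i) => j ->; last by rewrite sconsS mxE.
  by rewrite (ord1 j) scons0; congr (x _ _); exact: val_inj.
apply: (IH _ (slice_csupp _ fL) _ (J0t _)) => y; exact: f0.
Qed.

(** A derivative in the first variable integrates to 0 by the fundamental theorem of calculus; for
    the other variables the inner integral is already 0 by induction. *)
Lemma iterated_integral_pd N L (F : 'rV[R]_N -> R) a : 0 <= L -> csupp L F ->
  (forall x a, derivable F x (delta_mx ord0 a)) -> (forall a, continuous (pd a F)) ->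
  iterated_integral (pd a F) = 0.
Proof.
move=> L0; elim: N F a => [F [] //|N IH F a FL Fd Fc].
case: (@split_ordP 1 N a) => j ->.
  rewrite (ord1 j) /=.
  apply: (integral_derivative (slice_integral_csupp1
    (iterated_integral_linear_bounded N) L0 FL)).
    exact: (slice_integral_csupp1 (iterated_integral_linear_bounded N) L0
      (csupp_pd FL (Fc _))).1.
  by move=> t; apply: (slice_derivative _ (iterated_integral_linear_bounded N) L0 FL).
have Ed t y b : is_derive y (delta_mx ord0 b) (fun y => F (scons t y))
    (pd (rshift 1 b) F (scons t y)).
  have := derivableP (Fd (scons t y) (rshift 1 b)) => /is_deriveE H.
  apply: (is_deriveE _ y _ _).2; apply: cvg_trans H; apply: near_eq_cvg; near=> h.
  by rewrite [h *: _ + scons _ _]addrC scons_shiftS [_ + y]addrC.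
have E t b : pd b (fun y => F (scons t y)) = (fun y => pd (rshift 1 b) F (scons t y)).
  by apply/funext => y; exact: is_derive_pd (Ed t y b).
rewrite /= (_ : (fun t => _) = fun=> 0) ?[X in Rintegral _ _ X](_ : _ = cst 0) //.
  by rewrite Rintegral_cst // mul0r.
apply/funext => t.
rewrite -[RHS](IH (fun y => F (scons t y)) j (slice_csupp t FL)) ?E //.
by move=> b; rewrite E; exact: (slice_csupp t (csupp_pd FL (Fc _))).1.
Unshelve. all: by end_near. Qed.

End IteratedIntegral.

(** * Unitary frames on a Kaehler manifold *)

Local Opaque smooth_on pd.

Section ConjugateMatrices.
Variable R : realType.

Lemma conjmxK p q (A : 'M[R[i]]_(p, q)) : conjmx (conjmx A) = A.
Proof. by apply/matrixP => i j; rewrite !mxE conjCK. Qed.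

Lemma conjmx_adj p q (A : 'M[R[i]]_(p, q)) : conjmx (adj A) = A^T.
Proof. by apply/matrixP => i j; rewrite !mxE conjCK. Qed.

Lemma conjmxM p q r (A : 'M[R[i]]_(p, q)) (B : 'M[R[i]]_(q, r)) :
  conjmx (A *m B) = conjmx A *m conjmx B.
Proof. exact: map_mxM. Qed.

Lemma conjmx_cplx p q (A : 'M[R]_(p, q)) : conjmx (cplx A) = cplx A.
Proof.
by apply/matrixP => i j; rewrite !mxE; apply: complexP; rewrite ?reJ ?imJ //= oppr0.
Qed.

Lemma conjmxZ p q a (A : 'M[R[i]]_(p, q)) : conjmx (a *: A) = Num.conj a *: conjmx A.
Proof. exact: map_mxZ. Qed.

Lemma conjmx_sum p q (J : Type) (s : seq J) (P : pred J) (F : J -> 'M[R[i]]_(p, q)) :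
  conjmx (\sum_(j <- s | P j) F j) = \sum_(j <- s | P j) conjmx (F j).
Proof. exact: raddf_sum. Qed.

End ConjugateMatrices.

Section DirectionalDerivatives.
Variables (R : realType) (N : nat).
Local Notation E := 'rV[R]_N.
Local Notation C := R[i].
Implicit Types (X Y : 'rV[C]_N) (x : E).

(** [pd_cmx] is total; the property says that its values at x are genuine partial derivatives. *)
Definition diff_at p q (F : E -> 'M[C]_(p, q)) x :=
  forall a, dM (delta_mx ord0 a) F x (pd_cmx a F x).

Definition dirD p q X (F : E -> 'M[C]_(p, q)) x : 'M[C]_(p, q) :=
  \sum_a X ord0 a *: pd_cmx a F x.

Lemma dirDE p q X (F : E -> 'M[C]_(p, q)) x (L : 'I_N -> 'M[C]_(p, q)) :
  (forall a, dM (delta_mx ord0 a) F x (L a)) -> dirD X F x = \sum_a X ord0 a *: L a.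
Proof. by move=> FL; apply: eq_bigr => a _; rewrite (dM_pd_cmx (FL a)). Qed.

Lemma dM_diff_at p q (F : E -> 'M[C]_(p, q)) x (L : 'I_N -> 'M[C]_(p, q)) :
  (forall a, dM (delta_mx ord0 a) F x (L a)) -> diff_at F x.
Proof. by move=> FL a; rewrite (dM_pd_cmx (FL a)). Qed.

Lemma smooth_diff_at p q U (F : E -> 'M[C]_(p, q)) x :
  smooth_cmx_on U F -> U x -> diff_at F x.
Proof. by move=> Fs Ux a; exact: smooth_cmx_dM Fs Ux. Qed.

Lemma dirD_ext p q U X (F G : E -> 'M[C]_(p, q)) x : open U ->
  (forall y, U y -> F y = G y) -> U x -> dirD X F x = dirD X G x.
Proof. by move=> Uo FG Ux; apply: eq_bigr => a _; rewrite (pd_cmx_ext a Uo FG Ux). Qed.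

Lemma dirD_mul p q r X (F : E -> 'M[C]_(p, q)) (G : E -> 'M[C]_(q, r)) x :
  diff_at F x -> diff_at G x ->
  dirD X (fun y => F y *m G y) x = dirD X F x *m G x + F x *m dirD X G x.
Proof.
move=> Fd Gd; rewrite (dirDE _ (fun a => dM_mul (Fd a) (Gd a))).
rewrite mulmx_suml mulmx_sumr -big_split; apply: eq_bigr => a _ /=.
by rewrite scalerDr scalemxAl -scalemxAr.
Qed.

Lemma dirD_tr p q X (F : E -> 'M[C]_(p, q)) x : diff_at F x ->
  dirD X (fun y => (F y)^T) x = (dirD X F x)^T.
Proof.
move=> Fd; rewrite (dirDE _ (fun a => dM_tr (Fd a))) raddf_sum.
by apply: eq_bigr => a _; rewrite /= linearZ.
Qed.

Lemma dirD_conj p q X (F : E -> 'M[C]_(p, q)) x : diff_at F x ->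
  dirD X (fun y => conjmx (F y)) x = conjmx (dirD (conjmx X) F x).
Proof.
move=> Fd; rewrite (dirDE _ (fun a => dM_conj (Fd a))) conjmx_sum.
by apply: eq_bigr => a _; rewrite conjmxZ mxE conjCK.
Qed.

Lemma dirD_adj p q X (F : E -> 'M[C]_(p, q)) x : diff_at F x ->
  dirD X (fun y => adj (F y)) x = adj (dirD (conjmx X) F x).
Proof.
move=> Fd; have Fc : diff_at (fun y => conjmx (F y)) x.
  exact: (dM_diff_at (fun a => dM_conj (Fd a))).
by transitivity (dirD X (fun y => conjmx (F y)) x)^T; [exact: dirD_tr Fc|rewrite dirD_conj].
Qed.

Lemma dirD_cst p q X (A : 'M[C]_(p, q)) x : dirD X (fun=> A) x = 0.
Proof.
by rewrite (dirDE _ (fun a => dM_cst _ A x)) big1 // => a _; rewrite scaler0.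
Qed.

Lemma dirD_mulC p q r X (A : 'M[C]_(q, r)) (F : E -> 'M[C]_(p, q)) x : diff_at F x ->
  dirD X (fun y => F y *m A) x = dirD X F x *m A.
Proof.
move=> Fd; rewrite (dirDE _ (fun a => dM_mulr A (Fd a))) mulmx_suml.
by apply: eq_bigr => a _; rewrite scalemxAl.
Qed.

Lemma dirD_Cmul p q r X (A : 'M[C]_(p, q)) (F : E -> 'M[C]_(q, r)) x : diff_at F x ->
  dirD X (fun y => A *m F y) x = A *m dirD X F x.
Proof.
move=> Fd; rewrite (dirDE _ (fun a => dM_mull A (Fd a))) mulmx_sumr.
by apply: eq_bigr => a _; rewrite scalemxAr.
Qed.

Lemma dirD_vecZ p q c X (F : E -> 'M[C]_(p, q)) x : dirD (c *: X) F x = c *: dirD X F x.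
Proof.
by rewrite /dirD scaler_sumr; apply: eq_bigr => a _; rewrite mxE scalerA.
Qed.

Lemma dirD_vecD p q X Y (F : E -> 'M[C]_(p, q)) x :
  dirD (X + Y) F x = dirD X F x + dirD Y F x.
Proof.
by rewrite /dirD -big_split; apply: eq_bigr => a _; rewrite mxE scalerDl.
Qed.

Lemma diff_at_mul p q r (F : E -> 'M[C]_(p, q)) (G : E -> 'M[C]_(q, r)) x :
  diff_at F x -> diff_at G x -> diff_at (fun y => F y *m G y) x.
Proof. by move=> Fd Gd; exact: (dM_diff_at (fun a => dM_mul (Fd a) (Gd a))). Qed.

Lemma diff_at_adj p q (F : E -> 'M[C]_(p, q)) x : diff_at F x -> diff_at (fun y => adj (F y)) x.
Proof. by move=> Fd; exact: (dM_diff_at (fun a => dM_tr (dM_conj (Fd a)))). Qed.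

End DirectionalDerivatives.

Section Types.
Variables (R : realType) (m : nat).
Local Notation C := R[i].
Local Notation im := (Complex 0 1 : C).
Local Notation J := (cplx (stdJ R m)).

Definition type10 p (A : 'M[C]_(p, m + m)) := A *m J = im *: A.
Definition type01 p (A : 'M[C]_(p, m + m)) := A *m J = - im *: A.

Lemma type10_conj p (A : 'M[C]_(p, m + m)) : type10 A -> type01 (conjmx A).
Proof.
rewrite /type10 /type01 -{2}[J]conjmx_cplx -conjmxM => ->.
by rewrite conjmxZ conj_im.
Qed.

Lemma opp_eq0 (V : lmodType C) (v : V) : v = - v -> v = 0.
Proof.
move=> /eqP; rewrite -subr_eq0 opprK -mulr2n -scaler_nat scaler_eq0 pnatr_eq0.
by move=> /eqP.
Qed.

End Types.

Section Frames.
Variables (R : realType) (m : nat) (M : topologicalType) (K : kahler R m M).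
Variables (al : local_frame K).
Local Notation C := R[i].
Local Notation im := (Complex 0 1 : C).
Local Notation J := (cplx (stdJ R m)).
Local Notation c := (lfr_idx al).
Local Notation U := (lfr_dom al).
Local Notation E := (lfr_mx al).
Local Notation G := (fun x => cplx (kmet (lfr_idx al) x)).
Implicit Types (x : 'rV[R]_(m + m)) (X Y Z : 'rV[C]_(m + m)) (a b : 'I_(m + m)).

Let Uo : open U := @lfr_open _ _ _ _ al.

Lemma met_tr x : kcod c x -> (G x)^T = G x.
Proof. by move=> cx; rewrite /cplx map_trmx kmet_sym. Qed.

Lemma met_adj x : kcod c x -> adj (G x) = G x.
Proof. by move=> cx; rewrite /adj conjmx_cplx met_tr. Qed.

Lemma met_herm x : kcod c x -> J *m G x *m J^T = G x.
Proof. by move=> cx; rewrite /cplx map_trmx -!map_mxM kmet_herm. Qed.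

Lemma met_smooth : smooth_cmx_on U G.
Proof.
apply: (smooth_cmx_sub (@lfr_sub _ _ _ _ al)).
apply: smooth_cplx; first exact: kcod_open.
exact: kmet_smooth.
Qed.

(** For X and Y of type (1,0), g X Y = g (J X) (J Y) = i i g X Y = - g X Y. *)
Lemma type10_isotropic p q x (A : 'M[C]_(p, m + m)) (B : 'M[C]_(q, m + m)) :
  kcod c x -> type10 A -> type10 B -> A *m G x *m B^T = 0.
Proof.
move=> cx A1 B1; apply: opp_eq0; rewrite -{1}(met_herm cx) !mulmxA A1.
rewrite -mulmxA -trmx_mul B1 linearZ /= -!scalemxAl -scalemxAr scalerA im_sqr.
by rewrite scaleN1r.
Qed.

Lemma frame10 x : U x -> type10 (E x).
Proof. exact: lfr_type10. Qed.

Lemma frameG x : U x -> E x *m G x *m adj (E x) = 1%:M.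
Proof. exact: lfr_unitary. Qed.

Definition full_frame x : 'M[C]_(m + m) := col_mx (E x) (conjmx (E x)).

Lemma adj_col p q r (A : 'M[C]_(p, r)) (B : 'M[C]_(q, r)) :
  adj (col_mx A B) = row_mx (adj A) (adj B).
Proof. by rewrite /adj /Defs.conjmx map_col_mx tr_col_mx. Qed.

Lemma full_frameG x : U x -> full_frame x *m (G x *m adj (full_frame x)) = 1%:M.
Proof.
move=> Ux; have cx := lfr_sub Ux; rewrite mulmxA /full_frame adj_col mul_col_mx mul_col_row.
have T : E x *m G x *m (E x)^T = 0 by apply: type10_isotropic => //; exact: frame10.
have -> : adj (conjmx (E x)) = (E x)^T by rewrite /adj conjmxK.
rewrite frameG // T [in RHS]scalar_mx_block; congr block_mx.
- have := congr1 (@Defs.conjmx R m m) T; rewrite !conjmxM conjmx_cplx.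
  by rewrite -[conjmx (_^T)]map_trmx /Defs.conjmx map_mx0.
- have := congr1 (@Defs.conjmx R m m) (frameG Ux); rewrite !conjmxM conjmx_cplx.
  by rewrite conjmx_adj /Defs.conjmx map_mx1.
Qed.

(** The full frame is square, so the right inverse given by unitarity is also a left inverse. *)
Lemma full_frame_completeness x : U x ->
  G x *m (adj (E x) *m E x + (E x)^T *m conjmx (E x)) = 1%:M.
Proof.
move=> /full_frameG/mulmx1C; rewrite -mulmxA adj_col mul_row_col.
by rewrite {2}/adj conjmxK.
Qed.

Lemma frame_decomposition p x (A : 'M[C]_(p, m + m)) : U x ->
  A = A *m G x *m adj (E x) *m E x + A *m G x *m (E x)^T *m conjmx (E x).
Proof.
move=> Ux; rewrite -{1}[A]mulmx1 -(full_frame_completeness Ux).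
by rewrite !mulmxDr !mulmxA.
Qed.

Lemma type10_frame p x (A : 'M[C]_(p, m + m)) : U x -> type10 A ->
  A = A *m G x *m adj (E x) *m E x.
Proof.
move=> Ux A1; rewrite {1}(frame_decomposition A Ux).
by rewrite (type10_isotropic (lfr_sub Ux) A1 (frame10 Ux)) mul0mx addr0.
Qed.

Definition christ a x : 'M[C]_(m + m) := cplx (\matrix_(b, e) christoffel c a b e x).
(** For Y with constant coefficients, nabla_X Y is Y times this matrix. *)
Definition christX X x : 'M[C]_(m + m) := \sum_a X ord0 a *: christ a x.

Lemma connE X x : conn al X x = ((dirD X E x + E x *m christX X x) *m G x *m adj (E x))^T.
Proof.
apply/matrixP => k l; rewrite [RHS]mxE mxE /cmet.
have -> : levi_civita c X (eps al l) x = row l (dirD X E x + E x *m christX X x).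
  rewrite /levi_civita raddfD /= /dirD /christX mulmx_sumr !raddf_sum -big_split.
  apply: eq_bigr => a _ /=; rewrite linearZ /= -scalemxAr linearZ /= -scalerDr; congr (_ *: _).
  congr (_ + _); apply/rowP => e; rewrite !mxE.
    by congr Complex; congr (pd a _ x); apply/funext => y; rewrite mxE.
  by apply: eq_bigr => b _; rewrite !mxE.
rewrite -!row_mul [in RHS]mxE !mxE; apply: eq_bigr => e _; rewrite !mxE.
by congr (_ * _); rewrite !mxE.
Qed.

Lemma conn_linear k X Y x : conn al (k *: X + Y) x = k *: conn al X x + conn al Y x.
Proof.
rewrite !connE; have -> : christX (k *: X + Y) x = k *: christX X x + christX Y x.
  rewrite /christX scaler_sumr -big_split; apply: eq_bigr => a _ /=.
  by rewrite !mxE scalerDl scalerA.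
rewrite dirD_vecD dirD_vecZ mulmxDr -scalemxAr addrACA -scalerDr.
move: (dirD X E x + _) (dirD Y E x + _) => A B.
by rewrite mulmxDl -scalemxAl mulmxDl -scalemxAl linearP.
Qed.

Lemma pd_cmx_cplx p q i (F : 'rV[R]_(m + m) -> 'M[R]_(p, q)) x j k :
  pd_cmx i (fun y => cplx (F y)) x j k = real_complex R (pd i (fun y => F y j k) x).
Proof.
rewrite mxE; apply: complexP => /=.
  by congr (pd i _ x); apply/funext => y; rewrite mxE.
under eq_fun do rewrite mxE /=.
exact: pd_cst.
Qed.

Lemma pd_cmxE p q i (F : 'rV[R]_(m + m) -> 'M[C]_(p, q)) x j k : pd_cmx i F x j k =
  Complex (pd i (fun y => complex.Re (F y j k)) x) (pd i (fun y => complex.Im (F y j k)) x).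
Proof. by rewrite mxE. Qed.

Local Opaque pd_cmx.

Lemma real_sum3 (p q r : R) : p + q + r = 0 ->
  real_complex R p + real_complex R q + real_complex R r = 0.
Proof. by move=> H; rewrite -!rmorphD /= H. Qed.

Definition trilin (F : 'rV[R]_(m + m) -> 'M[C]_(m + m)) x X Y Z : C :=
  (Y *m dirD X F x *m Z^T) ord0 ord0.

Lemma trilinE F x X Y Z : trilin F x X Y Z =
  \sum_a \sum_b \sum_e X ord0 a * Y ord0 b * Z ord0 e * pd_cmx a F x b e.
Proof.
rewrite /trilin /dirD mulmx_sumr mulmx_suml summxE; apply: eq_bigr => a _.
rewrite -scalemxAr -scalemxAl mxE -mulmxA mxE mulr_sumr; apply: eq_bigr => b _.
rewrite mxE !mulr_sumr; apply: eq_bigr => e _; rewrite [Z^T _ _]mxE; ring.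
Qed.

(** The cyclic permutations are expanded over the indices of X, Y, Z in this fixed order, so that
    identities between them can be checked coefficient by coefficient. *)
Lemma trilinE1 F x X Y Z : trilin F x Y Z X =
  \sum_a \sum_b \sum_e X ord0 a * Y ord0 b * Z ord0 e * pd_cmx b F x e a.
Proof.
rewrite trilinE exchange_big /=; under eq_bigr do rewrite exchange_big /=.
rewrite exchange_big; apply: eq_bigr => a _; rewrite exchange_big.
by do 2!(apply: eq_bigr => ? _); ring.
Qed.

Lemma trilinE2 F x X Y Z : trilin F x Z X Y =
  \sum_a \sum_b \sum_e X ord0 a * Y ord0 b * Z ord0 e * pd_cmx e F x a b.
Proof.
rewrite trilinE exchange_big; apply: eq_bigr => a _; rewrite exchange_big.
by do 2!(apply: eq_bigr => ? _); ring.
Qed.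

Lemma trilinZ2 F x p X Y Z : trilin F x X (p *: Y) Z = p * trilin F x X Y Z.
Proof. by rewrite /trilin -!scalemxAl mxE. Qed.

Lemma trilinZ3 F x p X Y Z : trilin F x X Y (p *: Z) = p * trilin F x X Y Z.
Proof. by rewrite /trilin linearZ -scalemxAr mxE. Qed.

Let Gs : smooth_cmx_on U G := met_smooth.
Let Gd x : U x -> diff_at G x. Proof. exact: smooth_diff_at. Qed.

Lemma dmet_herm x X Y Z : U x -> trilin G x X (Y *m J) (Z *m J) = trilin G x X Y Z.
Proof.
move=> Ux; rewrite /trilin trmx_mul !mulmxA; congr ((_ *m _) _ _).
rewrite -!mulmxA; congr (_ *m _); rewrite mulmxA.
rewrite -(dirD_Cmul _ _ (Gd Ux)) -dirD_mulC.
  by apply: dirD_ext Uo _ Ux => y Uy; exact: met_herm (lfr_sub Uy).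
exact: (dM_diff_at (fun a => dM_mull J (Gd Ux a))).
Qed.

(** The three terms are the cyclic sum for d omega (X, Y, Z), where omega = g (J . , .) and X, Y, Z
    have constant coefficients. *)
Lemma dmet_closed x X Y Z : U x ->
  trilin G x X (Y *m J) Z + trilin G x Y (Z *m J) X + trilin G x Z (X *m J) Y = 0.
Proof.
move=> Ux; pose F y := J *m G y.
have FE V W T : trilin G x V (W *m J) T = trilin F x V W T.
  by rewrite /trilin /F (dirD_Cmul _ _ (Gd Ux)) !mulmxA.
rewrite !FE (trilinE F x X) (trilinE1 F x X) (trilinE2 F x X) -!big_split.
apply: big1 => a _; rewrite -!big_split; apply: big1 => b _.
rewrite -!big_split; apply: big1 => e _ /=; rewrite -!mulrDr.
have E1 : F = (fun y => cplx (stdJ R m *m kmet c y)).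
  by apply/funext => y; rewrite /F /cplx map_mxM.
have H i j k := pd_cmx_cplx i (fun y => stdJ R m *m kmet c y) x j k.
rewrite E1 (H a b e) (H b e a) (H e a b).
exact: etrans (congr1 _ (real_sum3 (@kform_closed _ _ _ K c x a b e (lfr_sub Ux)))) (mulr0 _).
Qed.

Definition lowered x X Y Z : C := (Y *m christX X x *m G x *m Z^T) ord0 ord0.

Lemma met_unit x : U x -> G x \in unitmx.
Proof. by move=> /full_frame_completeness/mulmx1_unit[]. Qed.

Lemma half_real (a b e : R) : real_complex R (2^-1 * (a + b - e)) =
  2^-1 * (real_complex R a + real_complex R b - real_complex R e).
Proof. by rewrite rmorphM fmorphV rmorph_nat rmorphB rmorphD. Qed.

Lemma christ_lower a b e x : U x -> (christ a x *m G x) b e =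
  2^-1 * (real_complex R (pd a (fun y => kmet c y e b) x) +
    real_complex R (pd b (fun y => kmet c y e a) x) -
    real_complex R (pd e (fun y => kmet c y a b) x)).
Proof.
rewrite -half_real => Ux; have gu : kmet c x \in unitmx.
  by have := met_unit Ux; rewrite /cplx map_unitmx.
rewrite /christ /cplx -map_mxM mxE; congr (real_complex R _).
set D := fun f => pd a (fun y => kmet c y f b) x + pd b (fun y => kmet c y f a) x
  - pd f (fun y => kmet c y a b) x.
transitivity (\sum_f \sum_k 2^-1 * (invmx (kmet c x) k f * D f * kmet c x k e)).
  rewrite mxE exchange_big; apply: eq_bigr => k _; rewrite mxE /christoffel /=.
  by rewrite mulr_sumr mulr_suml; apply: eq_bigr => f _; rewrite !mulrA.
transitivity (\sum_f 2^-1 * D f * ((kmet c x)^T *m invmx (kmet c x)) e f).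
  apply: eq_bigr => f _; rewrite mxE mulr_sumr; apply: eq_bigr => k _.
  by rewrite mxE; ring.
rewrite kmet_sym ?mulmxV //; last exact: lfr_sub.
rewrite (bigD1 e isT) /= mxE eqxx mulr1 big1 ?addr0 => [//|f fe].
by rewrite mxE eq_sym (negbTE fe) mulr0.
Qed.

(** Koszul's formula for vector fields with constant coefficients, whose brackets vanish, extended
    to complex vectors. *)
Lemma koszul x X Y Z : U x -> lowered x X Y Z =
  2^-1 * (trilin G x X Y Z + trilin G x Y Z X - trilin G x Z X Y).
Proof.
move=> Ux; rewrite (trilinE G x X) (trilinE1 G x X) (trilinE2 G x X).
rewrite -big_split -sumrB mulr_sumr /lowered /christX mulmx_sumr !mulmx_suml summxE.
apply: eq_bigr => a _; rewrite -scalemxAr -!scalemxAl mxE -[Y *m _ *m _]mulmxA -mulmxA mxE.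
rewrite -big_split -sumrB !mulr_sumr; apply: eq_bigr => b _.
rewrite mxE -big_split -sumrB !mulr_sumr; apply: eq_bigr => e _ /=.
rewrite [Z^T _ _]mxE christ_lower //.
have P i j k := pd_cmx_cplx i (kmet c) x j k.
rewrite (P a b e) (P b e a) (P e a b).
have -> : pd a (fun y => kmet c y e b) x = pd a (fun y => kmet c y b e) x.
  apply: pd_ext Uo _ Ux => y Uy; by rewrite -{1}(kmet_sym (lfr_sub Uy)) mxE.
by move: (real_complex R _) (real_complex R _) (real_complex R _) => u v w; ring.
Qed.

(** The Kaehler condition enters here. In Koszul's formula the derivative of g on two vectors of the
    same type vanishes by hermitian symmetry, and the two other terms cancel because the Kaehler
    form is closed. Testing against Z of either type gives the result. *)
Lemma christX_mixed x p X (A : 'M[C]_(p, m + m)) : U x -> type01 X -> type10 A ->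
  A *m christX X x = 0.
Proof.
move=> Ux X01 A10; have two0 : (2 : C) != 0 by rewrite pnatr_eq0.
have row10 q (B : 'M[C]_(q, m + m)) r (D : 'M[C]_(r, q)) : type10 B -> type10 (D *m B).
  by rewrite /type10 -mulmxA => ->; rewrite scalemxAr.
have row01 q (B : 'M[C]_(q, m + m)) r (D : 'M[C]_(r, q)) : type01 B -> type01 (D *m B).
  by rewrite /type01 -mulmxA => ->; rewrite scalemxAr.
(* The condition k l = -1 with k, l among i and - i says that the two arguments have the same
   type. *)
have tn (V W T : 'rV[C]_(m + m)) k l : W *m J = k *: W -> T *m J = l *: T ->
    k * l = -1 -> trilin G x V W T = 0.
  move=> WJ TJ kl; apply: (@opp_eq0 R C^o); rewrite -{1}(dmet_herm _ _ _ Ux) WJ TJ.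
  by rewrite trilinZ2 trilinZ3 mulrA kl mulN1r.
have NN : - im * - im = -1 by rewrite mulrNN im_sqr.
have Z10 (Y Z : 'rV[C]_(m + m)) : type10 Y -> type10 Z -> lowered x X Y Z = 0.
  move=> Y10 Z1; rewrite koszul // (tn X Y Z _ _ Y10 Z1 (im_sqr R)) add0r.
  have := dmet_closed X Y Z Ux; rewrite Y10 Z1 X01 !trilinZ2.
  rewrite (tn X Y Z _ _ Y10 Z1 (im_sqr R)) mulr0 add0r mulNr -mulrBr => /eqP.
  by rewrite mulf_eq0 (negbTE (im_neq0 R)) => /eqP ->; rewrite mulr0.
have Z01 (Y Z : 'rV[C]_(m + m)) : type10 Y -> type01 Z -> lowered x X Y Z = 0.
  move=> Y10 Z1; rewrite koszul // (tn Y Z X _ _ Z1 X01 NN) addr0.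
  have := dmet_closed X Y Z Ux; rewrite Y10 Z1 X01 !trilinZ2.
  rewrite (tn Y Z X _ _ Z1 X01 NN) mulr0 addr0 mulNr -mulrBr => /eqP.
  by rewrite mulf_eq0 (negbTE (im_neq0 R)) => /eqP ->; rewrite mulr0.
apply/row_matrixP => k; rewrite row0 row_mul; set Y := row k A.
have Y10 : type10 Y by rewrite /Y rowE; exact: row10.
have H Z : lowered x X Y Z = 0.
  rewrite (frame_decomposition Z Ux) /lowered raddfD /= mulmxDr mxE.
  rewrite [X in X + _]Z10 ?add0r //; last exact: row10 (frame10 Ux).
  exact: Z01 (row01 _ _ _ _ (type10_conj (frame10 Ux))).
have : Y *m christX X x *m G x = 0.
  apply/rowP => j; rewrite [RHS]mxE -[RHS](H (delta_mx ord0 j)) /lowered trmx_delta.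
  by rewrite -colE !mxE.
by move/(congr1 (mulmx^~ (invmx (G x)))); rewrite mulmxK ?mul0mx // met_unit.
Qed.

(* Chern's formula: along (0,1) vectors the connection is determined by the
   derivatives of the frame. *)
Lemma chern x X : U x -> type01 X -> dirD X E x = (conn al X x)^T *m E x.
Proof.
move=> Ux X01; rewrite connE trmxK (christX_mixed Ux X01 (frame10 Ux)) addr0.
apply: type10_frame => //; rewrite /type10.
have Ed := smooth_diff_at (@lfr_smooth _ _ _ _ al) Ux.
rewrite -(dirD_mulC _ _ Ed) -mul_mx_scalar -[in RHS](dirD_mulC _ _ Ed).
by apply: dirD_ext Uo _ Ux => y Uy; rewrite (frame10 Uy) mul_mx_scalar.
Qed.

Lemma christX_tr x X : (christX X x)^T = adj (christX (conjmx X) x).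
Proof.
rewrite /christX adj_sum raddf_sum; apply: eq_bigr => a _.
by rewrite /= linearZ adjZ mxE conjCK /adj /christ conjmx_cplx.
Qed.

(** Metric compatibility: in the symmetrization of [christ_lower] only the derivative of g along d_a
    survives. *)
Lemma met_compat x X : U x -> dirD X G x = christX X x *m G x + G x *m (christX X x)^T.
Proof.
move=> Ux; have cx := lfr_sub Ux; rewrite /dirD /christX raddf_sum mulmx_suml mulmx_sumr.
rewrite -big_split; apply: eq_bigr => a _ /=.
rewrite linearZ /= -scalemxAl -scalemxAr -scalerDr; congr (_ *: _).
rewrite -[X in _ + X]trmxK trmx_mul trmxK (met_tr cx).
apply/matrixP => b e; rewrite [RHS]mxE [X in _ + X]mxE !christ_lower //.
have P i j k := pd_cmx_cplx i (kmet c) x j k.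
have S i j k : pd i (fun y => kmet c y j k) x = pd i (fun y => kmet c y k j) x.
  by apply: pd_ext Uo _ Ux => y Uy; rewrite -{1}(kmet_sym (lfr_sub Uy)) mxE.
rewrite (P a b e) (S a e b) (S b e a) (S e b a).
move: (pd a _ x) (pd b _ x) (pd e _ x) => p q r.
by apply: complexP => /=; rewrite ?addr0 //; field.
Qed.

(** This is the derivative of E G E^* = 1. For real X it says that the connection form takes values
    in u(m). *)
Lemma conn_adj x X : U x -> conn al X x = - adj (conn al (conjmx X) x).
Proof.
move=> Ux; have Ed := smooth_diff_at (@lfr_smooth _ _ _ _ al) Ux.
have H : dirD X (fun y => E y *m G y *m adj (E y)) x = 0.
  by rewrite (dirD_ext X Uo (G := fun=> 1%:M) _ Ux) ?dirD_cst // => y; exact: frameG.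
rewrite (dirD_mul X (diff_at_mul Ed (Gd Ux)) (diff_at_adj Ed)) in H.
rewrite (dirD_mul X Ed (Gd Ux)) (dirD_adj X Ed) (met_compat X Ux) in H.
apply: trmx_inj; rewrite !connE trmxK linearN /=.
set A := dirD X E x + _; set B := dirD (conjmx X) E x + _.
have -> : (adj (B *m G x *m adj (E x))^T)^T = E x *m G x *m adj B.
  rewrite -[in RHS](met_adj (lfr_sub Ux)) -[E x in RHS]adjK -!adjM mulmxA.
  by apply/matrixP => i j; rewrite !mxE.
apply/eqP; rewrite -addr_eq0; apply/eqP; rewrite -[RHS]H /A /B adjD adjM -christX_tr.
rewrite !(mulmxDl, mulmxDr) !mulmxA -!addrA; congr (_ + (_ + _)); exact: addrC.
Qed.

(** The Riemannian divergence d_a X^a + X^a Gamma^b_ab; [density_div] ties it to the volume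
    density. *)
Definition cdiv (X : 'rV[R]_(m + m) -> 'rV[C]_(m + m)) x : C :=
  \sum_a pd_cmx a X x ord0 a + \sum_a X x ord0 a * \tr (christ a x).

Lemma christ_sym x a b e : U x -> christ a x b e = christ b x a e.
Proof.
move=> Ux; rewrite !mxE; congr (real_complex R _); rewrite /christoffel; congr (_ * _).
apply: eq_bigr => f _; rewrite [X in _ * (X - _)]addrC; congr (_ * (_ - _)).
by apply: pd_ext Uo _ Ux => y Uy; rewrite -{1}(kmet_sym (lfr_sub Uy)) mxE.
Qed.

(** The divergence is the trace of Y |-> nabla_Y X, evaluated in the full frame by completeness. *)
Lemma cdiv_frame x (X : 'rV[R]_(m + m) -> 'rV[C]_(m + m)) : U x ->
  let D Y := dirD Y X x + X x *m christX Y x in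
  cdiv X x = \sum_l ((D (eps al l x) *m G x *m adj (eps al l x)) ord0 ord0 +
                     (D (epsbar al l x) *m G x *m (eps al l x)^T) ord0 ord0).
Proof.
move=> Ux D; pose N : 'M[C]_(m + m) := \matrix_a (pd_cmx a X x + X x *m christ a x).
have -> : cdiv X x = \tr N.
  rewrite /cdiv /mxtrace -[RHS]/(\sum_a N a a).
  under [RHS]eq_bigr do rewrite mxE mxE [X in _ + X]mxE.
  rewrite big_split; congr (_ + _) => /=.
  rewrite exchange_big; apply: eq_bigr => a _.
  by rewrite /mxtrace mulr_sumr; apply: eq_bigr => b _; rewrite (christ_sym _ _ _ Ux).
have NE Y : Y *m N = D Y.
  rewrite /D /dirD /christX mulmx_sumr -big_split.
  rewrite [Y *m N](_ : _ = \sum_a Y ord0 a *: row a N).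
    by apply: eq_bigr => a _; rewrite rowK /= -scalemxAr scalerDr.
  apply/rowP => j; rewrite summxE mxE; apply: eq_bigr => a _.
  by rewrite [RHS]mxE [row _ _ _ _]mxE.
have tE (A : 'M[C]_(m, m + m)) (B : 'M[C]_(m + m, m)) :
    \tr (N *m G x *m (B *m A)) = \sum_l (row l A *m N *m G x *m col l B) ord0 ord0.
  rewrite mulmxA mxtrace_mulC !mulmxA; apply: eq_bigr => l _.
  by rewrite -!row_mul [RHS]mxE [LHS]mxE [RHS]mxE; apply: eq_bigr => j _; rewrite mxE [col _ _ _ _]mxE.
rewrite -[N]mulmx1 -(full_frame_completeness Ux) mulmxA mulmxDr mxtraceD !tE -big_split.
apply: eq_bigr => l _ /=; rewrite !NE; congr (_ + _).
  by congr ((_ *m _) _ _); apply/matrixP => i j; rewrite !mxE.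
rewrite (_ : row l (conjmx (E x)) = epsbar al l x); last by apply/rowP => j; rewrite !mxE.
by congr ((_ *m _) _ _); apply/matrixP => i j; rewrite !mxE.
Qed.

Lemma smooth_eps k : smooth_cmx_on U (eps al k).
Proof.
move=> i j; rewrite -/(smoothC U (fun x => eps al k x i j)).
have -> : (fun x => eps al k x i j) = fun x => E x k j.
  by apply/funext => x; rewrite mxE.
exact: (@lfr_smooth _ _ _ _ al k j).
Qed.

Lemma dirD_eps k x X : dirD X (eps al k) x = row k (dirD X E x).
Proof.
rewrite /dirD raddf_sum; apply: eq_bigr => a _ /=; rewrite linearZ /=; congr (_ *: _).
apply/rowP => j; rewrite [RHS]mxE !pd_cmxE.
by congr Complex; congr (pd a _ x); apply/funext => y; rewrite mxE.
Qed.

Lemma eps10 k x : U x -> type10 (eps al k x).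
Proof. by move=> Ux; rewrite /type10 /eps -row_mul frame10 // linearZ. Qed.

Lemma epsbar01 k x : U x -> type01 (epsbar al k x).
Proof. by move=> Ux; exact: type10_conj (eps10 k Ux). Qed.

Lemma chern_type10 x X : U x -> type01 X -> type10 (dirD X E x).
Proof. by move=> Ux X01; rewrite (chern Ux X01) /type10 -mulmxA frame10 // scalemxAr. Qed.

(** By Chern's formula the derivative of eps_k along epsbar_l is of type (1,0), so its g-product
    with eps_l vanishes and only the derivatives along eps_l contribute. *)
Lemma cdiv_eps k x : U x -> cdiv (eps al k) x = \sum_l conn al (eps al l x) x l k.
Proof.
move=> Ux; rewrite cdiv_frame //; apply: eq_bigr => l _.
rewrite !dirD_eps (christX_mixed Ux (epsbar01 l Ux) (eps10 k Ux)) addr0.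
rewrite (type10_isotropic (lfr_sub Ux) _ (eps10 l Ux)); last first.
  by rewrite /type10 -row_mul (chern_type10 Ux (epsbar01 l Ux)) linearZ.
rewrite [X in _ + X]mxE addr0 connE [RHS]mxE -row_mul -raddfD -!row_mul.
rewrite [LHS]mxE [LHS]mxE [RHS]mxE; apply: eq_bigr => j _.
by congr (_ * _); rewrite !mxE.
Qed.

Lemma cdiv_conj (X : 'rV[R]_(m + m) -> 'rV[C]_(m + m)) x : diff_at X x ->
  cdiv (fun y => conjmx (X y)) x = Num.conj (cdiv X x).
Proof.
move=> Xd; rewrite /cdiv rmorphD /= !conjC_sum; congr (_ + _); apply: eq_bigr => a _.
  by rewrite (dM_pd_cmx (dM_conj (Xd a))) mxE.
rewrite rmorphM /= mxE; congr (_ * _); rewrite conjC_sum; apply: eq_bigr => b _.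
by rewrite /christ -[in LHS]conjmx_cplx mxE.
Qed.

(* In a unitary frame the bracket is [nabla_X Y - nabla_Y X], and the mixed terms are
   given by Chern's formula. *)
Lemma bracket_frame k l x : U x -> bracket (eps al k) (epsbar al l) x =
  \sum_j Num.conj (conn al (epsbar al k x) x j l) *: epsbar al j x
  - \sum_j conn al (epsbar al l x) x j k *: eps al j x.
Proof.
move=> Ux; have Ed := smooth_diff_at (@smooth_eps l) Ux.
have -> : bracket (eps al k) (epsbar al l) x =
    dirD (eps al k x) (epsbar al l) x - dirD (epsbar al l x) (eps al k) x.
  by rewrite /bracket /dirD sumrB.
have cE k' l' : dirD (epsbar al l' x) (eps al k') x =
    \sum_j conn al (epsbar al l' x) x j k' *: eps al j x.
  rewrite dirD_eps (chern Ux (epsbar01 l' Ux)) row_mul mulmx_sum_row.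
  by apply: eq_bigr => j _; rewrite !mxE.
rewrite cE; congr (_ - _).
rewrite (dirD_conj (eps al k x) Ed) -/(epsbar al k x) cE conjmx_sum.
by apply: eq_bigr => j _; rewrite conjmxZ.
Qed.

Lemma conn_epsX l x : U x -> conn al (eps al l x) x = - adj (conn al (epsbar al l x) x).
Proof. exact: conn_adj. Qed.

Lemma christ_smooth a : smooth_cmx_on U (christ a).
Proof.
apply: smooth_cplx => // b e.
have ks i j : smooth_on U (fun y => kmet c y i j).
  by apply: (smooth_on_sub (@lfr_sub _ _ _ _ al)); exact: kmet_smooth.
have gis : smooth_mx_on U (fun y => invmx (kmet c y)).
  apply: smooth_invmx => // x Ux; rewrite -unitfE -unitmxE.
  by have := met_unit Ux; rewrite /cplx map_unitmx.
have -> : (fun x => (\matrix_(b, e) christoffel c a b e x) b e) = christoffel c a b e.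
  by apply/funext => x; rewrite mxE.
apply: smooth_mul => //; first exact: smooth_cst.
apply: smooth_sum => [|f _]; first exact: Uo.
exact: (smooth_mul Uo (gis e f) (smooth_sub Uo (smooth_add Uo (smooth_pd a (ks f b))
  (smooth_pd b (ks f a))) (smooth_pd f (ks a b)))).
Qed.

Definition coordvec a : 'rV[C]_(m + m) := delta_mx ord0 a.

Lemma dirD_coord p q (F : 'rV[R]_(m + m) -> 'M[C]_(p, q)) a x :
  dirD (coordvec a) F x = pd_cmx a F x.
Proof.
rewrite /dirD (bigD1 a isT) /= big1 ?addr0 => [|b ba]; first by rewrite mxE !eqxx scale1r.
by rewrite mxE (negbTE ba) andbF scale0r.
Qed.

Lemma conn_smooth a : smooth_cmx_on U (conn al (coordvec a)).
Proof.
have -> : conn al (coordvec a) = fun x =>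
    ((pd_cmx a E x + E x *m christ a x) *m G x *m adj (E x))^T.
  apply/funext => x; rewrite connE dirD_coord; congr (((_ + _ *m _) *m _ *m _)^T).
  rewrite /christX (bigD1 a isT) /= big1 ?addr0 => [|b ba].
    by rewrite mxE !eqxx scale1r.
  by rewrite mxE (negbTE ba) andbF scale0r.
have Es := @lfr_smooth _ _ _ _ al.
apply: smooth_cmx_tr; apply: (smooth_cmx_mul Uo _ (smooth_cmx_tr (smooth_cmx_conj Uo Es))).
apply: (smooth_cmx_mul Uo _ Gs); apply: (smooth_cmx_add Uo (smooth_cmx_pd a Es)).
exact: smooth_cmx_mul Uo Es (christ_smooth a).
Qed.

Lemma conn_coord X x : conn al X x = \sum_a X ord0 a *: conn al (coordvec a) x.
Proof.
have c0 : conn al 0 x = 0.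
  by have := conn_linear (-1) 0 0 x; rewrite scaler0 addr0 scaleN1r addNr.
have cD Y Z : conn al (Y + Z) x = conn al Y x + conn al Z x.
  by have := conn_linear 1 Y Z x; rewrite !scale1r.
rewrite {1}[X]row_sum_delta (big_morph (fun Y => conn al Y x) cD c0).
by apply: eq_bigr => a _; rewrite -[_ *: delta_mx _ _]addr0 conn_linear c0 addr0.
Qed.

(** * Covariant derivative and curvature of the associated bundle in a frame *)

Section LocalBundle.
Variables (d : nat) (V : unitary_rep R m d).
Local Notation pi := (urep_diff V).
Implicit Types (f h : 'rV[R]_(m + m) -> 'cV[C]_d) (v w : 'rV[R]_(m + m) -> 'rV[C]_(m + m)).

Definition theta a x : 'M[C]_d := pi (conn al (coordvec a) x).

Definition covC a f x : 'cV[C]_d := pd_cmx a f x + theta a x *m f x.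

Lemma theta_smooth a : smooth_cmx_on U (theta a).
Proof. exact: smooth_cmx_linear Uo (conn_smooth a). Qed.

Lemma pi_conn X x : pi (conn al X x) = \sum_a X ord0 a *: theta a x.
Proof.
rewrite conn_coord (big_morph pi (raddfD pi) (raddf0 pi)).
by apply: eq_bigr => a _; rewrite urep_diffZ.
Qed.

Lemma covE v f x : cov V al v f x = \sum_a v x ord0 a *: covC a f x.
Proof.
rewrite /cov pi_conn mulmx_suml -big_split; apply: eq_bigr => a _ /=.
by rewrite scalerDr scalemxAl.
Qed.

Lemma cov_dirD v f x : cov V al v f x = dirD (v x) f x + pi (conn al (v x) x) *m f x.
Proof. by []. Qed.

Lemma covC_smooth a f : smooth_cmx_on U f -> smooth_cmx_on U (covC a f).
Proof.
move=> fs; apply: (smooth_cmx_add Uo (smooth_cmx_pd a fs)).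
exact: smooth_cmx_mul Uo (theta_smooth a) fs.
Qed.

Lemma cov_smooth v f : smooth_cmx_on U v -> smooth_cmx_on U f ->
  smooth_cmx_on U (cov V al v f).
Proof.
move=> Xs fs; rewrite (_ : cov V al v f = fun x => \sum_a v x ord0 a *: covC a f x).
  apply: smooth_cmx_sum Uo _ => a _.
  exact: smooth_cmx_scale Uo (Xs ord0 a) (covC_smooth a fs).
by apply/funext => x; rewrite covE.
Qed.

(** The coefficient of d theta + theta /\ theta on d_a, d_b. *)
Definition curvC a b x : 'M[C]_d :=
  pd_cmx a (theta b) x - pd_cmx b (theta a) x + (theta a x *m theta b x - theta b x *m theta a x).

Lemma commutator_algebra (P u ua ub : 'cV[C]_d) (ta tb Ta Tb : 'M[C]_d) :
  P + (Tb *m u + tb *m ua) + ta *m (ub + tb *m u)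
    - (P + (Ta *m u + ta *m ub) + tb *m (ua + ta *m u)) =
  (Tb - Ta + (ta *m tb - tb *m ta)) *m u.
Proof.
rewrite mulmxDl !mulmxBl !mulmxDr !mulmxA.
move: (Tb *m u) (tb *m ua) (ta *m ub) (ta *m tb *m u) (Ta *m u) (tb *m ta *m u) => q1 q2 q3 q4 q5 q6.
by apply/matrixP => i j; rewrite !mxE; ring.
Qed.

Lemma covC_comm a b f x : smooth_cmx_on U f -> U x ->
  covC a (covC b f) x - covC b (covC a f) x = curvC a b x *m f x.
Proof.
move=> fs Ux; have fd := smooth_diff_at fs Ux.
have td e := smooth_diff_at (theta_smooth e) Ux.
have pdd e := smooth_diff_at (smooth_cmx_pd e fs) Ux.
have pdE e e' : pd_cmx e (covC e' f) x =
    pd_cmx e (pd_cmx e' f) x + (pd_cmx e (theta e') x *m f x + theta e' x *m pd_cmx e f x).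
  exact: dM_pd_cmx (dM_add (pdd e' e) (dM_mul (td e' e) (fd e))).
have E1 e g : covC e g x = pd_cmx e g x + theta e x *m g x by [].
rewrite (E1 a (covC b f)) (E1 b (covC a f)) (pdE a b) (pdE b a) (E1 a f) (E1 b f).
rewrite (pd_cmxC a b Uo fs Ux); exact: commutator_algebra.
Qed.

(** The derivatives of the coefficients of v and w cancel against the covariant derivative along the
    bracket, and commutators of [covC] remain. *)
Lemma curv_opE v w f x : diff_at v x -> diff_at w x -> smooth_cmx_on U f -> U x ->
  curv_op V al v w f x =
  \sum_a \sum_b (v x ord0 a * w x ord0 b) *: (curvC a b x *m f x).
Proof.
move=> vd wd fs Ux; have covCd b := smooth_diff_at (covC_smooth b fs) Ux.
have key (v1 w1 : 'rV[R]_(m + m) -> 'rV[C]_(m + m)) : diff_at w1 x ->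
    cov V al v1 (cov V al w1 f) x =
    \sum_a \sum_b (v1 x ord0 a *: (pd_cmx a w1 x ord0 b *: covC b f x +
       w1 x ord0 b *: covC a (covC b f) x)).
  move=> w1d; rewrite covE; apply: eq_bigr => a _; rewrite -scaler_sumr; congr (_ *: _).
  rewrite {1}/covC.
  have -> : pd_cmx a (cov V al w1 f) x =
      \sum_b (pd_cmx a w1 x ord0 b *: covC b f x + w1 x ord0 b *: pd_cmx a (covC b f) x).
    rewrite (_ : cov V al w1 f = fun y => \sum_b w1 y ord0 b *: covC b f y).
      apply: dM_pd_cmx; apply: dM_sum => b _.
      exact: dM_scale (w1d a ord0 b) (covCd b a).
    by apply/funext => y; rewrite covE.
  rewrite covE mulmx_sumr -big_split; apply: eq_bigr => b _ /=.
  by rewrite -addrA -scalemxAr -scalerDr.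
rewrite /curv_op (key _ _ wd) (key _ _ vd) covE.
have -> : \sum_e bracket v w x ord0 e *: covC e f x = \sum_a \sum_b
    (v x ord0 a * pd_cmx a w x ord0 b - w x ord0 a * pd_cmx a v x ord0 b) *: covC b f x.
  rewrite exchange_big; apply: eq_bigr => b _; rewrite -scaler_suml; congr (_ *: _).
  rewrite /bracket summxE; apply: eq_bigr => a _.
  by rewrite !mxE.
rewrite -sumrB -sumrB.
transitivity (\sum_a \sum_b ((v x ord0 a * w x ord0 b) *: covC a (covC b f) x -
    (w x ord0 a * v x ord0 b) *: covC a (covC b f) x)).
  apply: eq_bigr => a _; rewrite -!sumrB; apply: eq_bigr => b _.
  move: (covC a (covC b f) x) (covC b f x) (v x ord0 a) (w x ord0 a) => p q k1 k2.
  move: (v x ord0 b) (w x ord0 b) (pd_cmx a w x ord0 b) (pd_cmx a v x ord0 b) => k3 k4 k5 k6.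
  by apply/matrixP => i j; rewrite !mxE; ring.
under eq_bigr do rewrite sumrB; rewrite sumrB [X in _ - X]exchange_big -sumrB.
apply: eq_bigr => a _; rewrite -sumrB; apply: eq_bigr => b _ /=.
by rewrite -covC_comm // scalerBr [w x _ _ * _]mulrC.
Qed.

Lemma curvE v w x : diff_at v x -> diff_at w x -> U x ->
  curv V al v w x = \sum_a \sum_b (v x ord0 a * w x ord0 b) *: curvC a b x.
Proof.
move=> vd wd Ux; apply/matrixP => i j; rewrite mxE curv_opE //; last exact: smooth_cmx_cst.
rewrite !summxE; apply: eq_bigr => a _; rewrite !summxE; apply: eq_bigr => b _.
by rewrite mxE [RHS]mxE -colE mxE.
Qed.

Lemma curv_op_tensorial v w f x : diff_at v x -> diff_at w x -> smooth_cmx_on U f -> U x ->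
  curv_op V al v w f x = curv V al v w x *m f x.
Proof.
move=> vd wd fs Ux; rewrite curv_opE // curvE // mulmx_suml; apply: eq_bigr => a _.
by rewrite mulmx_suml; apply: eq_bigr => b _; rewrite scalemxAl.
Qed.

End LocalBundle.

End Frames.

(** * The divergence identity *)

Local Opaque smooth_on pd pd_cmx cov conn bracket curv.

Section TripleSums.
Variables (m : nat) (W : zmodType).

Lemma triple_sum_swap (F : 'I_m -> 'I_m -> 'I_m -> W) :
  \sum_k \sum_l \sum_j F k l j = \sum_k \sum_l \sum_j F j l k.
Proof.
under eq_bigr do rewrite exchange_big; rewrite exchange_big.
by apply: eq_bigr => j _; rewrite exchange_big.
Qed.

End TripleSums.

Section BundleAlgebra.
Variables (R : realType) (m d : nat).
Local Notation C := R[i].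
Variables (T : 'I_m -> 'I_m -> 'M[C]_d) (A : 'I_m -> 'M[C]_m) (u : 'I_m -> 'cV[C]_d).

(** In the divergence of the flux, the terms from the first index of T cancel against the divergence
    of the frame. What remains is, up to sign, the contribution of [bracket_frame] to the
    curvature. *)
Lemma connection_terms01 :
  \sum_k \sum_l ((\sum_j (A l j l *: T j k - A l k j *: T l j)) *m u k
     + (- \sum_j A j l j) *: (T l k *m u k)) =
  - \sum_k \sum_l T l k *m (\sum_j A l j k *: u j).
Proof.
transitivity (\sum_k ((\sum_l \sum_j A l j l *: (T j k *m u k)
     - \sum_l \sum_j A j l j *: (T l k *m u k))
     - \sum_l \sum_j A l k j *: (T l j *m u k))).
  apply: eq_bigr => k _; rewrite -!sumrB; apply: eq_bigr => l _.
  rewrite mulmx_suml scaleNr scaler_suml -!sumrB; apply: eq_bigr => j _.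
  by rewrite mulmxBl -!scalemxAl addrAC.
transitivity (- \sum_k \sum_l \sum_j A l k j *: (T l j *m u k)).
  rewrite -sumrN; apply: eq_bigr => k _.
  by rewrite [X in X - _ - _]exchange_big /= subrr sub0r.
rewrite triple_sum_swap; congr (- _); apply: eq_bigr => k _; apply: eq_bigr => l _.
by rewrite mulmx_sumr; apply: eq_bigr => j _; rewrite -scalemxAr.
Qed.

(** The conjugate case: here the terms from the second index of T cancel against the divergence of
    the conjugate frame. *)
Lemma connection_terms10 :
  \sum_k \sum_l ((\sum_j (A k j l *: T j k - A k k j *: T l j)) *m u l
     + (\sum_j A j j k) *: (T l k *m u l)) =
  \sum_k \sum_l T l k *m (\sum_j A k l j *: u j).
Proof.
transitivity (\sum_k \sum_l \sum_j A k j l *: (T j k *m u l)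
     + (\sum_k \sum_l \sum_j A j j k *: (T l k *m u l)
     - \sum_k \sum_l \sum_j A k k j *: (T l j *m u l))).
  rewrite -sumrB -big_split; apply: eq_bigr => k _; rewrite -sumrB -big_split.
  apply: eq_bigr => l _; rewrite mulmx_suml scaler_suml -sumrB -!big_split.
  by apply: eq_bigr => j _ /=; rewrite mulmxBl -!scalemxAl -addrA [X in _ + X]addrC.
rewrite [X in _ + (_ - X)]triple_sum_swap subrr addr0; apply: eq_bigr => k _.
rewrite exchange_big; apply: eq_bigr => l _; rewrite mulmx_sumr.
by apply: eq_bigr => j _; rewrite -scalemxAr.
Qed.

End BundleAlgebra.

Lemma flux_term (R : realType) d (T T' : 'M[R[i]]_d) (a b c e h r s : 'cV[R[i]]_d) :
  adj T = T' ->
  hdot (T *m a) b - hdot (T *m c) e + hdot h (r - s) =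
  hdot a (T' *m b) + hdot h r - (hdot c (T' *m e) + hdot h s).
Proof. by move=> <-; rewrite !hdotMl hdotDr hdotNr opprD addrACA. Qed.

Lemma curvature_terms (R : realType) (m d : nat) (T : 'I_m -> 'I_m -> 'M[R[i]]_d)
    (A B : 'I_m -> 'M[R[i]]_m) (u v : 'I_m -> 'cV[R[i]]_d)
    (D1 D2 F : 'I_m -> 'I_m -> 'cV[R[i]]_d) :
  (forall k l, F k l = D2 k l - D1 k l + (\sum_j A k l j *: v j + \sum_j B l j k *: u j)) ->
  \sum_k \sum_l T l k *m F k l =
  - \sum_k \sum_l ((T l k *m D1 k l
      + ((\sum_j (B l j l *: T j k - B l k j *: T l j)) *m u k
        + (- \sum_j B j l j) *: (T l k *m u k)))
    - (T l k *m D2 k l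
      + ((\sum_j (A k j l *: T j k - A k k j *: T l j)) *m v l
        + (\sum_j A j j k) *: (T l k *m v l)))).
Proof.
move=> FE.
have S01 := connection_terms01 T B u; have S10 := connection_terms10 T A v.
transitivity (\sum_k \sum_l T l k *m D2 k l - \sum_k \sum_l T l k *m D1 k l
   + (\sum_k \sum_l T l k *m (\sum_j A k l j *: v j)
     + \sum_k \sum_l T l k *m (\sum_j B l j k *: u j))).
  rewrite -sumrB -!big_split; apply: eq_bigr => k _ /=.
  rewrite -sumrB -!big_split; apply: eq_bigr => l _ /=.
  by rewrite FE !mulmxDr mulmxN.
rewrite -S10 -[X in _ + (_ + X)]opprK -S01 -!sumrN -!big_split; apply: eq_bigr => k _ /=.
rewrite -!sumrN -!big_split; apply: eq_bigr => l _ /=.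
by rewrite [RHS]opprB [LHS]addrACA -opprD.
Qed.

Section LocalWeitzenboeck.
Variables (R : realType) (m : nat) (M : topologicalType) (K : kahler R m M).
Variables (al : local_frame K) (d : nat) (V : unitary_rep R m d).
Local Notation C := R[i].
Local Notation U := (lfr_dom al).
Local Notation pi := (urep_diff V).
Local Notation D10 k := (cov V al (eps al k)).
Local Notation D01 k := (cov V al (epsbar al k)).
Implicit Types (x : 'rV[R]_(m + m)) (f h : 'rV[R]_(m + m) -> 'cV[C]_d).

Lemma dC_hdot p q (v x : 'rV[R]_(m + m)) (F H : 'rV[R]_(m + m) -> 'M[C]_(p, q)) L L' :
  dM v F x L -> dM v H x L' ->
  dC v (fun y => hdot (F y) (H y)) x (hdot L (H x) + hdot (F x) L').
Proof.
move=> FL HL; rewrite /hdot -big_split; apply: dC_sum => i _; rewrite -big_split.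
apply: dC_sum => j _; exact: dC_mul (FL i j) (dC_conj (HL i j)).
Qed.

Lemma cdivZ (s : 'rV[R]_(m + m) -> C) (v : 'rV[R]_(m + m) -> 'rV[C]_(m + m)) x
    (ds : 'I_(m + m) -> C) :
  (forall a, dC (delta_mx ord0 a) s x (ds a)) -> diff_at v x ->
  cdiv al (fun y => s y *: v y) x = \sum_a v x ord0 a * ds a + s x * cdiv al v x.
Proof.
move=> sd vd; rewrite /cdiv mulrDr !mulr_sumr addrA; congr (_ + _); rewrite -?big_split.
  apply: eq_bigr => a _ /=; rewrite (dM_pd_cmx (dM_scale (sd a) (vd a))) !mxE.
  by rewrite mulrC.
by apply: eq_bigr => a _; rewrite mxE mulrA.
Qed.

Lemma cdiv_sum (J : Type) (s : seq J) (P : pred J)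
    (v : J -> 'rV[R]_(m + m) -> 'rV[C]_(m + m)) x : (forall j, P j -> diff_at (v j) x) ->
  cdiv al (fun y => \sum_(j <- s | P j) v j y) x = \sum_(j <- s | P j) cdiv al (v j) x.
Proof.
move=> vd; rewrite /cdiv big_split /=; congr (_ + _).
  rewrite exchange_big; apply: eq_bigr => a _ /=.
  by rewrite (dM_pd_cmx (dM_sum s (fun j Pj => vd j Pj a))) summxE.
by rewrite exchange_big; apply: eq_bigr => a _ /=; rewrite summxE mulr_suml.
Qed.

Lemma cdivB (v w : 'rV[R]_(m + m) -> 'rV[C]_(m + m)) x : diff_at v x -> diff_at w x ->
  cdiv al (fun y => v y - w y) x = cdiv al v x - cdiv al w x.
Proof.
move=> vd wd; rewrite /cdiv opprD addrACA -!sumrB; congr (_ + _); apply: eq_bigr => a _.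
  by rewrite (dM_pd_cmx (dM_add (vd a) (dM_opp (wd a)))) !mxE.
by rewrite !mxE mulrBl.
Qed.

Lemma diff_atZ p q (s : 'rV[R]_(m + m) -> C) (F : 'rV[R]_(m + m) -> 'M[C]_(p, q)) x
    (ds : 'I_(m + m) -> C) :
  (forall a, dC (delta_mx ord0 a) s x (ds a)) -> diff_at F x ->
  diff_at (fun y => s y *: F y) x.
Proof. by move=> sd Fd; exact: dM_diff_at (fun a => dM_scale (sd a) (Fd a)). Qed.

(** By [conn_adj] the connection terms of the two covariant derivatives cancel: nabla is a metric
    connection, and the conjugate direction appears in the conjugate-linear argument. *)
Lemma cov_hdot v w h f x : U x -> diff_at h x -> diff_at f x -> w x = conjmx (v x) ->
  \sum_a v x ord0 a * (hdot (pd_cmx a h x) (f x) + hdot (h x) (pd_cmx a f x)) =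
  hdot (cov V al v h x) (f x) + hdot (h x) (cov V al w f x).
Proof.
move=> Ux hd fd wv; rewrite !cov_dirD hdotDl hdotDr hdotMl -urep_diff_adj.
have -> : adj (conn al (v x) x) = - conn al (w x) x.
  by rewrite [conn al (v x) x]conn_adj // adjN adjK wv.
rewrite raddfN mulNmx hdotNr addrACA [- _ + _]addrC subrr addr0.
rewrite /dirD hdot_suml hdot_sumr -big_split; apply: eq_bigr => a _ /=.
by rewrite hdotZl hdotZr wv mxE conjCK mulrDr.
Qed.

Lemma cdiv_hdot v w h f x : U x -> diff_at h x -> diff_at f x -> diff_at v x ->
  w x = conjmx (v x) ->
  cdiv al (fun y => hdot (h y) (f y) *: v y) x =
  hdot (cov V al v h x) (f x) + hdot (h x) (cov V al w f x) + hdot (h x) (f x) * cdiv al v x.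
Proof.
move=> Ux hd fd vd wv; rewrite (cdivZ (fun a => dC_hdot (hd a) (fd a)) vd).
by rewrite (cov_hdot Ux hd fd wv).
Qed.

(** S is constant in the trivialization but need not be parallel; its covariant derivative is the
    commutator with the connection form. *)
Lemma cov_mull v (S : 'M[C]_d) f x : diff_at f x ->
  cov V al v (fun y => S *m f y) x =
  S *m cov V al v f x + (pi (conn al (v x) x) *m S - S *m pi (conn al (v x) x)) *m f x.
Proof.
move=> fd; rewrite !cov_dirD (dirD_Cmul _ _ fd) mulmxDr mulmxBl !mulmxA.
by rewrite -addrA; congr (_ + _); rewrite addrC subrK.
Qed.

Lemma cov_vec v f x (J : finType) (c1 c2 : J -> C) (v1 v2 : J -> 'rV[R]_(m + m) -> 'rV[C]_(m + m)) :
  v x = \sum_j c1 j *: v1 j x - \sum_j c2 j *: v2 j x ->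
  cov V al v f x = \sum_j c1 j *: cov V al (v1 j) f x - \sum_j c2 j *: cov V al (v2 j) f x.
Proof.
move=> vE; have covS (c : J -> C) (w : J -> 'rV[R]_(m + m) -> 'rV[C]_(m + m)) :
    \sum_j c j *: cov V al (w j) f x = \sum_a (\sum_j c j *: w j x) ord0 a *: covC al V a f x.
  under eq_bigr do rewrite covE scaler_sumr.
  rewrite exchange_big; apply: eq_bigr => a _ /=; rewrite summxE scaler_suml.
  by apply: eq_bigr => j _; rewrite mxE scalerA.
have E1 := covS c1 v1.
have E2 := covS c2 v2.
transitivity (\sum_a (v x) ord0 a *: covC al V a f x); first exact: covE.
apply: etrans (congr2 (fun p q => p - q) (esym E1) (esym E2)).
have {}vE a : v x ord0 a = (\sum_j c1 j *: v1 j x) ord0 a - (\sum_j c2 j *: v2 j x) ord0 a.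
  by rewrite vE !mxE.
move: (\sum_j c1 j *: _) (\sum_j c2 j *: _) vE => w1 w2 vE.
rewrite -[RHS]sumrB; apply: eq_bigr => a _.
by rewrite -scalerBl vE.
Qed.

Variable T : 'I_m -> 'I_m -> 'M[C]_d.
Hypothesis Tadj : forall k l, adj (T k l) = T l k.
Hypothesis Tcomm : forall A k l,
  pi A *m T l k - T l k *m pi A = \sum_j (A j l *: T j k - A k j *: T l j).

(** Differentiation along eps_l moves nabla along epsbar_l to the second argument of the product. So
    the divergence contains <h, T_lk (nabla_lbar nabla_k - nabla_k nabla_lbar) f>, where a curvature
    appears. *)
Definition flux h f y : 'rV[C]_(m + m) := \sum_k \sum_l
  (hdot (h y) (T l k *m D10 k f y) *: eps al l y - hdot (h y) (T l k *m D01 l f y) *: epsbar al k y).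

(** The second-order terms of the divergence are commutators of nabla_k and nabla_lbar, that is,
    curvature up to a derivative along the bracket of eps_k and epsbar_l. Chern's formula expresses
    this bracket by the connection form, and it matches the connection terms left over by the
    product rule. *)
Lemma local_weitzenboeck h f x : smooth_cmx_on U h -> smooth_cmx_on U f -> U x ->
  \sum_k \sum_l (hdot (T k l *m D10 l h x) (D10 k f x) - hdot (T k l *m D01 k h x) (D01 l f x))
  - hdot (h x) ((\sum_k \sum_l T l k *m curv V al (eps al k) (epsbar al l) x) *m f x)
  = cdiv al (flux h f) x.
Proof.
move=> hs fs Ux; have hd := smooth_diff_at hs Ux.
have Uo : open U := @lfr_open _ _ _ _ al.
have es k : smooth_cmx_on U (eps al k) := smooth_eps al k.
have bs k : smooth_cmx_on U (epsbar al k) := smooth_cmx_conj Uo (es k).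
have ed k := smooth_diff_at (es k) Ux; have bd k := smooth_diff_at (bs k) Ux.
have fd k := smooth_diff_at (cov_smooth V (es k) fs) Ux.
have gd k := smooth_diff_at (cov_smooth V (bs k) fs) Ux.
have Td l k (g : 'rV[R]_(m + m) -> 'cV[C]_d) : diff_at g x -> diff_at (fun y => T l k *m g y) x.
  by move=> gd'; exact: dM_diff_at (fun a => dM_mull _ (gd' a)).
set u := fun k => D10 k f x; set v := fun k => D01 k f x.
pose Cc l := conn al (epsbar al l x) x; pose A k := conn al (eps al k x) x.
have AC k : A k = - adj (Cc k) by exact: conn_epsX.
have eb k : epsbar al k x = conjmx (eps al k x) by [].
have be k : eps al k x = conjmx (epsbar al k x) by rewrite eb conjmxK.
have sd1 k l a := dC_hdot (hd a) (Td l k (D10 k f) (fd k) a).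
have sd2 k l a := dC_hdot (hd a) (Td l k (D01 l f) (gd l) a).
have d1 k l := diff_atZ (sd1 k l) (ed l); have d2 k l := diff_atZ (sd2 k l) (bd k).
have dB k l := dM_diff_at (fun a => dM_add (d1 k l a) (dM_opp (d2 k l a))).
rewrite /flux cdiv_sum => [|k _]; last first.
  exact: dM_diff_at (fun a => dM_sum (index_enum 'I_m) (fun l _ => dB k l a)).
have F1 k l : cdiv al (fun y => hdot (h y) (T l k *m D10 k f y) *: eps al l y) x =
    hdot (D10 l h x) (T l k *m u k) + hdot (h x) (T l k *m D01 l (D10 k f) x +
    ((\sum_j (Cc l j l *: T j k - Cc l k j *: T l j)) *m u k
      + (- \sum_j Cc j l j) *: (T l k *m u k))).
  rewrite (cdiv_hdot Ux hd (Td l k _ (fd k)) (ed l) (eb l)) (cov_mull _ _ (fd k)) Tcomm.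
  rewrite -addrA; congr (_ + _); rewrite addrA [RHS]hdotDr; congr (_ + _).
  rewrite hdotZr mulrC cdiv_eps //; congr (_ * _).
  rewrite rmorphN rmorph_sum -sumrN; apply: eq_bigr => j _.
  by rewrite conn_epsX // !mxE.
have F2 k l : cdiv al (fun y => hdot (h y) (T l k *m D01 l f y) *: epsbar al k y) x =
    hdot (D01 k h x) (T l k *m v l) + hdot (h x) (T l k *m D10 k (D01 l f) x +
    ((\sum_j (A k j l *: T j k - A k k j *: T l j)) *m v l
      + (\sum_j A j j k) *: (T l k *m v l))).
  rewrite (cdiv_hdot Ux hd (Td l k _ (gd l)) (bd k) (be k)) (cov_mull _ _ (gd l)) Tcomm.
  rewrite -addrA; congr (_ + _); rewrite addrA [RHS]hdotDr; congr (_ + _).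
  have cb : cdiv al (epsbar al k) x = Num.conj (cdiv al (eps al k) x) by exact: cdiv_conj (ed k).
  by rewrite hdotZr mulrC cb cdiv_eps.
transitivity (\sum_k \sum_l (
    hdot (D10 l h x) (T l k *m u k) + hdot (h x) (T l k *m D01 l (D10 k f) x +
    ((\sum_j (Cc l j l *: T j k - Cc l k j *: T l j)) *m u k
      + (- \sum_j Cc j l j) *: (T l k *m u k))) -
    (hdot (D01 k h x) (T l k *m v l) + hdot (h x) (T l k *m D10 k (D01 l f) x +
    ((\sum_j (A k j l *: T j k - A k k j *: T l j)) *m v l
      + (\sum_j A j j k) *: (T l k *m v l)))))); last first.
  apply: eq_bigr => k _; rewrite cdiv_sum => [|l _]; last exact: dB.
  apply: eq_bigr => l _; rewrite (cdivB (d1 k l) (d2 k l)).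
  by congr (_ - _); apply: esym; [exact: F1 | exact: F2].
have cE k l : curv V al (eps al k) (epsbar al l) x *m f x =
    D10 k (D01 l f) x - D01 l (D10 k f) x
    + (\sum_j A k l j *: v j + \sum_j Cc l j k *: u j).
  rewrite -(curv_op_tensorial V (ed k) (bd l) fs Ux) /curv_op; congr (_ + _).
  apply: etrans (congr1 (fun p => - p) (cov_vec f (bracket_frame k l Ux))) _.
  have Ak : \sum_j A k l j *: v j =
    - \sum_j Num.conj (conn al (epsbar al k x) x j l) *: v j.
    by rewrite -sumrN; apply: eq_bigr => j _; rewrite AC !mxE scaleNr.
  apply: (etrans (opprB _ _)); apply: (etrans (addrC _ _)).
  exact: (congr1 (fun p => p + \sum_j Cc l j k *: u j) (esym Ak)).
have -> : (\sum_k \sum_l T l k *m curv V al (eps al k) (epsbar al l) x) *m f x =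
    \sum_k \sum_l T l k *m (curv V al (eps al k) (epsbar al l) x *m f x).
  by rewrite mulmx_suml; apply: eq_bigr => k _; rewrite mulmx_suml; apply: eq_bigr => l _;
    rewrite mulmxA.
apply: etrans (congr1 (fun p => _ - hdot (h x) p) (curvature_terms T cE)) _.
rewrite hdotNr opprK hdot_sumr -big_split; apply: eq_bigr => k _ /=.
rewrite hdot_sumr -big_split; apply: eq_bigr => l _ /=.
exact: flux_term (Tadj k l).
Qed.

End LocalWeitzenboeck.

Local Opaque smooth_on pd pd_cmx cov conn bracket curv.

(** * The two divergence identities and their combination *)

Section GreenIdentity.
Variables (R : realType) (n : nat) (M : topologicalType) (K : kahler R n.+1 M).
Variables (al : local_frame K) (d : nat) (V : unitary_rep R n.+1 d).
Variables (rho : 'I_n.+1 -> int) (Pp Pm : 'I_n.+1 -> 'End('M[R[i]]_(d, n.+1))).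
Hypotheses (HV : irreducible_of_weight V rho) (Hrho : dominant rho) (Hd : (2 <= d)%N)
  (HPp : weight_decomposition (actp V) (diffp V) (fun i j => rho j + mu i j) Pp)
  (HPm : weight_decomposition (actm V) (diffm V) (fun i j => rho j - mu i j) Pm).
Local Notation C := R[i].
Local Notation U := (lfr_dom al).
Local Notation pi := (urep_diff V).
Local Notation m := n.+1.
Implicit Types (x : 'rV[R]_(m + m)) (f h : 'rV[R]_(m + m) -> 'cV[C]_d).

(** [cov10] and [cov01] agree with [nabla10] and [nabla01], but take a function on one frame domain
    that need not come from a section. *)
Definition cov10 f x : 'M[C]_(d, m) := \matrix_(i, k) cov V al (eps al k) f x i ord0.
Definition cov01 f x : 'M[C]_(d, m) := \matrix_(i, k) cov V al (epsbar al k) f x i ord0.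

Lemma col_cov10 k f x : col k (cov10 f x) = cov V al (eps al k) f x.
Proof. by apply/matrixP => i j; rewrite 2!mxE (ord1 j). Qed.

Lemma col_cov01 k f x : col k (cov01 f x) = cov V al (epsbar al k) f x.
Proof. by apply/matrixP => i j; rewrite 2!mxE (ord1 j). Qed.

Local Opaque cov10 cov01 hdot.

Local Transparent hdot.
Lemma hdot_col p q (A B : 'M[C]_(p, q)) : hdot A B = \sum_k hdot (col k A) (col k B).
Proof.
rewrite /hdot exchange_big; apply: eq_bigr => k _; apply: eq_bigr => i _ /=.
by rewrite big_ord1 !mxE.
Qed.

Local Opaque hdot.

Lemma col_mul_delta p q r (A : 'M[C]_(p, q)) (k j : 'I_r) l :
  col j (A *m delta_mx l k) = if j == k then col l A else 0.
Proof.
apply/matrixP => a b; rewrite !mxE (bigD1 l) //= big1 => [|i il]; last first.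
  by rewrite mxE (negbTE il) mulr0.
by rewrite mxE eqxx addr0; case: (j == k); rewrite !mxE ?mulr1 ?mulr0.
Qed.

Lemma hdot_mul_delta (X : 'M[C]_d) (A B : 'M[C]_(d, m)) k l :
  hdot (X *m A *m delta_mx l k) B = hdot (X *m col l A) (col k B).
Proof.
rewrite hdot_col (bigD1 k) //= big1 => [|i ik]; last first.
  by rewrite col_mul_delta (negbTE ik) hdot0l.
by rewrite addr0 col_mul_delta eqxx !colE mulmxA.
Qed.

Lemma hdot_casimir_m A B :
  hdot (casimir_m V A) B = \sum_k \sum_l hdot (pi (delta_mx k l) *m col l A) (col k B).
Proof.
rewrite /casimir_m hdot_suml; apply: eq_bigr => k _.
by rewrite hdot_suml; apply: eq_bigr => l _; rewrite hdot_mul_delta.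
Qed.

Lemma hdot_casimir_p A B :
  hdot (casimir_p V A) B = - \sum_k \sum_l hdot (pi (delta_mx k l) *m col k A) (col l B).
Proof.
rewrite /casimir_p hdotNl hdot_suml; congr (- _); apply: eq_bigr => k _.
by rewrite hdot_suml; apply: eq_bigr => l _; rewrite hdot_mul_delta.
Qed.

Definition delta_op (k l : 'I_m) : 'M[C]_d := (k == l)%:R *: 1%:M.
Definition rep_op (k l : 'I_m) : 'M[C]_d := pi (delta_mx k l).

Lemma delta_op_adj k l : adj (delta_op k l) = delta_op l k.
Proof. by rewrite /delta_op adjZ adj1 eq_sym; case: (l == k); rewrite ?rmorph0 ?rmorph1. Qed.

Lemma rep_op_adj k l : adj (rep_op k l) = rep_op l k.
Proof. by rewrite /rep_op -urep_diff_adj adj_delta. Qed.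

Lemma delta_op_comm (A : 'M[C]_m) k l :
  pi A *m delta_op l k - delta_op l k *m pi A =
  \sum_j (A j l *: delta_op j k - A k j *: delta_op l j).
Proof.
rewrite /delta_op -scalemxAl -scalemxAr mulmx1 mul1mx subrr sumrB.
rewrite (bigD1 k) //= big1 => [|j jk]; last by rewrite (negbTE jk) scale0r scaler0.
rewrite [X in _ - X](bigD1 l) //= big1 => [|j jl]; last first.
  by rewrite eq_sym (negbTE jl) scale0r scaler0.
by rewrite !eqxx !addr0 subrr.
Qed.

Lemma delta_op_sum (a b c e : 'I_m -> 'cV[C]_d) :
  \sum_k \sum_l (hdot (delta_op k l *m a l) (b k) - hdot (delta_op k l *m c k) (e l)) =
  \sum_k hdot (a k) (b k) - \sum_k hdot (c k) (e k).
Proof.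
rewrite -[RHS]sumrB; apply: eq_bigr => k _; rewrite (bigD1 k) //= big1 => [|l lk]; last first.
  by rewrite /delta_op eq_sym (negbTE lk) scale0r !mul0mx !hdot0l subrr.
by rewrite /delta_op eqxx scale1r !mul1mx addr0.
Qed.

Lemma hdot_curv (p q : C) (S T : 'M[C]_d) (h f : 'cV[C]_d) :
  Num.conj p = p -> Num.conj q = q ->
  hdot h ((- (p *: S) - (q *: T)) *m f) = - (p * hdot h (S *m f)) - q * hdot h (T *m f).
Proof.
move=> pr qr; rewrite mulmxBl mulNmx -!scalemxAl hdotDr !hdotNr !hdotZr.
by rewrite pr qr.
Qed.

Lemma rep_op_comm (A : 'M[C]_m) k l :
  pi A *m rep_op l k - rep_op l k *m pi A =
  \sum_j (A j l *: rep_op j k - A k j *: rep_op l j).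
Proof.
rewrite /rep_op urep_diff_bracket sumrB.
have piS (c : 'I_m -> C) (D : 'I_m -> 'M[C]_m) :
    \sum_j c j *: pi (D j) = pi (\sum_j c j *: D j).
  by rewrite raddf_sum; apply: eq_bigr => j _; rewrite -urep_diffZ.
rewrite !piS -raddfB; congr (pi (_ - _)); apply/matrixP => a b.
  rewrite mxE summxE (bigD1 l) //= big1 => [|j jl]; last by rewrite mxE (negbTE jl) mulr0.
  rewrite mxE eqxx addr0 (bigD1 a) //= big1 => [|j ja]; last first.
    by rewrite !mxE eq_sym (negbTE ja) mulr0.
  by rewrite !mxE eqxx addr0.
rewrite mxE summxE (bigD1 k) //= big1 => [|j jl]; last first.
  by rewrite mxE (negbTE jl) andbF mul0r.
rewrite mxE eqxx andbT addr0 (bigD1 b) //= big1 => [|j jb]; last first.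
  by rewrite !mxE [b == j]eq_sym (negbTE jb) andbF mulr0.
by rewrite !mxE eqxx andbT addr0 mulrC.
Qed.

Lemma weitzenboeck0 h f x : smooth_cmx_on U h -> smooth_cmx_on U f -> U x ->
  hdot (cov10 h x) (cov10 f x) - hdot (cov01 h x) (cov01 f x)
  - hdot (h x) (curv0 V al x *m f x) = cdiv al (flux al V delta_op h f) x.
Proof.
move=> hs fs Ux; rewrite -(local_weitzenboeck delta_op_adj _ hs fs Ux); last first.
  exact: delta_op_comm.
have E1 := delta_op_sum (fun k => cov V al (eps al k) h x) (fun k => cov V al (eps al k) f x)
  (fun k => cov V al (epsbar al k) h x) (fun k => cov V al (epsbar al k) f x).
have F1 : hdot (cov10 h x) (cov10 f x) =
    \sum_k hdot (cov V al (eps al k) h x) (cov V al (eps al k) f x).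
  apply: etrans (hdot_col _ _) _; apply: eq_bigr => k _.
  exact: (congr2 (fun p q => hdot p q) (col_cov10 k h x) (col_cov10 k f x)).
have F2 : hdot (cov01 h x) (cov01 f x) =
    \sum_k hdot (cov V al (epsbar al k) h x) (cov V al (epsbar al k) f x).
  apply: etrans (hdot_col _ _) _; apply: eq_bigr => k _.
  exact: (congr2 (fun p q => hdot p q) (col_cov01 k h x) (col_cov01 k f x)).
have {}E1 := etrans E1 (congr2 (fun p q => p - q) (esym F1) (esym F2)).
have E2 : \sum_k \sum_l delta_op l k *m curv V al (eps al k) (epsbar al l) x = curv0 V al x.
  apply: eq_bigr => k _; rewrite (bigD1 k) //= big1 => [|l lk]; last first.
    by rewrite /delta_op (negbTE lk) scale0r mul0mx.
  by rewrite /delta_op eqxx scale1r mul1mx addr0.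
exact: (congr2 (fun p q => p - hdot (h x) (q *m f x)) (esym E1) (esym E2)).
Qed.

Lemma weitzenboeck1 h f x : smooth_cmx_on U h -> smooth_cmx_on U f -> U x ->
  hdot (casimir_m V (cov10 h x)) (cov10 f x) + hdot (casimir_p V (cov01 h x)) (cov01 f x)
  - hdot (h x) (curv1 V al x *m f x) = cdiv al (flux al V rep_op h f) x.
Proof.
move=> hs fs Ux; rewrite -(local_weitzenboeck rep_op_adj _ hs fs Ux); last first.
  exact: rep_op_comm.
rewrite hdot_casimir_m hdot_casimir_p -sumrB; congr (_ - _).
apply: eq_bigr => k _; rewrite -sumrB; apply: eq_bigr => l _.
by rewrite !col_cov10 !col_cov01.
Qed.

Local Notation gap := ((wp rho ord0 + wm rho ord_max)%:~R : C).
Local Notation coefm i := ((2 * (wm rho ord_max - wm rho i))%:~R / gap).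
Local Notation coefp i := ((2 * (wp rho ord0 - wp rho i))%:~R / gap).

(** The projections are self-adjoint idempotents with sum 1, and the term i = i0 has coefficient 0.
    This turns a weighted sum of gradients into a multiple of the full product and a Casimir
    operator. *)
Lemma weighted_projections (Q : 'I_m -> 'End('M[C]_(d, m))) act diff lam
    (w : 'I_m -> int) i0 (c : C) A B :
  weight_decomposition act diff lam Q ->
  \sum_(i | i != i0) ((2 * (w i0 - w i))%:~R / c) * hdot (Q i A) (Q i B) =
  2 / c * ((w i0)%:~R * hdot A B - hdot (\sum_i (w i)%:~R *: Q i A) B).
Proof.
move=> [Qp Q1]; have QQ i : hdot (Q i A) (Q i B) = hdot (Q i A) B.
  by have [[Qi Qs] _ _] := Qp i; rewrite -Qs Qi.
have AE : hdot A B = \sum_i hdot (Q i A) B.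
  by rewrite -hdot_suml -sum_lfunE Q1 id_lfunE.
rewrite AE hdot_suml mulr_sumr -sumrB mulr_sumr [RHS](bigD1 i0) //= hdotZl subrr mulr0 add0r.
apply: eq_bigr => i _; rewrite QQ hdotZl -mulrBl rmorphM rmorphB /= mulrA.
by congr (_ * _); rewrite mulrAC.
Qed.

(** The integrand of the difference of the two sides of the formula, polarized in h and f. *)
Definition energy h f x : C :=
  \sum_(i | i != ord_max) coefm i * hdot (Pm i (cov10 h x)) (Pm i (cov10 f x))
  + \sum_(i | i != ord0) coefp i * hdot (Pp i (cov01 h x)) (Pp i (cov01 f x))
  - (hdot (cov01 h x) (cov01 f x) + hdot (cov10 h x) (cov10 f x))
  - hdot (h x) (weitzenboeck_curv V rho al x *m f x).

Lemma energy_algebra (w1 wn : int) (a b c0 c1 r0 r1 : C) : (w1 + wn)%:~R != 0 :> C ->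
  2 / (w1 + wn)%:~R * (wn%:~R * a - c1) + 2 / (w1 + wn)%:~R * (w1%:~R * b - c0) - (b + a)
  - (- (2%:~R / (w1 + wn)%:~R * r1) - (w1 - wn)%:~R / (w1 + wn)%:~R * r0) =
  - ((w1 - wn)%:~R / (w1 + wn)%:~R * (a - b - r0)) - 2 / (w1 + wn)%:~R * (c1 + c0 - r1).
Proof.
rewrite (rmorphD _ w1 wn) (rmorphB _ w1 wn) /=; move: (w1%:~R) (wn%:~R) => p q s0.
rewrite -[2%:~R]/(2 : C); move: (p : C) (q : C) s0 => {p q} p q s0; field.
exact: s0.
Qed.

Lemma energyE h f x : smooth_cmx_on U h -> smooth_cmx_on U f -> U x ->
  energy h f x = - ((wp rho ord0 - wm rho ord_max)%:~R / gap * cdiv al (flux al V delta_op h f) x)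
    - 2 / gap * cdiv al (flux al V rep_op h f) x.
Proof.
move=> hs fs Ux; have s0 := weight_gap HV HPp Hrho Hd.
have W0 := weitzenboeck0 hs fs Ux; have W1 := weitzenboeck1 hs fs Ux.
apply: etrans (congr2 (fun p q => - (_ * p) - _ * q) W0 W1).
have Wm := weighted_projections (wm rho) ord_max gap (cov10 h x) (cov10 f x) HPm.
have Wp := weighted_projections (wp rho) ord0 gap (cov01 h x) (cov01 f x) HPp.
rewrite -(casimir_mE HV HPm) in Wm; rewrite -(casimir_pE HV HPp) in Wp.
have conj_int (a b : int) : Num.conj (a%:~R / b%:~R : C) = a%:~R / b%:~R.
  by rewrite rmorphM fmorphV !rmorph_int.
have Wc := hdot_curv (curv1 V al x) (curv0 V al x) (h x) (f x)
  (conj_int 2 (wp rho ord0 + wm rho ord_max))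
  (conj_int (wp rho ord0 - wm rho ord_max) (wp rho ord0 + wm rho ord_max)).
apply: etrans (congr2 (fun p q => p - _ - q) (congr2 (fun p q => p + q) Wm Wp) Wc) _.
exact: energy_algebra s0.
Qed.

End GreenIdentity.

(** * Riemannian density and integration by parts *)

Section DeterminantDerivative.
Variables (R : realType) (W : normedModType R).
Local Notation C := R[i].

Lemma dC_prod_seq (J : eqType) (s : seq J) (v x : W) (f : J -> W -> C) (d : J -> C) :
  uniq s -> (forall j, dC v (f j) x (d j)) ->
  dC v (fun y => \prod_(j <- s) f j y) x
    (\sum_(i <- s) \prod_(j <- s) (if j == i then d j else f j x)).
Proof.
move=> us fd; elim: s us => [_|a s IH /= /andP[as_ /IH {}IH]].
  rewrite big_nil; apply: (dC_near _ (dC_cst v 1 x)).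
  by apply: nearW => y; rewrite big_nil.
have H := dC_mul (fd a) IH; rewrite (_ : \sum_(i <- a :: s) _ =
    d a * \prod_(j <- s) f j x
    + f a x * \sum_(i <- s) \prod_(j <- s) (if j == i then d j else f j x)).
  apply: (dC_near _ H); by apply: nearW => y; rewrite big_cons.
rewrite big_cons; congr (_ + _).
  rewrite big_cons eqxx; congr (_ * _); apply: eq_big_seq => j js.
  by case: eqP => // ja; rewrite -ja js in as_.
rewrite mulr_sumr; apply: eq_big_seq => i is_; rewrite big_cons.
by case: eqP => // ai; rewrite ai is_ in as_.
Qed.

(** Jacobi's formula. The product rule differentiates one row at a time, and each resulting
    determinant is expanded along that row. *)
Lemma dC_det n (v x : W) (F : W -> 'M[C]_n) L : dM v F x L ->
  dC v (fun y => \det (F y)) x (\tr (L *m \adj (F x))).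
Proof.
move=> FL; rewrite (_ : \tr _ = \sum_(s : {perm 'I_n}) (-1) ^+ s *
    \sum_i \prod_j (if j == i then L j (s j) else F x j (s j))).
  apply: dC_sum => s _.
  have H := dC_prod_seq (index_enum_uniq _) (fun j : 'I_n => FL j (s j)).
  have := dC_mul (dC_cst v ((-1) ^+ s) x) H; rewrite mul0r add0r.
  exact.
under [RHS]eq_bigr do rewrite mulr_sumr; rewrite exchange_big; apply: eq_bigr => i _ /=.
pose A := \matrix_(a, b) (if a == i then L a b else F x a b).
transitivity (\det A); last first.
  apply: eq_bigr => s _; congr (_ * _); apply: eq_bigr => j _.
  by rewrite mxE.
rewrite (expand_det_row A i) mxE; apply: eq_bigr => j _; rewrite !mxE eqxx.
rewrite /cofactor; congr (_ * (_ * \det _)); apply/matrixP => a b.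
by rewrite !mxE eq_sym (negbTE (neq_lift _ _)).
Qed.

End DeterminantDerivative.

Local Opaque smooth_on pd pd_cmx.

Section Density.
Variables (R : realType) (m : nat) (M : topologicalType) (K : kahler R m M).
Variables (al : local_frame K).
Local Notation C := R[i].
Local Notation U := (lfr_dom al).
Local Notation c := (lfr_idx al).
Implicit Types (x : 'rV[R]_(m + m)).

Let Uo : open U := @lfr_open _ _ _ _ al.

Definition density x : R := Num.sqrt (\det (kmet c x)).

(** The full frame F satisfies F G F^* = 1, so |det F|^2 det g = 1. *)
Lemma det_met_gt0 x : U x -> 0 < \det (kmet c x).
Proof.
move=> Ux; have /(congr1 determinant) := full_frameG Ux.
rewrite !det_mulmx det1 /adj det_tr.
have -> : \det (conjmx (full_frame al x)) = Num.conj (\det (full_frame al x)).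
  exact: (det_map_mx (Num.conj : {rmorphism C -> C})).
rewrite /cplx (det_map_mx (real_complex R)) /= mulrCA.
move: (\det (full_frame al x)) (\det (kmet c x)) => z g /(congr1 (@complex.Re R)).
rewrite !reM !imM reJ imJ /= !mul0r !subr0 => E.
have : 0 < g * (complex.Re z * complex.Re z - complex.Im z * - complex.Im z) by rewrite E.
rewrite mulrN opprK -!expr2; move: (complex.Re z) (complex.Im z) => a b ab.
by have := sqr_ge0 a; have := sqr_ge0 b; nra.
Qed.

Lemma density_smooth : smooth_on U density.
Proof.
apply: smooth_sqrt Uo _ det_met_gt0.
apply: (smooth_det Uo) => i j.
by apply: (smooth_on_sub (@lfr_sub _ _ _ _ al)); exact: kmet_smooth.
Qed.

Lemma density_gt0 x : U x -> 0 < density x.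
Proof. by move=> Ux; rewrite sqrtr_gt0; exact: det_met_gt0. Qed.

(** Its square is det g, whose derivative is 2 det g times the trace of the Christoffel matrix, by
    Jacobi's formula and metric compatibility; one factor of the density then cancels. *)
Lemma dC_density a x : U x ->
  dC (delta_mx ord0 a) (fun y => real_complex R (density y)) x
     (real_complex R (density x) * \tr (christ al a x)).
Proof.
move=> Ux; have D1 := dC_real (smooth_is_derive a density_smooth Ux).
set t := pd a density x in D1.
have D2 := dC_mul D1 D1.
have G1 := smooth_cmx_dM a (met_smooth al) Ux.
have D3 := dC_det G1.
have E : pd_cmx a (fun y => cplx (kmet c y)) x =
    christ al a x *m cplx (kmet c x) + cplx (kmet c x) *m (christ al a x)^T.
  have := met_compat (coordvec R a) Ux; rewrite dirD_coord => ->.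
  have -> // : christX al (coordvec R a) x = christ al a x.
  rewrite /christX (bigD1 a) //= big1 => [|b ba]; last first.
    by rewrite mxE (negbTE ba) andbF scale0r.
  by rewrite mxE !eqxx scale1r addr0.
have {}D3 : dC (delta_mx ord0 a) (fun y => real_complex R (density y) * real_complex R (density y)) x
   (\tr (pd_cmx a (fun y => cplx (kmet c y)) x *m \adj (cplx (kmet c x)))).
  apply: (dC_near _ D3); apply: near_open Uo Ux _ => y Uy.
  rewrite /cplx (det_map_mx (real_complex R)) /= -rmorphM /= -expr2 sqr_sqrtr //.
  exact/ltW/det_met_gt0.
have {D2 D3} := dC_unique D2 D3; rewrite E mulmxDl mxtraceD -mulmxA mul_mx_adj.
rewrite (mxtrace_mulC (_ *m _) (\adj _)) mulmxA mul_adj_mx mul_scalar_mx mul_mx_scalar !mxtraceZ mxtrace_tr.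
rewrite /cplx (det_map_mx (real_complex R)) /=.
have -> : \det (kmet c x) = density x ^+ 2.
  by rewrite sqr_sqrtr //; exact/ltW/det_met_gt0.
have : real_complex R (density x) != 0.
  by rewrite fmorph_eq0 gt_eqF //; exact: density_gt0.
rewrite rmorphXn /=; move: D1; move: (real_complex R t) (real_complex R (density x)) (\tr _).
move=> s w tr D1 w0 E1; rewrite (_ : w * tr = s) //.
apply: (mulfI w0); apply: (@mulfI _ 2); first by rewrite pnatr_eq0.
have {}E1 : 2 * (w * s) = 2 * (w ^+ 2 * tr) by move: E1; rewrite !mulr2n !mulrDl !mul1r [s * w]mulrC.
by rewrite E1 (expr2 w) -mulrA.
Qed.

Lemma density_div (X : 'rV[R]_(m + m) -> 'rV[C]_(m + m)) x : U x -> diff_at X x ->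
  \sum_a pd_cmx a (fun y => real_complex R (density y) *: X y) x ord0 a =
  real_complex R (density x) * cdiv al X x.
Proof.
move=> Ux Xd; rewrite /cdiv mulrDr !mulr_sumr -big_split; apply: eq_bigr => a _ /=.
rewrite (dM_pd_cmx (dM_scale (dC_density a Ux) (Xd a))) !mxE addrC; congr (_ + _).
by rewrite -mulrA; congr (_ * _); rewrite mulrC.
Qed.

End Density.

(** * Extension by zero from a compact box *)

Section Patch.
Variables (R : realType) (N : nat).
Local Notation E := 'rV[R]_N.
Implicit Types (x y : E) (U : set E) (F G : E -> R).

(** Closed, hence compact: a function on U that vanishes outside such a box in U extends by zero
    without loss of smoothness. *)
Definition cbox (r : R) x : set E := [set y | forall i, `|y ord0 i - x ord0 i| <= r].

Lemma cbox_compact r x : compact (cbox r x).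
Proof.
have -> : cbox r x = [set y : E | forall i, `[x ord0 i - r, x ord0 i + r]%classic (y ord0 i)].
  apply/seteqP; split=> y H i; have := H i; rewrite /= in_itv /= ler_distl //.
apply: (@rV_compact R N (fun i => `[x ord0 i - r, x ord0 i + r]%classic)) => i.
exact: segment_compact.
Qed.

Lemma cbox_coopen r x : open (~` cbox r x).
Proof.
apply: closed_openC; apply: (@compact_closed E (cbox r x)); last exact: cbox_compact.
exact: (@norm_hausdorff R E).
Qed.

Variables (U : set E) (x0 : E) (r : R).
Hypotheses (Uo : open U) (QU : cbox r x0 `<=` U).

Let Oo : open (~` cbox r x0). Proof. exact: cbox_coopen. Qed.

Definition supported F := forall x, U x -> ~ cbox r x0 x -> F x = 0.

Lemma patch_on F x : U x -> (F \_ U) x = F x.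
Proof. by move=> Ux; rewrite patchE mem_set. Qed.

Lemma patch_off F x : supported F -> ~ cbox r x0 x -> (F \_ U) x = 0.
Proof.
move=> F0 xQ; rewrite patchE; case: ifPn => // /set_mem Ux; exact: F0.
Qed.

Lemma patch_continuous F : (forall x, U x -> {for x, continuous F}) -> supported F ->
  continuous (F \_ U).
Proof.
move=> Fc F0 x; have [Ux|Ux] := pselect (U x).
  apply: (continuous_ext Uo _ Ux (Fc x Ux)) => y Uy; by rewrite patch_on.
have xQ : (~` cbox r x0) x by move=> /QU.
have cc : {for x, continuous (fun=> 0 : R)} by exact: cst_continuous.
apply: (continuous_ext Oo _ xQ cc) => y yQ.
by rewrite patch_off.
Qed.

Lemma patch_smooth F : smooth_on U F -> supported F -> smooth_on setT (F \_ U).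
Proof.
move=> Fs F0; apply: smooth_on_bigcup => x _; have [Ux|Ux] := pselect (U x).
  have [e e0 eU] := (openP U).1 Uo x Ux; exists e => //.
  apply: smooth_on_sub eU _; apply: (smooth_on_ext Uo _ Fs) => y Uy.
  by rewrite patch_on.
have xQ : (~` cbox r x0) x by move=> /QU.
have [e e0 eQ] := (openP (~` cbox r x0)).1 Oo x xQ; exists e => //.
apply: smooth_on_sub eQ _.
apply: (smooth_on_ext Oo _ (smooth_cst 0 Oo)) => y yQ.
by rewrite patch_off.
Qed.

(** The box around x0 lies in the cube around the origin with this half-side, as [csupp] wants. *)
Definition support_bound : R := r + \sum_i `|x0 ord0 i|.

Lemma support_bound_ge0 : 0 <= r -> 0 <= support_bound.
Proof. by move=> r0; apply: addr_ge0 => //; apply: sumr_ge0. Qed.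

Lemma patch_csupp F : (forall x, U x -> {for x, continuous F}) -> supported F ->
  csupp support_bound (F \_ U).
Proof.
move=> Fc F0; split; first exact: patch_continuous.
move=> x i xi; apply: patch_off => // /(_ i) xQ.
suff : `|x ord0 i| <= support_bound by rewrite leNgt xi.
have := ler_normD (x ord0 i - x0 ord0 i) (x0 ord0 i); rewrite subrK => /le_trans; apply.
apply: lerD => //; rewrite (bigD1 i) //= lerDl; exact: sumr_ge0.
Qed.

Lemma patch_pd F a : smooth_on U F -> supported F ->
  pd a (F \_ U) = (pd a F) \_ U.
Proof.
move=> Fs F0; apply/funext => x; have [Ux|Ux] := pselect (U x).
  by rewrite patch_on //; apply: (pd_ext a Uo _ Ux) => y Uy; rewrite patch_on.
have xQ : (~` cbox r x0) x by move=> /QU.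
transitivity (pd a (fun=> 0) x); last by rewrite pd_cst patchE memNset.
by apply: (pd_ext a Oo _ xQ) => y yQ; rewrite patch_off.
Qed.

Lemma supported_pd F a : supported F -> supported (pd a F).
Proof.
move=> F0 x Ux xQ; rewrite -(pd_cst a 0 x).
have O2 : open (U `&` ~` cbox r x0) by apply: openI.
by apply: (pd_ext a O2 _ (conj Ux xQ)) => y [Uy yQ]; exact: F0.
Qed.

Lemma iterated_integral_pd_patch F a : 0 <= r -> smooth_on U F -> supported F ->
  iterated_integral ((pd a F) \_ U) = 0.
Proof.
move=> r0 Fs F0; rewrite -patch_pd //.
have Ps := patch_smooth Fs F0.
apply: (iterated_integral_pd a (support_bound_ge0 r0) (patch_csupp _ F0)).
- by move=> x Ux; exact: smooth_continuous Fs Ux.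
- by move=> x b; exact: smooth_derivable Ps _.
- by move=> b x; exact: smooth_continuous (smooth_pd b Ps) _.
Qed.

Lemma iterated_integral_patch_sum (J : Type) (s : seq J) (F : J -> E -> R) : 0 <= r ->
  (forall j x, U x -> {for x, continuous (F j)}) -> (forall j, supported (F j)) ->
  iterated_integral ((fun x => \sum_(j <- s) F j x) \_ U) =
  \sum_(j <- s) iterated_integral ((F j) \_ U).
Proof.
move=> r0 Fc F0; have [JD JZ _] := @iterated_integral_linear_bounded R N.
have L0 := support_bound_ge0 r0.
elim: s => [|j s IH].
  have Z0 : csupp support_bound (fun _ : E => 0 : R) by split=> // x; exact: cst_continuous.
  rewrite big_nil; have J0 := JZ support_bound 0 _ L0 Z0; rewrite [RHS]mul0r in J0.
  apply: etrans J0; congr iterated_integral; apply/funext => x.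
  by rewrite patchE big_nil mul0r; case: ifP.
rewrite big_cons -IH -(JD support_bound) //.
- congr iterated_integral; apply/funext => x; rewrite !patchE; case: ifP => _ /=.
    by rewrite big_cons.
  by rewrite addr0.
- exact: patch_csupp (Fc j) (F0 j).
- apply: patch_csupp => [x Ux|x Ux xQ]; last by rewrite big1 // => i _; exact: F0.
  have FF := nbhs_filter x.
  by apply: cvg_big => [|k _]; [exact: add_continuous | exact: Fc].
Qed.

End Patch.

Section LocalDivergence.
Variables (R : realType) (m : nat) (M : topologicalType) (K : kahler R m M).
Variables (al : local_frame K) (x0 : 'rV[R]_(m + m)) (r : R).
Local Notation C := R[i].
Local Notation U := (lfr_dom al).
Hypotheses (r0 : 0 <= r) (QU : cbox r x0 `<=` U).

(** By [density_div] the divergence times the density is a sum of partial derivatives of functions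
    supported in the box. *)
Lemma divergence_integral (X : 'rV[R]_(m + m) -> 'rV[C]_(m + m)) : smooth_cmx_on U X ->
  (forall x, U x -> ~ cbox r x0 x -> X x = 0) ->
  iterated_integral ((fun x => complex.Re (cdiv al X x) * density al x) \_ U) = 0 /\
  iterated_integral ((fun x => complex.Im (cdiv al X x) * density al x) \_ U) = 0.
Proof.
move=> Xs X0; have Uo : open U := @lfr_open _ _ _ _ al.
have Ds : smooth_on U (density al) := @density_smooth _ _ _ _ al.
have F0 a : supported U x0 r (fun x => density al x * complex.Re (X x ord0 a)).
  by move=> x Ux xQ; rewrite X0 // mxE mulr0.
have G0 a : supported U x0 r (fun x => density al x * complex.Im (X x ord0 a)).
  by move=> x Ux xQ; rewrite X0 // mxE mulr0.
have Fs a : smooth_on U (fun x => density al x * complex.Re (X x ord0 a)).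
  exact: (smooth_mul Uo Ds (Xs ord0 a).1).
have Gs a : smooth_on U (fun x => density al x * complex.Im (X x ord0 a)).
  exact: (smooth_mul Uo Ds (Xs ord0 a).2).
have Z x : U x -> real_complex R (density al x) * cdiv al X x =
    \sum_a Complex (pd a (fun x => density al x * complex.Re (X x ord0 a)) x)
                   (pd a (fun x => density al x * complex.Im (X x ord0 a)) x).
  move=> Ux; rewrite -(density_div Ux (smooth_diff_at Xs Ux)); apply: eq_bigr => a _.
  rewrite pd_cmxE; congr (Complex (pd a _ x) (pd a _ x)); apply/funext => y.
    by rewrite mxE reM /= mul0r subr0.
  by rewrite mxE imM /= mul0r addr0.
split.
  transitivity (iterated_integral ((fun x => \sum_a
      pd a (fun x => density al x * complex.Re (X x ord0 a)) x) \_ U)).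
    congr iterated_integral; apply/funext => x; rewrite !patchE; case: ifPn => // /set_mem Ux.
    have /(congr1 (@complex.Re R)) := Z x Ux; rewrite reM re_sum /= mul0r subr0 mulrC => ->.
    by [].
  rewrite (iterated_integral_patch_sum (r := r) (x0 := x0)) //.
  - by rewrite big1 // => a _; exact: iterated_integral_pd_patch (F0 a).
  - by move=> a x Ux; exact: smooth_continuous (smooth_pd a (Fs a)) Ux.
  - by move=> a; exact: supported_pd.
transitivity (iterated_integral ((fun x => \sum_a
    pd a (fun x => density al x * complex.Im (X x ord0 a)) x) \_ U)).
  congr iterated_integral; apply/funext => x; rewrite !patchE; case: ifPn => // /set_mem Ux.
  have /(congr1 (@complex.Im R)) := Z x Ux; rewrite imM im_sum /= mul0r addr0 mulrC => ->.
  by [].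
rewrite (iterated_integral_patch_sum (r := r) (x0 := x0)) //.
- by rewrite big1 // => a _; exact: iterated_integral_pd_patch (G0 a).
- by move=> a x Ux; exact: smooth_continuous (smooth_pd a (Gs a)) Ux.
- by move=> a; exact: supported_pd.
Qed.

End LocalDivergence.

Local Opaque smooth_on pd pd_cmx cov conn bracket curv.

(** * The integral of functions supported in one frame domain *)

Section FrameIntegral.
Variables (R : realType) (m : nat) (M : topologicalType) (K : kahler R m M).
Hypothesis Mhausdorff : hausdorff_space M.
Variable I : (M -> R) -> R.
Hypothesis HI : riemannian_integral K I.
Local Notation C := R[i].

Lemma kchart_nbhs (c : kidx K) p (A : set 'rV[R]_(m + m)) : kdom c p -> open A -> A (kchart c p) ->
  \forall q \near p, kdom c q /\ A (kchart c q).
Proof.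
move=> cp Ao Ap; have H1 : nbhs p (kdom c) by apply: open_nbhs_nbhs; split=> //; exact: kdom_open.
have H2 : nbhs p (kchart c @^-1` A).
  by apply: (kchart_cont cp); exact: open_nbhs_nbhs.
exact: filterI H1 H2.
Qed.

Definition ext (al : local_frame K) (F : 'rV[R]_(m + m) -> R) (p : M) : R :=
  if `[< kdom (lfr_idx al) p /\ lfr_dom al (kchart (lfr_idx al) p) >]
  then F (kchart (lfr_idx al) p) else 0.

Section Box.
Variables (al : local_frame K) (x0 : 'rV[R]_(m + m)) (r : R).
Local Notation U := (lfr_dom al).
Local Notation c := (lfr_idx al).
Hypothesis QU : cbox r x0 `<=` U.
Implicit Types F G : 'rV[R]_(m + m) -> R.

Let Uo : open U := @lfr_open _ _ _ _ al.
Let Ucod x : U x -> kcod c x := @lfr_sub _ _ _ _ al x.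

Lemma ext_pt F x : U x -> ext al F (lfr_pt al x) = F x.
Proof.
move=> Ux; have cx := Ucod Ux; rewrite /ext /lfr_pt; case: asboolP => [_|[]].
  by rewrite kinvK.
by split; [exact: kinv_dom | rewrite kinvK].
Qed.

Lemma ext_off F p : (forall x, U x -> lfr_pt al x <> p) -> ext al F p = 0.
Proof.
move=> H; rewrite /ext; case: asboolP => // -[cp Up].
by case: (H _ Up); exact: kchartK.
Qed.

Definition box_image : set M := lfr_pt al @` cbox r x0.

(** A compact set in a Hausdorff space. Closedness makes the complement a domain on which to glue
    with 0. *)
Lemma box_image_closed : closed box_image.
Proof.
apply: (compact_closed Mhausdorff); apply: continuous_compact; last exact: cbox_compact.
apply: continuous_in_subspaceT => x /set_mem /QU Ux.
exact: (kinv_cont (Ucod Ux)).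
Qed.

Lemma box_image_dom : box_image `<=` kdom c.
Proof. by move=> _ [x /QU Ux <-]; exact: kinv_dom (Ucod Ux). Qed.

Lemma box_coimage_open (be : local_frame K) :
  open (lfr_dom be `&` [set z | ~ box_image (lfr_pt be z)]).
Proof.
rewrite openE => z [Uz zQ]; apply: filterI.
  by apply: open_nbhs_nbhs; split=> //; exact: (@lfr_open _ _ _ _ be).
have zc := kinv_cont (@lfr_sub _ _ _ _ be z Uz).
apply: (zc (~` box_image)); apply: open_nbhs_nbhs; split=> //.
exact: closed_openC box_image_closed.
Qed.

Lemma ext_off_box F p : supported U x0 r F -> ~ box_image p -> ext al F p = 0.
Proof.
move=> F0 pQ; rewrite /ext; case: asboolP => // -[cp Up]; apply: F0 => // pq.
by apply: pQ; exists (kchart c p) => //; exact: kchartK.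
Qed.

Lemma ext_continuous F : (forall x, U x -> {for x, continuous F}) -> supported U x0 r F ->
  continuous (ext al F).
Proof.
move=> Fc F0 p; have [[cp Up]|pU] := pselect (kdom c p /\ U (kchart c p)).
  have H : {for p, continuous (F \o kchart c)}.
    by apply: continuous_comp; [exact: kchart_cont | exact: Fc].
  have Ep : ext al F p = F (kchart c p) by rewrite /ext asboolT.
  rewrite /continuous_at Ep; apply: cvg_trans H; apply: near_eq_cvg.
  apply: filterS (kchart_nbhs cp Uo Up) => q [cq Uq].
  by rewrite /ext asboolT.
have pQ : ~ box_image p.
  move=> [x /QU Ux xp]; apply: pU; rewrite -xp; split; first exact: kinv_dom (Ucod Ux).
  by rewrite /lfr_pt kinvK //; exact: Ucod.
rewrite /continuous_at (ext_off_box F0 pQ).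
have H : {for p, continuous (fun=> 0 : R)} by exact: cst_continuous.
apply: cvg_trans H; apply: near_eq_cvg.
have Oo : open (~` box_image) by exact: closed_openC box_image_closed.
have : nbhs p (~` box_image) by exact: open_nbhs_nbhs.
by apply: filterS => q qQ; rewrite ext_off_box.
Qed.

Lemma ext_closure F : supported U x0 r F ->
  closure [set p | ext al F p != 0] `<=` kdom c.
Proof.
move=> F0 p H; apply: box_image_dom; apply: box_image_closed.
apply: closureS H => q /= /eqP qF; apply: contrapT => qQ.
by apply: qF; exact: ext_off_box.
Qed.

(** The support of the extension lies in the image of the box, which is closed and contained in the
    chart; so the local clause of [riemannian_integral] applies. *)
Lemma ext_integral F : (forall x, U x -> {for x, continuous F}) -> supported U x0 r F ->
  I (ext al F) = iterated_integral ((fun x => F x * density al x) \_ U).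
Proof.
move=> Fc F0; have [_ _ /(_ c (ext al F)) ->] := HI.
- congr iterated_integral; apply/funext => x; rewrite !patchE.
  case: ifPn => [/set_mem cx|/negP cx]; last first.
    by case: ifPn => // /set_mem /Ucod Ux; case: cx; exact: mem_set.
  case: ifPn => [/set_mem Ux|/negP Ux]; first by rewrite (ext_pt F Ux).
  rewrite /ext asboolF ?mul0r // => -[_]; rewrite kinvK // => Ux'.
  by apply: Ux; exact: mem_set.
- exact: ext_continuous.
- exact: ext_closure.
Qed.

Lemma ext_integral_ge0 F : (forall x, U x -> {for x, continuous F}) -> supported U x0 r F ->
  (forall x, U x -> 0 <= F x) -> 0 <= I (ext al F).
Proof.
move=> Fc F0 Fp; rewrite ext_integral //; apply: iterated_integral_ge0 => x.
rewrite patchE; case: ifPn => // /set_mem Ux.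
by apply: mulr_ge0; [exact: Fp | exact/ltW/density_gt0].
Qed.

Lemma ext_integral_eq0 F : 0 <= r ->
  (forall x, U x -> {for x, continuous F}) -> supported U x0 r F ->
  (forall x, U x -> 0 <= F x) -> I (ext al F) = 0 -> forall x, U x -> F x = 0.
Proof.
move=> r0 Fc F0 Fp; rewrite ext_integral // => J0 x Ux.
have Dc y : U y -> {for y, continuous (density al)}.
  by move=> Uy; exact: smooth_continuous (@density_smooth _ _ _ _ al) Uy.
have FDc y : U y -> {for y, continuous (fun x => F x * density al x)}.
  by move=> Uy; exact: continuousM (Fc y Uy) (Dc y Uy).
have FD0 : supported U x0 r (fun x => F x * density al x).
  by move=> y Uy yQ; rewrite F0 ?mul0r.
have H0 := iterated_integral_eq0 (support_bound_ge0 x0 r0) (patch_csupp Uo QU FDc FD0).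
have /H0/(_ J0 x) : forall y, 0 <= ((fun x => F x * density al x) \_ U) y.
  move=> y; rewrite patchE; case: ifPn => // /set_mem Uy.
  by apply: mulr_ge0; [exact: Fp | exact/ltW/density_gt0].
rewrite patch_on // => /eqP; rewrite mulf_eq0 => /orP[/eqP//|].
by rewrite gt_eqF //; exact: density_gt0.
Qed.

Section Divergence.
Variable X : 'rV[R]_(m + m) -> 'rV[C]_(m + m).
Hypotheses (Xs : smooth_cmx_on U X) (X0 : forall x, U x -> ~ cbox r x0 x -> X x = 0).

Lemma cdiv_off x : U x -> ~ cbox r x0 x -> cdiv al X x = 0.
Proof.
have Os : open (U `&` ~` cbox r x0) by apply: openI => //; exact: cbox_coopen.
move=> Ux xQ; rewrite /cdiv big1 => [|a _]; last first.
  have -> : pd_cmx a X x = pd_cmx a (fun=> 0) x.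
    by apply: (pd_cmx_ext a Os _ (conj Ux xQ)) => y [Uy yQ]; exact: X0.
  by rewrite (dM_pd_cmx (dM_cst _ _ _)) mxE.
by rewrite add0r big1 // => a _; rewrite X0 // mxE mul0r.
Qed.

Lemma cdiv_smooth : smoothC U (cdiv al X).
Proof.
apply: (smoothC_add Uo).
  by apply: smoothC_sum => // a _; exact: (smooth_cmx_pd a Xs ord0 a).
apply: smoothC_sum => // a _; apply: (smoothC_mul Uo); first exact: Xs.
apply: (@smoothC_sum _ _ _ _ _ _ (fun j x => christ al a x j j) Uo) => j _.
exact: (christ_smooth al a j j).
Qed.

Lemma ext_divergence : 0 <= r ->
  I (ext al (fun x => complex.Re (cdiv al X x))) = 0 /\
  I (ext al (fun x => complex.Im (cdiv al X x))) = 0.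
Proof.
move=> r0; have [D1 D2] := divergence_integral r0 QU Xs X0.
have Ds := cdiv_smooth.
rewrite !ext_integral //.
- by move=> x Ux; exact: smooth_continuous Ds.2 Ux.
- by move=> x Ux xQ; rewrite cdiv_off.
- by move=> x Ux; exact: smooth_continuous Ds.1 Ux.
- by move=> x Ux xQ; rewrite cdiv_off.
Qed.

End Divergence.

End Box.

Lemma integral_sum (J : Type) (s : seq J) (f : J -> M -> R) : (forall j, continuous (f j)) ->
  I (fun p => \sum_(j <- s) f j p) = \sum_(j <- s) I (f j).
Proof.
move=> fc; have [ID IZ _] := HI; elim: s => [|j s IH].
  rewrite big_nil; have cc : continuous (fun _ : M => 0 : R) by move=> p; exact: cst_continuous.
  have := IZ 0 _ cc; rewrite [RHS]mul0r => J0; apply: etrans J0; congr I.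
  by apply/funext => p; rewrite big_nil mul0r.
have sc : continuous (fun p => \sum_(j <- s) f j p).
  by move=> p; have FF := nbhs_filter p;
    apply: cvg_big => [|k _]; [exact: add_continuous | exact: fc].
rewrite big_cons -IH -(ID _ _ (fc j) sc); congr I.
by apply/funext => p; rewrite big_cons.
Qed.

End FrameIntegral.

(** * Change of frame *)

Local Opaque smooth_on pd pd_cmx cov conn.

Section SmoothUnitaryRep.
Variables (R : realType) (N m d : nat) (V : unitary_rep R m d).
Local Notation C := R[i].
Local Notation pi := (urep_diff V).
Variables (U : set 'rV[R]_N) (w : 'rV[R]_N -> 'M[C]_m).
Hypotheses (Uo : open U) (ws : smooth_cmx_on U w) (wu : forall x, U x -> w x \is unitarymx).

(** The logarithmic derivative: d_a (V o w) = (V o w) L a. *)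
Let L a x := pi (adj (w x) *m pd_cmx a w x).

Let L_smooth a : smooth_cmx_on U (L a).
Proof.
apply: (smooth_cmx_linear _ Uo); apply: (smooth_cmx_mul Uo); last exact: smooth_cmx_pd.
exact: (smooth_cmx_tr (smooth_cmx_conj Uo ws)).
Qed.

Lemma dM_urep_smooth a x : U x ->
  dM (delta_mx ord0 a) (fun y => V (w y)) x (V (w x) *m L a x).
Proof.
move=> Ux; apply: dM_urep_unitary; last exact: smooth_cmx_dM ws Ux.
exact: near_open Uo Ux wu.
Qed.

Lemma unitary_entry_le1 n (u : 'M[C]_n) i j : u \is unitarymx ->
  `|complex.Re (u i j)| <= 1 /\ `|complex.Im (u i j)| <= 1.
Proof.
move=> /unitary_adjr/matrixP/(_ i i); rewrite !mxE eqxx => /(congr1 (@complex.Re R)).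
rewrite re_sum (bigD1 j) //= => E.
have : complex.Re (u i j) ^+ 2 + complex.Im (u i j) ^+ 2 <= 1.
  rewrite -[X in _ <= X]E; rewrite [X in _ <= X + _](_ : _ =
    complex.Re (u i j) ^+ 2 + complex.Im (u i j) ^+ 2).
    rewrite lerDl; apply: sumr_ge0 => k _; rewrite adjE reM reJ imJ mulrN opprK -!expr2.
    by rewrite addr_ge0 ?sqr_ge0.
  by rewrite adjE reM reJ imJ mulrN opprK -!expr2.
move: (complex.Re _) (complex.Im _) => a b ab.
have a2 := sqr_ge0 a; have b2 := sqr_ge0 b.
have le1 (z : R) : z ^+ 2 <= 1 -> `|z| <= 1.
  by move=> z1; rewrite ler_norml; apply/andP; split; nra.
by split; apply: le1; lra.
Qed.

(* [V] is only assumed differentiable along unitary curves at 1, but the partial derivatives of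
   the entries of [V (w x)] are polynomials in these entries and in smooth functions. *)
Lemma smooth_urep : smooth_cmx_on U (fun x => V (w x)).
Proof.
pose S : set ('rV[R]_N -> R) := smooth_on U `|`
  [set f | exists i j, f = (fun x => complex.Re (V (w x) i j)) \/
                       f = (fun x => complex.Im (V (w x) i j))].
have SR i j : gen U S (fun x => complex.Re (V (w x) i j)).
  by apply: gen_in; right; exists i, j; left.
have SI i j : gen U S (fun x => complex.Im (V (w x) i j)).
  by apply: gen_in; right; exists i, j; right.
have gsum (J : finType) (F : J -> 'rV[R]_N -> R) : (forall k, gen U S (F k)) ->
    gen U S (fun x => \sum_k F k x).
  move=> HF; elim: (index_enum J) => [|k s IH].
    by apply: gen_eq (gen_cst _ _ 0) _ => x _; rewrite big_nil.
  by apply: gen_eq (gen_add (HF k) IH) _ => x _; rewrite big_cons.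
have gN f : gen U S f -> gen U S (fun x => - f x).
  by move=> Sf; apply: gen_eq (gen_mul (gen_cst _ _ (-1)) Sf) _ => x _; rewrite mulN1r.
have LR a k j : gen U S (fun x => complex.Re (L a x k j)).
  by apply: gen_in; left; exact: (L_smooth a k j).1.
have LI a k j : gen U S (fun x => complex.Im (L a x k j)).
  by apply: gen_in; left; exact: (L_smooth a k j).2.
have dV a x i j Ux := dM_urep_smooth a (x := x) Ux i j.
have pdR a x i j : U x -> pd a (fun y => complex.Re (V (w y) i j)) x =
    \sum_k (complex.Re (V (w x) i k) * complex.Re (L a x k j)
          + - (complex.Im (V (w x) i k) * complex.Im (L a x k j))).
  move=> Ux; rewrite (is_derive_pd (dV a x i j Ux).1) mxE re_sum.
  by apply: eq_bigr => k _; rewrite reM.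
have pdI a x i j : U x -> pd a (fun y => complex.Im (V (w y) i j)) x =
    \sum_k (complex.Re (V (w x) i k) * complex.Im (L a x k j)
          + complex.Im (V (w x) i k) * complex.Re (L a x k j)).
  move=> Ux; rewrite (is_derive_pd (dV a x i j Ux).2) mxE im_sum.
  by apply: eq_bigr => k _; rewrite imM.
have H f : S f -> [/\ forall x, U x -> {for x, continuous f},
     forall x a, U x -> derivable f x (delta_mx ord0 a) & forall a, gen U S (pd a f)].
  move=> [/smooth_self[fc fd fp]|[i [j fE]]].
    by split; [exact: fc | exact: fd | move=> a; apply: gen_in; left; exact: fp].
  have fd x a : U x -> derivable f x (delta_mx ord0 a).
    by move=> Ux; case: fE => ->;
      [exact: (@ex_derive _ _ _ _ _ _ _ (dV a x i j Ux).1)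
      |exact: (@ex_derive _ _ _ _ _ _ _ (dV a x i j Ux).2)].
  have fg a : gen U S (pd a f).
    case: fE => ->.
      apply: (gen_eq (gsum _ (fun k x => complex.Re (V (w x) i k) * complex.Re (L a x k j)
          + - (complex.Im (V (w x) i k) * complex.Im (L a x k j))) _)) => [k|x Ux].
        by apply: gen_add; [exact: gen_mul | apply: gN; exact: gen_mul].
      by rewrite pdR.
    apply: (gen_eq (gsum _ (fun k x => complex.Re (V (w x) i k) * complex.Im (L a x k j)
          + complex.Im (V (w x) i k) * complex.Re (L a x k j)) _)) => [k|x Ux].
      by apply: gen_add; exact: gen_mul.
    by rewrite pdI.
  split=> // x Ux.
  (* The entries of V (w x) are not yet known to be continuous. Their partial derivatives are
     bounded near x, because entries of unitary matrices have size at most 1 and those of [L] are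
     continuous; then [partials_bounded_continuous] applies. *)
  have Lb (e : R) : 0 < e -> exists2 r : R, 0 < r & box r x `<=` U /\
      forall y, box r x y -> forall a k, `|complex.Re (L a y k j)| <= `|complex.Re (L a x k j)| + e
        /\ `|complex.Im (L a y k j)| <= `|complex.Im (L a x k j)| + e.
    move=> e0; suff : \forall y \near x, U y /\ forall a k,
        `|complex.Re (L a y k j)| <= `|complex.Re (L a x k j)| + e
        /\ `|complex.Im (L a y k j)| <= `|complex.Im (L a x k j)| + e.
      by move=> /nbhs_box[r r0 rP]; exists r => //; split=> y /rP[].
    apply: filterI; first exact: open_nbhs_nbhs.
    apply: (@filter_forall _ _ _ _ (nbhs_filter x)) => a.
    apply: (@filter_forall _ _ _ _ (nbhs_filter x)) => k.
    have [c1 c2] := smooth_cmx_continuous k j (L_smooth a) Ux.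
    have near_le (g : 'rV[R]_N -> R) : {for x, continuous g} ->
        nbhs x [set y | `|g y| <= `|g x| + e].
      move=> /continuous_box/(_ e e0)[q q0 qP]; apply/nbhs_box; exists q => // y /qP /ltW ge.
      rewrite /= -(subrK (g x) (g y)) addrC; apply: le_trans (ler_normD _ _) _.
      by rewrite lerD2l.
    exact: filterI (near_le _ c1) (near_le _ c2).
  have [r r0 [rU rL]] := Lb 1 ltr01.
  pose B := \sum_a \sum_k ((`|complex.Re (L a x k j)| + 1) + (`|complex.Im (L a x k j)| + 1)).
  apply: (@partials_bounded_continuous _ _ f x r B r0) => z xz.
    by move=> a; apply: fd; exact: rU.
  move=> a; have Uz := rU _ xz.
  have le1 (p q s t : R) : `|p| <= 1 -> `|q| <= s -> `|p * q| <= s.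
    by move=> p1 qs; rewrite normrM; apply: le_trans (ler_pM _ _ p1 qs) _ => //; rewrite mul1r.
  have Bge : \sum_k ((`|complex.Re (L a x k j)| + 1) + (`|complex.Im (L a x k j)| + 1)) <= B.
    rewrite /B [X in _ <= X](bigD1 a) //= lerDl; apply: sumr_ge0 => b _.
    by apply: sumr_ge0 => k _; rewrite !addr_ge0.
  apply: le_trans Bge.
  case: fE => ->; [rewrite pdR // | rewrite pdI //].
    apply: le_trans (ler_norm_sum _ _ _) _; apply: ler_sum => k _.
    have [v1 v2] := unitary_entry_le1 i k (urep_unitary V (wu Uz)).
    have [l1 l2] := rL _ xz a k.
    apply: le_trans (ler_normD _ _) _; rewrite normrN; apply: lerD.
      exact: le1 0 v1 l1.
    exact: le1 0 v2 l2.
  apply: le_trans (ler_norm_sum _ _ _) _; apply: ler_sum => k _.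
  have [v1 v2] := unitary_entry_le1 i k (urep_unitary V (wu Uz)).
  have [l1 l2] := rL _ xz a k.
  apply: le_trans (ler_normD _ _) _; rewrite addrC; apply: lerD.
    exact: le1 0 v2 l1.
  exact: le1 0 v1 l2.
by move=> i j; split; [exact: (gen_smooth Uo H (SR i j)) | exact: (gen_smooth Uo H (SI i j))].
Qed.

End SmoothUnitaryRep.

Local Opaque smooth_on pd pd_cmx cov conn.

(** * Transformation of frames and of the connection form *)

Section Transitions.
Variables (R : realType) (m : nat) (M : topologicalType) (K : kahler R m M).
Variables (al be : local_frame K).
Local Notation C := R[i].
Local Notation im := (Complex 0 1 : C).
Local Notation J := (cplx (stdJ R m)).
Local Notation c := (lfr_idx al).
Local Notation c' := (lfr_idx be).
Local Notation E := (lfr_mx al).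
Local Notation E' := (lfr_mx be).
Local Notation G' := (fun y => cplx (kmet (lfr_idx be) y)).
Implicit Types (x : 'rV[R]_(m + m)) (X : 'rV[C]_(m + m)).

(** The adjoint of the transformation law for (0,1) vectors, multiplied by w on both sides.
    Skew-adjointness of the connection forms turns it into the law for (1,0) vectors. *)
Lemma conn_change_algebra (A A' B B' w dw dw' : 'M[C]_m) : w \is unitarymx ->
  A = - adj A' -> B = - adj B' -> w *m adj dw' = - (dw *m adj w) ->
  A' *m w = dw' + w *m B' -> A *m w = dw + w *m B.
Proof.
move=> wu AE BE wd /(congr1 (fun X : 'M[C]_m => w *m adj X *m w)).
rewrite adjM adjD adjM !mulmxA (unitary_adjr wu) mul1mx mulmxDr mulmxDl wd AE BE.
rewrite mulNmx -(mulmxA dw) -(mulmxA w) -(mulmxA (adj B')) (unitary_adjl wu) !mulmx1 => E.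
by rewrite !mulNmx E opprD opprK mulmxN.
Qed.

Definition chart_overlap : set 'rV[R]_(m + m) :=
  [set x | kcod c x /\ kdom c' (kinv c x)].

Definition trans x := kchart c' (kinv c x).

Definition overlap : set 'rV[R]_(m + m) :=
  [set x | [/\ lfr_dom al x, kdom c' (kinv c x) & lfr_dom be (trans x)]].

Lemma overlap_chart x : overlap x -> chart_overlap x.
Proof. by case=> Ux cx _; split=> //; exact: (@lfr_sub _ _ _ _ al). Qed.

Lemma trans_smooth : smooth_mx_on chart_overlap trans.
Proof. exact: ktrans_smooth. Qed.

Lemma trans_continuous x : kcod c x -> kdom c' (kinv c x) -> {for x, continuous trans}.
Proof.
move=> cx dx; apply: (@continuous_comp _ _ _ (kinv c) (kchart c')).
  exact: kinv_cont.
exact: kchart_cont.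
Qed.

Lemma chart_overlap_open : open chart_overlap.
Proof.
rewrite openE => x [cx dx]; apply: filterI.
  by apply: open_nbhs_nbhs; split=> //; exact: kcod_open.
by apply: (kinv_cont cx); apply: open_nbhs_nbhs; split=> //; exact: kdom_open.
Qed.

Lemma overlap_open : open overlap.
Proof.
rewrite openE => x [Ux dx Uy].
have cx : kcod c x by exact: (@lfr_sub _ _ _ _ al).
have N1 : nbhs x (lfr_dom al).
  by apply: open_nbhs_nbhs; split=> //; exact: (@lfr_open _ _ _ _ al).
have N2 : nbhs x chart_overlap.
  by apply: open_nbhs_nbhs; split=> //; exact: chart_overlap_open.
have N3 : nbhs x (trans @^-1` lfr_dom be).
  apply: (trans_continuous cx dx); apply: open_nbhs_nbhs; split=> //.
  exact: (@lfr_open _ _ _ _ be).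
by apply: filterS3 N1 N2 N3 => y Uy' [_ dy] Uty; split.
Qed.

Lemma trans_pt x : overlap x -> lfr_pt be (trans x) = lfr_pt al x.
Proof. by case=> _ dx _; exact: kchartK. Qed.

Lemma pt_overlap x y : lfr_dom al x -> lfr_dom be y -> lfr_pt al x = lfr_pt be y ->
  overlap x /\ trans x = y.
Proof.
move=> Ux Uy xy; have cy : kcod c' y by exact: (@lfr_sub _ _ _ _ be).
have ty : trans x = y by rewrite /trans -/(lfr_pt al x) xy; exact: kinvK.
split=> //; split=> //; last by rewrite ty.
by rewrite -/(lfr_pt al x) xy; exact: kinv_dom.
Qed.

Definition djac x : 'M[C]_(m + m) := cplx (trans_jac c c' x).

Lemma djacE x a b : djac x a b = real_complex R (pd a (fun y => trans y ord0 b) x).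
Proof. by rewrite !mxE. Qed.

Lemma djac_holo x : overlap x -> djac x *m J = J *m djac x.
Proof.
move=> /overlap_chart[cx dx]; rewrite /djac /cplx -!map_mxM; congr (map_mx _ _).
exact: ktrans_holo.
Qed.

Lemma djac_met x : overlap x ->
  cplx (kmet c x) = djac x *m G' (trans x) *m (djac x)^T.
Proof.
move=> /overlap_chart[cx dx]; rewrite /djac /cplx map_trmx -!map_mxM.
by congr (map_mx _ _); exact: kmet_trans.
Qed.

Lemma djac_smooth : smooth_cmx_on overlap djac.
Proof.
apply: (smooth_cplx overlap_open) => a b.
apply: (@smooth_on_sub _ _ overlap chart_overlap); first exact: overlap_chart.
have H := smooth_pd a (trans_smooth ord0 b).
apply: (smooth_on_ext chart_overlap_open _ H) => x _.
by rewrite mxE.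
Qed.

Lemma adj_djac x : adj (djac x) = (djac x)^T.
Proof. by rewrite /adj /djac conjmx_cplx. Qed.

Lemma type10_djac p (A : 'M[C]_(p, m + m)) x : overlap x -> type10 A -> type10 (A *m djac x).
Proof. by move=> Ox A10; rewrite /type10 -mulmxA djac_holo // mulmxA A10 scalemxAl. Qed.

Lemma type01_djac p (A : 'M[C]_(p, m + m)) x : overlap x -> type01 A -> type01 (A *m djac x).
Proof. by move=> Ox A01; rewrite /type01 -mulmxA djac_holo // mulmxA A01 scalemxAl. Qed.

(** The matrix w with E D = w E', where D is the Jacobian of the coordinate change; it is read off
    by pairing E D with the unitary frame E'. The matrix u of [is_section] is its complex conjugate,
    see [frame_change_uniq]. *)
Definition frame_change x : 'M[C]_m :=
  E x *m djac x *m G' (trans x) *m adj (E' (trans x)).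

Lemma frame_changeE x : overlap x -> E x *m djac x = frame_change x *m E' (trans x).
Proof.
move=> Ox; have [Ux _ Uy] := Ox.
exact: (type10_frame Uy (type10_djac Ox (frame10 Ux))).
Qed.

Lemma frame_change_unitary x : overlap x -> frame_change x \is unitarymx.
Proof.
move=> Ox; have [Ux _ Uy] := Ox; apply/unitaryP.
have : frame_change x *m (E' (trans x) *m G' (trans x) *m adj (E' (trans x)))
    *m adj (frame_change x) = 1%:M.
  rewrite -(frameG Ux) (djac_met Ox) -adj_djac !mulmxA -(mulmxA (E x *m _)).
  rewrite -(mulmxA (frame_change x *m _ *m _)) -adjM -(frame_changeE Ox) adjM !mulmxA.
  by rewrite -(mulmxA (E x *m _)).
by rewrite (frameG Uy) mulmx1.
Qed.

Lemma frame_change_smooth : smooth_cmx_on overlap frame_change.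
Proof.
have Oo := overlap_open.
have S1 : smooth_cmx_on overlap E.
  by apply: smooth_cmx_sub (@lfr_smooth _ _ _ _ al) => x [].
have ts : smooth_mx_on overlap trans.
  by move=> i j; apply: smooth_on_sub (trans_smooth i j); exact: overlap_chart.
have Eo := @lfr_open _ _ _ _ be.
have tU x : overlap x -> lfr_dom be (trans x) by case.
have S2 : smooth_cmx_on overlap (fun x => E' (trans x)).
  exact: (smooth_cmx_comp Oo Eo ts (@lfr_smooth _ _ _ _ be) tU).
have S3 : smooth_cmx_on overlap (fun x => G' (trans x)).
  exact: (smooth_cmx_comp Oo Eo ts (met_smooth be) tU).
apply: (smooth_cmx_mul Oo); last exact: (smooth_cmx_tr (smooth_cmx_conj Oo S2)).
by apply: (smooth_cmx_mul Oo _ S3); apply: (smooth_cmx_mul Oo S1); exact: djac_smooth.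
Qed.

Lemma frame_change_uniq x u : overlap x -> u \is unitarymx ->
  E' (trans x) = u^T *m E x *m djac x -> u = conjmx (frame_change x).
Proof.
move=> Ox uu EE; have [Ux _ Uy] := Ox.
have uE : conjmx u *m E' (trans x) = E x *m djac x.
  rewrite EE !mulmxA (_ : conjmx u *m u^T = 1%:M) ?mul1mx //.
  by have := unitary_adjr (conj_unitary uu); rewrite /adj conjmxK.
rewrite /frame_change -uE -(mulmxA (conjmx u)) -(mulmxA (conjmx u)) (frameG Uy) mulmx1.
by rewrite conjmxK.
Qed.

Lemma frame_change_rel x : overlap x ->
  E' (trans x) = (conjmx (frame_change x))^T *m E x *m djac x.
Proof.
move=> Ox; rewrite -mulmxA frame_changeE // mulmxA -/(adj _).
by rewrite unitary_adjl ?mul1mx //; exact: frame_change_unitary.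
Qed.

Lemma eps_djac k x : overlap x ->
  eps al k x *m djac x = \sum_l frame_change x k l *: eps be l (trans x).
Proof.
move=> Ox; rewrite /eps -row_mul frame_changeE // row_mul.
rewrite mulmx_sum_row; apply: eq_bigr => l _; by rewrite mxE.
Qed.

Lemma epsbar_djac k x : overlap x ->
  epsbar al k x *m djac x = \sum_l Num.conj (frame_change x k l) *: epsbar be l (trans x).
Proof.
move=> Ox; have := congr1 (@Defs.conjmx R _ _) (eps_djac k Ox).
rewrite conjmxM conjmx_cplx conjmx_sum => ->; apply: eq_bigr => l _.
by rewrite conjmxZ.
Qed.

Lemma dirD_trans p q (F : 'rV[R]_(m + m) -> 'M[C]_(p, q)) X x : overlap x ->
  smooth_cmx_on (lfr_dom be) F ->
  diff_at (fun y => F (trans y)) x /\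
  dirD X (fun y => F (trans y)) x = dirD (X *m djac x) F (trans x).
Proof.
move=> Ox Fs; have Eo := @lfr_open _ _ _ _ be; have [_ _ Uy] := Ox.
have ts : smooth_mx_on overlap trans.
  by move=> i j; apply: smooth_on_sub (trans_smooth i j); exact: overlap_chart.
have H a := dM_comp a Eo ts Fs Ox Uy.
split; first exact: dM_diff_at H.
rewrite (dirDE X H) /dirD; under eq_bigr do rewrite scaler_sumr.
rewrite exchange_big; apply: eq_bigr => b _ /=; rewrite mxE scaler_suml.
by apply: eq_bigr => a _; rewrite djacE scalerA.
Qed.

(* d(E D) along a (0,1) vector is of type (1,0) as a derivative of E D, and of type (0,1)
   by the symmetry of second derivatives. *)
Lemma dirD_djac_type01 k X x : overlap x -> type01 X -> eps al k x *m dirD X djac x = 0.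
Proof.
move=> Ox X01; have Oo := overlap_open; have [Ux _ _] := Ox.
have Dd := smooth_diff_at djac_smooth Ox.
have sym : eps al k x *m dirD X djac x = X *m dirD (eps al k x) djac x.
  apply/rowP => b; rewrite !mxE.
  transitivity (\sum_a \sum_a' eps al k x ord0 a * (X ord0 a' * pd_cmx a' djac x a b)).
    apply: eq_bigr => a _; rewrite /dirD summxE mulr_sumr.
    by apply: eq_bigr => a' _; congr (_ * _); exact: mxE.
  rewrite exchange_big; apply: eq_bigr => a' _ /=; rewrite /dirD summxE mulr_sumr.
  apply: eq_bigr => a _; rewrite [in RHS]mxE mulrCA; congr (_ * (_ * _)).
  have cc i j l : pd_cmx i djac x j l =
      real_complex R (pd i (pd j (fun y => trans y ord0 l)) x).
    rewrite /djac pd_cmx_cplx; congr (real_complex R (pd i _ x)).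
    by apply/funext => y; rewrite mxE.
  apply: etrans (cc a' a b) _; apply: etrans _ (esym (cc a a' b)); apply: congr1.
  exact: (pdC _ _ chart_overlap_open (trans_smooth ord0 b) (overlap_chart Ox)).
have DJ Y : dirD Y djac x *m J = J *m dirD Y djac x.
  rewrite -(dirD_mulC _ _ Dd) -(dirD_Cmul _ _ Dd).
  by apply: (dirD_ext _ Oo _ Ox) => y Oy; exact: djac_holo.
have t10 : type10 (eps al k x *m dirD X djac x).
  by rewrite /type10 -mulmxA DJ mulmxA (eps10 k Ux) scalemxAl.
have t01 : type01 (eps al k x *m dirD X djac x).
  by rewrite sym /type01 -mulmxA DJ mulmxA X01 scalemxAl.
move: t10; rewrite /type10 t01 scaleNr => /eqP; rewrite eq_sym => /eqP/opp_eq0/eqP.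
by rewrite scaler_eq0 (negbTE (im_neq0 R)) => /eqP.
Qed.

(** Differentiate E D = w E' along X and apply Chern's formula to both frames; the derivative of D
    drops out by [dirD_djac_type01]. *)
Lemma conn_frame_change01 X x : overlap x -> type01 X ->
  (conn al X x)^T *m frame_change x =
  dirD X frame_change x + frame_change x *m (conn be (X *m djac x) (trans x))^T.
Proof.
move=> Ox X01; have [Ux _ Uy] := Ox; have Oo := overlap_open.
have Dd := smooth_diff_at djac_smooth Ox.
have Ed := smooth_diff_at (@lfr_smooth _ _ _ _ al) Ux.
have Wd := smooth_diff_at frame_change_smooth Ox.
have [Ed' Ed'E] := dirD_trans X Ox (@lfr_smooth _ _ _ _ be).
have := dirD_ext X Oo frame_changeE Ox.
rewrite (dirD_mul _ Ed Dd) (dirD_mul _ Wd Ed') Ed'E.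
rewrite (chern Ux X01) (chern Uy (type01_djac Ox X01)).
have -> : E x *m dirD X djac x = 0.
  apply/row_matrixP => k; rewrite row_mul row0.
  exact: (dirD_djac_type01 k Ox X01).
rewrite addr0 -mulmxA (frame_changeE Ox) !mulmxA -mulmxDl.
move=> /(congr1 (fun A => A *m (G' (trans x) *m adj (E' (trans x))))).
by rewrite -!(mulmxA _ (E' _)) !(mulmxA (E' _)) (frameG Uy) !mulmx1.
Qed.

Lemma dirD_unitary_adj X x : overlap x ->
  frame_change x *m dirD X (fun y => adj (frame_change y)) x =
  - (dirD X frame_change x *m adj (frame_change x)).
Proof.
move=> Ox; have Oo := overlap_open; have Wd := smooth_diff_at frame_change_smooth Ox.
have H : dirD X (fun y => frame_change y *m adj (frame_change y)) x = 0.
  rewrite -(dirD_cst X (1%:M : 'M[C]_m) x); apply: (dirD_ext _ Oo _ Ox) => y Oy.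
  by apply: unitary_adjr; exact: frame_change_unitary.
by move: H; rewrite (dirD_mul _ Wd (diff_at_adj Wd)) addrC => /eqP; rewrite addr_eq0 => /eqP.
Qed.

(** Chern's formula covers the conjugate of X; the adjoint of that case gives this one. *)
Lemma conn_frame_change10 X x : overlap x -> type10 X ->
  (conn al X x)^T *m frame_change x =
  dirD X frame_change x + frame_change x *m (conn be (X *m djac x) (trans x))^T.
Proof.
move=> Ox X10; have [Ux _ Uy] := Ox; have X01 := type10_conj X10.
have Wd := smooth_diff_at frame_change_smooth Ox.
have wu := frame_change_unitary Ox.
have trC (A : 'M[C]_m) : A^T = adj (conjmx A) by rewrite /adj conjmxK.
have cE : (conn al X x)^T = - adj ((conn al (conjmx X) x)^T).
  rewrite (conn_adj X Ux) raddfN /=; congr (- _); rewrite !adj_t.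
  by apply/matrixP => i j; rewrite !mxE.
have cE' : (conn be (X *m djac x) (trans x))^T =
    - adj ((conn be (conjmx X *m djac x) (trans x))^T).
  rewrite (conn_adj _ Uy) raddfN /=; congr (- _); rewrite conjmxM conjmx_cplx !adj_t.
  by apply/matrixP => i j; rewrite !mxE.
have dE : adj (dirD (conjmx X) frame_change x) = dirD X (fun y => adj (frame_change y)) x.
  by rewrite (dirD_adj _ Wd).
apply: (conn_change_algebra wu cE cE' _ (conn_frame_change01 Ox X01)).
by rewrite dE; exact: dirD_unitary_adj.
Qed.

End Transitions.

(** * Sections *)

Local Opaque smooth_on pd pd_cmx cov conn frame_change.

Lemma smooth_cmx_local (R : realType) N p q (U : set 'rV[R]_N) (F : 'rV[R]_N -> 'M[R[i]]_(p, q)) :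
  (forall x, U x -> exists B, [/\ open B, B x & smooth_cmx_on B F]) -> smooth_cmx_on U F.
Proof.
move=> H i j; split; apply: smooth_on_bigcup => x /H[B [Bo Bx Fs]].
  by have [r r0 rB] := (openP B).1 Bo x Bx; exists r => //; apply: smooth_on_sub rB (Fs i j).1.
by have [r r0 rB] := (openP B).1 Bo x Bx; exists r => //; apply: smooth_on_sub rB (Fs i j).2.
Qed.

Section Cocycle.
Variables (R : realType) (m : nat) (M : topologicalType) (K : kahler R m M).
Local Notation C := R[i].
Implicit Types (al be ga : local_frame K) (x y : 'rV[R]_(m + m)).

Definition transition al be x : 'M[C]_m := conjmx (frame_change al be x).

Lemma transition_unitary al be x : overlap al be x -> transition al be x \is unitarymx.
Proof. by move=> Ox; apply: conj_unitary; exact: frame_change_unitary. Qed.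

Lemma transition_smooth al be : smooth_cmx_on (overlap al be) (transition al be).
Proof. exact: (smooth_cmx_conj (@overlap_open _ _ _ _ al be) (frame_change_smooth al be)). Qed.

Lemma self_overlap al x : lfr_dom al x -> overlap al al x /\ trans al al x = x.
Proof. by move=> Ux; exact: (pt_overlap Ux Ux erefl). Qed.

Lemma djac_self al x : lfr_dom al x -> djac al al x = 1%:M.
Proof.
move=> Ux; apply/matrixP => a b; rewrite djacE mxE.
have co : open (kcod (lfr_idx al)) by exact: kcod_open.
have -> : pd a (fun y => trans al al y ord0 b) x = pd a (fun y : 'rV[R]_(m + m) => y ord0 b) x.
  apply: (pd_ext a co _ (@lfr_sub _ _ _ _ al x Ux)) => y cy.
  by rewrite /trans kinvK.
rewrite (is_derive_pd (is_derive_coord b x (delta_mx ord0 a))) mxE eqxx [b == a]eq_sym.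
by case: (a == b).
Qed.

Lemma transition_self al x : lfr_dom al x -> transition al al x = 1%:M.
Proof.
move=> Ux; have [Ox tx] := self_overlap Ux; apply: esym; apply: frame_change_uniq => //.
  by apply/unitaryP; rewrite adj1 mulmx1.
by rewrite djac_self // mulmx1 trmx1 mul1mx tx.
Qed.

Lemma djac_cocycle al be ga x : overlap al be x -> overlap be ga (trans al be x) ->
  overlap al ga x ->
  djac al ga x = djac al be x *m djac be ga (trans al be x).
Proof.
move=> O1 O2 O3; apply/matrixP => a b; rewrite djacE mxE.
under eq_bigr do rewrite !djacE -rmorphM /=; rewrite -rmorph_sum; apply: congr1.
have H := smooth_is_derive_comp a (@chart_overlap_open _ _ _ _ be ga)
  (@trans_smooth _ _ _ _ al be) (@trans_smooth _ _ _ _ be ga ord0 b) (overlap_chart O1) (overlap_chart O2).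
rewrite -(is_derive_pd H); apply: (pd_ext a (@overlap_open _ _ _ _ al be) _ O1) => y [_ dy _] /=.
by rewrite /trans kchartK.
Qed.

(** The product relates the frames al and ga, and the relating unitary matrix is unique. *)
Lemma transition_cocycle al be ga x : overlap al be x -> overlap be ga (trans al be x) ->
  [/\ overlap al ga x, trans al ga x = trans be ga (trans al be x) &
  transition al ga x = transition al be x *m transition be ga (trans al be x)].
Proof.
move=> O1 O2; have [Ux _ Uy] := O1; have [_ _ Uz] := O2.
have [ov3 tE] : overlap al ga x /\ trans al ga x = trans be ga (trans al be x).
  by apply: pt_overlap => //; rewrite (trans_pt O2) (trans_pt O1).
split=> //; apply: esym; apply: frame_change_uniq => //.
  by apply: mul_unitary; exact: transition_unitary.
rewrite tE (frame_change_rel O2) (frame_change_rel O1) (djac_cocycle O1 O2 ov3).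
by rewrite trmx_mul !mulmxA.
Qed.

Section Action.
Variables (d e : nat) (act : 'M[C]_m -> 'M[C]_(d, e) -> 'M[C]_(d, e)).
Variable W : {vspace 'M[C]_(d, e)}.

(** [is_section] quantifies over all u that relate two frames. Here the canonical one is inserted;
    [is_sectionI] goes back by uniqueness. *)
Lemma section_transition phi al be x : is_section act W phi -> overlap al be x ->
  phi al x = act (transition al be x) (phi be (trans al be x)).
Proof.
move=> [_ _ H] Ox; have [Ux _ Uy] := Ox; apply: H => //.
- by rewrite trans_pt.
- exact: transition_unitary.
- by rewrite /transition (frame_change_rel Ox).
Qed.

Lemma is_sectionI (phi : field K d e) :
  (forall al, smooth_cmx_on (lfr_dom al) (phi al)) ->
  (forall al x, lfr_dom al x -> phi al x \in W) ->
  (forall al be x, overlap al be x ->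
     phi al x = act (transition al be x) (phi be (trans al be x))) ->
  is_section act W phi.
Proof.
move=> H1 H2 H3; split=> // al be x y u Ux Uy xy uu EE.
have [Ox tx] := pt_overlap Ux Uy xy; rewrite (H3 al be x Ox) tx; congr (act _ _).
by apply: esym; apply: frame_change_uniq => //; rewrite tx.
Qed.

End Action.

Section FibreDot.
Variables (d e : nat) (act : 'M[C]_m -> 'M[C]_(d, e) -> 'M[C]_(d, e)).
Hypothesis act_hdot : forall u A B, u \is unitarymx -> hdot (act u A) (act u B) = hdot A B.
Variables (W W' : {vspace 'M[C]_(d, e)}) (phi psi : field K d e).
Hypotheses (phis : is_section act W phi) (psis : is_section act W' psi).

(** The frame picked by [xget] is immaterial, since two frames at a point give values that differ by
    a unitary action. *)
Lemma fibre_dotE al x : lfr_dom al x ->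
  fibre_dot phi psi (lfr_pt al x) = hdot (phi al x) (psi al x).
Proof.
move=> Ux; rewrite /fibre_dot.
have [|be [y [Uy yx ->]]] := @xgetPex _ 0 [set z | exists be y,
    [/\ lfr_dom be y, lfr_pt be y = lfr_pt al x & z = hdot (phi be y) (psi be y)]].
  by exists (hdot (phi al x) (psi al x)), al, x.
have [Ox tx] := pt_overlap Ux Uy (esym yx).
rewrite (section_transition phis Ox) (section_transition psis Ox) tx act_hdot //.
exact: transition_unitary.
Qed.

Lemma fibre_dot0 p : (forall al x, lfr_dom al x -> lfr_pt al x = p ->
  hdot (phi al x) (psi al x) = 0) -> fibre_dot phi psi p = 0.
Proof.
move=> H; rewrite /fibre_dot; case: xgetP => // z _ [al [x [Ux xp ->]]].
exact: H.
Qed.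

Lemma fibre_dot_ext al (r : R) x0 p :
  (forall be y, lfr_dom be y -> ~ box_image al x0 r (lfr_pt be y) -> phi be y = 0) ->
  cbox r x0 `<=` lfr_dom al ->
  complex.Re (fibre_dot phi psi p) = ext al (fun x => complex.Re (hdot (phi al x) (psi al x))) p /\
  complex.Im (fibre_dot phi psi p) = ext al (fun x => complex.Im (hdot (phi al x) (psi al x))) p.
Proof.
move=> phi0 QU; have [[x [Ux <-]]|H] := pselect (exists x, lfr_dom al x /\ lfr_pt al x = p).
  by rewrite fibre_dotE // !(ext_pt _ Ux).
have H' x : lfr_dom al x -> lfr_pt al x <> p by move=> Ux xp; apply: H; exists x.
rewrite !(ext_off _ H') fibre_dot0 // => be y Uy yp; rewrite phi0 ?hdot0l // yp.
by move=> [x /QU Ux]; exact: H'.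
Qed.

End FibreDot.

Section Derivatives.
Variables (d : nat) (V : unitary_rep R m d).
Local Notation pi := (urep_diff V).
Variable phi : field K d 1.
Hypothesis phis : sections K V phi.

Lemma adj_transition al be x : adj (transition al be x) = (frame_change al be x)^T.
Proof. by rewrite /transition /adj conjmxK. Qed.

(** The gauge transformation law u^* A u + u^* du, on vectors of pure type, where Chern's formula or
    its adjoint provides it. *)
Lemma conn_transition al be X x : overlap al be x -> type10 X \/ type01 X ->
  conn be (X *m djac al be x) (trans al be x) =
  adj (transition al be x) *m conn al X x *m transition al be x
  + adj (transition al be x) *m dirD X (transition al be) x.
Proof.
move=> Ox X1; have Td := smooth_diff_at (transition_smooth al be) Ox.
have uu := transition_unitary Ox.
have Wd := smooth_diff_at (frame_change_smooth al be) Ox.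
have E0 : (conn al X x)^T *m frame_change al be x =
    dirD X (frame_change al be) x
    + frame_change al be x *m (conn be (X *m djac al be x) (trans al be x))^T.
  by case: X1 => H; [exact: conn_frame_change10 | exact: conn_frame_change01].
have E : (frame_change al be x)^T *m conn al X x = (dirD X (frame_change al be) x)^T
    + conn be (X *m djac al be x) (trans al be x) *m (frame_change al be x)^T.
  by have := congr1 trmx E0; rewrite linearD /= !trmx_mul !trmxK.
rewrite -(adj_transition al be x) in E.
have F : adj (transition al be x) *m dirD X (transition al be) x =
    - ((dirD X (frame_change al be) x)^T *m transition al be x).
  have D1 : dirD X (fun y => adj (transition al be y)) x = (dirD X (frame_change al be) x)^T.
    rewrite -(dirD_tr _ Wd); apply: (dirD_ext _ (@overlap_open _ _ _ _ al be) _ Ox) => y _.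
    exact: adj_transition.
  have D2 : dirD X (fun y => adj (transition al be y) *m transition al be y) x = 0.
    rewrite -(dirD_cst X (1%:M : 'M[C]_m) x).
    apply: (dirD_ext _ (@overlap_open _ _ _ _ al be) _ Ox) => y Oy.
    by apply: unitary_adjl; exact: transition_unitary.
  by move: D2; rewrite (dirD_mul _ (diff_at_adj Td) Td) D1 addrC => /eqP; rewrite addr_eq0 => /eqP.
by rewrite F E mulmxDl -mulmxA (unitary_adjl uu) mulmx1 addrAC subrr add0r.
Qed.

Lemma product_rule_algebra (U P Q : 'M[C]_d) (f df : 'cV[C]_d) :
  U *m P *m f + U *m df + U *m Q *m f = U *m (df + (Q + P) *m f).
Proof. by rewrite mulmxDr mulmxDl mulmxDr !mulmxA addrAC [LHS]addrC (addrC (U *m P *m f)). Qed.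

Lemma dirD_urep al be X x : overlap al be x ->
  diff_at (fun y => V (transition al be y)) x /\
  dirD X (fun y => V (transition al be y)) x =
  V (transition al be x) *m pi (adj (transition al be x) *m dirD X (transition al be) x).
Proof.
move=> Ox; have H a := dM_urep_smooth V (@overlap_open _ _ _ _ al be)
  (transition_smooth al be) (@transition_unitary al be) a Ox.
split; first exact: dM_diff_at H.
rewrite (dirDE X H) /dirD mulmx_sumr raddf_sum mulmx_sumr; apply: eq_bigr => a _.
have -> : adj (transition al be x) *m (X ord0 a *: pd_cmx a (transition al be) x) =
    X ord0 a *: (adj (transition al be x) *m pd_cmx a (transition al be) x).
  by rewrite scalemxAr.
apply: etrans (scalemxAr _ _ _) _; apply: congr1; exact: (esym (urep_diffZ V (X ord0 a) _)).
Qed.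

Lemma cov_transition al be v x : overlap al be x -> type10 (v x) \/ type01 (v x) ->
  cov V al v (phi al) x =
  V (transition al be x) *m cov V be (fun=> v x *m djac al be x) (phi be) (trans al be x).
Proof.
move=> Ox v1; have uu := transition_unitary Ox.
have [Vd VE] := dirD_urep (v x) Ox.
have [[fs _ _] _] := (phis, phis); have [Fd FE] := dirD_trans (v x) Ox (fs be).
have Oo := @overlap_open _ _ _ _ al be.
have phiE y : overlap al be y ->
    phi al y = V (transition al be y) *m phi be (trans al be y).
  by move=> Oy; exact: (section_transition phis Oy).
rewrite !cov_dirD (dirD_ext (v x) Oo phiE Ox) (dirD_mul _ Vd Fd) VE FE (phiE x Ox).
rewrite (conn_transition Ox v1) (raddfD pi) /=.
rewrite mulmxA (_ : pi (conn al (v x) x) *m V (transition al be x) =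
    V (transition al be x) *m pi (adj (transition al be x) *m conn al (v x) x *m transition al be x)); last first.
  have VV := unitary_adjl (urep_unitary V uu).
  have := urep_diff_conj V (adj (transition al be x) *m conn al (v x) x *m transition al be x) uu.
  rewrite !mulmxA (unitary_adjr uu) mul1mx -(mulmxA (conn _ _ _)) (unitary_adjr uu) mulmx1.
  by move=> <-; rewrite -mulmxA VV mulmx1.
exact: product_rule_algebra.
Qed.

Lemma cov_lin al v x (J : finType) (c : J -> C) (v1 : J -> 'rV[R]_(m + m) -> 'rV[C]_(m + m)) f :
  v x = \sum_j c j *: v1 j x ->
  cov V al v f x = \sum_j c j *: cov V al (v1 j) f x.
Proof.
move=> vE; have covS : \sum_j c j *: cov V al (v1 j) f x =
    \sum_a (\sum_j c j *: v1 j x) ord0 a *: covC al V a f x.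
  under eq_bigr do rewrite covE scaler_sumr.
  rewrite exchange_big; apply: eq_bigr => a _ /=; rewrite summxE scaler_suml.
  by apply: eq_bigr => j _; rewrite mxE scalerA.
by apply: etrans (covE _ _ _ _ _) _; apply: etrans (esym covS); rewrite vE.
Qed.

(** The covariant derivative is tensorial in its direction, and the frame eps transforms by w = conj
    u; this produces the factor conj u in the action on V (x) conj(C^m). *)
Lemma nabla10_transition al be x : overlap al be x ->
  nabla10 V phi al x = actm V (transition al be x) (nabla10 V phi be (trans al be x)).
Proof.
move=> Ox; have [Ux _ Uy] := Ox; apply/matrixP => i k; rewrite mxE.
rewrite (cov_transition Ox (or_introl (eps10 k Ux))).
have CE := @cov_lin be (fun=> eps al k x *m djac al be x) (trans al be x) _
  (fun l => frame_change al be x k l) (fun l => eps be l) (phi be) (eps_djac k Ox).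
rewrite CE /actm /tensor_act -mulmxA !mxE.
apply: eq_bigr => j _; congr (_ * _); rewrite summxE mxE.
apply: eq_bigr => l _; rewrite [LHS]mxE [LHS]mulrC; congr (_ * _); first by rewrite [RHS]mxE.
by rewrite /transition conjmxK [RHS]mxE.
Qed.

Lemma nabla01_transition al be x : overlap al be x ->
  nabla01 V phi al x = actp V (transition al be x) (nabla01 V phi be (trans al be x)).
Proof.
move=> Ox; have [Ux _ Uy] := Ox; apply/matrixP => i k; rewrite mxE.
rewrite (cov_transition Ox (or_intror (epsbar01 k Ux))).
have CE := @cov_lin be (fun=> epsbar al k x *m djac al be x) (trans al be x) _
  (fun l => Num.conj (frame_change al be x k l)) (fun l => epsbar be l) (phi be) (epsbar_djac k Ox).
rewrite CE /actp /tensor_act -mulmxA !mxE.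
apply: eq_bigr => j _; congr (_ * _); rewrite summxE mxE.
apply: eq_bigr => l _; rewrite [LHS]mxE [LHS]mulrC; congr (_ * _); first by rewrite [RHS]mxE.
by rewrite 2![RHS]mxE.
Qed.

Lemma row_block_algebra (A : 'M[C]_d) (B D : 'M[C]_(d, m)) (u w : 'M[C]_m) :
  row_mx (A *m B *m u^T) (A *m D *m w^T) = A *m row_mx B D *m (block_mx u 0 0 w)^T.
Proof. by rewrite mul_mx_row tr_block_mx !trmx0 mul_row_block !mulmx0 addr0 add0r. Qed.

Lemma nabla_transition al be x : overlap al be x ->
  nabla V phi al x = actpm V (transition al be x) (nabla V phi be (trans al be x)).
Proof.
move=> Ox; rewrite /nabla (nabla01_transition Ox) (nabla10_transition Ox) /actpm /actp /actm /tensor_act.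
exact: row_block_algebra.
Qed.

Lemma nabla10_smooth al : smooth_cmx_on (lfr_dom al) (nabla10 V phi al).
Proof.
move=> i k; have [fs _ _] := phis.
have H := cov_smooth V (smooth_eps al k) (fs al).
have Uo := @lfr_open _ _ _ _ al.
have := smoothC_ext Uo _ (H i ord0); apply=> x _.
by rewrite [RHS]mxE.
Qed.

Lemma nabla01_smooth al : smooth_cmx_on (lfr_dom al) (nabla01 V phi al).
Proof.
move=> i k; have [fs _ _] := phis.
have Uo := @lfr_open _ _ _ _ al.
have H := cov_smooth V (smooth_cmx_conj Uo (smooth_eps al k)) (fs al).
have := smoothC_ext Uo _ (H i ord0); apply=> x _.
by rewrite [RHS]mxE.
Qed.

Lemma nabla_section : is_section (actpm V) fullv (nabla V phi).
Proof.
apply: is_sectionI => [al|al x _|al be x Ox].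
- exact: smooth_cmx_row_mx (nabla01_smooth al) (nabla10_smooth al).
- exact: memvf.
- exact: nabla_transition.
Qed.

Lemma grad_m_section (P : 'I_m -> 'End('M[C]_(d, m))) i :
  (forall u A, u \is unitarymx -> P i (actm V u A) = actm V u (P i A)) ->
  is_section (actm V) (limg (P i)) (grad_m V P i phi).
Proof.
move=> Pe; apply: is_sectionI => [al|al x _|al be x Ox].
- exact: (smooth_cmx_linear (P i) (@lfr_open _ _ _ _ al) (nabla10_smooth al)).
- by apply: memv_img; exact: memvf.
- by rewrite /grad_m (nabla10_transition Ox) Pe //; exact: transition_unitary.
Qed.

Lemma grad_p_section (P : 'I_m -> 'End('M[C]_(d, m))) i :
  (forall u A, u \is unitarymx -> P i (actp V u A) = actp V u (P i A)) ->
  is_section (actp V) (limg (P i)) (grad_p V P i phi).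
Proof.
move=> Pe; apply: is_sectionI => [al|al x _|al be x Ox].
- exact: (smooth_cmx_linear (P i) (@lfr_open _ _ _ _ al) (nabla01_smooth al)).
- by apply: memv_img; exact: memvf.
- by rewrite /grad_p (nabla01_transition Ox) Pe //; exact: transition_unitary.
Qed.

End Derivatives.

Section Bump.
Hypothesis Mhausdorff : hausdorff_space M.
Variables (d : nat) (V : unitary_rep R m d) (al : local_frame K) (x0 : 'rV[R]_(m + m)) (r : R).
Variable v : 'rV[R]_(m + m) -> 'cV[C]_d.
Local Notation U := (lfr_dom al).
Hypotheses (QU : cbox r x0 `<=` U) (vs : smooth_cmx_on U v)
  (v0 : forall x, U x -> ~ cbox r x0 x -> v x = 0).

(** The global section that is v in the frame al and 0 away from its domain. Vanishing of v outside
    a box makes it smooth. *)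
Definition local_section : field K d 1 := fun be y =>
  if `[< overlap be al y >] then V (transition be al y) *m v (trans be al y) else 0.

Lemma local_section_off be y : lfr_dom be y -> ~ box_image al x0 r (lfr_pt be y) ->
  local_section be y = 0.
Proof.
move=> Uy yQ; rewrite /local_section; case: asboolP => // Oy; have [_ _ Ux] := Oy.
rewrite v0 ?mulmx0 // => xQ; apply: yQ; exists (trans be al y) => //.
exact: trans_pt.
Qed.

Lemma local_section_self x : U x -> local_section al x = v x.
Proof.
move=> Ux; have [Ox tx] := self_overlap Ux.
by rewrite /local_section asboolT // transition_self // urep_1 mul1mx tx.
Qed.

Lemma local_section_smooth be : smooth_cmx_on (lfr_dom be) (local_section be).
Proof.
apply: smooth_cmx_local => y Uy; have [Oy|Oy] := pselect (overlap be al y).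
  have Oo := @overlap_open _ _ _ _ be al.
  exists (overlap be al); split=> //.
  apply: (smooth_cmx_ext Oo (F := fun y => V (transition be al y) *m v (trans be al y))).
    by move=> z Oz; rewrite /local_section asboolT.
  apply: (smooth_cmx_mul Oo).
    exact: (smooth_urep V Oo (transition_smooth be al) (@transition_unitary be al)).
  have ts : smooth_mx_on (overlap be al) (trans be al).
    by move=> i j; apply: smooth_on_sub (@trans_smooth _ _ _ _ be al i j); exact: overlap_chart.
  by apply: (smooth_cmx_comp Oo (@lfr_open _ _ _ _ al) ts vs) => z [].
pose B := lfr_dom be `&` [set z | ~ box_image al x0 r (lfr_pt be z)].
have Bo : open B by exact: (box_coimage_open Mhausdorff QU).
exists B; split=> //.
  split=> // -[x /QU Ux xy]; apply: Oy.
  exact: (pt_overlap Uy Ux (esym xy)).1.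
apply: (smooth_cmx_ext Bo (F := fun=> 0)); last exact: smooth_cmx_cst.
by move=> z [Uz zQ]; rewrite local_section_off.
Qed.

Lemma local_sectionP : sections K V local_section.
Proof.
apply: is_sectionI => [be|be y _|be ga y Oy].
- exact: local_section_smooth.
- exact: memvf.
have [Uy _ Uz] := Oy; have [h1|h1] := pselect (overlap ga al (trans be ga y)).
  have [ov2 tE uE] := transition_cocycle Oy h1.
  rewrite /local_section !asboolT // tE uE /act0 urep_mul; last exact: transition_unitary.
    by rewrite mulmxA.
  exact: transition_unitary.
rewrite {2}/local_section asboolF // /act0 mulmx0 /local_section asboolF // => O2.
apply: h1; have [_ _ Ux] := O2; apply: (pt_overlap Uz Ux _).1.
by rewrite (trans_pt Oy) (trans_pt O2).
Qed.

End Bump.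

End Cocycle.

(** * Existence of frames *)

Local Opaque smooth_on pd pd_cmx.

Section Cholesky.
Variables (R : realType) (N : nat).
Local Notation C := R[i].
Local Notation E := 'rV[R]_N.
Variable U : set E.
Hypothesis Uo : open U.

Definition positive_definite n (A : 'M[C]_n) := adj A = A /\
  forall v : 'rV[C]_n, v != 0 -> 0 < complex.Re ((v *m A *m adj v) ord0 ord0).

Lemma adj_row p q r (A : 'M[C]_(p, q)) (B : 'M[C]_(p, r)) :
  adj (row_mx A B) = col_mx (adj A) (adj B).
Proof. by rewrite /adj /Defs.conjmx map_row_mx tr_row_mx. Qed.

Lemma hermitian_diag_real n (A : 'M[C]_n) i : adj A = A ->
  A i i = real_complex R (complex.Re (A i i)).
Proof.
move=> /matrixP/(_ i i); rewrite adjE => /(congr1 (@complex.Im R)); rewrite imJ => H.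
by apply: complexP => //=; lra.
Qed.

Section SchurComplement.
Variables (n : nat) (H : 'M[C]_(1 + n)).
Hypothesis Hpos : positive_definite H.

Let a : R := complex.Re (H ord0 ord0).
Let b : 'M[C]_(1, n) := ursubmx H.
(** Left multiplication by [P] clears the first column of H and leaves the Schur complement. *)
Let P : 'M[C]_(n, 1 + n) := row_mx (- (real_complex R a^-1 *: adj b)) 1%:M.

Definition schur_complement : 'M[C]_n := drsubmx H - real_complex R a^-1 *: (adj b *m b).

Lemma corner_gt0 : 0 < a.
Proof.
have [Hh Hp] := Hpos; have := Hp (delta_mx ord0 ord0); rewrite -rowE adj_delta -colE !mxE.
apply; apply/eqP => /matrixP/(_ ord0 ord0); rewrite !mxE /= => /eqP.
by rewrite oner_eq0.
Qed.

Lemma corner_block : H = block_mx (real_complex R a)%:M b (adj b) (drsubmx H).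
Proof.
have [Hh _] := Hpos; rewrite -{1}[H]submxK; congr block_mx.
  apply/matrixP => i j; rewrite !ord1 !mxE eqxx mulr1n.
  have -> : lshift n ord0 = ord0 :> 'I_(1 + n) by apply: val_inj.
  exact: hermitian_diag_real.
apply/matrixP => i j; rewrite -{1}Hh !mxE.
by [].
Qed.

Lemma schur_row : P *m H = row_mx 0 schur_complement.
Proof.
have a0 : real_complex R a != 0 by rewrite fmorph_eq0 gt_eqF //; exact: corner_gt0.
rewrite {1}corner_block /P mul_row_block !mul1mx; congr row_mx.
  rewrite mulNmx -scalemxAl mul_mx_scalar scalerA -rmorphM mulVf ?gt_eqF ?corner_gt0 //.
  by rewrite scale1r addNr.
by rewrite mulNmx -scalemxAl addrC.
Qed.

Lemma schur_adj : P *m H *m adj P = schur_complement.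
Proof. by rewrite schur_row adj_row mul_row_col mul0mx add0r adj1 mulmx1. Qed.

Lemma schur_positive : positive_definite schur_complement.
Proof.
have [Hh Hp] := Hpos; split; first by rewrite -schur_adj !adjM adjK Hh mulmxA.
move=> v v0; have := Hp (v *m P); rewrite adjM -mulmxA (mulmxA H) -(mulmxA v).
rewrite (mulmxA P) (mulmxA P) schur_adj mulmxA; apply.
apply: contra_neq v0 => /(congr1 (fun w : 'rV[C]_(1 + n) => rsubmx w)).
by rewrite /P mul_mx_row row_mxKr mulmx1 => ->; apply/matrixP => i j; rewrite !mxE.
Qed.

Definition cholesky_step (L : 'M[C]_n) : 'M[C]_(1 + n) :=
  col_mx (row_mx (real_complex R (Num.sqrt a)^-1)%:M 0) (L *m P).

Lemma cholesky_stepP L : L *m schur_complement *m adj L = 1%:M ->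
  cholesky_step L *m H *m adj (cholesky_step L) = 1%:M.
Proof.
move=> LS; have a0 := corner_gt0.
have sa : real_complex R (Num.sqrt a)^-1 * real_complex R a * real_complex R (Num.sqrt a)^-1 = 1.
  rewrite -!rmorphM /= -[X in _ * X * _]sqr_sqrtr ?ltW // expr2 mulrA mulVf ?mul1r.
    by rewrite mulfV ?rmorph1 // gt_eqF // sqrtr_gt0.
  by rewrite gt_eqF // sqrtr_gt0.
pose e : 'M[C]_(1, 1 + n) := row_mx (real_complex R (Num.sqrt a)^-1)%:M 0.
have eH : e *m H *m adj e = 1%:M.
  rewrite {1}corner_block /e mul_row_block !mul0mx !addr0 adj_row adj0 mul_row_col mulmx0 addr0.
  rewrite mul_scalar_mx -[X in _ *: X]/(real_complex R a)%:M scale_scalar_mx.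
  have -> : adj (real_complex R (Num.sqrt a)^-1)%:M = (real_complex R (Num.sqrt a)^-1)%:M :> 'M[C]_1.
    apply/matrixP => i j; rewrite adjE !ord1 !mxE eqxx !mulr1n.
    by apply: complexP => //=; rewrite oppr0.
  by rewrite -scalar_mxM sa.
have PHe : P *m H *m adj e = 0.
  by rewrite schur_row /e adj_row adj0 mul_row_col mul0mx mulmx0 addr0.
have [Hh _] := Hpos.
have eHP : e *m H *m adj P = 0 by rewrite -(adj0 _ _ _) -PHe !adjM adjK Hh mulmxA.
rewrite /cholesky_step -/e.
have -> : adj (col_mx e (L *m P)) = row_mx (adj e) (adj P *m adj L).
  by rewrite /adj /Defs.conjmx map_col_mx tr_col_mx; congr row_mx; exact: adjM.
have E12 : e *m H *m (adj P *m adj L) = 0 by rewrite mulmxA eHP mul0mx.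
have E21 : L *m P *m H *m adj e = 0 by rewrite -!mulmxA (mulmxA P) PHe mulmx0.
have E22 : L *m P *m H *m (adj P *m adj L) = 1%:M.
  by rewrite mulmxA -(mulmxA L P H) -(mulmxA L (P *m H)) schur_adj LS.
by rewrite mul_col_mx mul_col_row eH E12 E21 E22 -scalar_mx_block.
Qed.

End SchurComplement.

(** Orthonormalization one row at a time, by recursion on the Schur complement. It only takes
    inverses and square roots of positive smooth functions, so L is smooth. *)
Lemma cholesky n (H : E -> 'M[C]_n) : smooth_cmx_on U H ->
  (forall x, U x -> positive_definite (H x)) ->
  exists L : E -> 'M[C]_n, smooth_cmx_on U L /\
    forall x, U x -> L x *m H x *m adj (L x) = 1%:M.
Proof.
elim: n H => [|n IH] H Hs Hp.
  by exists (fun=> 0); split=> [|x _]; [exact: smooth_cmx_cst | apply/matrixP => -[]].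
pose a x : R := complex.Re ((H x : 'M[C]_(1 + n)) ord0 ord0).
have as_ : smooth_on U a by exact: (Hs ord0 ord0).1.
have a0 x : U x -> 0 < a x by move=> Ux; exact: corner_gt0 (Hp x Ux).
have ai : smooth_on U (fun x => (a x)^-1).
  by apply: (smooth_inv Uo as_) => x Ux; rewrite gt_eqF ?a0.
have asi : smooth_on U (fun x => (Num.sqrt (a x))^-1).
  by apply: (smooth_inv Uo (smooth_sqrt Uo as_ a0)) => x Ux; rewrite gt_eqF // sqrtr_gt0 a0.
have bs : smooth_cmx_on U (fun x => ursubmx (H x : 'M[C]_(1 + n))).
  move=> i j; have := Hs (lshift n i) (rshift 1 j); apply: (smoothC_ext Uo) => x _.
  by rewrite !mxE.
have ds : smooth_cmx_on U (fun x => drsubmx (H x : 'M[C]_(1 + n))).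
  move=> i j; have := Hs (rshift 1 i) (rshift 1 j); apply: (smoothC_ext Uo) => x _.
  by rewrite !mxE.
have bas : smooth_cmx_on U (fun x => adj (ursubmx (H x : 'M[C]_(1 + n)))).
  exact: (smooth_cmx_tr (smooth_cmx_conj Uo bs)).
have Ss : smooth_cmx_on U (fun x => schur_complement (H x)).
  apply: (smooth_cmx_add Uo ds); apply: (smooth_cmx_opp Uo).
  exact: (smooth_cmx_scale Uo (smoothC_real Uo ai) (smooth_cmx_mul Uo bas bs)).
have [L [Ls LH]] := IH _ Ss (fun x Ux => schur_positive (Hp x Ux)).
exists (fun x => cholesky_step (H x) (L x)); split=> [|x Ux]; last first.
  exact: cholesky_stepP (Hp x Ux) _ (LH x Ux).
apply: (@smooth_cmx_col_mx R N 1 n (1 + n) U).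
  apply: smooth_cmx_row_mx; last exact: smooth_cmx_cst.
  move=> i j; have := smoothC_real Uo asi; apply: (smoothC_ext Uo) => x _.
  by rewrite !ord1 !mxE eqxx mulr1n.
apply: (smooth_cmx_mul Uo Ls); apply: smooth_cmx_row_mx; last exact: smooth_cmx_cst.
apply: (smooth_cmx_opp Uo).
exact: (smooth_cmx_scale Uo (smoothC_real Uo ai) bas).
Qed.

End Cholesky.

Section FrameExistence.
Variables (R : realType) (m : nat) (M : topologicalType) (K : kahler R m M).
Local Notation C := R[i].
Local Notation im := (Complex 0 1 : C).
Local Notation J := (cplx (stdJ R m)).

(** The rows are d/dx_k - i d/dy_k, that is, 2 d/dz_k. *)
Definition std10 : 'M[C]_(m, m + m) := row_mx 1%:M (- im)%:M.

Lemma std10_type : type10 std10.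
Proof.
rewrite /type10 /std10 /cplx /stdJ map_block_mx mul_row_block !mul1mx.
have -> : map_mx (real_complex R) (0 : 'M[R]_m) = 0 by apply/matrixP => i j; rewrite !mxE.
have -> : map_mx (real_complex R) (1%:M : 'M[R]_m) = 1%:M by rewrite map_mx1.
have -> : map_mx (real_complex R) (- 1%:M : 'M[R]_m) = - 1%:M by rewrite map_mxN map_mx1.
rewrite mulmx0 addr0 add0r mulmxN mulmx1 scale_row_mx; congr row_mx.
  by rewrite -raddfN opprK scalemx1.
by rewrite scale_scalar_mx mulrN im_sqr opprK.
Qed.

Lemma real_imag_form (A : 'M[R]_(m + m)) (z : 'rV[C]_(m + m)) : A^T = A ->
  complex.Re ((z *m cplx A *m adj z) ord0 ord0) =
  (map_mx (@complex.Re R) z *m A *m (map_mx (@complex.Re R) z)^T) ord0 ord0 +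
  (map_mx (@complex.Im R) z *m A *m (map_mx (@complex.Im R) z)^T) ord0 ord0.
Proof.
move=> As; rewrite !mxE re_sum -big_split; apply: eq_bigr => j _ /=.
rewrite adjE reM reJ imJ mulrN opprK !mxE re_sum im_sum; congr (_ * _ + _ * _).
  by apply: eq_bigr => k _; rewrite !mxE reM /= mulr0 subr0.
by apply: eq_bigr => k _; rewrite !mxE imM /= mulr0 add0r.
Qed.

(** On a complex vector the hermitian form is the sum of g on the real part and g on the imaginary
    part, one of which is non-zero. *)
Lemma std10_positive (c : kidx K) x : kcod c x ->
  positive_definite (std10 *m cplx (kmet c x) *m adj std10).
Proof.
move=> cx; split.
  rewrite !adjM adjK mulmxA; congr (_ *m _ *m _).
  by rewrite /adj conjmx_cplx /cplx map_trmx kmet_sym.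
move=> v v0; rewrite -!mulmxA -adjM !mulmxA real_imag_form ?kmet_sym //.
set z := v *m std10.
have z0 : z != 0.
  apply: contra_neq v0; rewrite /z /std10 mul_mx_row mulmx1 => /(congr1 (fun w => lsubmx w)).
  by rewrite row_mxKl => ->; apply/matrixP => i j; rewrite !mxE.
have ge0 (w : 'rV[R]_(m + m)) : 0 <= (w *m kmet c x *m w^T) ord0 ord0.
  have [->|w0] := eqVneq w 0; first by rewrite !mul0mx mxE.
  exact: ltW (kmet_pos cx w0).
have [r0|r0] := eqVneq (map_mx (@complex.Re R) z) 0.
  apply: ltr_wpDl; first exact: ge0.
  apply: kmet_pos => //; apply: contra_neq z0 => i0; apply/matrixP => i j.
  move/matrixP/(_ i j): r0; move/matrixP/(_ i j): i0; rewrite !mxE => i0 r0.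
  by apply: complexP; rewrite ?i0 ?r0.
by apply: ltr_wpDr; [exact: ge0 | exact: kmet_pos].
Qed.

Lemma frame_exists p : exists (al : local_frame K) x, lfr_dom al x /\ lfr_pt al x = p.
Proof.
have [c cp] := kdom_cover K p; have co : open (kcod c) by exact: kcod_open.
have Hs : smooth_cmx_on (kcod c) (fun x => std10 *m cplx (kmet c x) *m adj std10).
  apply: (smooth_cmx_mul co); last exact: smooth_cmx_cst.
  apply: (smooth_cmx_mul co); first exact: smooth_cmx_cst.
  by apply: (smooth_cplx co); exact: kmet_smooth.
have [L [Ls LH]] := cholesky co Hs (@std10_positive c).
have Es : smooth_cmx_on (kcod c) (fun x => L x *m std10).
  by apply: (smooth_cmx_mul co Ls); exact: smooth_cmx_cst.
have E10 x : kcod c x -> L x *m std10 *m J = im *: (L x *m std10).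
  by move=> _; rewrite -mulmxA std10_type scalemxAr.
have EG x : kcod c x ->
    L x *m std10 *m cplx (kmet c x) *m (conjmx (L x *m std10))^T = 1%:M.
  by move=> cx; rewrite -/(adj _) adjM -(LH x cx) !mulmxA.
exists (@LocalFrame _ _ _ K c (kcod c) (fun x => L x *m std10) co (fun x cx => cx) Es E10 EG).
exists (kchart c p); split; first exact: kchart_cod.
exact: kchartK.
Qed.

End FrameExistence.

(** * Bump functions *)

Local Opaque smooth_on pd pd_cmx.

Section FlatFunction.
Variable R : realType.

(* [flat 0] is the usual flat function; the derivative of [flat k] is a combination of
   [flat k.+1] and [flat k.+2]. *)
Definition flat (k : nat) (t : R) : R := if 0 < t then t ^- k * expR (- t^-1) else 0.

Lemma flat_ge0 k t : 0 <= flat k t.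
Proof.
rewrite /flat; case: ltP => // t0.
by rewrite mulr_ge0 ?expR_ge0 // invr_ge0 exprn_ge0 // ltW.
Qed.

Lemma flat_gt0 t : 0 < t -> 0 < flat 0 t.
Proof. by move=> t0; rewrite /flat t0 expr0 invr1 mul1r expR_gt0. Qed.

Lemma flat_eq0 k t : t <= 0 -> flat k t = 0.
Proof. by rewrite /flat leNgt => /negbTE ->. Qed.

(** From e^s >= s^(k+2) / (k+2)! with s = 1 / t. The power t^2 that is left over makes the
    difference quotient at 0 tend to 0. *)
Lemma flat_bound k t : flat k t <= (k.+2)`!%:R * t ^+ 2.
Proof.
have [t0|t0] := ltP 0 t; last by rewrite flat_eq0 // mulr_ge0 ?sqr_ge0.
have s0 : 0 < t^-1 by rewrite invr_gt0.
have H : t^-1 ^+ k.+2 / (k.+2)`!%:R <= expR t^-1.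
  by apply: le_trans (expR_ge1Dxn k.+1 (ltW s0)); rewrite lerDr.
have p0 : 0 < t^-1 ^+ k.+2 / (k.+2)`!%:R.
  by rewrite divr_gt0 ?exprn_gt0 // ltr0n fact_gt0.
rewrite /flat t0 expRN.
have : (expR t^-1)^-1 <= (t^-1 ^+ k.+2 / (k.+2)`!%:R)^-1 by rewrite lef_pV2 ?posrE ?expR_gt0.
move=> H2; have tk : 0 <= t ^- k by rewrite invr_ge0 exprn_ge0 // ltW.
apply: le_trans (ler_wpM2l tk H2) _.
have tE : t ^+ k.+2 = t ^+ k * t ^+ 2 by rewrite -exprD addn2.
by rewrite invf_div exprVn invrK tE mulrCA mulKf ?lexx // expf_neq0 // gt_eqF.
Qed.

Lemma is_derive_flat k (t : R) : is_derive t (1 : R) (flat k) (flat k.+2 t - k%:R * flat k.+1 t).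
Proof.
case: (ltrgtP t 0) => [t0|t0|->].
- rewrite !flat_eq0 ?ltW // mulr0 subr0.
  have H : is_derive t (1 : R) (fun=> 0 : R) 0 by exact: is_derive_cst.
  have nt : \forall s \near t, (fun=> 0 : R) s = flat k s.
    near=> s; rewrite flat_eq0 // ltW //; near: s; exact: lt_nbhsl.
  by apply: DeriveDef; [apply: near_eq_derivable nt _; exact: ex_derive
    | rewrite -(near_eq_derive _ nt); exact: derive_val].
- have nt : \forall s \near t, s ^- k * expR (- s^-1) = flat k s.
    near=> s; rewrite /flat ifT //; near: s; exact: lt_nbhsr.
  have H : is_derive t (1 : R) (fun s => s ^- k * expR (- s^-1))
      (flat k.+2 t - k%:R * flat k.+1 t).
    have I1 : is_derive t (1 : R) (fun y : R => y^-1) (- t ^- 2 *: 1).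
      by apply: is_deriveV; rewrite ?gt_eqF.
    have I2 := is_deriveX k I1.
    have I3 := @is_derive1_comp R expR (- (@GRing.inv R)) t _ _ (is_derive_expR _) (is_deriveN I1).
    have I4 := is_deriveM I2 I3.
    apply: is_derive_eq1 I4.
      by apply/funext => s /=; rewrite !fctE exprVn.
    rewrite !fctE /= /flat t0 -!exprVn /GRing.scale /=.
    move: (expR _) => w; case: k {nt I2 I3} => [|j] /=; move: (t^-1) => s.
      by rewrite !expr0 !mul0r; ring.
    by rewrite -natr1 !exprS; ring.
  by apply: DeriveDef; [apply: near_eq_derivable nt _; exact: ex_derive
    | rewrite -(near_eq_derive _ nt); exact: derive_val].
(* At 0 the difference quotient is 0 for h < 0 and at most (k+2)! h for h > 0. *)
rewrite !flat_eq0 // mulr0 subr0; apply/is_deriveE.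
apply/cvgrPdist_le => e e0; near=> h.
have C0 : 0 < (k.+2)`!%:R :> R by rewrite ltr0n fact_gt0.
rewrite sub0r normrN addr0 (flat_eq0 k (lexx 0)) subr0 /GRing.scale /= mulr1.
have [h0|h0] := ltP 0 h; last by rewrite flat_eq0 // mulr0 normr0 ltW.
rewrite ger0_norm; last by rewrite mulr_ge0 ?flat_ge0 // invr_ge0 ltW.
apply: le_trans (ler_wpM2l _ (flat_bound k h)) _; first by rewrite invr_ge0 ltW.
rewrite mulrCA expr2 mulKf ?gt_eqF // mulrC -ler_pdivlMr // ltW //.
apply: le_lt_trans (ler_norm h) _.
near: h; apply: dnbhs0_lt; exact: divr_gt0.
Unshelve. all: by end_near.
Qed.

Lemma flat_smooth N (U : set 'rV[R]_N) (f : 'rV[R]_N -> R) k : open U -> smooth_on U f ->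
  smooth_on U (fun x => flat k (f x)).
Proof.
move=> Uo fs; pose S := smooth_on U `|` [set g | exists k, g = (fun x => flat k (f x))].
have Sf (j : nat) : gen U S (fun x => flat j (f x)) by apply: gen_in; right; exists j.
apply: (gen_smooth Uo _ (Sf k)) => g [/smooth_self[gc gd gp]|[j ->]].
  by split; [exact: gc|exact: gd|move=> a; apply: gen_in; left; exact: gp].
have H x a (Ux : U x) := @is_derive_comp1 _ _ (flat j) f x (delta_mx ord0 a) _ _
  (is_derive_flat j (f x)) (smooth_is_derive a fs Ux).
split=> [x Ux|x a Ux|a].
- apply: (continuous_comp (smooth_continuous fs Ux)).
  apply: differentiable_continuous; apply/derivable1_diffP.
  exact: (@ex_derive _ _ _ _ _ _ _ (is_derive_flat j (f x))).
- exact: (@ex_derive _ _ _ _ _ _ _ (H x a Ux)).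
- have Pa : gen U S (pd a f) by apply: gen_in; left; exact: smooth_pd.
  apply: (gen_eq (gen_mul (gen_add (Sf j.+2) (gen_mul (gen_cst _ _ (- j%:R)) (Sf j.+1))) Pa)) => x Ux.
  by rewrite (is_derive_pd (H x a Ux)) mulNr.
Qed.

End FlatFunction.

Section BoxBump.
Variables (R : realType) (N : nat) (x0 : 'rV[R]_N) (r : R).

Definition box_bump (x : 'rV[R]_N) : R := \prod_i flat 0 (r ^+ 2 - (x ord0 i - x0 ord0 i) ^+ 2).

Lemma box_bump_smooth U : open U -> smooth_on U box_bump.
Proof.
move=> Uo; apply: smooth_prod => // i _; apply: (flat_smooth 0 Uo).
have cs : smooth_on U (fun x : 'rV[R]_N => x ord0 i - x0 ord0 i).
  exact: (smooth_add Uo (smooth_coord i Uo) (smooth_cst (- x0 ord0 i) Uo)).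
exact: (smooth_add Uo (smooth_cst _ Uo) (smooth_opp Uo (smooth_mul Uo cs cs))).
Qed.

Lemma box_bump_ge0 x : 0 <= box_bump x.
Proof. by apply: prodr_ge0 => i _; exact: flat_ge0. Qed.

Lemma box_bump_gt0 : 0 < r -> 0 < box_bump x0.
Proof.
move=> r0; apply: prodr_gt0 => i _; apply: flat_gt0.
by rewrite subrr expr0n subr0 exprn_gt0.
Qed.

Lemma box_bump_off x : 0 <= r -> ~ cbox r x0 x -> box_bump x = 0.
Proof.
move=> r0 xQ; have [i xi] : exists i, r < `|x ord0 i - x0 ord0 i|.
  apply: contrapT => H; apply: xQ => i; rewrite leNgt; apply/negP => xi.
  by apply: H; exists i.
rewrite /box_bump (bigD1 i) //= flat_eq0 ?mul0r // subr_le0.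
by rewrite -[X in _ <= X]real_normK ?num_real // ler_sqr ?nnegrE // ltW.
Qed.

End BoxBump.

Section SmoothFunctions.
Variables (R : realType) (m : nat) (M : topologicalType) (K : kahler R m M).
Hypothesis Mhausdorff : hausdorff_space M.
Implicit Types (al be : local_frame K).

(** Tested in the domains of the frames, which cover M by [frame_exists]. *)
Definition smooth_fun (f : M -> R) := forall be, smooth_on (lfr_dom be) (fun y => f (lfr_pt be y)).

(** A point of another frame domain either lies in the overlap with al or has a neighbourhood off
    the closed image of the box. *)
Lemma ext_smooth al x0 r (F : 'rV[R]_(m + m) -> R) : cbox r x0 `<=` lfr_dom al ->
  smooth_on (lfr_dom al) F -> supported (lfr_dom al) x0 r F -> smooth_fun (ext al F).
Proof.
move=> QU Fs F0 be; apply: smooth_on_bigcup => y Uy.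
suff [B [Bo By Bs]] : exists B, [/\ open B, B y & smooth_on B (fun y => ext al F (lfr_pt be y))].
  have [q q0 qB] := (openP B).1 Bo y By; exists q => //; exact: smooth_on_sub qB Bs.
have [Oy|Oy] := pselect (overlap be al y).
  have Oo := @overlap_open _ _ _ _ be al; exists (overlap be al); split=> //.
  apply: (smooth_on_ext Oo (f := F \o trans be al)).
    by move=> z Oz; rewrite -(trans_pt Oz) ext_pt //; case: Oz.
  have ts : smooth_mx_on (overlap be al) (trans be al).
    by move=> i j; apply: smooth_on_sub (@trans_smooth _ _ _ _ be al i j); exact: overlap_chart.
  by apply: (smooth_comp Oo (@lfr_open _ _ _ _ al) ts Fs) => z [].
pose B := lfr_dom be `&` [set z | ~ box_image al x0 r (lfr_pt be z)].
have Bo : open B by exact: (box_coimage_open Mhausdorff QU).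
exists B; split=> //.
  split=> // -[x /QU Ux xy]; apply: Oy.
  exact: (pt_overlap Uy Ux (esym xy)).1.
apply: (smooth_on_ext Bo (f := fun=> 0)); last exact: smooth_cst.
by move=> z [Uz zQ]; rewrite (ext_off_box F0).
Qed.

Lemma frame_box al x : lfr_dom al x -> exists2 r : R, 0 < r & cbox r x `<=` lfr_dom al.
Proof.
move=> Ux; have [q q0 qU] := (openP _).1 (@lfr_open _ _ _ _ al) x Ux.
exists (q / 2); first by rewrite divr_gt0.
move=> y yq; apply: qU => i; apply: le_lt_trans (yq i) _.
by rewrite ltr_pdivrMr // ltr_pMr // ltr1n.
Qed.

Definition bump al x0 r : M -> R := ext al (box_bump x0 r).

Section Bump.
Variables (al : local_frame K) (x0 : 'rV[R]_(m + m)) (r : R).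
Hypotheses (r0 : 0 < r) (QU : cbox r x0 `<=` lfr_dom al).

Lemma bump_smooth : smooth_fun (bump al x0 r).
Proof.
apply: (ext_smooth QU); first exact: box_bump_smooth (@lfr_open _ _ _ _ al).
by move=> x Ux xQ; apply: box_bump_off => //; exact: ltW.
Qed.

Lemma bump_ge0 p : 0 <= bump al x0 r p.
Proof. by rewrite /bump /ext; case: ifP => // _; exact: box_bump_ge0. Qed.

Lemma bump_gt0 : 0 < bump al x0 r (lfr_pt al x0).
Proof.
rewrite /bump ext_pt ?box_bump_gt0 //; apply: QU => i.
by rewrite subrr normr0 ltW.
Qed.

Lemma bump_off p : ~ box_image al x0 r p -> bump al x0 r p = 0.
Proof.
move=> pQ; apply: (ext_off_box _ pQ) => x Ux xQ; apply: box_bump_off => //.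
exact: ltW.
Qed.

End Bump.

Lemma smooth_fun_continuous f : smooth_fun f -> continuous f.
Proof.
move=> fs p; have [al [x [Ux <-]]] := frame_exists K p.
have fc := smooth_continuous (fs al) Ux.
have cx : kcod (lfr_idx al) x by exact: (@lfr_sub _ _ _ _ al).
have dp := kinv_dom cx.
have H : {for lfr_pt al x, continuous ((fun y => f (lfr_pt al y)) \o kchart (lfr_idx al))}.
  apply: continuous_comp; first exact: kchart_cont.
  by rewrite /lfr_pt kinvK.
have Ep : f (lfr_pt al x) = ((fun y => f (lfr_pt al y)) \o kchart (lfr_idx al)) (lfr_pt al x).
  by rewrite /= /lfr_pt kinvK.
rewrite /continuous_at Ep; apply: cvg_trans H; apply: near_eq_cvg.
have : nbhs (lfr_pt al x) (kdom (lfr_idx al)).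
  by apply: open_nbhs_nbhs; split=> //; exact: kdom_open.
by apply: filterS => q dq /=; rewrite /lfr_pt kchartK.
Qed.

End SmoothFunctions.

(** * Green formula *)

Local Opaque smooth_on pd pd_cmx cov conn bracket curv hdot.

Section HermitianSquares.
Variable R : realType.
Local Notation C := R[i].

Lemma hdot_real p q (A : 'M[C]_(p, q)) : complex.Im (hdot A A) = 0 /\ 0 <= complex.Re (hdot A A).
Proof.
have := hdot_ge0 A; rewrite lecE /= => /andP[/eqP -> ->].
by [].
Qed.

Lemma re_hdot_eq0 p q (A : 'M[C]_(p, q)) : complex.Re (hdot A A) = 0 -> A = 0.
Proof. by move=> A0; apply: hdot_eq0; apply: complexP => //; exact: (hdot_real A).1. Qed.

Lemma smoothC_hdot N p q (U : set 'rV[R]_N) (F G : 'rV[R]_N -> 'M[C]_(p, q)) : open U ->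
  smooth_cmx_on U F -> smooth_cmx_on U G -> smoothC U (fun x => hdot (F x) (G x)).
Proof.
move=> Uo Fs Gs; apply: smoothC_sum => // i _; apply: smoothC_sum => // j _.
exact: (smoothC_mul Uo (Fs i j) (smoothC_conj Uo (Gs i j))).
Qed.

End HermitianSquares.

Section LocalFunctional.
Variables (R : realType) (m : nat) (M : topologicalType) (K : kahler R m M).
Hypothesis Mhausdorff : hausdorff_space M.
Variable I : (M -> R) -> R.
Hypothesis HI : riemannian_integral K I.
Variables (al : local_frame K) (x0 : 'rV[R]_(m + m)) (r : R).
Local Notation C := R[i].
Local Notation U := (lfr_dom al).
Hypotheses (r0 : 0 <= r) (QU : cbox r x0 `<=` U).
Implicit Types F G : 'rV[R]_(m + m) -> C.

Let Uo : open U := @lfr_open _ _ _ _ al.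

Definition cintegral F : C :=
  Complex (I (ext al (fun x => complex.Re (F x)))) (I (ext al (fun x => complex.Im (F x)))).

Definition test_function F := smoothC U F /\ forall x, U x -> ~ cbox r x0 x -> F x = 0.

Lemma test_re F : test_function F -> continuous (ext al (fun x => complex.Re (F x))).
Proof.
move=> [Fs F0]; apply: (ext_continuous Mhausdorff QU) => x Ux.
  exact: smooth_continuous Fs.1 Ux.
by move=> xQ; rewrite F0.
Qed.

Lemma test_im F : test_function F -> continuous (ext al (fun x => complex.Im (F x))).
Proof.
move=> [Fs F0]; apply: (ext_continuous Mhausdorff QU) => x Ux.
  exact: smooth_continuous Fs.2 Ux.
by move=> xQ; rewrite F0.
Qed.

Lemma cintegral_ext F G : (forall x, U x -> F x = G x) -> cintegral F = cintegral G.
Proof.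
move=> FG; rewrite /cintegral; congr (Complex (I _) (I _)); apply/funext => p;
  by rewrite /ext; case: asboolP => // -[_ Up]; rewrite FG.
Qed.

Lemma test_function_ext F G : (forall x, U x -> F x = G x) -> test_function F -> test_function G.
Proof.
move=> FG [Fs F0]; split; first exact: smoothC_ext Uo FG Fs.
by move=> x Ux xQ; rewrite -FG // F0.
Qed.

Lemma test_function_add F G : test_function F -> test_function G ->
  test_function (fun x => F x + G x).
Proof.
move=> [Fs F0] [Gs G0]; split; first exact: smoothC_add.
by move=> x Ux xQ; rewrite F0 // G0 // addr0.
Qed.

Lemma test_function_scale (a : C) F : test_function F -> test_function (fun x => a * F x).
Proof.
move=> [Fs F0]; split; first exact: (smoothC_mul Uo (smoothC_cst a Uo) Fs).
by move=> x Ux xQ; rewrite F0 // mulr0.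
Qed.

Lemma test_function_sum (J : Type) (s : seq J) (P : pred J) (F : J -> 'rV[R]_(m + m) -> C) :
  (forall j, P j -> test_function (F j)) -> test_function (fun x => \sum_(j <- s | P j) F j x).
Proof.
move=> FT; split; first by apply: smoothC_sum => // j Pj; exact: (FT j Pj).1.
by move=> x Ux xQ; rewrite big1 // => j Pj; exact: (FT j Pj).2.
Qed.

Lemma test_function_hdot p q (h f : 'rV[R]_(m + m) -> 'M[C]_(p, q)) :
  smooth_cmx_on U h -> smooth_cmx_on U f -> (forall x, U x -> ~ cbox r x0 x -> h x = 0) ->
  test_function (fun x => hdot (h x) (f x)).
Proof.
move=> hs fs h0; split; first exact: smoothC_hdot.
by move=> x Ux xQ; rewrite h0 // hdot0l.
Qed.

Lemma cintegral_add F G : test_function F -> test_function G ->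
  cintegral (fun x => F x + G x) = cintegral F + cintegral G.
Proof.
move=> FT GT; have [ID _ _] := HI; apply: complexP => /=.
  rewrite -(ID _ _ (test_re FT) (test_re GT)); congr I; apply/funext => p.
  by rewrite /ext; case: asboolP; rewrite ?reD ?addr0.
rewrite -(ID _ _ (test_im FT) (test_im GT)); congr I; apply/funext => p.
by rewrite /ext; case: asboolP; rewrite ?imD ?addr0.
Qed.

Lemma cintegral_scale a F : test_function F -> cintegral (fun x => a * F x) = a * cintegral F.
Proof.
move=> FT; have [ID IZ _] := HI.
have [c1 c2] := (test_re FT, test_im FT).
have comb (p q : R) : I (fun z => p * ext al (fun x => complex.Re (F x)) z
      + q * ext al (fun x => complex.Im (F x)) z) =
    p * I (ext al (fun x => complex.Re (F x))) + q * I (ext al (fun x => complex.Im (F x))).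
  rewrite -(IZ p _ c1) -(IZ q _ c2); apply: ID => z.
    exact: (continuousM (@cst_continuous _ _ p z) (c1 z)).
  exact: (continuousM (@cst_continuous _ _ q z) (c2 z)).
apply: complexP.
  rewrite reM /= -mulNr -comb; congr I; apply/funext => z.
  by rewrite /ext; case: asboolP; rewrite ?reM ?mulr0 ?addr0 ?mulNr.
rewrite imM /= [RHS]addrC -comb; congr I; apply/funext => z.
by rewrite /ext; case: asboolP; rewrite ?imM ?mulr0 ?addr0 // addrC.
Qed.

Lemma cintegral_conj F : test_function F -> cintegral (fun x => Num.conj (F x)) = Num.conj (cintegral F).
Proof.
move=> FT; have [_ IZ _] := HI; apply: complexP; rewrite ?reJ ?imJ /=.
  by congr I; apply/funext => z; rewrite /ext; case: asboolP; rewrite ?reJ.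
rewrite -mulN1r -(IZ (-1) _ (test_im FT)); congr I; apply/funext => z.
by rewrite /ext; case: asboolP; rewrite ?imJ ?mulr0 ?mulN1r.
Qed.

Lemma cintegral0 : cintegral (fun=> 0) = 0.
Proof.
have T0 : test_function (fun=> 0) by split=> //; exact: smoothC_cst.
have J0 := cintegral_scale 0 T0; rewrite [RHS]mul0r in J0; apply: etrans J0.
by apply: cintegral_ext => x _; rewrite mul0r.
Qed.

Lemma cintegral_sum (J : Type) (s : seq J) (P : pred J) (F : J -> 'rV[R]_(m + m) -> C) :
  (forall j, P j -> test_function (F j)) ->
  cintegral (fun x => \sum_(j <- s | P j) F j x) = \sum_(j <- s | P j) cintegral (F j).
Proof.
move=> FT; elim: s => [|j s IH].
  by rewrite big_nil -[RHS]cintegral0; apply: cintegral_ext => x _; rewrite big_nil.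
rewrite big_cons; case: ifP => Pj; last first.
  by rewrite -IH; apply: cintegral_ext => x _; rewrite big_cons Pj.
rewrite -IH -cintegral_add; first by apply: cintegral_ext => x _; rewrite big_cons Pj.
  exact: FT.
exact: test_function_sum.
Qed.

Lemma cintegral_pos F : test_function F -> (forall x, U x -> complex.Im (F x) = 0) ->
  (forall x, U x -> 0 <= complex.Re (F x)) -> cintegral F = 0 -> forall x, U x -> F x = 0.
Proof.
move=> [Fs F0] Fi Fp /(congr1 (@complex.Re R)) /= J0 x Ux; apply: complexP; last exact: Fi.
apply: (ext_integral_eq0 Mhausdorff HI QU r0 _ _ Fp J0 Ux).
  by move=> y Uy; exact: smooth_continuous Fs.1 Uy.
by move=> y Uy yQ; rewrite F0.
Qed.

Lemma cintegral_div (X : 'rV[R]_(m + m) -> 'rV[C]_(m + m)) : smooth_cmx_on U X ->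
  (forall x, U x -> ~ cbox r x0 x -> X x = 0) ->
  test_function (cdiv al X) /\ cintegral (cdiv al X) = 0.
Proof.
move=> Xs X0; split.
  split; first exact: (cdiv_smooth Xs).
  by move=> x Ux xQ; exact: (cdiv_off X0).
have [E1 E2] := ext_divergence Mhausdorff HI QU Xs X0 r0.
by rewrite /cintegral E1 E2.
Qed.

Section Flux.
Variables (d : nat) (V : unitary_rep R m d) (T : 'I_m -> 'I_m -> 'M[C]_d).
Variables (h f : 'rV[R]_(m + m) -> 'cV[C]_d).
Hypotheses (hs : smooth_cmx_on U h) (fs : smooth_cmx_on U f)
  (h0 : forall x, U x -> ~ cbox r x0 x -> h x = 0).

Lemma flux_smooth : smooth_cmx_on U (flux al V T h f).
Proof.
have bs k : smooth_cmx_on U (epsbar al k) := smooth_cmx_conj Uo (smooth_eps al k).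
have Ts l k g : smooth_cmx_on U g -> smooth_cmx_on U (fun y => T l k *m g y : 'cV[C]_d).
  by move=> gs; exact: (smooth_cmx_mul Uo (smooth_cmx_cst (T l k) Uo) gs).
apply: smooth_cmx_sum => // k _; apply: smooth_cmx_sum => // l _.
apply: (smooth_cmx_add Uo).
  apply: (smooth_cmx_scale Uo _ (smooth_eps al l)); apply: (smoothC_hdot Uo hs).
  exact: (Ts _ _ _ (cov_smooth V (smooth_eps al k) fs)).
apply: (smooth_cmx_opp Uo).
apply: (smooth_cmx_scale Uo _ (bs k)); apply: (smoothC_hdot Uo hs).
exact: (Ts _ _ _ (cov_smooth V (bs l) fs)).
Qed.

Lemma flux_off x : U x -> ~ cbox r x0 x -> flux al V T h f x = 0.
Proof.
move=> Ux xQ; rewrite /flux big1 // => k _; rewrite big1 // => l _.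
have Z (a b : 'cV[C]_d) (p q : 'rV[C]_(m + m)) : hdot 0 a *: p - hdot 0 b *: q = 0.
  by rewrite !hdot0l !scale0r subrr.
by rewrite (h0 Ux xQ); exact: Z.
Qed.

End Flux.

End LocalFunctional.

Section Green.
Variables (R : realType) (n : nat) (M : topologicalType) (K : kahler R n.+1 M).
Local Notation m := n.+1.
Hypothesis Mhausdorff : hausdorff_space M.
Variable I : (M -> R) -> R.
Hypothesis HI : riemannian_integral K I.
Variables (d : nat) (V : unitary_rep R m d).
Variables (rho : 'I_m -> int) (Pp Pm : 'I_m -> 'End('M[R[i]]_(d, m))).
Hypotheses (HV : irreducible_of_weight V rho) (Hrho : dominant rho) (Hd : (2 <= d)%N)
  (HPp : weight_decomposition (actp V) (diffp V) (fun i j => rho j + mu i j) Pp)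
  (HPm : weight_decomposition (actm V) (diffm V) (fun i j => rho j - mu i j) Pm).
Local Notation C := R[i].
Local Notation pi := (urep_diff V).

Section LocalGreen.
Variables (al : local_frame K) (x0 : 'rV[R]_(m + m)) (r : R).
Local Notation U := (lfr_dom al).
Hypotheses (r0 : 0 <= r) (QU : cbox r x0 `<=` U).
Local Notation W := (weitzenboeck_curv V rho al).

Let Uo : open U := @lfr_open _ _ _ _ al.

Lemma curv_smooth v w : smooth_cmx_on U v -> smooth_cmx_on U w -> smooth_cmx_on U (curv V al v w).
Proof.
move=> vs ws; apply: (smooth_cmx_ext Uo (F := fun x =>
    \sum_a \sum_b (v x ord0 a * w x ord0 b) *: curvC al V a b x)).
  by move=> x Ux; rewrite (curvE V (smooth_diff_at vs Ux) (smooth_diff_at ws Ux) Ux).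
apply: smooth_cmx_sum => // a _; apply: smooth_cmx_sum => // b _.
apply: (smooth_cmx_scale Uo); first exact: (smoothC_mul Uo (vs ord0 a) (ws ord0 b)).
have ts := theta_smooth al V.
apply: (smooth_cmx_add Uo).
  by apply: (smooth_cmx_add Uo); [|apply: (smooth_cmx_opp Uo)]; exact: smooth_cmx_pd.
by apply: (smooth_cmx_add Uo); [|apply: (smooth_cmx_opp Uo)]; exact: smooth_cmx_mul.
Qed.

Lemma weitzenboeck_smooth : smooth_cmx_on U W.
Proof.
have bs k : smooth_cmx_on U (epsbar al k) := smooth_cmx_conj Uo (smooth_eps al k).
have sc (a : C) (F : 'rV[R]_(m + m) -> 'M[C]_d) : smooth_cmx_on U F ->
    smooth_cmx_on U (fun x => a *: F x).
  by move=> Fs; exact: (smooth_cmx_scale Uo (smoothC_cst a Uo) Fs).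
apply: (smooth_cmx_add Uo); apply: (smooth_cmx_opp Uo); apply: sc.
  apply: smooth_cmx_sum => // k _; apply: smooth_cmx_sum => // l _.
  apply: (smooth_cmx_mul Uo (smooth_cmx_cst _ Uo)).
  exact: (curv_smooth (smooth_eps al k) (bs l)).
by apply: smooth_cmx_sum => // k _; exact: (curv_smooth (smooth_eps al k) (bs k)).
Qed.

(** By [energyE] the energy is a combination of the divergences of two fluxes, and the support of h
    controls theirs. So f may be a section that does not vanish near the boundary of the box. *)
Lemma green h f : smooth_cmx_on U h -> smooth_cmx_on U f ->
  (forall x, U x -> ~ cbox r x0 x -> h x = 0) ->
  test_function al x0 r (energy al V rho Pp Pm h f) /\
  cintegral I al (energy al V rho Pp Pm h f) = 0.
Proof.
move=> hs fs h0.
pose T0 := @delta_op R n d; pose T1 := rep_op V.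
have [t0 J0] := cintegral_div Mhausdorff HI r0 QU (flux_smooth V T0 hs fs) (flux_off V T0 f h0).
have [t1 J1] := cintegral_div Mhausdorff HI r0 QU (flux_smooth V T1 hs fs) (flux_off V T1 f h0).
pose c0 : C := - ((wp rho ord0 - wm rho ord_max)%:~R / (wp rho ord0 + wm rho ord_max)%:~R).
pose c1 : C := - (2 / (wp rho ord0 + wm rho ord_max)%:~R).
have E x : U x -> c0 * cdiv al (flux al V T0 h f) x + c1 * cdiv al (flux al V T1 h f) x =
    energy al V rho Pp Pm h f x.
  by move=> Ux; rewrite (energyE HV Hrho Hd HPp HPm hs fs Ux) !mulNr.
have s0 := test_function_scale c0 t0; have s1 := test_function_scale c1 t1.
split; first exact: test_function_ext E (test_function_add s0 s1).
rewrite -(cintegral_ext _ E) (cintegral_add Mhausdorff HI QU s0 s1).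
have Z (F : 'rV[R]_(m + m) -> C) c : test_function al x0 r F -> cintegral I al F = 0 ->
    cintegral I al (fun x => c * F x) = 0.
  by move=> Ft F0; rewrite (cintegral_scale Mhausdorff HI QU c Ft) F0 mulr0.
exact: etrans (congr2 (fun p q => p + q) (Z _ c0 t0 J0) (Z _ c1 t1 J1)) (addr0 0).
Qed.

Lemma col_eq0 (A : 'M[C]_d) : (forall j, A *m delta_mx j ord0 = 0 :> 'cV[C]_d) -> A = 0.
Proof.
by move=> H; apply/matrixP => i j; move/matrixP/(_ i ord0): (H j); rewrite -colE !mxE.
Qed.

Lemma conj_four (a b c e a' b' c' e' : C) : Num.conj a = a' -> Num.conj b = b' ->
  Num.conj c = c' -> Num.conj e = e' -> Num.conj (a + b - c - e) = a' + b' - c' - e'.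
Proof. by move=> <- <- <- <-; rewrite !rmorphB rmorphD. Qed.

(** The coefficients are real, so all terms of the energy but the curvature term are hermitian in h
    and f. *)
Lemma energy_conj h f x :
  energy al V rho Pp Pm h f x - Num.conj (energy al V rho Pp Pm f h x) =
  hdot (h x) ((adj (W x) - W x) *m f x).
Proof.
have cr (a b : int) : Num.conj (a%:~R / b%:~R : C) = a%:~R / b%:~R.
  by rewrite rmorphM fmorphV !rmorph_int.
have S1 (P : pred 'I_m) (Q : 'I_m -> 'End('M[C]_(d, m))) (a : 'I_m -> int) (b : int) (A B : 'M[C]_(d, m)) :
    Num.conj (\sum_(i | P i) (a i)%:~R / b%:~R * hdot (Q i A) (Q i B)) =
    \sum_(i | P i) (a i)%:~R / b%:~R * hdot (Q i B) (Q i A).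
  by rewrite conjC_sum; apply: eq_bigr => i _; rewrite rmorphM /= cr -hdotC.
have A1 := S1 (fun i => i != ord_max) Pm (fun i => 2 * (wm rho ord_max - wm rho i))
  (wp rho ord0 + wm rho ord_max) (cov10 al V f x) (cov10 al V h x).
have A2 := S1 (fun i => i != ord0) Pp (fun i => 2 * (wp rho ord0 - wp rho i))
  (wp rho ord0 + wm rho ord_max) (cov01 al V f x) (cov01 al V h x).
have A3 (p q : nat) (A B : 'M[C]_(p, q)) (A' B' : 'M[C]_(p, q)) :
    Num.conj (hdot A B + hdot A' B') = hdot B A + hdot B' A'.
  by rewrite (hdotC B A) (hdotC B' A') rmorphD.
have E : Num.conj (energy al V rho Pp Pm f h x) =
    energy al V rho Pp Pm h f x + hdot (h x) (W x *m f x) - hdot (W x *m h x) (f x).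
  rewrite /energy subrK.
  exact: (conj_four A1 A2 (A3 _ _ _ _ _ _) (esym (hdotC _ _))).
have G : hdot (h x) ((adj (W x) - W x) *m f x) = hdot (W x *m h x) (f x) - hdot (h x) (W x *m f x).
  by rewrite mulmxBl hdotDr hdotNr hdotMl.
have alg (e p q : C) : e - (e + p - q) = q - p by ring.
by rewrite E G; exact: alg.
Qed.

(* By [energy_conj] and [green], h = chi (W^* - W) e_j and f = chi e_j give that the integral of
   chi^2 |(W^* - W) e_j|^2 vanishes. *)
Lemma weitzenboeck_hermitian_at (r1 : 0 < r) : adj (W x0) = W x0.
Proof.
have Ws := weitzenboeck_smooth.
pose B x := adj (W x) - W x.
have Bs : smooth_cmx_on U B.
  exact: (smooth_cmx_add Uo (smooth_cmx_tr (smooth_cmx_conj Uo Ws)) (smooth_cmx_opp Uo Ws)).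
pose chi x : C := real_complex R (box_bump x0 r x).
have cs : smoothC U chi by apply: (smoothC_real Uo); exact: box_bump_smooth.
have c0 x : ~ cbox r x0 x -> chi x = 0 by move=> xQ; rewrite /chi box_bump_off.
suff H j : B x0 *m delta_mx j ord0 = 0 :> 'cV[C]_d.
  by apply/eqP; rewrite -subr_eq0; apply/eqP; exact: col_eq0.
pose f x : 'cV[C]_d := chi x *: delta_mx j ord0.
pose h x : 'cV[C]_d := chi x *: (B x *m delta_mx j ord0).
have fs : smooth_cmx_on U f by exact: (smooth_cmx_scale Uo cs (smooth_cmx_cst _ Uo)).
have hs : smooth_cmx_on U h.
  exact: (smooth_cmx_scale Uo cs (smooth_cmx_mul Uo Bs (smooth_cmx_cst _ Uo))).
have f0 x : U x -> ~ cbox r x0 x -> f x = 0 by move=> _ xQ; rewrite /f c0 // scale0r.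
have h0 x : U x -> ~ cbox r x0 x -> h x = 0 by move=> _ xQ; rewrite /h c0 // scale0r.
have [t1 J1] := green hs fs h0; have [t2 J2] := green fs hs f0.
have t3 : test_function al x0 r (fun x => hdot (h x) (B x *m f x)).
  exact: (test_function_hdot hs (smooth_cmx_mul Uo Bs fs) h0).
have E x : U x -> energy al V rho Pp Pm h f x = hdot (h x) (B x *m f x)
    + Num.conj (energy al V rho Pp Pm f h x).
  by move=> _; rewrite -energy_conj subrK.
have t4 : test_function al x0 r (fun x => Num.conj (energy al V rho Pp Pm f h x)).
  by case: t2 => s z; split; [exact: smoothC_conj | move=> x Ux xQ; rewrite z // rmorph0].
have J3 : cintegral I al (fun x => hdot (h x) (B x *m f x)) = 0.
  have := J1; rewrite (cintegral_ext I E) (cintegral_add Mhausdorff HI QU t3 t4).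
  by rewrite (cintegral_conj Mhausdorff HI QU t2) J2 rmorph0 addr0.
have hE x : hdot (h x) (B x *m f x) =
    real_complex R (box_bump x0 r x ^+ 2) * hdot (B x *m delta_mx j ord0 : 'cV[C]_d) (B x *m delta_mx j ord0).
  rewrite /h /f hdotZl -scalemxAr hdotZr mulrA; congr (_ * _).
  rewrite rmorphXn /= expr2; congr (_ * _).
  by apply: complexP; rewrite ?reJ ?imJ //= oppr0.
have P1 x : U x -> complex.Im (hdot (h x) (B x *m f x)) = 0.
  by move=> _; rewrite hE imM (hdot_real _).1 /= mulr0 mul0r addr0.
have P2 x : U x -> 0 <= complex.Re (hdot (h x) (B x *m f x)).
  move=> _; rewrite hE reM /= mul0r subr0; apply: mulr_ge0; first exact: sqr_ge0.
  exact: (hdot_real _).2.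
have Ux0 : U x0 by apply: QU => i; rewrite subrr normr0.
have := cintegral_pos Mhausdorff HI r0 QU t3 P1 P2 J3 Ux0; rewrite hE => /eqP.
rewrite mulf_eq0 => /orP[|/eqP]; last by move/hdot_eq0.
by rewrite fmorph_eq0 expf_eq0 /= gt_eqF // box_bump_gt0.
Qed.

End LocalGreen.

Lemma weitzenboeck_hermitian (al : local_frame K) x : lfr_dom al x ->
  adj (weitzenboeck_curv V rho al x) = weitzenboeck_curv V rho al x.
Proof.
move=> Ux; have [r r0 QU] := frame_box Ux.
exact: (weitzenboeck_hermitian_at (ltW r0) QU r0).
Qed.

End Green.

(** * The formula for the adjoints *)

Local Opaque smooth_on pd pd_cmx cov conn bracket curv hdot.

Section NullFunctions.
Variables (R : realType) (m : nat) (M : topologicalType) (K : kahler R m M).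
Hypothesis Mhausdorff : hausdorff_space M.
Variable I : (M -> R) -> R.
Hypothesis HI : riemannian_integral K I.
Variables (al : local_frame K) (x0 : 'rV[R]_(m + m)) (r : R).
Local Notation C := R[i].
Local Notation U := (lfr_dom al).
Hypothesis QU : cbox r x0 `<=` U.
Implicit Types F G : 'rV[R]_(m + m) -> C.

(** Integral identities are stored as null integrands, so that several of them can be combined by
    pointwise algebra. *)
Definition null_function F := test_function al x0 r F /\ cintegral I al F = 0.

Lemma null_ext F G : (forall x, U x -> F x = G x) -> null_function F -> null_function G.
Proof.
move=> FG [Ft F0]; split; first exact: test_function_ext FG Ft.
by rewrite -F0; apply: cintegral_ext => x Ux; rewrite FG.
Qed.

Lemma null_add F G : null_function F -> null_function G -> null_function (fun x => F x + G x).
Proof.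
move=> [Ft F0] [Gt G0]; split; first exact: test_function_add.
by rewrite (cintegral_add Mhausdorff HI QU Ft Gt) F0 G0 addr0.
Qed.

Lemma null_scale a F : null_function F -> null_function (fun x => a * F x).
Proof.
move=> [Ft F0]; split; first exact: test_function_scale.
by rewrite (cintegral_scale Mhausdorff HI QU a Ft) F0 mulr0.
Qed.

Lemma null_sum (J : Type) (s : seq J) (P : pred J) (F : J -> 'rV[R]_(m + m) -> C) :
  (forall j, P j -> null_function (F j)) -> null_function (fun x => \sum_(j <- s | P j) F j x).
Proof.
move=> FN; have FT j : P j -> test_function al x0 r (F j) by move=> /FN[].
split; first exact: test_function_sum.
rewrite (cintegral_sum Mhausdorff HI QU _ FT) big1 // => j /FN[_].
exact.
Qed.

Lemma null_sub F G : test_function al x0 r F -> test_function al x0 r G ->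
  cintegral I al F = cintegral I al G -> null_function (fun x => F x - G x).
Proof.
move=> Ft Gt FG; have Gn := test_function_scale (-1) Gt.
have H : null_function (fun x => F x + -1 * G x).
  split; first exact: test_function_add.
  rewrite (cintegral_add Mhausdorff HI QU Ft Gn) (cintegral_scale Mhausdorff HI QU (-1) Gt).
  by rewrite FG mulN1r subrr.
by apply: null_ext H => x _; rewrite mulN1r.
Qed.

End NullFunctions.

Section TensorInvariance.
Variables (R : realType) (m d : nat) (V : unitary_rep R m d).
Local Notation C := R[i].

Lemma act0_hdot (u : 'M[C]_m) (A B : 'cV[C]_d) : u \is unitarymx ->
  hdot (act0 V u A) (act0 V u B) = hdot A B.
Proof. by move=> uu; apply: hdot_unitary; exact: urep_unitary. Qed.

Lemma actp_hdot (u : 'M[C]_m) (A B : 'M[C]_(d, m)) : u \is unitarymx ->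
  hdot (actp V u A) (actp V u B) = hdot A B.
Proof. by move=> uu; exact: tensor_hdot. Qed.

Lemma actm_hdot (u : 'M[C]_m) (A B : 'M[C]_(d, m)) : u \is unitarymx ->
  hdot (actm V u A) (actm V u B) = hdot A B.
Proof. by move=> uu; apply: tensor_hdot => //; exact: conj_unitary. Qed.

Lemma actpm_hdot (u : 'M[C]_m) (A B : 'M[C]_(d, m + m)) : u \is unitarymx ->
  hdot (actpm V u A) (actpm V u B) = hdot A B.
Proof.
move=> uu; apply: tensor_hdot => //; apply/unitaryP.
rewrite /adj /Defs.conjmx map_block_mx tr_block_mx mulmx_block !map_mx0 !trmx0.
rewrite !mul0mx !mulmx0 !addr0 !add0r -/(adj u) (unitary_adjr uu).
by have := unitary_adjr (conj_unitary uu); rewrite /adj => ->; rewrite -scalar_mx_block.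
Qed.

Lemma hdot_row_mx p q r (A A' : 'M[C]_(p, q)) (B B' : 'M[C]_(p, r)) :
  hdot (row_mx A B) (row_mx A' B') = hdot A A' + hdot B B'.
Proof. by rewrite !hdotE adj_row mul_row_col mxtraceD. Qed.

End TensorInvariance.

Section LocalL2.
Variables (R : realType) (m : nat) (M : topologicalType) (K : kahler R m M).
Hypothesis Mhausdorff : hausdorff_space M.
Variable I : (M -> R) -> R.
Variables (al : local_frame K) (x0 : 'rV[R]_(m + m)) (r : R).
Hypothesis QU : cbox r x0 `<=` lfr_dom al.
Local Notation C := R[i].

Definition supported_field d e (phi : field K d e) := forall be y, lfr_dom be y ->
  ~ box_image al x0 r (lfr_pt be y) -> phi be y = 0.

(** By the support of phi the fibre product is 0 away from the frame domain, so it is the extension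
    by zero of its expression in al. *)
Lemma L2_local d e (act : 'M[C]_m -> 'M[C]_(d, e) -> 'M[C]_(d, e)) W W' (phi psi : field K d e) :
  (forall u A B, u \is unitarymx -> hdot (act u A) (act u B) = hdot A B) ->
  is_section act W phi -> is_section act W' psi -> supported_field phi ->
  L2_dot I phi psi = cintegral I al (fun x => hdot (phi al x) (psi al x)).
Proof.
move=> acth phis psis phi0; have H p := fibre_dot_ext acth phis psis p phi0 QU.
by rewrite /L2_dot /cintegral; congr (Complex (I _) (I _)); apply/funext => p; have [] := H p.
Qed.

Lemma supported_field_local d e (phi : field K d e) x : supported_field phi -> lfr_dom al x ->
  ~ cbox r x0 x -> phi al x = 0.
Proof.
move=> phi0 Ux xQ; apply: phi0 => // -[y yQ yx]; apply: xQ.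
have [_ tx] := pt_overlap Ux (QU yQ) (esym yx).
by have [_ <-] := self_overlap Ux; rewrite tx.
Qed.

Variables (d : nat) (V : unitary_rep R m d) (phi : field K d 1).
Hypothesis phi0 : supported_field phi.

Lemma cov_off be X y : lfr_dom be y -> ~ box_image al x0 r (lfr_pt be y) ->
  cov V be X (phi be) y = 0.
Proof.
move=> Uy yQ; have By : (lfr_dom be `&` [set z | ~ box_image al x0 r (lfr_pt be z)]) y by split.
have Bz z : (lfr_dom be `&` [set z | ~ box_image al x0 r (lfr_pt be z)]) z -> phi be z = 0.
  by move=> [Uz zQ]; exact: phi0.
have Bo : open (lfr_dom be `&` [set z | ~ box_image al x0 r (lfr_pt be z)]).
  exact: (box_coimage_open Mhausdorff QU).
have D0 := dirD_ext (X y) Bo Bz By.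
by rewrite cov_dirD phi0 // mulmx0 addr0 D0 dirD_cst.
Qed.

Lemma nabla10_off : supported_field (nabla10 V phi).
Proof. by move=> be y Uy yQ; apply/matrixP => i k; rewrite mxE cov_off // !mxE. Qed.

Lemma nabla01_off : supported_field (nabla01 V phi).
Proof. by move=> be y Uy yQ; apply/matrixP => i k; rewrite mxE cov_off // !mxE. Qed.

Lemma nabla_off : supported_field (nabla V phi).
Proof. by move=> be y Uy yQ; rewrite /nabla nabla01_off // nabla10_off // row_mx0. Qed.

End LocalL2.

Section AdjointFormula.
Variables (R : realType) (n : nat) (M : topologicalType) (K : kahler R n.+1 M).
Local Notation m := n.+1.
Hypothesis Mhausdorff : hausdorff_space M.
Variable I : (M -> R) -> R.
Hypothesis HI : riemannian_integral K I.
Variables (d : nat) (V : unitary_rep R m d).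
Variables (rho : 'I_m -> int) (Pp Pm : 'I_m -> 'End('M[R[i]]_(d, m))).
Hypotheses (HV : irreducible_of_weight V rho) (Hrho : dominant rho) (Hd : (2 <= d)%N)
  (HPp : weight_decomposition (actp V) (diffp V) (fun i j => rho j + mu i j) Pp)
  (HPm : weight_decomposition (actm V) (diffm V) (fun i j => rho j - mu i j) Pm).
Local Notation C := R[i].
Local Notation gap := ((wp rho ord0 + wm rho ord_max)%:~R : C).
Local Notation coefm i := ((2 * (wm rho ord_max - wm rho i))%:~R / gap).
Local Notation coefp i := ((2 * (wp rho ord0 - wp rho i))%:~R / gap).

Section Adjoints.
Variables (Dp_adj Dm_adj : 'I_m -> field K d m -> field K d 1)
  (nabla_adj : field K d (m + m) -> field K d 1).
Hypotheses
  (Hp : forall i, formal_adjoint I (sections K V)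
     (is_section (actp V) (limg (Pp i))) (grad_p V Pp i) (Dp_adj i))
  (Hm : forall i, formal_adjoint I (sections K V)
     (is_section (actm V) (limg (Pm i))) (grad_m V Pm i) (Dm_adj i))
  (Hn : formal_adjoint I (sections K V)
     (is_section (actpm V) fullv) (nabla V) nabla_adj).
Variables (phi : field K d 1) (phis : sections K V phi).
Variables (al : local_frame K).
Local Notation U := (lfr_dom al).
Local Notation W := (weitzenboeck_curv V rho al).

Let Uo : open U := @lfr_open _ _ _ _ al.

Definition defect x : 'cV[C]_d :=
  \sum_(i < m | i != ord_max) coefm i *: Dm_adj i (grad_m V Pm i phi) al x
  + \sum_(i < m | i != ord0) coefp i *: Dp_adj i (grad_p V Pp i phi) al x
  - (nabla_adj (nabla V phi) al x + W x *m phi al x).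

Let gps i : is_section (actp V) (limg (Pp i)) (grad_p V Pp i phi).
Proof. by apply: grad_p_section => // u A uu; exact: (Pp_equivariant HPp). Qed.

Let gms i : is_section (actm V) (limg (Pm i)) (grad_m V Pm i phi).
Proof. by apply: grad_m_section => // u A uu; exact: (Pm_equivariant HPm). Qed.

Lemma defect_smooth : smooth_cmx_on U defect.
Proof.
have sc (a : C) (F : 'rV[R]_(m + m) -> 'cV[C]_d) : smooth_cmx_on U F ->
    smooth_cmx_on U (fun x => a *: F x).
  by move=> Fs; exact: (smooth_cmx_scale Uo (smoothC_cst a Uo) Fs).
have [ps _ _] := phis.
apply: (smooth_cmx_add Uo).
  apply: (smooth_cmx_add Uo); apply: smooth_cmx_sum => // i _; apply: sc.
    by have [H _ _] := (Hm i).1 _ (gms i); exact: H.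
  by have [H _ _] := (Hp i).1 _ (gps i); exact: H.
apply: (smooth_cmx_opp Uo); apply: (smooth_cmx_add Uo).
  by have [H _ _] := Hn.1 _ (nabla_section phis); exact: H.
exact: (smooth_cmx_mul Uo (weitzenboeck_smooth V rho al) (ps al)).
Qed.

Variables (x0 : 'rV[R]_(m + m)) (r : R).
Hypotheses (r0 : 0 < r) (QU : cbox r x0 `<=` U).

Lemma adjoint_null d' e' act (W1 W2 : {vspace 'M[C]_(d', e')}) (psi A : field K d 1) (Dpsi Dphi : field K d' e') :
  (forall u X Y, u \is unitarymx -> hdot (act u X) (act u Y) = hdot X Y) ->
  sections K V psi -> sections K V A -> is_section act W1 Dpsi -> is_section act W2 Dphi ->
  supported_field al x0 r psi -> supported_field al x0 r Dpsi ->
  L2_dot I Dpsi Dphi = L2_dot I psi A ->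
  null_function I al x0 r (fun x => hdot (psi al x) (A al x) - hdot (Dpsi al x) (Dphi al x)).
Proof.
move=> acth ps As Ps Qs p0 P0 E.
have E1 := L2_local I QU (@act0_hdot _ _ _ V) ps As p0.
have E2 := L2_local I QU acth Ps Qs P0.
have [sp _ _] := ps; have [sA _ _] := As; have [sP _ _] := Ps; have [sQ _ _] := Qs.
apply: (null_sub Mhausdorff HI QU).
- exact: (test_function_hdot (sp al) (sA al) (fun x => supported_field_local QU (x := x) p0)).
- exact: (test_function_hdot (sP al) (sQ al) (fun x => supported_field_local QU (x := x) P0)).
- by rewrite -E1 -E2 E.
Qed.

Lemma defect_algebra (P1 P2 : pred 'I_m) (c1 c2 t a u b : 'I_m -> C) (q y z : C) (e : C) :
  (\sum_(i | P1 i) c1 i * a i + \sum_(i | P2 i) c2 i * b i - (y + z) - e)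
  + (-1 * (q - (y + z)) + (\sum_(i | P1 i) c1 i * (t i - a i) + \sum_(i | P2 i) c2 i * (u i - b i))) =
  \sum_(i | P1 i) c1 i * t i + \sum_(i | P2 i) c2 i * u i - (q + e).
Proof.
have HB (P : pred 'I_m) (c f g : 'I_m -> C) :
    \sum_(i | P i) c i * (f i - g i) = \sum_(i | P i) c i * f i - \sum_(i | P i) c i * g i.
  by rewrite -sumrB; apply: eq_bigr => i _; rewrite mulrBr.
rewrite !HB; move: (\sum_(i | P1 i) _) (\sum_(i | P1 i) _) (\sum_(i | P2 i) _) (\sum_(i | P2 i) _).
by move=> A B D F; ring.
Qed.

(** For psi supported in the box the adjoint relations replace <psi, D^* D phi> by <D psi, D phi>,
    and likewise for nabla, up to null functions. What is left is the energy of psi and phi. *)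
Lemma defect_null psi : sections K V psi -> supported_field al x0 r psi ->
  null_function I al x0 r (fun x => hdot (psi al x) (defect x)).
Proof.
move=> ps p0; have [fs _ _] := phis; have [hs _ _] := ps.
have h0 x (Ux : U x) (xQ : ~ cbox r x0 x) := supported_field_local QU p0 Ux xQ.
have En : null_function I al x0 r (energy al V rho Pp Pm (psi al) (phi al)).
  exact: (green Mhausdorff HI HV Hrho Hd HPp HPm (ltW r0) QU (hs al) (fs al) h0).
have Nm i : null_function I al x0 r (fun x =>
    hdot (psi al x) (Dm_adj i (grad_m V Pm i phi) al x)
    - hdot (grad_m V Pm i psi al x) (grad_m V Pm i phi al x)).
  have gs : is_section (actm V) (limg (Pm i)) (grad_m V Pm i psi).
    by apply: grad_m_section => // u A uu; exact: (Pm_equivariant HPm).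
  apply: (adjoint_null (@actm_hdot _ _ _ V) ps ((Hm i).1 _ (gms i)) gs (gms i) p0).
    by move=> be y Uy yQ; rewrite /grad_m (nabla10_off Mhausdorff QU V p0) // linear0.
  exact: ((Hm i).2 _ _ ps (gms i)).
have Np i : null_function I al x0 r (fun x =>
    hdot (psi al x) (Dp_adj i (grad_p V Pp i phi) al x)
    - hdot (grad_p V Pp i psi al x) (grad_p V Pp i phi al x)).
  have gs : is_section (actp V) (limg (Pp i)) (grad_p V Pp i psi).
    by apply: grad_p_section => // u A uu; exact: (Pp_equivariant HPp).
  apply: (adjoint_null (@actp_hdot _ _ _ V) ps ((Hp i).1 _ (gps i)) gs (gps i) p0).
    by move=> be y Uy yQ; rewrite /grad_p (nabla01_off Mhausdorff QU V p0) // linear0.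
  exact: ((Hp i).2 _ _ ps (gps i)).
have Nn : null_function I al x0 r (fun x =>
    hdot (psi al x) (nabla_adj (nabla V phi) al x)
    - hdot (nabla V psi al x) (nabla V phi al x)).
  apply: (adjoint_null (@actpm_hdot _ _ _ V) ps (Hn.1 _ (nabla_section phis))
    (nabla_section ps) (nabla_section phis) p0).
    exact: (nabla_off Mhausdorff QU V p0).
  exact: (Hn.2 _ _ ps (nabla_section phis)).
pose Sm x := \sum_(i < m | i != ord_max) coefm i * (hdot (psi al x) (Dm_adj i (grad_m V Pm i phi) al x)
    - hdot (grad_m V Pm i psi al x) (grad_m V Pm i phi al x)).
pose Sp x := \sum_(i < m | i != ord0) coefp i * (hdot (psi al x) (Dp_adj i (grad_p V Pp i phi) al x)
    - hdot (grad_p V Pp i psi al x) (grad_p V Pp i phi al x)).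
have Sm0 : null_function I al x0 r Sm.
  by apply: (null_sum Mhausdorff HI QU) => i _; exact: (null_scale Mhausdorff HI QU _ (Nm i)).
have Sp0 : null_function I al x0 r Sp.
  by apply: (null_sum Mhausdorff HI QU) => i _; exact: (null_scale Mhausdorff HI QU _ (Np i)).
have Nn' : null_function I al x0 r (fun x => hdot (psi al x) (nabla_adj (nabla V phi) al x)
    - (hdot (nabla01 V psi al x) (nabla01 V phi al x) + hdot (nabla10 V psi al x) (nabla10 V phi al x))).
  apply: null_ext Nn => x _; apply: (congr1 (fun z => _ - z)); exact: hdot_row_mx.
have N1 := null_scale Mhausdorff HI QU (-1) Nn'.
have := null_add Mhausdorff HI QU En (null_add Mhausdorff HI QU N1 (null_add Mhausdorff HI QU Sm0 Sp0)).
apply: null_ext => x Ux.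
have cr (a b : int) : Num.conj (a%:~R / b%:~R : C) = a%:~R / b%:~R.
  by rewrite rmorphM fmorphV !rmorph_int.
have HS (P : pred 'I_m) (c : 'I_m -> int) (b : int) (h : 'cV[C]_d) (A : 'I_m -> 'cV[C]_d) :
    hdot h (\sum_(i | P i) ((c i)%:~R / b%:~R) *: A i) = \sum_(i | P i) (c i)%:~R / b%:~R * hdot h (A i).
  by rewrite hdot_sumr; apply: eq_bigr => i _; rewrite hdotZr cr.
have Z1 := HS (fun i => i != ord_max) (fun i => 2 * (wm rho ord_max - wm rho i))
  (wp rho ord0 + wm rho ord_max) (psi al x) (fun i => Dm_adj i (grad_m V Pm i phi) al x).
have Z2 := HS (fun i => i != ord0) (fun i => 2 * (wp rho ord0 - wp rho i))
  (wp rho ord0 + wm rho ord_max) (psi al x) (fun i => Dp_adj i (grad_p V Pp i phi) al x).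
have Z4 : hdot (psi al x) (defect x) =
    \sum_(i | i != ord_max) coefm i * hdot (psi al x) (Dm_adj i (grad_m V Pm i phi) al x)
    + \sum_(i | i != ord0) coefp i * hdot (psi al x) (Dp_adj i (grad_p V Pp i phi) al x)
    - (hdot (psi al x) (nabla_adj (nabla V phi) al x) + hdot (psi al x) (W x *m phi al x)).
  by rewrite /defect hdotDr hdotNr !hdotDr; exact: (congr2 (fun p q => p + q - _) Z1 Z2).
exact: etrans (defect_algebra _ _ _ _ _ _ _ _ _ _ _ _) (esym Z4).
Qed.

(** With the test section chi times the defect, chi a bump at x0, the integral of chi |defect|^2
    vanishes. *)
Lemma defect_eq0_at : defect x0 = 0.
Proof.
pose chi x : C := real_complex R (box_bump x0 r x).
have cs : smoothC U chi by apply: (smoothC_real Uo); exact: box_bump_smooth.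
pose v x := chi x *: defect x.
have vs : smooth_cmx_on U v by exact: (smooth_cmx_scale Uo cs defect_smooth).
have v0 x : U x -> ~ cbox r x0 x -> v x = 0.
  by move=> _ xQ; rewrite /v /chi box_bump_off ?scale0r // ltW.
have ps := local_sectionP Mhausdorff V QU vs v0.
have p0 : supported_field al x0 r (local_section V al v).
  by move=> be y Uy yQ; exact: (local_section_off V v0 Uy yQ).
have [t0 J0] := defect_null ps p0.
have hE x : U x -> hdot (local_section V al v al x) (defect x) =
    real_complex R (box_bump x0 r x) * hdot (defect x) (defect x).
  by move=> Ux; rewrite local_section_self // hdotZl.
have P1 x : U x -> complex.Im (hdot (local_section V al v al x) (defect x)) = 0.
  by move=> Ux; rewrite hE // imM (hdot_real _).1 /= mulr0 mul0r addr0.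
have P2 x : U x -> 0 <= complex.Re (hdot (local_section V al v al x) (defect x)).
  move=> Ux; rewrite hE // reM /= mul0r subr0; apply: mulr_ge0; first exact: box_bump_ge0.
  exact: (hdot_real _).2.
have Ux0 : U x0 by apply: QU => i; rewrite subrr normr0 ltW.
have := cintegral_pos Mhausdorff HI (ltW r0) QU t0 P1 P2 J0 Ux0; rewrite hE // => /eqP.
rewrite mulf_eq0 => /orP[|/eqP]; last by move/hdot_eq0.
by rewrite fmorph_eq0 gt_eqF // box_bump_gt0.
Qed.

End Adjoints.

End AdjointFormula.

(** * Vanishing *)

Local Opaque smooth_on pd pd_cmx cov conn bracket curv hdot.

Section HermitianForms.
Variables (R : realType) (d : nat) (A : 'M[R[i]]_d).
Local Notation C := R[i].
Hypothesis Ah : adj A = A.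

(** The sign hypotheses speak of eigenvalues, so each diagonal entry is shown to be one: row i of
    the unitary matrix is an eigenvector. *)
Lemma hermitian_spectral : exists (P : 'M[C]_d) (D : 'rV[C]_d), P \is unitarymx /\
  A = adj P *m diag_mx D *m P /\ forall i, eigenvalue A (D ord0 i).
Proof.
have An : A \is normalmx by apply/normalmxP; rewrite -adj_t Ah.
exists (spectralmx A), (spectral_diag A); have Pu := spectral_unitarymx A.
have AE : A = adj (spectralmx A) *m diag_mx (spectral_diag A) *m spectralmx A.
  have /orthomx_spectralP {1}-> := An; congr (_ *m _ *m _).
  by rewrite -[LHS]mulmx1 -(unitary_adjr Pu) mulmxA mulVmx ?mul1mx // unitarymx_unit.
split=> //; split=> // i; apply/eigenvalueP; exists (row i (spectralmx A)).
  have PA : spectralmx A *m A = diag_mx (spectral_diag A) *m spectralmx A.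
    by rewrite [X in _ *m X = _]AE !mulmxA (unitary_adjr Pu) mul1mx.
  by rewrite -row_mul PA; apply/rowP => j; rewrite mul_diag_mx !mxE.
apply/eqP => r0; have := congr1 (fun B => row i B) (unitary_adjr Pu).
by rewrite row_mul r0 mul0mx => /matrixP/(_ ord0 i); rewrite !mxE eqxx => /esym/eqP; rewrite oner_eq0.
Qed.

Lemma hermitian_form_sum (P : 'M[C]_d) (D : 'rV[C]_d) (v : 'cV[C]_d) :
  A = adj P *m diag_mx D *m P ->
  hdot v (A *m v) = \sum_i ((P *m v) i ord0 * Num.conj ((P *m v) i ord0)) * Num.conj (D ord0 i).
Proof.
move=> AE; rewrite {1}AE -!mulmxA -hdotMl.
Local Transparent hdot.
rewrite /hdot; apply: eq_bigr => i _; rewrite big_ord1 mul_diag_mx !mxE rmorphM /=.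
Local Opaque hdot.
by rewrite mulrA mulrAC.
Qed.

Lemma normC_ge0 (z : C) : 0 <= z * Num.conj z.
Proof. by rewrite -normCK exprn_ge0. Qed.

Lemma hermitian_form_ge0 (v : 'cV[C]_d) : (forall a, eigenvalue A a -> 0 <= a) ->
  0 <= hdot v (A *m v).
Proof.
have [P [D [_ [AE De]]]] := hermitian_spectral => Hp; rewrite (hermitian_form_sum v AE).
by apply: sumr_ge0 => i _; rewrite mulr_ge0 ?normC_ge0 // conjC_ge0; apply: Hp.
Qed.

Lemma hermitian_form_eq0 (v : 'cV[C]_d) : (forall a, eigenvalue A a -> 0 < a) ->
  hdot v (A *m v) = 0 -> v = 0.
Proof.
have [P [D [Pu [AE De]]]] := hermitian_spectral => Hp; rewrite (hermitian_form_sum v AE) => H.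
have Pv i : (P *m v) i ord0 = 0.
  have := psumr_eq0P _ H (i := i) isT; rewrite -normCK => /(_ _)/eqP H'.
  have /H' : forall i, true -> 0 <= (P *m v) i ord0 * Num.conj ((P *m v) i ord0) * Num.conj (D ord0 i).
    by move=> j _; rewrite mulr_ge0 ?normC_ge0 // conjC_ge0 ltW // Hp.
  rewrite mulf_eq0 conjC_eq0 (gt_eqF (Hp _ (De i))) orbF expf_eq0 /= normr_eq0.
  by move=> /eqP.
have : P *m v = 0 by apply/matrixP => i j; rewrite ord1 Pv mxE.
by move=> /(congr1 (mulmx (adj P))); rewrite mulmxA (unitary_adjl Pu) mul1mx mulmx0.
Qed.

End HermitianForms.

Section PartitionOfUnity.
Variables (R : realType) (m : nat) (M : topologicalType) (K : kahler R m M).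
Hypotheses (Mhausdorff : hausdorff_space M) (Mcompact : compact [set: M]).

Record frame_box_at := FrameBox {
  fb_frame : local_frame K;
  fb_center : 'rV[R]_(m + m);
  fb_radius : R;
  fb_gt0 : 0 < fb_radius;
  fb_sub : cbox fb_radius fb_center `<=` lfr_dom fb_frame
}.

Definition fb_bump (b : frame_box_at) : M -> R := bump (fb_frame b) (fb_center b) (fb_radius b).

Lemma fb_bump_smooth b : smooth_fun K (fb_bump b).
Proof. exact: (bump_smooth Mhausdorff (fb_gt0 b) (fb_sub (f := b))). Qed.

Lemma fb_bump_ge0 b p : 0 <= fb_bump b p.
Proof. exact: bump_ge0. Qed.

Lemma frame_box_exists al x : lfr_dom al x -> exists b, fb_frame b = al /\ fb_center b = x.
Proof.
move=> Ux; have [r r0 QU] := frame_box Ux.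
by exists (FrameBox r0 QU).
Qed.

Lemma finite_cover : exists s : seq frame_box_at, forall p, 0 < \sum_(b <- s) fb_bump b p.
Proof.
(* Compactness is used as a near-covering property. In this filter a property holds eventually if it
   holds for all lists whose bump sum dominates that of a fixed list, so that list itself has it. *)
pose F : set_system (seq frame_box_at) := [set A | exists s0, forall s,
  (forall q, \sum_(b <- s0) fb_bump b q <= \sum_(b <- s) fb_bump b q) -> A s].
have FF : Filter F.
  split; first by exists [::].
    move=> A B [s0 HA] [s1 HB]; exists (s0 ++ s1) => s Hs; split.
      apply: HA => q; apply: le_trans (Hs q); rewrite big_cat lerDl /=.
      by apply: sumr_ge0 => b _; exact: fb_bump_ge0.
    apply: HB => q; apply: le_trans (Hs q); rewrite big_cat lerDr /=.
    by apply: sumr_ge0 => b _; exact: fb_bump_ge0.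
  by move=> A B AB [s0 HA]; exists s0 => s /HA; exact: AB.
have := (compact_near_coveringP [set: M]).1 Mcompact _ F (fun s p => 0 < \sum_(b <- s) fb_bump b p) FF.
case=> [p _|s0 H].
  have [al [x [Ux <-]]] := frame_exists K p.
  have [b [bal bx]] := frame_box_exists Ux.
  have b0 : 0 < fb_bump b (lfr_pt al x).
    by rewrite -bal -bx; apply: bump_gt0; [exact: fb_gt0 | exact: fb_sub].
  exists ([set q | 0 < fb_bump b q], [set s | forall q, fb_bump b q <= \sum_(b <- s) fb_bump b q]).
    split=> /=.
      have bc := smooth_fun_continuous (fb_bump_smooth b).
      exact: (bc (lfr_pt al x) _ (lt_nbhsr b0)).
    by exists [:: b] => s Hs q; have := Hs q; rewrite big_seq1.
  by move=> [q s] [/= q0 Hs]; exact: lt_le_trans q0 (Hs q).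
by exists s0 => p; apply: H => // q.
Qed.

(** The box centred at x is put first, so that the function of index 0 is positive at the chosen
    point. *)
Lemma partition_of_unity al x : lfr_dom al x -> exists k (b : 'I_k.+1 -> frame_box_at),
  [/\ fb_frame (b ord0) = al, fb_center (b ord0) = x & forall p, 0 < \sum_i fb_bump (b i) p].
Proof.
move=> Ux; have [b0 [E1 E2]] := frame_box_exists Ux; have [s sP] := finite_cover.
exists (size s), (fun i => if unlift ord0 i is Some j then tnth (in_tuple s) j else b0).
rewrite unlift_none; split=> // p; rewrite big_ord_recl.
apply: ltr_wpDl; first exact: fb_bump_ge0.
have := sP p; rewrite big_tnth => H; apply: lt_le_trans H _.
by rewrite le_eqVlt; apply/orP; left; apply/eqP/eq_bigr => i _; rewrite liftK.
Qed.

Lemma scale_section d (V : unitary_rep R m d) (phi : field K d 1) (f : M -> R) :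
  smooth_fun K f -> sections K V phi ->
  sections K V (fun be y => real_complex R (f (lfr_pt be y)) *: phi be y).
Proof.
move=> fs phis; have [ps _ _] := phis; apply: is_sectionI => [be|be y _|be ga y Oy].
- have Uo := @lfr_open _ _ _ _ be.
  exact: (smooth_cmx_scale Uo (smoothC_real Uo (fs be)) (ps be)).
- exact: memvf.
- by rewrite (section_transition phis Oy) (trans_pt Oy) /act0 scalemxAr.
Qed.

End PartitionOfUnity.

Section Vanishing.
Variables (R : realType) (n : nat) (M : topologicalType) (K : kahler R n.+1 M).
Local Notation m := n.+1.
Hypotheses (Mhausdorff : hausdorff_space M) (Mcompact : compact [set: M]).
Hypothesis Mconnected : connected [set: M].
Variable I : (M -> R) -> R.
Hypothesis HI : riemannian_integral K I.
Variables (d : nat) (V : unitary_rep R m d).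
Local Notation C := R[i].

Section Parallel.
Variables (phi : field K d 1) (phis : sections K V phi).
Hypothesis phi_parallel : forall al x, lfr_dom al x -> nabla V phi al x = 0.

Lemma parallel_cov al k x : lfr_dom al x ->
  cov V al (eps al k) (phi al) x = 0 /\ cov V al (epsbar al k) (phi al) x = 0.
Proof.
move=> Ux; have := phi_parallel Ux; rewrite /nabla -row_mx0 => /eq_row_mx[H1 H2].
split; apply/matrixP => i j; rewrite (ord1 j).
  by move/matrixP/(_ i k): H2; rewrite !mxE.
by move/matrixP/(_ i k): H1; rewrite !mxE.
Qed.

(** The column of partial derivatives of |phi|^2 is annihilated by all eps_k and epsbar_k, which
    span the complexified tangent space. *)
Lemma parallel_pd al a x : lfr_dom al x ->
  pd a (fun y => complex.Re (hdot (phi al y) (phi al y))) x = 0.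
Proof.
move=> Ux; have [ps _ _] := phis; have fd := smooth_diff_at (ps al) Ux.
rewrite (is_derive_pd (dC_hdot (fd a) (fd a)).1).
pose g : 'cV[C]_(m + m) := \col_b (hdot (pd_cmx b (phi al) x) (phi al x)
  + hdot (phi al x) (pd_cmx b (phi al) x)).
have gE (v w : 'rV[R]_(m + m) -> 'rV[C]_(m + m)) : w x = conjmx (v x) ->
    cov V al v (phi al) x = 0 -> cov V al w (phi al) x = 0 -> v x *m g = 0.
  move=> wv v0 w0; apply/matrixP => i j; rewrite !ord1 !mxE.
  have H0 := cov_hdot V Ux fd fd wv; rewrite v0 w0 hdot0l hdot0r addr0 in H0.
  by apply: etrans H0; apply: eq_bigr => b _; rewrite !mxE.
have g1 : lfr_mx al x *m g = 0.
  apply/row_matrixP => k; rewrite row_mul row0.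
  have [c1 c2] := parallel_cov k Ux.
  exact: (gE (eps al k) (epsbar al k) erefl c1 c2).
have g2 : conjmx (lfr_mx al x) *m g = 0.
  apply/row_matrixP => k; rewrite row_mul row0.
  have -> : row k (conjmx (lfr_mx al x)) = epsbar al k x.
    by rewrite /epsbar /eps /Defs.conjmx map_row.
  have [c1 c2] := parallel_cov k Ux.
  exact: (gE (epsbar al k) (eps al k) (esym (conjmxK _)) c2 c1).
have Fg : full_frame al x *m g = 0.
  by apply: etrans (mul_col_mx _ _ _) _; rewrite g1 g2 col_mx0.
have g0 : g = 0.
  have /mulmx1C H' := full_frameG Ux.
  by rewrite -[g]mul1mx -H' -mulmxA Fg mulmx0.
by move/matrixP/(_ a ord0): g0; rewrite !mxE => ->.
Qed.

Lemma parallel_locally_constant al x : lfr_dom al x -> exists2 r : R, 0 < r &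
  box r x `<=` lfr_dom al /\ forall y, box r x y ->
    complex.Re (hdot (phi al y) (phi al y)) = complex.Re (hdot (phi al x) (phi al x)).
Proof.
move=> Ux; have Uo := @lfr_open _ _ _ _ al; have [ps _ _] := phis.
have [r r0 rU] := (openP _).1 Uo x Ux; exists r => //; split=> // y xy.
have fs := (smoothC_hdot Uo (ps al) (ps al)).1.
have fd z : box r x z -> forall a,
    derivable (fun y => complex.Re (hdot (phi al y) (phi al y))) z (delta_mx ord0 a).
  by move=> xz a; exact: smooth_derivable fs (rU _ xz).
have [xi [xiB E]] := pd_telescope xy fd.
apply/eqP; rewrite -subr_eq0 E big1 // => a _; rewrite parallel_pd ?mulr0 //.
by apply: rU => i; apply: le_lt_trans (xiB a i) (xy i).
Qed.

Definition zero_set : set M := [set p | exists al x,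
  [/\ lfr_dom al x, lfr_pt al x = p & phi al x = 0]].

Lemma zero_set_frame al x : lfr_dom al x -> zero_set (lfr_pt al x) -> phi al x = 0.
Proof.
move=> Ux [be [y [Uy yx y0]]]; have [Ox tx] := pt_overlap Ux Uy (esym yx).
by rewrite (section_transition phis Ox) tx y0 /act0 mulmx0.
Qed.

Lemma parallel_near al x : lfr_dom al x -> \forall q \near lfr_pt al x,
  zero_set q <-> phi al x = 0.
Proof.
move=> Ux; have [r r0 [rU H]] := parallel_locally_constant Ux.
have cx : kcod (lfr_idx al) x by exact: (@lfr_sub _ _ _ _ al).
have dp := kinv_dom cx; have Bx : (box r x)^° x by exact: box_nbhs.
have := kchart_nbhs dp (@open_interior _ (box r x)); rewrite /lfr_pt kinvK // => /(_ Bx).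
apply: filterS => q [dq /interior_subset Bq]; have Uq := rU _ Bq.
have qE : lfr_pt al (kchart (lfr_idx al) q) = q by exact: kchartK.
have qz : zero_set q <-> phi al (kchart (lfr_idx al) q) = 0.
  split=> [qz|q0]; first by apply: zero_set_frame => //; rewrite qE.
  by exists al, (kchart (lfr_idx al) q).
rewrite qz; split=> z0; apply: re_hdot_eq0.
  by rewrite -(H _ Bq) z0 hdot0l.
by rewrite (H _ Bq) z0 hdot0l.
Qed.

(** Near each point, phi vanishes everywhere or nowhere, because |phi|^2 is locally constant. So the
    zero set is open and closed. *)
Lemma parallel_zero al x : lfr_dom al x -> phi al x = 0 -> vanishes phi.
Proof.
move=> Ux x0; have zo : open zero_set.
  rewrite openE => p [be [y [Uy <- y0]]].
  by apply: filterS (parallel_near Uy) => q ->.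
have zc : closed zero_set.
  rewrite -openC openE => p pz; have [be [y [Uy yp]]] := frame_exists K p.
  have := parallel_near Uy; rewrite yp; apply: filterS => q qz qz'.
  by apply: pz; exists be, y; split=> //; exact/qz.
have zT : zero_set = setT.
  apply: Mconnected; first by exists (lfr_pt al x), al, x.
    by exists zero_set => //; rewrite setTI.
  by exists zero_set => //; rewrite setTI.
by move=> be y Uy; apply: zero_set_frame => //; rewrite zT.
Qed.

End Parallel.

Lemma ext_frame_fun (al : local_frame K) (f : M -> R) p : (forall q, (forall x, lfr_dom al x -> lfr_pt al x <> q) -> f q = 0) ->
  ext al (fun x => f (lfr_pt al x)) p = f p.
Proof.
move=> H; have [[x [Ux <-]]|pU] := pselect (exists x, lfr_dom al x /\ lfr_pt al x = p).
  by rewrite ext_pt.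
have pU' x : lfr_dom al x -> lfr_pt al x <> p by move=> Ux xp; apply: pU; exists x.
by rewrite ext_off // H.
Qed.

Section Partition.
Variables (k : nat) (b : 'I_k.+1 -> frame_box_at K).
Hypothesis bS : forall p, 0 < \sum_i fb_bump (b i) p.

Definition lambda i p : R := fb_bump (b i) p / \sum_j fb_bump (b j) p.

Lemma lambda_smooth i : smooth_fun K (lambda i).
Proof.
move=> be; have Uo := @lfr_open _ _ _ _ be.
apply: (smooth_mul Uo); first exact: fb_bump_smooth.
apply: (smooth_inv Uo) => [|x _]; last by rewrite gt_eqF.
by apply: smooth_sum => // j _; exact: fb_bump_smooth.
Qed.

Lemma lambda_ge0 i p : 0 <= lambda i p.
Proof. by apply: divr_ge0; [exact: fb_bump_ge0 | exact: ltW]. Qed.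

Lemma lambda_sum p : \sum_i lambda i p = 1.
Proof. by rewrite -mulr_suml mulfV // gt_eqF. Qed.

Lemma lambda_off i p : ~ box_image (fb_frame (b i)) (fb_center (b i)) (fb_radius (b i)) p ->
  lambda i p = 0.
Proof.
by move=> pQ; rewrite /lambda /fb_bump (bump_off (fb_gt0 (b i))) ?mul0r.
Qed.

(** [riemannian_integral] does not state that I is monotone. Positivity is available for functions
    supported in one frame domain, and the partition writes F as a sum of such functions. *)
Lemma integral_eq0 (F : M -> R) : continuous F -> (forall p, 0 <= F p) -> I F = 0 ->
  forall p, F p = 0.
Proof.
move=> Fc F0 IF p.
pose G i x := lambda i (lfr_pt (fb_frame (b i)) x) * F (lfr_pt (fb_frame (b i)) x).
have off i x : lfr_dom (fb_frame (b i)) x -> ~ cbox (fb_radius (b i)) (fb_center (b i)) x ->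
    lambda i (lfr_pt (fb_frame (b i)) x) = 0.
  move=> Ux xQ; apply: lambda_off => -[y yQ yx]; apply: xQ.
  have [_ tx] := pt_overlap Ux (fb_sub yQ) (esym yx).
  by have [_ <-] := self_overlap Ux; rewrite tx.
have GE i q : ext (fb_frame (b i)) (G i) q = lambda i q * F q.
  apply: (ext_frame_fun (f := fun q => lambda i q * F q)) => z zU.
  by rewrite lambda_off ?mul0r // => -[x /(@fb_sub _ _ _ _ (b i)) Ux]; exact: zU.
have Gc i x : lfr_dom (fb_frame (b i)) x -> {for x, continuous (G i)}.
  move=> Ux; have lc := smooth_continuous (lambda_smooth i (be := fb_frame (b i))) Ux.
  have Fx : {for x, continuous (fun x => F (lfr_pt (fb_frame (b i)) x))}.
    apply: (@continuous_comp _ _ _ (lfr_pt (fb_frame (b i))) F); last exact: Fc.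
    exact: (kinv_cont (@lfr_sub _ _ _ _ _ x Ux)).
  exact: (continuousM lc Fx).
have Gs i : supported (lfr_dom (fb_frame (b i))) (fb_center (b i)) (fb_radius (b i)) (G i).
  by move=> x Ux xQ; rewrite /G off // mul0r.
have Gp i x : lfr_dom (fb_frame (b i)) x -> 0 <= G i x.
  by move=> _; apply: mulr_ge0; [exact: lambda_ge0 | exact: F0].
have Gcont i : continuous (ext (fb_frame (b i)) (G i)).
  exact: (ext_continuous Mhausdorff (fb_sub (f := b i)) (Gc i) (Gs i)).
have SI : \sum_i I (ext (fb_frame (b i)) (G i)) = 0.
  apply: etrans IF; apply: etrans (esym (integral_sum HI _ Gcont)) _.
  congr I; apply/funext => q.
  by under eq_bigr do rewrite GE; rewrite -mulr_suml lambda_sum mul1r.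
have Gn i : true -> 0 <= I (ext (fb_frame (b i)) (G i)).
  by move=> _; exact: (ext_integral_ge0 Mhausdorff HI (fb_sub (f := b i)) (Gc i) (Gs i) (Gp i)).
have G0 i q : lambda i q * F q = 0.
  have Ii := psumr_eq0P Gn SI (i := i) isT.
  rewrite -GE /ext; case: asboolP => // -[_ Uq].
  exact: (ext_integral_eq0 Mhausdorff HI (fb_sub (f := b i)) (ltW (fb_gt0 (b i))) (Gc i) (Gs i) (Gp i) Ii Uq).
rewrite -[F p]mul1r -(lambda_sum p) mulr_suml; exact: big1.
Qed.

End Partition.

Lemma cov_fsum (be : local_frame K) X (J : finType) (f : J -> 'rV[R]_(m + m) -> 'cV[C]_d) y :
  (forall j, diff_at (f j) y) ->
  cov V be X (fun z => \sum_j f j z) y = \sum_j cov V be X (f j) y.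
Proof.
move=> fd; rewrite cov_dirD.
have D a := dM_sum (index_enum J) (P := xpredT) (fun j _ => fd j a).
rewrite (dirDE (X y) D) mulmx_sumr; under [RHS]eq_bigr do rewrite cov_dirD.
rewrite big_split /=; congr (_ + _); rewrite /dirD exchange_big.
by apply: eq_bigr => a _; rewrite scaler_sumr.
Qed.

Section WeitzenboeckVanishing.
Variables (rho : 'I_m -> int) (Pp Pm : 'I_m -> 'End('M[C]_(d, m))).
Hypotheses (HV : irreducible_of_weight V rho) (Hrho : dominant rho) (Hd : (2 <= d)%N)
  (HPp : weight_decomposition (actp V) (diffp V) (fun i j => rho j + mu i j) Pp)
  (HPm : weight_decomposition (actm V) (diffm V) (fun i j => rho j - mu i j) Pm).
Local Notation W al x := (weitzenboeck_curv V rho al x).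
Hypothesis Wge0 : forall (al : local_frame K) x, lfr_dom al x ->
  forall a, eigenvalue (W al x) a -> 0 <= a.
Variables (phi : field K d 1) (phis : sections K V phi).
Hypotheses (gm0 : forall i, i != ord_max -> vanishes (grad_m V Pm i phi))
  (gp0 : forall i, i != ord0 -> vanishes (grad_p V Pp i phi)).

Let Wh (al : local_frame K) x (Ux : lfr_dom al x) :=
  weitzenboeck_hermitian Mhausdorff HI HV Hrho Hd HPp HPm Ux.

Let form al x := hdot (phi al x) (W al x *m phi al x).

Let form_ge0 al x : lfr_dom al x -> complex.Im (form al x) = 0 /\ 0 <= complex.Re (form al x).
Proof.
move=> Ux; have := hermitian_form_ge0 (Wh Ux) (phi al x) (Wge0 Ux).
by rewrite lecE /= => /andP[/eqP -> ->].
Qed.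

Section Pieces.
Variables (k : nat) (b : 'I_k.+1 -> frame_box_at K).
Hypothesis bS : forall p, 0 < \sum_i fb_bump (b i) p.

Let al i := fb_frame (b i).
Let lam i := lambda b i.

Definition piece i : field K d 1 :=
  fun be y => real_complex R (lam i (lfr_pt be y)) *: phi be y.

Lemma pieceP i : sections K V (piece i).
Proof. exact: (scale_section (lambda_smooth bS i) phis). Qed.

Lemma piece_supported i : supported_field (al i) (fb_center (b i)) (fb_radius (b i)) (piece i).
Proof. by move=> be y Uy yQ; rewrite /piece /lam lambda_off // scale0r. Qed.

Lemma piece_sum be y : \sum_i piece i be y = phi be y.
Proof. by rewrite -scaler_suml -rmorph_sum lambda_sum // scale1r. Qed.

Lemma nabla_piece_sum be y : lfr_dom be y -> \sum_i nabla V (piece i) be y = nabla V phi be y.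
Proof.
move=> Uy; have pd_ i : diff_at (piece i be) y.
  by have [ps _ _] := pieceP i; exact: smooth_diff_at (ps be) Uy.
have CS X : \sum_i cov V be X (piece i be) y = cov V be X (phi be) y.
  rewrite -cov_fsum //; congr (cov V be X _ y); apply/funext => z.
  exact: piece_sum.
apply/matrixP => a c; rewrite summxE; case: (split_ordP c) => l ->.
  by under eq_bigr do rewrite /nabla row_mxEl mxE; rewrite /nabla row_mxEl mxE -CS summxE.
by under eq_bigr do rewrite /nabla row_mxEr mxE; rewrite /nabla row_mxEr mxE -CS summxE.
Qed.

Let G i x := hdot (nabla V (piece i) (al i) x) (nabla V phi (al i) x)
  + hdot (piece i (al i) x) (W (al i) x *m phi (al i) x).

(** The gradients of phi in the sum vanish, so the energy of the piece and phi reduces to minus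
    [G i]. *)
Lemma piece_null i : null_function I (al i) (fb_center (b i)) (fb_radius (b i)) (G i).
Proof.
have QU := fb_sub (f := b i); have r0 := fb_gt0 (b i).
have [hs _ _] := pieceP i; have [fs _ _] := phis.
have h0 x (Ux : lfr_dom (al i) x) xQ := supported_field_local QU (piece_supported (i := i)) Ux xQ.
have En : null_function I (al i) (fb_center (b i)) (fb_radius (b i))
    (energy (al i) V rho Pp Pm (piece i (al i)) (phi (al i))).
  exact: (green Mhausdorff HI HV Hrho Hd HPp HPm (ltW r0) QU (hs (al i)) (fs (al i)) h0).
apply: null_ext (null_scale Mhausdorff HI QU (-1) En) => x Ux.
have S0 (P : pred 'I_m) (c : 'I_m -> C) (A B : 'I_m -> 'M[C]_(d, m)) :
    (forall j, P j -> B j = 0) -> \sum_(j | P j) c j * hdot (A j) (B j) = 0.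
  by move=> B0; rewrite big1 // => j Pj; rewrite B0 // hdot0r mulr0.
have Z1 := S0 (fun j => j != ord_max)
  (fun j => (2 * (wm rho ord_max - wm rho j))%:~R / (wp rho ord0 + wm rho ord_max)%:~R)
  (fun j => Pm j (cov10 (al i) V (piece i (al i)) x)) _ (fun j jm => gm0 jm Ux).
have Z2 := S0 (fun j => j != ord0)
  (fun j => (2 * (wp rho ord0 - wp rho j))%:~R / (wp rho ord0 + wm rho ord_max)%:~R)
  (fun j => Pp j (cov01 (al i) V (piece i (al i)) x)) _ (fun j j0 => gp0 j0 Ux).
have Z3 : hdot (nabla V (piece i) (al i) x) (nabla V phi (al i) x) =
    hdot (cov01 (al i) V (piece i (al i)) x) (cov01 (al i) V (phi (al i)) x)
    + hdot (cov10 (al i) V (piece i (al i)) x) (cov10 (al i) V (phi (al i)) x).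
  exact: hdot_row_mx.
have alg (p q y e : C) : p = 0 -> q = 0 -> -1 * (p + q - y - e) = y + e.
  by move=> -> ->; ring.
by apply: etrans (congr1 (fun z => z + _) (esym Z3)); exact: (alg _ _ _ _ Z1 Z2).
Qed.

Let F p := \sum_i ext (al i) (fun x => complex.Re (G i x)) p.

Let rhs i p := ext (al i) (fun x => complex.Re (hdot (piece i (al i) x) (W (al i) x *m phi (al i) x))) p.

Lemma rhs_ge0 i p : 0 <= rhs i p.
Proof.
rewrite /rhs /ext; case: asboolP => // -[_ Ux].
rewrite /piece hdotZl reM /= mul0r subr0; apply: mulr_ge0; first exact: lambda_ge0.
exact: (form_ge0 Ux).2.
Qed.

(** The terms <nabla (lambda_i phi), nabla phi> need not have a sign; only their sum over i is
    |nabla phi|^2. Hence the integrands are added before positivity is used. *)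
Lemma total_energyE be y : lfr_dom be y -> F (lfr_pt be y) =
  complex.Re (hdot (nabla V phi be y) (nabla V phi be y)) + \sum_i rhs i (lfr_pt be y).
Proof.
move=> Uy; have E i : ext (al i) (fun x => complex.Re (G i x)) (lfr_pt be y) =
    complex.Re (hdot (nabla V (piece i) be y) (nabla V phi be y)) + rhs i (lfr_pt be y).
  have N0 : supported_field (al i) (fb_center (b i)) (fb_radius (b i)) (nabla V (piece i)).
    exact: (nabla_off Mhausdorff (fb_sub (f := b i)) V (piece_supported (i := i))).
  have [H _] := fibre_dot_ext (@actpm_hdot _ _ _ V) (nabla_section (pieceP i)) (nabla_section phis)
    (lfr_pt be y) N0 (fb_sub (f := b i)).
  rewrite (fibre_dotE (@actpm_hdot _ _ _ V) (nabla_section (pieceP i)) (nabla_section phis) Uy) in H.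
  rewrite H /rhs /ext; case: asboolP => _; last by rewrite addr0.
  exact: reD.
rewrite /F; under eq_bigr do rewrite E; rewrite big_split /=; congr (_ + _).
by rewrite -re_sum -hdot_suml nabla_piece_sum.
Qed.

Lemma total_energy_eq0 p : F p = 0.
Proof.
have Gc i : continuous (ext (al i) (fun x => complex.Re (G i x))).
  exact: (test_re Mhausdorff (fb_sub (f := b i)) (piece_null i).1).
apply: (integral_eq0 bS).
- move=> q; have FF := nbhs_filter q.
  by apply: cvg_big => [|i _]; [exact: add_continuous | exact: Gc].
- move=> q; have [be [y [Uy <-]]] := frame_exists K q.
  rewrite total_energyE //; apply: addr_ge0; first exact: (hdot_real _).2.
  by apply: sumr_ge0 => i _; exact: rhs_ge0.
- apply: etrans (integral_sum HI _ Gc) _; apply: big1 => i _.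
  by have /(congr1 (@complex.Re R)) := (piece_null i).2.
Qed.

Lemma energy_terms_eq0 be y : lfr_dom be y ->
  nabla V phi be y = 0 /\ forall i, rhs i (lfr_pt be y) = 0.
Proof.
move=> Uy; have := total_energy_eq0 (lfr_pt be y); rewrite total_energyE // => /eqP.
rewrite paddr_eq0; last by apply: sumr_ge0 => i _; exact: rhs_ge0.
  move=> /andP[/eqP H1 /eqP H2]; split; first exact: re_hdot_eq0.
  by move=> i; apply: (psumr_eq0P _ H2) => // j _; exact: rhs_ge0.
exact: (hdot_real _).2.
Qed.

End Pieces.

(** At the point where the curvature is positive, the function of index 0 of the partition is
    positive too, so its vanishing curvature term forces phi = 0 there. *)
Lemma weitzenboeck_vanishing (al0 : local_frame K) x0 : lfr_dom al0 x0 ->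
  (forall a, eigenvalue (W al0 x0) a -> 0 < a) -> vanishes phi.
Proof.
move=> Ux0 Wgt0; have [k [b [b0 c0 bS]]] := partition_of_unity Mhausdorff Mcompact Ux0.
have H be y (Uy : lfr_dom be y) := energy_terms_eq0 bS Uy.
apply: (parallel_zero phis _ Ux0); first by move=> be y Uy; exact: (H be y Uy).1.
move: Ux0 Wgt0; rewrite -b0 -c0 => Ux0 Wgt0.
apply: (hermitian_form_eq0 (Wh Ux0) Wgt0).
have lp : 0 < lambda b ord0 (lfr_pt (fb_frame (b ord0)) (fb_center (b ord0))).
  apply: divr_gt0; last exact: bS.
  by apply: bump_gt0; [exact: fb_gt0 | exact: fb_sub].
have := (H _ _ Ux0).2 ord0; rewrite (ext_pt _ Ux0) /piece hdotZl reM /= mul0r subr0 => /eqP.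
rewrite mulf_eq0 (gt_eqF lp) /= => /eqP R0.
by apply: complexP => //; exact: (form_ge0 Ux0).1.
Qed.

End WeitzenboeckVanishing.

End Vanishing.

Local Opaque smooth_on pd pd_cmx cov conn bracket curv hdot.

Theorem proposition9p2 (R : realType) (n : nat) (M : topologicalType)
    (K : kahler R n.+1 M) (I : (M -> R) -> R)
    (rho : 'I_n.+1 -> int) (d : nat) (V : unitary_rep R n.+1 d)
    (Pp Pm : 'I_n.+1 -> 'End('M[R[i]]_(d, n.+1)))
    (* M is a closed connected Kaehler manifold with volume integral I *)
    (Mcompact : compact [set: M]) (Mhausdorff : hausdorff_space M)
    (Mconnected : connected [set: M]) (HI : riemannian_integral K I)
    (* V = V_rho is irreducible of dimension at least 2 *)
    (Hrho : dominant rho) (HV : irreducible_of_weight V rho) (Hd : (2 <= d)%N)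
    (* the projections onto V_(rho + mu_i) and V_(rho - mu_i) *)
    (HPp : weight_decomposition (actp V) (diffp V)
             (fun i j => rho j + mu i j) Pp)
    (HPm : weight_decomposition (actm V) (diffm V)
             (fun i j => rho j - mu i j) Pm) :
  (forall (Dp_adj Dm_adj : 'I_n.+1 -> field K d n.+1 -> field K d 1)
          (nabla_adj : field K d (n.+1 + n.+1) -> field K d 1),
     (forall i, formal_adjoint I (sections K V)
        (is_section (actp V) (limg (Pp i))) (grad_p V Pp i) (Dp_adj i)) ->
     (forall i, formal_adjoint I (sections K V)
        (is_section (actm V) (limg (Pm i))) (grad_m V Pm i) (Dm_adj i)) ->
     formal_adjoint I (sections K V)
        (is_section (actpm V) fullv) (nabla V) nabla_adj ->
     forall phi, sections K V phi ->
     forall (al : local_frame K) x, lfr_dom al x ->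
       \sum_(i < n.+1 | i != ord_max)
          ((2 * (wm rho ord_max - wm rho i))%:~R
             / (wp rho ord0 + wm rho ord_max)%:~R)
            *: Dm_adj i (grad_m V Pm i phi) al x
       + \sum_(i < n.+1 | i != ord0)
          ((2 * (wp rho ord0 - wp rho i))%:~R
             / (wp rho ord0 + wm rho ord_max)%:~R)
            *: Dp_adj i (grad_p V Pp i phi) al x
       = nabla_adj (nabla V phi) al x
         + weitzenboeck_curv V rho al x *m phi al x)
  /\
  ((forall (al : local_frame K) x, lfr_dom al x ->
      forall a, eigenvalue (weitzenboeck_curv V rho al x) a -> 0 <= a) ->
   (exists (al : local_frame K) x, lfr_dom al x /\
      forall a, eigenvalue (weitzenboeck_curv V rho al x) a -> 0 < a) ->
   forall phi, sections K V phi ->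
     (forall i, i != ord_max -> vanishes (grad_m V Pm i phi)) ->
     (forall i, i != ord0 -> vanishes (grad_p V Pp i phi)) ->
     vanishes phi).
Proof.
split.
  move=> Dp_adj Dm_adj nabla_adj Hp Hm Hn phi phis al x Ux.
  have [r r0 QU] := frame_box Ux.
  have := defect_eq0_at Mhausdorff HI HV Hrho Hd HPp HPm Hp Hm Hn phis r0 QU.
  by rewrite /defect => /eqP; rewrite subr_eq0 => /eqP.
move=> Wge0 [al [x [Ux Wgt0]]] phi phis gm0 gp0.
exact: (weitzenboeck_vanishing Mhausdorff Mcompact Mconnected HI HV Hrho Hd HPp HPm
  Wge0 phis gm0 gp0 Ux Wgt0).
Qed.
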